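(* Let $\mathcal{B}_5$ be the Cartan group and let $B=-\left(X_1^2+X_2^2+X_3^2+X_4^2+X_5^2+X_4^{-2}+X_5^{-2}\right)$, where $X_1,\dots,X_5$ are the left-invariant vector fields on $\mathcal{B}_5$ given in the context. Let $1<p\le2\le q<\infty$. Then there is a constant $C'_{p,q}>0$ such that for every $t>0$ the solution $u(t,\cdot)=e^{-tB}u_0$ of the heat equation $$\partial_tu+Bu=0,\qquad u(0)=u_0,$$ satisfies $$\|u(t,\cdot)\|_{L^q(\mathcal{B}_5)}\le C'_{p,q}\,t^{-\frac92\left(\frac1p-\frac1q\right)}\,\|u_0\|_{L^p(\mathcal{B}_5)}.$$
   Context: The Cartan group $\mathcal{B}_5$ is $\mathbb{R}^5$ with the group law $$(x_1,\dots,x_5)\times(y_1,\dots,y_5)=\left(x_1+y_1,\;x_2+y_2,\;x_3+y_3-x_1y_2,\;x_4+y_4+\tfrac{x_1^2y_2}{2}-x_1y_3,\;x_5+y_5+\tfrac{x_1y_2^2}{2}-x_2y_3+x_1x_2y_2\right).$$ Its Haar measure is Lebesgue measure on $\mathbb{R}^5$; $L^p(\mathcal{B}_5)=L^p(\mathbb{R}^5)$ and $\mathcal{S}(\mathcal{B}_5)=\mathcal{S}(\mathbb{R}^5)$. The left-invariant vector fields are $$X_1=\partial_{x_1},\quad X_2=\partial_{x_2}-x_1\partial_{x_3}+\tfrac{x_1^2}{2}\partial_{x_4}+x_1x_2\partial_{x_5},\quad X_3=\partial_{x_3}-x_1\partial_{x_4}-x_2\partial_{x_5},\quad X_4=\partial_{x_4},\quad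 X_5=\partial_{x_5}.$$ The operators $X_4^{-2}$ and $X_5^{-2}$ are the left Fourier multipliers inverse to $X_4^2$ and $X_5^2$. Since $X_4=\partial_{x_4}$ and $X_5=\partial_{x_5}$ have symbols $i\lambda$ and $i\mu$, they act as multiplication by $-\lambda^{-2}$ and $-\mu^{-2}$ respectively on the Fourier side, where $\lambda\ne0$ and $\mu\neq0$ are the frequencies dual to $x_4$ and $x_5$. Thus $B$ is the nonnegative self-adjoint operator on $L^2(\mathcal{B}_5)$ that is the sum of strongly commuting nonnegative self-adjoint operators: the closure of $-(X_1^2+\dots+X_5^2)$ initially defined on $\mathcal{S}(\mathcal{B}_5)$, and the operator $-X_4^{-2}-X_5^{-2}$ given by multiplication by $\lambda^{-2}+\mu^{-2}$ after the partial Fourier transform in $(x_4,x_5)$. In terms of the generic irreducible unitary representations $\pi_{\lambda,\mu,\nu}$ of $\mathcal{B}_5$ on $L^2(\mathbb{R})$ (with $\lambda,\mu\neq 0$, $\nu\in\mathbb{R}$), the symbol of $B$ is $$\pi_{\lambda,\mu,\nu}(B)=-\frac{1}{\lambda^2+\mu^2}\frac{d^2}{du^2}+\frac14\frac{(\nu+(\lambda^2+\mu^2)^2u^2)^2}{\lambda^2+\mu^2}+(\lambda^2+\mu^2)^2u^2+\lambda^2+\mu^2+\lambda^{-2}+\mu^{-2},$$ and the Plancherel measure is $d\lambda\,d\mu\,d\nu$ up to a constant. The operator $e^{-tB}$ is defined by the spectral functional calculus on $L^2(\mathcal{B}_5)$, and the estimate is for $u_0\in L^p\cap L^2$, hence for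 all $u_0\in L^p$ by extending $e^{-tB}$ by density. *)

(* Defs.v *)
From HB Require Import structures.
From mathcomp Require Import all_boot all_order all_algebra.
From mathcomp Require Import complex ring.
From mathcomp Require Import all_classical all_reals all_analysis.

Set Implicit Arguments.
Unset Strict Implicit.
Unset Printing Implicit Defensive.

Import Order.TTheory GRing.Theory Num.Theory.
Import numFieldNormedType.Exports.
Import HBSimple.
Import ComplexField.Normc.

Local Open Scope classical_set_scope.
Local Open Scope ring_scope.
Local Open Scope complex_scope.

(** * The Cartan group and its Lebesgue spaces *)

(* A notation rather than a definition, so that the measurable and normed
   structures of the product are inferred. *)
Notation B5 R := (R * R * R * R * R)%type.

Definition cartan_mul (R : realType) (x y : B5 R) : B5 R :=
  let: (x1, x2, x3, x4, x5) := x in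
  let: (y1, y2, y3, y4, y5) := y in
  (x1 + y1,
   x2 + y2,
   x3 + y3 - x1 * y2,
   x4 + y4 + x1 ^+ 2 * y2 / 2 - x1 * y3,
   x5 + y5 + x1 * y2 ^+ 2 / 2 - x2 * y3 + x1 * x2 * y2).

(* The coefficients of h are those of the left-invariant fields X1, ..., X5
   below. *)
Lemma cartan_mul_flow (R : realType) (x : B5 R) (h : R) :
  let: (x1, x2, x3, x4, x5) := x in
  [/\ cartan_mul x (h, 0, 0, 0, 0) = (x1 + h, x2, x3, x4, x5),
      cartan_mul x (0, h, 0, 0, 0) =
        (x1, x2 + h, x3 - h * x1, x4 + h * (x1 ^+ 2 / 2),
         x5 + h * (x1 * x2) + h ^+ 2 * (x1 / 2)),
      cartan_mul x (0, 0, h, 0, 0) = (x1, x2, x3 + h, x4 - h * x1, x5 - h * x2),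
      cartan_mul x (0, 0, 0, h, 0) = (x1, x2, x3, x4 + h, x5)
    & cartan_mul x (0, 0, 0, 0, h) = (x1, x2, x3, x4, x5 + h)].
Proof.
case: x => [[[[x1 x2] x3] x4] x5].
by split; rewrite /cartan_mul; do ! congr (_, _); field.
Qed.

Definition haar {R : realType} :=
  ((((@lebesgue_measure R \x @lebesgue_measure R) \x @lebesgue_measure R)
      \x @lebesgue_measure R) \x @lebesgue_measure R)%E.

Section LebesgueSpaces.
Variable R : realType.
Implicit Types (f g : B5 R -> R[i]) (p : R).

Definition Lp_norm p f : \bar R :=
  Lnorm haar p%:E (fun x => (normc (f x))%:E).

Definition inLp p f : Prop :=
  [/\ measurable_fun setT (fun x => complex.Re (f x)),
      measurable_fun setT (fun x => complex.Im (f x))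
    & (Lp_norm p f < +oo)%E].

Definition Lp_dist p f g : \bar R := Lp_norm p (fun x => f x - g x).

Definition aeq f g : Prop := {ae haar, forall x, f x = g x}.

Definition cintegral d (T : measurableType d) (mu : {measure set T -> \bar R})
    (h : T -> R[i]) : R[i] :=
  (\int[mu]_x complex.Re (h x))%R +i* (\int[mu]_x complex.Im (h x))%R.

Definition L2_inner f g : R[i] :=
  cintegral haar (fun x => f x * (g x)^*).

End LebesgueSpaces.

(** * Vector fields and the Schwartz space *)

Section Derivatives.
Variable R : realType.
Implicit Types (f : B5 R -> R[i]) (x : B5 R).

(* Coordinates are numbered from 1; [basis_vec j] is 0 for other [j], and
   derivatives along it vanish. *)
Definition basis_vec (j : nat) : B5 R :=
  ((j == 1%N)%:R, (j == 2%N)%:R, (j == 3%N)%:R, (j == 4%N)%:R, (j == 5%N)%:R).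

Definition partial (j : nat) f : B5 R -> R[i] := fun x =>
  'D_(basis_vec j) (fun y => complex.Re (f y)) x
    +i* 'D_(basis_vec j) (fun y => complex.Im (f y)) x.

Definition partials (s : seq nat) f : B5 R -> R[i] := foldr partial f s.

Definition smooth f : Prop := forall s : seq nat,
  [/\ continuous (fun x => complex.Re (partials s f x)),
      continuous (fun x => complex.Im (partials s f x))
    & forall j x,
        derivable (fun y => complex.Re (partials s f y)) x (basis_vec j) /\
        derivable (fun y => complex.Im (partials s f y)) x (basis_vec j)].

Definition schwartz f : Prop :=
  smooth f /\
  forall (s : seq nat) (k : nat), exists M : R, forall x,
    (1 + `|x|) ^+ k * normc (partials s f x) <= M.

Definition X1 f : B5 R -> R[i] := partial 1 f.

Definition X2 f : B5 R -> R[i] := fun x =>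
  let: (x1, x2, x3, x4, x5) := x in
  partial 2 f x - x1%:C * partial 3 f x + (x1 ^+ 2 / 2)%:C * partial 4 f x
    + (x1 * x2)%:C * partial 5 f x.

Definition X3 f : B5 R -> R[i] := fun x =>
  let: (x1, x2, x3, x4, x5) := x in
  partial 3 f x - x1%:C * partial 4 f x - x2%:C * partial 5 f x.

Definition X4 f : B5 R -> R[i] := partial 4 f.

Definition X5 f : B5 R -> R[i] := partial 5 f.

Definition neg_laplacian f : B5 R -> R[i] := fun x =>
  - (X1 (X1 f) x + X2 (X2 f) x + X3 (X3 f) x + X4 (X4 f) x + X5 (X5 f) x).

(* The unitary normalization of the Fourier transform in (x4, x5). *)
Definition partial_fourier f : B5 R -> R[i] := fun x =>
  let: (x1, x2, x3, lam, mu) := x in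
  ((2 * pi)^-1)%:C *
  cintegral (@lebesgue_measure R \x @lebesgue_measure R)%E
    (fun yz : R * R =>
       f (x1, x2, x3, yz.1, yz.2)
       * (cos (lam * yz.1 + mu * yz.2) -i* sin (lam * yz.1 + mu * yz.2))).

End Derivatives.

(** * The operator B

   An operator on L^2 is given by its graph, a relation between
   representatives that is invariant under almost everywhere equality. *)

Section Operators.
Variable R : realType.
Implicit Types (u v w : B5 R -> R[i]).

(* Closure in L^2 x L^2 of the graph of [T] restricted to Schwartz functions. *)
Definition schwartz_closure (T : (B5 R -> R[i]) -> B5 R -> R[i]) u w : Prop :=
  [/\ inLp 2 u, inLp 2 w &
      exists phi : nat -> B5 R -> R[i],
        [/\ forall n, schwartz (phi n),
            Lp_dist 2 (phi n) u @[n --> \oo] --> 0%E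
          & Lp_dist 2 (T (phi n)) w @[n --> \oo] --> 0%E]].

Definition laplace_op : (B5 R -> R[i]) -> (B5 R -> R[i]) -> Prop :=
  schwartz_closure (@neg_laplacian R).

Definition L2_fourier : (B5 R -> R[i]) -> (B5 R -> R[i]) -> Prop :=
  schwartz_closure (@partial_fourier R).

(* -X_4^{-2} - X_5^{-2} *)
Definition inverse_op u w : Prop :=
  exists uh wh, [/\ L2_fourier u uh, L2_fourier w wh &
    aeq wh (fun x => let: (x1, x2, x3, lam, mu) := x in
                     (lam ^- 2 + mu ^- 2)%:C * uh (x1, x2, x3, lam, mu))].

(* The sum of the two operators, on the intersection of their domains. *)
Definition B_op u w : Prop :=
  inLp 2 w /\
  exists a m, [/\ laplace_op u a, inverse_op u m & aeq w (fun x => a x + m x)].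

End Operators.

(** * Spectral functional calculus *)

Section Spectral.
Variable R : realType.
Implicit Types (u v w : B5 R -> R[i]).
Implicit Types (E : set R -> (B5 R -> R[i]) -> B5 R -> R[i]).

(* Symmetry makes [P] linear and compatible with almost everywhere equality. *)
Definition orthogonal_projection (P : (B5 R -> R[i]) -> B5 R -> R[i]) : Prop :=
  [/\ forall u, inLp 2 u -> inLp 2 (P u),
      forall u, inLp 2 u -> aeq (P (P u)) (P u)
    & forall u v, inLp 2 u -> inLp 2 v ->
        L2_inner (P u) v = L2_inner u (P v)].

Definition projection_valued_measure E : Prop :=
  [/\ forall A, measurable A -> orthogonal_projection (E A),
      forall u, inLp 2 u -> aeq (E setT u) u,
      forall A A' u, measurable A -> measurable A' -> inLp 2 u ->
        aeq (E (A `&` A') u) (E A (E A' u))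
    & forall (F : (set R)^nat) u,
        (forall k, measurable (F k)) -> trivIset setT F -> inLp 2 u ->
        Lp_dist 2 (fun x => \sum_(0 <= k < n) E (F k) u x)
                  (E (\bigcup_k F k) u) @[n --> \oo] --> 0%E].

(* A |-> <E(A) u, u> = ||E(A) u||^2 *)
Definition spectral_mass E u (A : set R) : \bar R :=
  (Lp_norm 2 (E A u) ^+ 2)%E.

Definition simple_spectral_integral E (s : {sfun R >-> R}) u : B5 R -> R[i] :=
  fun x => \sum_(c \in range s) c%:C * E (s @^-1` [set c]) u x.

(* [w] is the integral of f dE applied to [u]: the simple functions [s n]
   tend to [f] in L^2 of the spectral mass of [u], which forces
   [u] to lie in the domain. *)
Definition spectral_integral E (f : R -> R) u w : Prop :=
  [/\ inLp 2 u, inLp 2 w &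
      exists s : {sfun R >-> R}^nat,
        (\int[spectral_mass E u]_l ((s n l - f l) ^+ 2)%:E)%E
          @[n --> \oo] --> 0%E /\
        Lp_dist 2 (simple_spectral_integral E (s n) u) w @[n --> \oo] --> 0%E].

(* [T] is the integral of l dE(l) *)
Definition spectral_resolution E
    (T : (B5 R -> R[i]) -> (B5 R -> R[i]) -> Prop) : Prop :=
  projection_valued_measure E /\
  forall u w, T u w <-> spectral_integral E id u w.

(* w = e^{-tT} u, where [E] is the spectral resolution of [T] *)
Definition exp_op E (t : R) u w : Prop :=
  spectral_integral E (fun l => expR (- (t * l))) u w.

(* The graph of the extension of e^{-tT} from L^p /\ L^2 to L^p, with values in
   L^q. *)
Definition exp_op_ext E (p q t : R) u w : Prop :=
  [/\ inLp p u, inLp q w &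
      exists un wn : nat -> B5 R -> R[i],
        [/\ forall n, [/\ inLp p (un n), inLp 2 (un n)
                        & exp_op E t (un n) (wn n)],
            Lp_dist p (un n) u @[n --> \oo] --> 0%E
          & Lp_dist q (wn n) w @[n --> \oo] --> 0%E]].

(* The Cauchy problem d_t u + T u = 0, u(0) = u0, with derivative and initial
   value taken in L^2. *)
Definition heat_solution (T : (B5 R -> R[i]) -> (B5 R -> R[i]) -> Prop)
    (u0 : B5 R -> R[i]) (u : R -> B5 R -> R[i]) : Prop :=
  [/\ aeq (u 0) u0,
      Lp_dist 2 (u t) u0 @[t --> 0^'+] --> 0%E
    & forall t, 0 < t -> exists w, T (u t) w /\
        Lp_norm 2 (fun x => (h^-1)%:C * (u (t + h) x - u t x) + w x)
          @[h --> 0^'] --> 0%E].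

End Spectral.

(* Main.v *)
Require Import Defs.
From HB Require Import structures.
From mathcomp Require Import all_boot all_order all_algebra.
From mathcomp Require Import complex ring lra.
From mathcomp Require Import all_classical all_reals all_analysis.
From mathcomp Require Import measurable_realfun.
Import Order.TTheory GRing.Theory Num.Theory.
Import numFieldNormedType.Exports.
Set Implicit Arguments.
Unset Strict Implicit.
Unset Printing Implicit Defensive.
Local Open Scope classical_set_scope.
Local Open Scope ring_scope.

(** Write S_t = e^{-tB}, given through the spectral measures of B.  After the
    Fourier transform in (x_4, x_5), Plancherel gives <Bu, u> >= 2 |u|^2, because
    lambda^2 + lambda^-2 >= 2, so S_t decays exponentially.  Averaging u over the
    translates x Q of a box Q of side r and integrating along the flows of
    X_1, ..., X_5, which preserve the measure, yields the Nash type inequality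
      |u|^2 <= 10 r^2 <Bu, u> + 4 D,
    where D is the squared norm of x |-> <u(x .), 1_Q> / |Q|.  Left translations
    commute with B, hence with S_t, so <S_t u(x .), g> = <u(x .), S_t g>, whose L^2
    norm in x is at most |u|_1 |g|_2 by Cauchy-Schwarz and Tonelli: along the orbit,
    D <= |u|_1^2 r^-5.  Iterating over the times t, t/4, t/16, ... gives
    |S_t u|_2 <= A t^{-5/4} |u|_1, and the exponential decay turns t^{-5/4} into
    t^{-9/4}.  Cutting u at a height and splitting the two pieces between L^1 and
    L^2 gives L^p -> L^2, duality gives L^2 -> L^q, and S_t = S_{t/2} S_{t/2} gives
    L^p -> L^q. *)

(** * Hilbert spaces with a possibly degenerate norm *)

(** The nonlocal terms X_4^{-2}, X_5^{-2} shape the proof: it does not rely on S_t contracting L^1,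
    which the usual Nash argument does. Only averages of S_t u have to be controlled. Once S_t is
    moved onto the averaging function, which is taken in L^2, it is u itself that is measured in
    L^1. This requires S_t to commute with left translations U. As B is known only through a given
    spectral resolution [E], the commutation is not read off from [E]; it comes from showing that <U
    S_{s} u, S_{t-s} g> does not depend on s. All five fields occur in B, so the box may have the
    same side r in every direction. Its volume r^5 produces the exponent 5/2 for |S_t u|_2^2, and (t
    e^{-t})^2 <= 1 converts exponential decay into the two further powers of t, at small and large
    times alike. Vectors are pairs of real functions, with the real part of the Hermitian product as
    scalar product. They are functions and not classes, so this product is not definite. *)

Record inner_product (R : realType) (V : lmodType R) := InnerProduct {
  ipf :> V -> V -> R;
  ipC : forall x y, ipf x y = ipf y x;
  ipDl : forall x y z, ipf (x + y) z = ipf x z + ipf y z;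
  ipZl : forall a x y, ipf (a *: x) y = a * ipf x y;
  ip_ge0 : forall x, 0 <= ipf x x }.

Section PreHilbert.
Variables (R : realType) (V : lmodType R) (ip : inner_product V).
Implicit Types x y z : V.

Definition nsq x := ip x x.
Definition ncvg (x : nat -> V) l := nsq (x n - l) @[n --> \oo] --> 0.
Definition ncauchy (x : nat -> V) := forall e, 0 < e ->
  exists N, forall m n, (N <= m)%N -> (N <= n)%N -> nsq (x m - x n) < e.
Definition ncomplete := forall x : nat -> V, ncauchy x -> exists l, ncvg x l.

Lemma ipDr x y z : ip z (x + y) = ip z x + ip z y.
Proof. by rewrite ipC ipDl !(ipC ip z). Qed.
Lemma ipZr a x y : ip x (a *: y) = a * ip x y.
Proof. by rewrite ipC ipZl ipC. Qed.
Lemma ipNl x y : ip (- x) y = - ip x y.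
Proof. by rewrite -scaleN1r ipZl mulN1r. Qed.
Lemma ipNr x y : ip x (- y) = - ip x y.
Proof. by rewrite ipC ipNl ipC. Qed.
Lemma ipBl x y z : ip (x - y) z = ip x z - ip y z.
Proof. by rewrite ipDl ipNl. Qed.
Lemma ipBr x y z : ip z (x - y) = ip z x - ip z y.
Proof. by rewrite ipDr ipNr. Qed.
Lemma ip0l x : ip 0 x = 0.
Proof. by rewrite -(scale0r 0) ipZl mul0r. Qed.

Lemma ip_suml (I : Type) (r : seq I) (P : pred I) (F : I -> V) y :
  ip (\sum_(i <- r | P i) F i) y = \sum_(i <- r | P i) ip (F i) y.
Proof. by elim/big_rec2 : _ => [|i z1 z2 _ <-]; rewrite ?ip0l ?ipDl. Qed.

Lemma nsq_ge0 x : 0 <= nsq x. Proof. exact: ip_ge0. Qed.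

Lemma nsqZ a x : nsq (a *: x) = a ^+ 2 * nsq x.
Proof. by rewrite /nsq ipZl ipZr mulrA expr2. Qed.

Lemma nsqN x : nsq (- x) = nsq x.
Proof. by rewrite /nsq ipNl ipNr opprK. Qed.

Lemma nsqBC x y : nsq (x - y) = nsq (y - x).
Proof. by rewrite -nsqN opprB. Qed.

Lemma nsqD x y : nsq (x + y) = nsq x + 2 * ip x y + nsq y.
Proof. by rewrite /nsq ipDl !ipDr (ipC ip y x); ring. Qed.

Lemma nsqB x y : nsq (x - y) = nsq x - 2 * ip x y + nsq y.
Proof. by rewrite nsqD nsqN ipNr; ring. Qed.

Lemma nsqD_le x y : nsq (x + y) <= 2 * nsq x + 2 * nsq y.
Proof. by have := nsq_ge0 (x - y); rewrite nsqB nsqD; lra. Qed.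

Lemma nsqB_le x y z : nsq (x - z) <= 2 * nsq (x - y) + 2 * nsq (y - z).
Proof.
have -> : x - z = (x - y) + (y - z) by rewrite addrA subrK.
exact: nsqD_le.
Qed.

Lemma cauchy_schwarz x y : ip x y ^+ 2 <= nsq x * nsq y.
Proof.
have key a : 0 <= a ^+ 2 * nsq x - 2 * a * ip x y + nsq y.
  by have := nsq_ge0 (a *: x - y); rewrite nsqB nsqZ ipZl; lra.
have := nsq_ge0 x; rewrite le_eqVlt => /predU1P[x0|x0].
  rewrite -x0 mul0r; have [->|xy0] := eqVneq (ip x y) 0; first by rewrite expr0n.
  (* When [nsq x = 0] the quadratic in [a] is affine, and at this [a] it takes the value -1. *)
  have := key ((nsq y + 1) / (2 * ip x y)).
  rewrite -x0 mulr0 sub0r.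
  have -> : 2 * ((nsq y + 1) / (2 * ip x y)) * ip x y = nsq y + 1 by field.
  lra.
have := key (ip x y / nsq x).
have -> : (ip x y / nsq x) ^+ 2 * nsq x - 2 * (ip x y / nsq x) * ip x y + nsq y
   = (nsq x * nsq y - ip x y ^+ 2) / nsq x by field; rewrite gt_eqF.
by rewrite pmulr_lge0 ?invr_gt0// subr_ge0.
Qed.

Lemma ip_abs_le x y : `|ip x y| <= Num.sqrt (nsq x) * Num.sqrt (nsq y).
Proof.
rewrite -sqrtrM ?nsq_ge0// -sqrtr_sqr ler_sqrt ?mulr_ge0 ?nsq_ge0//.
exact: cauchy_schwarz.
Qed.

Lemma ip_null x y : nsq x = 0 -> ip x y = 0.
Proof.
move=> x0; apply/eqP; rewrite -sqrf_eq0 eq_le sqr_ge0 andbT.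
by apply: le_trans (cauchy_schwarz _ _) _; rewrite x0 mul0r.
Qed.

(* Vectors at distance zero are not equal but cannot be told apart by [ip]. *)
Definition nequiv x y := nsq (x - y) = 0.

Lemma nequiv_ipl x y z : nequiv x y -> ip x z = ip y z.
Proof. by move=> /(ip_null z); rewrite ipBl => /eqP; rewrite subr_eq0 => /eqP. Qed.

Lemma nequiv_ipr x y z : nequiv x y -> ip z x = ip z y.
Proof. by move=> xy; rewrite ipC (nequiv_ipl _ xy) ipC. Qed.

Lemma nequiv_nsq x y : nequiv x y -> nsq x = nsq y.
Proof. by move=> xy; rewrite /nsq (nequiv_ipl _ xy) (nequiv_ipr _ xy). Qed.

Lemma nequiv_refl x : nequiv x x.
Proof. by rewrite /nequiv subrr /nsq ip0l. Qed.

Lemma nequivP x y : (forall z, ip x z = ip y z) -> nequiv x y.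
Proof. by move=> xy; rewrite /nequiv /nsq ipBl xy subrr. Qed.

Lemma ncvg_nequiv (x y : nat -> V) l k :
  (forall n, nequiv (x n) (y n)) -> nequiv l k -> ncvg x l -> ncvg y k.
Proof.
move=> xy lk; rewrite /ncvg; apply: cvg_trans; apply: near_eq_cvg.
near=> n; apply/nequiv_nsq; apply/nequivP => z; rewrite !ipBl.
by rewrite (nequiv_ipl _ (xy n)) (nequiv_ipl _ lk).
Unshelve. all: by end_near. Qed.

Lemma ncvg_ip (x y : nat -> V) l k : ncvg x l -> ncvg y k ->
  ip (x n) (y n) @[n --> \oo] --> ip l k.
Proof.
move=> xl yk.
have sq0 (u : nat -> V) m : ncvg u m ->
    Num.sqrt (nsq (u n - m)) @[n --> \oo] --> 0.
  move=> um; rewrite -(sqrtr0 R).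
  by apply: (continuous_cvg _ _ um); exact: sqrt_continuous.
have -> : ip l k = ip l k + 0 by rewrite addr0.
have -> : (fun n => ip (x n) (y n)) =
   (fun n => ip l k + (ip (x n - l) (y n - k) + ip (x n - l) k + ip l (y n - k))).
  by apply/funext => n; rewrite !ipBl !ipBr; ring.
apply: cvgD; first exact: cvg_cst.
have dom (f g : nat -> R) : (forall n, `|f n| <= g n) -> g n @[n --> \oo] --> 0 ->
    f n @[n --> \oo] --> 0.
  move=> fg g0; apply: norm_cvg0.
  apply: (@squeeze_cvgr _ _ _ _ (cst 0) g) => //; last exact: cvg_cst.
  by near=> n; rewrite normr_ge0/= fg.
rewrite -[X in _ --> X]addr0 -[X in _ --> X + _]addr0.
apply: cvgD; first apply: cvgD.
- apply: (dom _ _ (fun n => ip_abs_le _ _)).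
  by rewrite -(mulr0 0); apply: cvgM; exact: sq0.
- apply: (dom _ _ (fun n => ip_abs_le _ _)).
  by rewrite -(mul0r (Num.sqrt (nsq k))); apply: cvgM; [exact: sq0|exact: cvg_cst].
- apply: (dom _ _ (fun n => ip_abs_le _ _)).
  by rewrite -(mulr0 (Num.sqrt (nsq l))); apply: cvgM; [exact: cvg_cst|exact: sq0].
Unshelve. all: by end_near. Qed.

Lemma ncvg_cst l : ncvg (fun=> l) l.
Proof. by rewrite /ncvg subrr /nsq ip0l; exact: cvg_cst. Qed.

Lemma ncvg_ipl (x : nat -> V) l k : ncvg x l -> ip (x n) k @[n --> \oo] --> ip l k.
Proof. by move=> xl; exact: ncvg_ip xl (ncvg_cst k). Qed.

Lemma ncvg_nsq (x : nat -> V) l : ncvg x l -> nsq (x n) @[n --> \oo] --> nsq l.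
Proof. by move=> xl; exact: ncvg_ip. Qed.

Lemma squeeze0 (f g : nat -> R) : (forall n, 0 <= f n <= g n) ->
  g n @[n --> \oo] --> 0 -> f n @[n --> \oo] --> 0.
Proof.
move=> fg g0; apply: (@squeeze_cvgr _ _ _ _ (cst 0) g) => //; last exact: cvg_cst.
by near=> n; exact: fg.
Unshelve. all: by end_near. Qed.

Lemma ncvgD (x y : nat -> V) l k : ncvg x l -> ncvg y k ->
  ncvg (fun n => x n + y n) (l + k).
Proof.
move=> xl yk; apply: (@squeeze0 _ (fun n => 2 * nsq (x n - l) + 2 * nsq (y n - k))).
  by move=> n; rewrite nsq_ge0/= opprD addrACA nsqD_le.
by rewrite -[X in _ --> X]addr0 -[X in _ --> X + _](mulr0 2) -[X in _ --> _ + X](mulr0 2);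
  apply: cvgD; apply: cvgM => //; exact: cvg_cst.
Qed.

Lemma ncvgZ (a : R) (x : nat -> V) l : ncvg x l -> ncvg (fun n => a *: x n) (a *: l).
Proof.
move=> xl; rewrite /ncvg; under eq_fun do rewrite -scalerBr nsqZ.
by rewrite -(mulr0 (a ^+ 2)); apply: cvgM => //; exact: cvg_cst.
Qed.

Lemma ncvgP (x : nat -> V) l :
  ncvg x l <-> (nsq (x n - l))%:E @[n --> \oo] --> 0%E.
Proof.
split => [xl|xl]; first by apply: cvg_EFin; [exact: nearW|exact: xl].
exact: (fine_cvg xl).
Qed.

End PreHilbert.

(** * Square integrable functions and their scalar product *)

Section SquareIntegrable.
Context d (T : measurableType d) (R : realType).
Variable m : {measure set T -> \bar R}.
Implicit Types f g h : T -> R.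

Definition sqintegral f : \bar R := (\int[m]_x (f x ^+ 2)%:E)%E.
Definition square_integrable f :=
  measurable_fun setT f /\ (sqintegral f < +oo)%E.
Definition l2dot f g : R := \int[m]_x (f x * g x).

Lemma sqintegral_ge0 f : (0 <= sqintegral f)%E.
Proof. by apply: integral_ge0 => x _; rewrite lee_fin sqr_ge0. Qed.

Lemma measurable_sq f : measurable_fun setT f ->
  measurable_fun setT (fun x => (f x ^+ 2)%:E).
Proof. by move=> mf; apply/measurable_EFinP; exact: measurable_funX. Qed.

Lemma integrable_le f g : measurable_fun setT f ->
  m.-integrable setT (EFin \o g) -> (forall x, `|f x| <= g x) ->
  m.-integrable setT (EFin \o f).
Proof.
move=> mf ig fg; apply: le_integrable ig => //; first exact/measurable_EFinP.
by move=> x _; rewrite /= lee_fin (le_trans (fg x))// ler_norm.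
Qed.

Lemma integrable_add f g : m.-integrable setT (EFin \o f) ->
  m.-integrable setT (EFin \o g) -> m.-integrable setT (EFin \o (fun x => f x + g x)).
Proof. by move=> fi gi; have := integrableD measurableT fi gi; exact: eq_integrable. Qed.

Lemma integrable_scale a f : m.-integrable setT (EFin \o f) ->
  m.-integrable setT (EFin \o (fun x => a * f x)).
Proof. by move=> fi; have := integrableZl measurableT a fi; exact: eq_integrable. Qed.

Lemma square_integrable_sq f : square_integrable f ->
  m.-integrable setT (EFin \o (fun x => f x ^+ 2)).
Proof.
move=> [mf f2]; apply/integrableP; split; first exact: measurable_sq.
by under eq_integral do rewrite /= ger0_norm ?sqr_ge0//.
Qed.

Lemma square_integrableP f : measurable_fun setT f ->
  m.-integrable setT (EFin \o (fun x => f x ^+ 2)) -> square_integrable f.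
Proof.
move=> mf /integrableP[_ h]; split => //; move: h.
by under eq_integral do rewrite /= ger0_norm ?sqr_ge0//.
Qed.

Lemma square_integrable_mul f g : square_integrable f -> square_integrable g ->
  m.-integrable setT (EFin \o (fun x => f x * g x)).
Proof.
move=> Lf Lg; have [mf _] := Lf; have [mg _] := Lg.
apply: (@integrable_le _ (fun x => f x ^+ 2 + g x ^+ 2)).
- exact: measurable_funM.
- exact: integrable_add (square_integrable_sq Lf) (square_integrable_sq Lg).
- move=> x; have h1 := sqr_ge0 (f x - g x); have h2 := sqr_ge0 (f x + g x).
  have h3 := sqr_ge0 (f x); have h4 := sqr_ge0 (g x).
  by rewrite ler_norml; apply/andP; split; nra.
Qed.

Lemma square_integrableD f g : square_integrable f -> square_integrable g ->
  square_integrable (fun x => f x + g x).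
Proof.
move=> Lf Lg; have [mf _] := Lf; have [mg _] := Lg.
apply: square_integrableP; first exact: measurable_funD.
apply: (@integrable_le _ (fun x => (f x ^+ 2 + 2 * (f x * g x)) + g x ^+ 2)).
- by apply: measurable_funX; exact: measurable_funD.
- apply: integrable_add (square_integrable_sq Lg).
  apply: (integrable_add (square_integrable_sq Lf)).
  exact: integrable_scale (square_integrable_mul Lf Lg).
- by move=> x; rewrite ger0_norm ?sqr_ge0//; lra.
Qed.

Lemma square_integrableZ a f : square_integrable f ->
  square_integrable (fun x => a * f x).
Proof.
move=> Lf; have [mf _] := Lf; apply: square_integrableP; first exact: measurable_funM.
have := integrableZl measurableT (a ^+ 2) (square_integrable_sq Lf).
by apply: eq_integrable => // x _; rewrite /= exprMn.
Qed.

Lemma square_integrableN f : square_integrable f -> square_integrable (fun x => - f x).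
Proof.
move=> /(square_integrableZ (-1)); congr square_integrable.
by apply/funext => x; rewrite mulN1r.
Qed.

Lemma square_integrableB f g : square_integrable f -> square_integrable g ->
  square_integrable (fun x => f x - g x).
Proof. by move=> Lf /square_integrableN; exact: square_integrableD. Qed.

Lemma l2dotE f : square_integrable f -> (l2dot f f)%:E = sqintegral f.
Proof.
move=> Lf; rewrite /l2dot /Rintegral fineK; last first.
  by apply: integrable_fin_num => //; exact: square_integrable_mul.
by apply: eq_integral => x _; rewrite expr2.
Qed.

Lemma l2dotC f g : l2dot f g = l2dot g f.
Proof. by apply: eq_Rintegral => x _; rewrite mulrC. Qed.

Lemma l2dotDl f g h : square_integrable f -> square_integrable g ->
  square_integrable h ->
  l2dot (fun x => f x + g x) h = l2dot f h + l2dot g h.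
Proof.
move=> Lf Lg Lh; rewrite /l2dot -RintegralD//; [|exact: square_integrable_mul..].
by apply: eq_Rintegral => x _; rewrite mulrDl.
Qed.

Lemma l2dotZl a f h : square_integrable f -> square_integrable h ->
  l2dot (fun x => a * f x) h = a * l2dot f h.
Proof.
move=> Lf Lh; rewrite /l2dot -RintegralZl//; last exact: square_integrable_mul.
by apply: eq_Rintegral => x _; rewrite mulrA.
Qed.

Lemma l2dot_ge0 f : 0 <= l2dot f f.
Proof. by apply: Rintegral_ge0 => x _; rewrite -expr2 sqr_ge0. Qed.

Lemma poweR_ltyE (x : \bar R) (r : R) : 0 < r -> (0 <= x)%E ->
  (x `^ r < +oo)%E = (x < +oo)%E.
Proof.
by move=> r0; case: x => [x| |]// _; rewrite ?poweR_EFin ?ltry// poweRyr// gt_eqF.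
Qed.

Lemma Lnorm2E f :
  ('N[m]_2%:E[EFin \o f] = (sqintegral f) `^ 2^-1)%E.
Proof.
rewrite unlock; congr (_ `^ _)%E; apply: eq_integral => x _.
rewrite (_ : `|(EFin \o f) x| = `|f x|%:E)%E//.
by rewrite poweR_EFin -[2]/(2%:R) powR_mulrn// real_normK ?num_real.
Qed.

Lemma Lfun2P f : (f \in Lfun m 2%:E) <-> square_integrable f.
Proof.
rewrite inE; split.
  move=> /andP[]; rewrite !inE/= /finite_norm Lnorm2E poweR_ltyE ?sqintegral_ge0//.
move=> [mf f2]; apply/andP; rewrite !inE/= /finite_norm Lnorm2E.
by rewrite poweR_ltyE ?sqintegral_ge0.
Qed.

End SquareIntegrable.

Lemma one_le_two (R : realType) : (1%E <= 2%:E :> \bar R)%E.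
Proof. by rewrite lee_fin ler1n. Qed.

Section L2Space.
Context d (T : measurableType d) (R : realType).
Variable m : {measure set T -> \bar R}.
Notation L2 := (LfunType m (one_le_two R)).
Implicit Types f g h : L2.

Lemma L2P f : square_integrable m f.
Proof. by apply/Lfun2P; exact: LfunP. Qed.

Definition to_L2 (f : T -> R) (Lf : square_integrable m f) : L2 :=
  Lfun_Sub (one_le_two R) ((Lfun2P m f).2 Lf).

Fact l2_ipC f g : l2dot m f g = l2dot m g f. Proof. exact: l2dotC. Qed.
Fact l2_ipDl f g h : l2dot m (f + g) h = l2dot m f h + l2dot m g h.
Proof. exact: (l2dotDl (L2P f) (L2P g) (L2P h)). Qed.
Fact l2_ipZl a f g : l2dot m (a *: f) g = a * l2dot m f g.
Proof. exact: (l2dotZl a (L2P f) (L2P g)). Qed.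
Fact l2_ip_ge0 f : 0 <= l2dot m f f. Proof. exact: l2dot_ge0. Qed.

Definition l2ip : inner_product L2 :=
  @InnerProduct R L2 (fun f g => l2dot m f g) l2_ipC l2_ipDl l2_ipZl l2_ip_ge0.

Lemma l2_nsqE f : (nsq l2ip f)%:E = sqintegral m f.
Proof. exact/l2dotE/L2P. Qed.

End L2Space.

(** * Completeness of L^2 *)

Section L2Complete.
Context d (T : measurableType d) (R : realType).
Variable m : {measure set T -> \bar R}.
Notation L2 := (LfunType m (one_le_two R)).

Lemma ncauchy_fast_subseq (V : lmodType R) (ip : inner_product V) (f : nat -> V)
    (e : nat -> R) : (forall k, 0 < e k) -> ncauchy ip f ->
  exists s : nat -> nat, (forall k, (k <= s k)%N) /\
    forall k, nsq ip (f (s k.+1) - f (s k)) < e k.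
Proof.
move=> e0 cf.
have /choice[N HN] : forall k, exists N, forall m n, (N <= m)%N -> (N <= n)%N ->
  nsq ip (f m - f n) < e k by move=> k; exact: cf.
(* Running maxima make [s] monotone, so that [s k] and [s k.+1] both lie beyond the threshold
   [N k]. *)
pose s k := \max_(i < k.+1) maxn i (N i).
have sS k : (s k <= s k.+1)%N by rewrite [leqRHS]/s big_ord_recr/= leq_maxl.
have sN k : (maxn k (N k) <= s k)%N by exact: (@leq_bigmax _ (fun i : 'I_k.+1 => maxn i (N i)) ord_max).
exists s; split => [k|k]; first exact: leq_trans (leq_maxl _ _) (sN k).
have Nk : (N k <= s k)%N by exact: leq_trans (leq_maxr _ _) (sN k).
by apply: HN => //; exact: leq_trans Nk (sS k).
Qed.

Lemma measurable_limn_einf (f : nat -> T -> \bar R) :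
  (forall n, measurable_fun setT (f n)) ->
  measurable_fun setT (fun x => limn_einf (f^~ x)).
Proof.
move=> mf; apply: (@measurableT_comp _ _ _ _ _ _ (-%E)) => //.
apply: (@measurable_fun_limn_esup _ _ _ _ (fun n x => - f n x)%E) => n.
exact: measurableT_comp.
Qed.

(** Lower semicontinuity of the distance to a fixed function: it lets one of the two indices of a
    Cauchy estimate go to infinity. *)
Lemma sqintegralB_fatou (g : nat -> T -> R) (f h : T -> R) (c : \bar R) :
  (forall k, measurable_fun setT (g k)) -> measurable_fun setT h ->
  {ae m, forall x, g k x @[k --> \oo] --> f x} ->
  measurable_fun setT f ->
  (\forall k \near \oo, (sqintegral m (fun x => (g k x - h x)%R) <= c)%E) ->
  (sqintegral m (fun x => (f x - h x)%R) <= c)%E.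
Proof.
move=> mg mh gf mf lec; rewrite /sqintegral.
have mgh k : measurable_fun setT (fun x => ((g k x - h x) ^+ 2)%:E).
  by apply: measurable_sq; exact: measurable_funB.
have einf_ge0 x : (0 <= limn_einf (fun k => ((g k x - h x) ^+ 2)%:E))%E.
  rewrite limn_einf_lim; apply: lime_ge; first exact: is_cvg_einfs.
  by near=> n; apply: le_ereal_inf_tmp => _ [k _ <-]; rewrite lee_fin sqr_ge0.
rewrite (@ge0_ae_eq_integral _ _ _ _ _ _
  (fun x => limn_einf (fun k => ((g k x - h x) ^+ 2)%:E)))//.
- apply: le_trans (fatou _ _ _ _) _ => //.
    by move=> k x _; rewrite lee_fin sqr_ge0.
  have [N _ HN] := lec.
  rewrite limn_einf_lim; apply: lime_le; first exact: is_cvg_einfs.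
  near=> n; apply: (@le_trans _ _ (\int[m]_x ((g n x - h x) ^+ 2)%:E)%E).
    by apply: ereal_inf_lbound; exists n => /=.
  by apply: HN; near: n; exists N.
- by apply: measurable_sq; exact: measurable_funB.
- exact: measurable_limn_einf.
- by move=> x _; rewrite lee_fin sqr_ge0.
- move: gf; apply: filterS => x gfx _; apply/esym/(fun h => (cvg_limn_einf_sup h).1).
  apply: cvg_EFin; first exact: nearW.
  have ghx : g k x - h x @[k --> \oo] --> f x - h x.
    by apply: cvgB => //; exact: cvg_cst.
  have -> : fine \o (fun k => ((g k x - h x) ^+ 2)%:E) =
      (fun k => (g k x - h x) * (g k x - h x)).
    by apply/funext => k; rewrite /= expr2.
  by rewrite expr2; exact: (cvgM ghx ghx).
Unshelve. all: by end_near. Qed.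

(** On a space of infinite measure the increments need not be integrable, so their absolute values
    cannot be summed in L^1. Weighting the squares with w = 2^(k+1) still leaves a summable series
    of integrals, and |t| <= w t^2 + 1/w then bounds the series of absolute increments almost
    everywhere. *)
Lemma fast_cauchy_ae_cvg (g : nat -> T -> R) :
  (forall k, measurable_fun setT (g k)) ->
  (forall k, (sqintegral m (fun x => (g k.+1 x - g k x)%R)
     <= (((2 ^ k.+1)%:R ^+ 2)^-1)%:E)%E) ->
  {ae m, forall x, cvgn (fun k => g k x)}.
Proof.
move=> mg ge.
pose w k : R := (2 ^ k.+1)%:R.
have w0 k : 0 < w k by rewrite ltr0n expn_gt0.
pose h k x := (w k * (g k.+1 x - g k x) ^+ 2)%:E.
have h0 k x : (0 <= h k x)%E by rewrite lee_fin mulr_ge0 ?sqr_ge0// ltW.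
have mh k : measurable_fun setT (h k).
  apply/measurable_EFinP; apply: measurable_funM => //.
  by apply: measurable_funX; exact: measurable_funB.
have intS : (\int[m]_x (\sum_(0 <= k <oo) h k x) < +oo)%E.
  rewrite integral_nneseries//.
  apply: (@le_lt_trans _ _ (\sum_(0 <= k <oo) (1 / w k)%:E)%E).
    apply: lee_nneseries => [k _ _|k _]; first exact: integral_ge0.
    rewrite /h; under eq_integral do rewrite EFinM.
    rewrite ge0_integralZl_EFin//; last 2 first.
    - by move=> x _; rewrite lee_fin sqr_ge0.
    - by apply: measurable_sq; exact: measurable_funB.
    apply: (@le_trans _ _ ((w k)%:E * ((w k ^+ 2)^-1)%:E)%E).
      by apply: lee_wpmul2l; [rewrite lee_fin ltW|exact: ge].
    by rewrite -EFinM lee_fin; rewrite le_eqVlt; apply/orP; left; apply/eqP; field; rewrite gt_eqF.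
  exact: le_lt_trans (epsilon_trick0 _ _) (ltry 1).
have /integrable_ae : m.-integrable setT (fun x => \sum_(0 <= k <oo) h k x)%E.
  apply/integrableP; split.
    exact: ge0_emeasurable_sum.
  by under eq_integral do rewrite gee0_abs ?nneseries_ge0//.
move/(_ measurableT); apply: filterS => x /(_ I) Sfin.
have -> : (fun k => g k x) = (fun k => g 0%N x + series (telescope (g^~ x)) k).
  by apply/funext => k; rewrite -eq_sum_telescope.
apply: is_cvgD; first exact: is_cvg_cst.
apply: (@normed_cvg R R^o).
apply: nondecreasing_is_cvgn.
  by apply: nondecreasing_series => k _ _; exact: normr_ge0.
exists (fine (\sum_(0 <= k <oo) h k x)%E + 1) => _ [n _ <-].
rewrite -lee_fin EFinD fineK//.
apply: (@le_trans _ _ (\sum_(0 <= k < n) h k x + \sum_(0 <= k < n) (1 / w k)%:E)%E).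
  rewrite /series/= -sumEFin -big_split/=; apply: lee_sum => k _.
  rewrite /h -EFinD lee_fin /telescope/=.
  set t := g k.+1 x - g k x.
  (* Completed square: the right-hand side is w t^2 + 1/w - |t|. *)
  have : 0 <= w k * (`|t| - 1 / (2 * w k)) ^+ 2 + 3 / (4 * w k).
    have wk := ltW (w0 k).
    by apply: addr_ge0; [apply: mulr_ge0 => //; exact: sqr_ge0|apply: divr_ge0 => //; apply: mulr_ge0].
  rewrite -(real_normK (num_real t)).
  set a := `|t|; have wn0 : w k != 0 by rewrite gt_eqF.
  have -> : w k * (a - 1 / (2 * w k)) ^+ 2 + 3 / (4 * w k) =
    w k * a ^+ 2 + 1 / w k - a by field.
  lra.
apply: leeD; first exact: nneseries_lim_ge.
apply: (@le_trans _ _ (\sum_(0 <= k <oo) (1 / w k)%:E)%E); last exact: epsilon_trick0.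
by apply: nneseries_lim_ge => k _ _; rewrite lee_fin divr_ge0// ltW.
Qed.

Theorem l2_complete : ncomplete (l2ip m).
Proof.
move=> f cf.
have e0 k : 0 < (((2 ^ k.+1)%:R ^+ 2)^-1 : R).
  by rewrite invr_gt0 exprn_gt0// ltr0n expn_gt0.
have [s [ks Hs]] := ncauchy_fast_subseq e0 cf.
have mf k : measurable_fun setT (f k) by have [] := L2P (f k).
pose g k : T -> R := f (s k).
have gcvg : {ae m, forall x, cvgn (fun k => g k x)}.
  apply: fast_cauchy_ae_cvg => [k|k]; first exact: mf.
  by have := Hs k; rewrite -lte_fin l2_nsqE => /ltW.
(* The lower limit is defined and measurable everywhere, also on the null set where the subsequence
   diverges. *)
pose l x := fine (limn_einf (fun k => (g k x)%:E)).
have ml : measurable_fun setT l.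
  apply: (@measurableT_comp _ _ _ _ _ _ fine); first exact: fine_measurable.
  by apply: measurable_limn_einf => k; apply/measurable_EFinP; exact: mf.
have gl : {ae m, forall x, g k x @[k --> \oo] --> l x}.
  move: gcvg; apply: filterS => x /cvg_ex[y gy].
  suff -> : l x = y by [].
  have gE : (g k x)%:E @[k --> \oo] --> y%:E.
    by apply: cvg_EFin; [exact: nearW|exact: gy].
  by rewrite /l; have [-> _] := cvg_limn_einf_sup gE.
have key e : 0 < e -> exists N, forall j, (N <= j)%N ->
    (sqintegral m (fun x => (l x - f j x)%R) <= e%:E)%E.
  move=> /cf[N HN]; exists N => j Nj.
  apply: (@sqintegralB_fatou g) => //.
  exists N => // k /= Nk; have := HN (s k) j (leq_trans Nk (ks k)) Nj.
  by rewrite -lte_fin l2_nsqE => /ltW.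
have Ll : square_integrable m l.
  have [N HN] := key 1 ltr01.
  have := @square_integrableD _ _ _ m (fun x => l x - f N x) (f N).
  have -> : (fun x => l x - f N x + f N x) = l by apply/funext => x; rewrite subrK.
  apply; last exact: L2P.
  split; first exact: measurable_funB.
  exact: le_lt_trans (HN _ (leqnn _)) (ltry _).
exists (to_L2 Ll); apply/cvgrPdist_le => e /key[N HN].
exists N => // j /= Nj.
have h : nsq (l2ip m) (f j - to_L2 Ll) <= e.
  by rewrite nsqBC -lee_fin l2_nsqE; exact: HN.
by rewrite sub0r normrN ger0_norm ?(nsq_ge0 (l2ip m) (f j - to_L2 Ll)).
Qed.

End L2Complete.

(** * Spectral measures and their functional calculus *)

Import HBSimple.
Import HBNNSimple.

Lemma cvge0_lt (R : realType) (f : nat -> \bar R) (e : R) : 0 < e ->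
  f @ \oo --> 0%E -> \forall n \near \oo, (f n < e%:E)%E.
Proof.
move=> e0 /fine_cvgP[ff /cvgrPdist_lt/(_ e e0) fe].
near=> n.
have fn : f n \is a fin_num by near: n.
rewrite -(fineK fn) lte_fin; apply: le_lt_trans (ler_norm _) _.
by rewrite -normrN -[- _]sub0r; near: n.
Unshelve. all: by end_near. Qed.

Section L2Extra.
Context d (T : measurableType d) (R : realType).
Variable m : {measure set T -> \bar R}.
Implicit Types f g h : T -> R.

Lemma l2dot_cvg (s : nat -> T -> R) f g :
  (forall n, square_integrable m (s n)) -> square_integrable m f ->
  square_integrable m g ->
  (sqintegral m (fun x => (s n x - f x)%R) @[n --> \oo] --> 0%E) ->
  l2dot m (s n) g @[n --> \oo] --> l2dot m f g.
Proof.
move=> Ls Lf Lg sf.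
apply: (@ncvg_ipl _ _ (l2ip m) (fun n => to_L2 (Ls n)) (to_L2 Lf) (to_L2 Lg)).
by apply/ncvgP; under eq_fun do rewrite l2_nsqE.
Qed.

Lemma Rintegral_sum (I : Type) (r : seq I) (F : I -> T -> R) :
  (forall i, m.-integrable setT (EFin \o F i)) ->
  \int[m]_x (\sum_(i <- r) F i x) = \sum_(i <- r) \int[m]_x F i x.
Proof.
move=> iF; elim: r => [|i r IH].
  by rewrite big_nil; under eq_Rintegral do rewrite big_nil; rewrite /Rintegral integral0.
rewrite big_cons -IH -RintegralD//.
  by apply: eq_Rintegral => x _; rewrite big_cons.
elim: r {IH} => [|j r IH].
  have := integrable0 m setT.
  by apply: eq_integrable => // x _; rewrite /= big_nil.
have := integrable_add (iF j) IH.
by apply: eq_integrable => // x _; rewrite /= big_cons.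
Qed.

Lemma integrable_mul_bounded f g (M : R) : measurable_fun setT f ->
  (forall x, `|f x| <= M) -> m.-integrable setT (EFin \o g) ->
  m.-integrable setT (EFin \o (fun x => f x * g x)).
Proof.
move=> mf fM ig.
have mg : measurable_fun setT g by apply/measurable_EFinP; case/integrableP: ig.
apply: (@le_integrable _ _ _ m _ measurableT _ (EFin \o (fun x => M * g x))).
- by apply/measurable_EFinP; exact: measurable_funM.
- move=> x _; rewrite /= lee_fin !normrM ler_wpM2r//.
  exact: le_trans (fM x) (ler_norm _).
- exact: integrable_scale.
Qed.

Lemma integrable_indicM (A : set T) f : measurable A ->
  m.-integrable setT (EFin \o f) ->
  m.-integrable setT (EFin \o (fun x => \1_A x * f x)).
Proof.
move=> mA; apply: (@integrable_mul_bounded _ _ 1); first exact: measurable_indic.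
by move=> x; rewrite indicE ger0_norm// lern1 leq_b1.
Qed.

Lemma square_integrable_indicM (A : set T) f : measurable A ->
  square_integrable m f -> square_integrable m (fun x => \1_A x * f x).
Proof.
move=> mA Lf; have [mf _] := Lf.
apply: square_integrableP; first by apply: measurable_funM => //; exact: measurable_indic.
have := integrable_indicM mA (square_integrable_sq Lf).
apply: eq_integrable => // x _; rewrite /= exprMn.
by rewrite indicE; case: (x \in A); rewrite /= ?expr1n ?expr0n.
Qed.

Lemma sfun_mulM (s : {sfun T >-> R}) (g : T -> R) :
  m.-integrable setT (EFin \o g) ->
  \int[m]_x (s x * g x) =
  \sum_(c \in range s) c * \int[m]_x (\1_(s @^-1` [set c]) x * g x).
Proof.
move=> ig; rewrite fsbig_finite; last exact: fimfunP.
have mpre c : measurable (s @^-1` [set c]) by exact: measurable_sfunP.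
transitivity (\int[m]_x (\sum_(c <- finmap.enum_fset (fset_set (range s)))
    (c * (\1_(s @^-1` [set c]) x * g x)))).
  apply: eq_Rintegral => x _; rewrite {1}fimfunE fsbig_finite; last exact: fimfunP.
  by rewrite big_distrl/=; apply: eq_bigr => c _; rewrite mulrA.
rewrite Rintegral_sum; last first.
  by move=> c; apply: integrable_scale; exact: integrable_indicM.
by apply: eq_bigr => c _; rewrite RintegralZl//; exact: integrable_indicM.
Qed.

Lemma mk_sfun (f : T -> R) : measurable_fun setT f -> finite_set (range f) ->
  exists s : {sfun T >-> R}, s = f :> (T -> R).
Proof.
move=> mf ff; have fs : f \in @sfun _ T R by rewrite inE; apply/andP; rewrite !inE.
by exists (sfun_Sub fs).
Qed.

Lemma nn_approx (f : T -> R) : measurable_fun setT f -> (forall x, 0 <= f x) ->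
  exists s : nat -> T -> R, [/\ forall n, measurable_fun setT (s n),
    forall n, finite_set (range (s n)), forall n x, 0 <= s n x <= f x &
    forall x, s n x @[n --> \oo] --> f x].
Proof.
move=> mf f0; have mf' : measurable_fun setT (EFin \o f) by exact/measurable_EFinP.
have f0' x : setT x -> (0 <= (EFin \o f) x)%E by rewrite lee_fin.
pose s := nnsfun_approx measurableT mf'.
exists (fun n => s n); split.
- by move=> n; exact: measurable_funPT.
- by move=> n; exact: fimfunP.
- move=> n x; apply/andP; split; first exact: fun_ge0.
  rewrite /s nnsfun_approxE -lee_fin; exact: (le_approx n f0').
- move=> x; have := @cvg_nnsfun_approx _ _ _ _ measurableT _ mf' f0' x I.
  by move/fine_cvg.
Qed.

(* The approximating sequence depends on [f] only, not on the measure. *)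
Lemma sfun_approx (f : T -> R) : measurable_fun setT f ->
  exists s : nat -> {sfun T >-> R},
    (forall n x, `|s n x - f x| <= `|f x|) /\
    forall x, s n x @[n --> \oo] --> f x.
Proof.
move=> mf.
have mp : measurable_fun setT (fun x => Num.max (f x) 0).
  by apply: measurable_maxr => //; exact: measurable_cst.
have mn : measurable_fun setT (fun x => Num.max (- f x) 0).
  by apply: measurable_maxr => //; exact: measurableT_comp.
have [|a [ma fa a0 ac]] := nn_approx mp; first by move=> x; rewrite le_max lexx orbT.
have [|b [mb fb b0 bc]] := nn_approx mn; first by move=> x; rewrite le_max lexx orbT.
have /choice[s Hs] : forall n, exists s : {sfun T >-> R},
    s = (fun x => a n x - b n x) :> (T -> R).
  move=> n; apply: mk_sfun; first exact: measurable_funB.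
  apply: (@sub_finite_set _ _ ((fun p : R * R => p.1 - p.2) @`
     (range (a n) `*` range (b n)))).
    by move=> _ [x _ <-]; exists (a n x, b n x) => //; split; exists x.
  by apply: finite_image; exact: finite_setX.
exists s; split => [n x|x]; last first.
  under eq_fun do rewrite Hs.
  suff fE : f x = Num.max (f x) 0 - Num.max (- f x) 0 by rewrite [f x]fE; exact: cvgB.
  have [h|h] := leP 0 (f x).
    by rewrite (max_idPr _) ?oppr_le0// subr0.
  by rewrite (max_idPl _) ?oppr_ge0 ?ltW// sub0r opprK.
rewrite Hs; have := a0 n x; have := b0 n x.
have [h|h] := leP 0 (f x).
  rewrite (max_idPr _) ?oppr_le0// => /andP[h1 h2] /andP[h3 h4].
  have -> : b n x = 0 by apply/eqP; rewrite eq_le h1 h2.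
  by rewrite subr0 (ger0_norm h) distrC ger0_norm ?subr_ge0//; lra.
have h' := ltW h; rewrite (max_idPl _) ?oppr_ge0// => /andP[h1 h2] /andP[h3 h4].
have -> : a n x = 0 by apply/eqP; rewrite eq_le h3 h4.
rewrite (ltr0_norm h) sub0r ler_norml; apply/andP; split; lra.
Qed.

Lemma sfun_approx_l2 (f : T -> R) (s : nat -> {sfun T >-> R}) :
  square_integrable m f ->
  (forall n x, `|s n x - f x| <= `|f x|) ->
  (forall x, s n x @[n --> \oo] --> f x) ->
  sqintegral m (fun x => (s n x - f x)%R) @[n --> \oo] --> 0%E.
Proof.
move=> Lf sf sc; have [mf _] := Lf.
have ms n : measurable_fun setT (fun x => s n x - f x).
  by apply: measurable_funB => //; exact: measurable_funPT.
suff [_ _] : [/\ m.-integrable setT (cst 0%E),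
   [sequence \int[m]_x (`|((s n x - f x) ^+ 2)%:E - 0|)]_n @ \oo --> 0 &
   [sequence \int[m]_x ((s n x - f x) ^+ 2)%:E]_n @ \oo --> \int[m]_x (cst 0 x)]%E.
  by rewrite integral0.
apply: (@dominated_convergence _ _ _ m setT measurableT
  (fun n x => ((s n x - f x) ^+ 2)%:E) (cst 0%E) (fun x => (f x ^+ 2)%:E)
  (fun n => measurable_sq (ms n)) (measurable_cst _) _ (square_integrable_sq Lf) _).
- apply: aeW => x _; apply: cvg_EFin; first exact: nearW.
  have -> : fine \o (fun n => ((s n x - f x) ^+ 2)%:E) =
      (fun n => (s n x - f x) * (s n x - f x)).
    by apply/funext => k; rewrite /= expr2.
  have h : s n x - f x @[n --> \oo] --> f x - f x by apply: cvgB => //; exact: cvg_cst.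
  by rewrite -(mulr0 0) -(subrr (f x)); exact: (cvgM h h).
- apply: aeW => x n _; rewrite /= lee_fin ger0_norm ?sqr_ge0//.
  by rewrite -[leLHS]real_normK ?num_real// -[leRHS]real_normK ?num_real// lerXn2r// nnegrE.
Qed.

(** From indicators to simple functions by linearity, then by monotone convergence. It will compare
    the spectral measure of a function of the operator applied to [u] with that of [u]. *)
Lemma integral_density (n : {measure set T -> \bar R}) (k : T -> R) (h : T -> \bar R) :
  measurable_fun setT k -> (forall x, 0 <= k x) ->
  (forall A, measurable A -> n A = \int[m]_x (\1_A x * k x)%:E)%E ->
  measurable_fun setT h -> (forall x, 0 <= h x)%E ->
  (\int[n]_x h x = \int[m]_x (h x * (k x)%:E))%E.
Proof.
move=> mk k0 nE mh h0.
have h0' x : setT x -> (0 <= h x)%E by [].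
pose s := nnsfun_approx measurableT mh.
have ms j : measurable_fun setT (s j) by exact: measurable_funPT.
have s0 j x : 0 <= s j x by exact: fun_ge0.
have nds x : {homo (fun j => s j x) : i j / (i <= j)%N >-> i <= j}.
  move=> i j ij; have /lefP := nd_nnsfun_approx measurableT mh ij; exact.
rewrite (@nd_ge0_integral_lim _ _ _ n h s)//; last first.
  by move=> x; exact: cvg_nnsfun_approx.
transitivity (limn (fun j => \int[m]_x ((s j x)%:E * (k x)%:E))%E).
  congr (limn _); apply/funext => j /=.
  rewrite sintegralE.
  have mpre c : measurable (s j @^-1` [set c]) by exact: measurable_sfunP.
  transitivity (\sum_(c \in range (s j)) \int[m]_x (c%:E * (\1_(s j @^-1` [set c]) x * k x)%:E))%E.
    apply: eq_fsbigr => c /set_mem [x _ <-].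
    rewrite nE// ge0_integralZl_EFin//.
    + by move=> y _; rewrite lee_fin mulr_ge0// indicE.
    + by apply/measurable_EFinP; apply: measurable_funM => //; exact: measurable_indic.
  (* The values of [s j] are nonnegative, but exchanging sum and integral asks for a nonnegative
     term at every real [c]; hence the positive part. *)
  rewrite (eq_fsbigr (fun c => \int[m]_x
     ((Num.max c 0)%:E * (\1_(s j @^-1` [set c]) x * k x)%:E))%E); last first.
    by move=> c /set_mem [x _ <-]; rewrite (max_idPl _).
  have mck c : measurable_fun setT (fun x =>
      ((Num.max c 0)%:E * (\1_(s j @^-1` [set c]) x * k x)%:E)%E).
    apply/measurable_EFinP; apply: measurable_funM => //.
    by apply: measurable_funM => //; exact: measurable_indic.
  rewrite -ge0_integral_fsum//; last first.
    by move=> c x _; rewrite -EFinM lee_fin !mulr_ge0// ?indicE// le_max lexx orbT.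
  apply: eq_integral => x _.
  rewrite fsbig_finite; last exact: fimfunP.
  rewrite -EFinM [in RHS]fimfunE fsbig_finite; last exact: fimfunP.
  rewrite big_distrl/= -sumEFin big_seq [in RHS]big_seq.
  apply: eq_bigr => c; rewrite in_fset_set; last exact: fimfunP.
  by move=> /set_mem[y _ <-]; rewrite (max_idPl _)// -EFinM mulrA.
have mck j : measurable_fun setT (fun x => ((s j x)%:E * (k x)%:E)%E).
  by apply/measurable_EFinP; exact: measurable_funM.
rewrite -monotone_convergence//.
- apply: eq_integral => x _; apply/cvg_lim => //.
  apply: cvgeMr => //; exact: cvg_nnsfun_approx.
- by move=> j x _; rewrite -EFinM lee_fin mulr_ge0.
- by move=> x _ i j ij; rewrite -!EFinM lee_fin ler_wpM2r//; exact: nds.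
Qed.

End L2Extra.

(** Abstract counterpart of [projection_valued_measure]. Equalities are up to [nequiv], which will
    be almost everywhere equality; symmetry already implies linearity up to [nequiv]. *)
Record projection_valued (R : realType) (V : lmodType R) (ip : inner_product V)
    (E : set R -> V -> V) : Prop := ProjectionValued {
  pv_sym : forall A u v, measurable A -> ip (E A u) v = ip u (E A v);
  pv_setT : forall u, nequiv ip (E setT u) u;
  pv_setI : forall A B u, measurable A -> measurable B ->
    nequiv ip (E (A `&` B) u) (E A (E B u));
  pv_sigma : forall (F : (set R)^nat) u, (forall k, measurable (F k)) ->
    trivIset setT F ->
    ncvg ip (fun n => \sum_(0 <= k < n) E (F k) u) (E (\bigcup_k F k) u) }.

Section SpectralMeasure.
Variables (R : realType) (V : lmodType R) (ip : inner_product V).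
Variable E : set R -> V -> V.
Hypothesis HE : projection_valued ip E.
Implicit Types (u v w : V) (A B : set R) (f g : R -> R).

Lemma pv_ip A B u v : measurable A -> measurable B ->
  ip (E A u) (E B v) = ip (E (A `&` B) u) v.
Proof.
move=> mA mB; rewrite -(pv_sym HE)//.
by rewrite -(nequiv_ipl _ (pv_setI HE _ mB mA)) setIC.
Qed.

Lemma pv_nsq A u : measurable A -> nsq ip (E A u) = ip (E A u) u.
Proof. by move=> mA; rewrite /nsq pv_ip// setIid. Qed.

(** Countable additivity for the constant family of empty sets makes the multiples n x converge to
    x, where x = <E(set0) u, u>. Consecutive multiples differ by x, so x = 0. *)
Lemma pv_nsq_set0 u : nsq ip (E set0 u) = 0.
Proof.
rewrite pv_nsq//; set x := ip _ _.
have h : (fun n : nat => n%:R * x) @ \oo --> x.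
  have := @pv_sigma _ _ _ _ HE (fun=> set0) u (fun=> measurable0).
  rewrite bigcup0// => /(_ (@trivIset_set0 _ _ _)) /(ncvg_ipl (k := u)).
  apply: cvg_trans; apply: near_eq_cvg; near=> n.
  by rewrite ip_suml sumr_const_nat subn0 mulr_natl.
have h1 : (fun n : nat => n.+1%:R * x) @ \oo --> x.
  by move: h; rewrite -(cvg_shiftS (fun n : nat => n%:R * x)).
have : (fun n : nat => n.+1%:R * x - n%:R * x) @ \oo --> x - x by exact: cvgB.
have -> : (fun n : nat => n.+1%:R * x - n%:R * x) = cst x.
  by apply/funext => n /=; rewrite -mulrBl -natrB// subSnn mul1r.
rewrite subrr => h2; have h3 : (cst x : nat -> R) @ \oo --> x by exact: cvg_cst.
by transitivity (limn (cst x : nat -> R)); [apply/esym|]; exact: cvg_lim.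
Unshelve. all: by end_near. Qed.

Definition smass u A : \bar R := (nsq ip (E A u))%:E.

Let smass0 u : smass u set0 = 0%E. Proof. by rewrite /smass pv_nsq_set0. Qed.
Let smass_ge0 u A : (0 <= smass u A)%E. Proof. by rewrite lee_fin nsq_ge0. Qed.
Let smass_sigma u : semi_sigma_additive (smass u).
Proof.
move=> F mF tF mUF.
have := ncvg_ipl (k := u) (pv_sigma HE u mF tF).
rewrite /smass pv_nsq// => h; apply: cvg_EFin.
  by near=> n; rewrite sumEFin.
move: h; apply: cvg_trans; apply: near_eq_cvg; near=> n.
rewrite /= sumEFin/= ip_suml; apply: eq_bigr => k _; by rewrite pv_nsq.
Unshelve. all: by end_near. Qed.

Definition spectral_measure u : {measure set R -> \bar R} :=
  HB.pack (smass u) (isMeasure.Build _ _ _ (smass u)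
    (smass0 u) (smass_ge0 u) (@smass_sigma u)).

Lemma spectral_measureE u : spectral_measure u = smass u :> (set R -> \bar R).
Proof. by []. Qed.

Lemma spectral_measureT u : spectral_measure u setT = (nsq ip u)%:E.
Proof. by rewrite spectral_measureE /smass (nequiv_nsq (pv_setT HE u)). Qed.

Definition simple_calculus (s : {sfun R >-> R}) u : V :=
  \sum_(c \in range s) c *: E (s @^-1` [set c]) u.

Local Notation mu := spectral_measure.

Lemma simple_calculusE (s : {sfun R >-> R}) u : simple_calculus s u =
  \sum_(c <- finmap.enum_fset (fset_set (range s))) c *: E (s @^-1` [set c]) u.
Proof. by rewrite /simple_calculus fsbig_finite; last exact: fimfunP. Qed.

Lemma measurable_sfun_pre (s : {sfun R >-> R}) c : measurable (s @^-1` [set c]).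
Proof. exact: measurable_sfunP. Qed.

(* [g] is the density of the real measure A |-> <w, E(A) u> *)
Definition spectral_density u w (g : R -> R) := forall A, measurable A ->
  ip w (E A u) = \int[mu u]_x (\1_A x * g x).

Lemma ip_simple_calculus u w g (s : {sfun R >-> R}) :
  (mu u).-integrable setT (EFin \o g) -> spectral_density u w g ->
  ip w (simple_calculus s u) = \int[mu u]_x (s x * g x).
Proof.
move=> ig Hw; rewrite sfun_mulM// fsbig_finite; last exact: fimfunP.
rewrite simple_calculusE ipC ip_suml; apply: eq_bigr => c _.
by rewrite ipZl ipC Hw//; exact: measurable_sfun_pre.
Qed.

Lemma simple_calculus_sym s u v :
  ip (simple_calculus s u) v = ip u (simple_calculus s v).
Proof.
rewrite !simple_calculusE (ipC ip u) !ip_suml; apply: eq_bigr => c _.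
by rewrite !ipZl (pv_sym HE)// ?(ipC ip u)//; exact: measurable_sfun_pre.
Qed.

Lemma integrable_cst u c : (mu u).-integrable setT (EFin \o cst c).
Proof.
apply/integrableP; split; first by apply/measurable_EFinP; exact: measurable_cst.
rewrite (_ : (fun x => _) = cst (`|c|%:E)); last by [].
by rewrite integral_cst// spectral_measureT -EFinM ltry.
Qed.

Lemma integrable_bounded u f (M : R) : measurable_fun setT f ->
  (forall x, `|f x| <= M) -> (mu u).-integrable setT (EFin \o f).
Proof. by move=> mf fM; apply: integrable_le (integrable_cst u M) _. Qed.

Lemma square_integrable_bounded u f (M : R) : measurable_fun setT f ->
  (forall x, `|f x| <= M) -> square_integrable (mu u) f.
Proof.
move=> mf fM; apply: square_integrableP => //.
apply: (@integrable_bounded _ _ (M ^+ 2)); first exact: measurable_funX.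
by move=> x; rewrite normrX lerXn2r// nnegrE (le_trans _ (fM x)).
Qed.

Lemma square_integrable_indic u A : measurable A ->
  square_integrable (mu u) (\1_A : R -> R).
Proof.
move=> mA; apply: (@square_integrable_bounded _ _ 1); first exact: measurable_indic.
by move=> x; rewrite indicE ger0_norm// lern1 leq_b1.
Qed.

Lemma square_integrable_sfun u (s : {sfun R >-> R}) : square_integrable (mu u) s.
Proof.
have [M [_ sM]] := simple_bounded s.
apply: (@square_integrable_bounded _ _ (M + 1)); first exact: measurable_funPT.
by move=> x; apply: sM => //; rewrite ltrDl.
Qed.

Lemma square_integrable_integrable u f : square_integrable (mu u) f ->
  (mu u).-integrable setT (EFin \o f).
Proof.
move=> Lf; have L1 : square_integrable (mu u) (cst 1).
  by apply: (@square_integrable_bounded _ _ 1) => // x; rewrite normr1.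
have := square_integrable_mul Lf L1.
by apply: eq_integrable => // x _; rewrite /= mulr1.
Qed.

Lemma spectral_density_indic u A : measurable A ->
  spectral_density u (E A u) (\1_A).
Proof.
move=> mA B mB; rewrite pv_ip// -pv_nsq; last exact: measurableI.
rewrite /Rintegral (_ : (\int[mu u]_x _)%E = mu u (A `&` B)).
  by rewrite spectral_measureE.
rewrite -[A `&` B]setIT -integral_indic//; last exact: measurableI.
by apply: eq_integral => x _; rewrite indicI /= mulrC.
Qed.

Lemma spectral_density_setT u : spectral_density u u (cst 1).
Proof.
move=> A mA; rewrite ipC -pv_nsq//; have := @spectral_density_indic u A mA A mA.
rewrite -/(nsq ip (E A u)) => ->; apply: eq_Rintegral => x _ /=.
by rewrite indicE; case: (_ \in _); rewrite ?mulr1 ?mulr0.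
Qed.

Lemma spectral_density_E u w g A : measurable A -> spectral_density u w g ->
  spectral_density u (E A w) (fun x => \1_A x * g x).
Proof.
move=> mA Hw B mB; rewrite (pv_sym HE)//.
rewrite -(nequiv_ipr _ (pv_setI HE _ mA mB)) Hw; last exact: measurableI.
by apply: eq_Rintegral => x _; rewrite indicI /= mulrCA mulrA.
Qed.

(* [w] is the integral of [f] dE applied to [u] *)
Definition spectral_calculus (f : R -> R) u w := exists s : nat -> {sfun R >-> R},
  (sqintegral (mu u) (fun x => (s n x - f x)%R) @[n --> \oo] --> 0%E) /\
  ncvg ip (fun n => simple_calculus (s n) u) w.

Lemma spectral_calculus_dom f u w : measurable_fun setT f ->
  spectral_calculus f u w -> square_integrable (mu u) f.
Proof.
move=> mf [s [sf _]].
have [n sn] : exists n, (sqintegral (mu u) (fun x => (s n x - f x)%R) < 1%:E)%E.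
  have : (\forall n \near \oo, (sqintegral (mu u) (fun x => (s n x - f x)%R) < 1%:E)%E).
    exact: cvge0_lt ltr01 sf.
  by case=> N _ HN; exists N; apply: HN => /=.
have ms := @measurable_funPT _ _ _ _ (s n).
have L1 : square_integrable (mu u) (fun x => s n x - f x).
  by split; [exact: measurable_funB|exact: lt_trans sn (ltry _)].
have := square_integrableB (square_integrable_sfun u (s n)) L1.
by congr square_integrable; apply/funext => x; rewrite subKr.
Qed.

(** Both sides are continuous in the approximating simple functions, for which the identity is a
    finite sum. The isometry, uniqueness and symmetry of the calculus all rest on this one
    pairing. *)
Lemma ip_spectral_calculus f g u w z : measurable_fun setT f ->
  spectral_calculus f u w -> square_integrable (mu u) g ->
  spectral_density u z g -> ip w z = l2dot (mu u) f g.
Proof.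
move=> mf If Lg Hz; have Lf := spectral_calculus_dom mf If; case: If => s [sf sw].
have h1 := ncvg_ipl (k := z) sw.
have h2 := l2dot_cvg (fun n => square_integrable_sfun u (s n)) Lf Lg sf.
apply: (cvg_unique _ h1 _) => //.
move: h2; apply: cvg_trans; apply: near_eq_cvg; near=> n.
by rewrite ipC (ip_simple_calculus _ (square_integrable_integrable Lg) Hz).
Unshelve. all: by end_near. Qed.

Lemma spectral_calculus_density f u w : measurable_fun setT f ->
  spectral_calculus f u w -> spectral_density u w f.
Proof.
move=> mf If A mA; rewrite (ip_spectral_calculus mf If (square_integrable_indic u mA)
  (spectral_density_indic u mA)).
exact: l2dotC.
Qed.

Lemma spectral_calculus_ip f g u w z : measurable_fun setT f -> measurable_fun setT g ->
  spectral_calculus f u w -> spectral_calculus g u z -> ip w z = l2dot (mu u) f g.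
Proof.
move=> mf mg If Ig; apply: (ip_spectral_calculus mf If).
  exact: spectral_calculus_dom Ig.
exact: spectral_calculus_density.
Qed.

Lemma spectral_calculus_unique f u w w' : measurable_fun setT f ->
  spectral_calculus f u w -> spectral_calculus f u w' -> nequiv ip w w'.
Proof.
move=> mf If If'; rewrite /nequiv nsqB /nsq.
rewrite (spectral_calculus_ip mf mf If If) (spectral_calculus_ip mf mf If If').
by rewrite (spectral_calculus_ip mf mf If' If'); lra.
Qed.

Lemma spectral_calculus_nequiv f u w w' : nequiv ip w w' ->
  spectral_calculus f u w -> spectral_calculus f u w'.
Proof.
move=> ww' [s [sf sw]]; exists s; split => //.
by apply: ncvg_nequiv ww' sw => n; exact: nequiv_refl.
Qed.

(** Isometry on simple functions, in the form of differences that the Cauchy criterion uses. *)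
Lemma nsq_simple_calculusB (s s' : {sfun R >-> R}) u :
  (nsq ip (simple_calculus s u - simple_calculus s' u))%:E =
  sqintegral (mu u) (fun x => s x - s' x).
Proof.
have Ls := square_integrable_sfun u s; have Ls' := square_integrable_sfun u s'.
have D (t : {sfun R >-> R}) : spectral_density u (simple_calculus t u) t.
  move=> A mA; rewrite ipC (ip_simple_calculus _ _ (spectral_density_indic u mA)).
    by apply: eq_Rintegral => x _; rewrite mulrC.
  exact/square_integrable_integrable/square_integrable_indic.
rewrite -l2dotE; last exact: square_integrableB.
have ipE (t t' : {sfun R >-> R}) :
    ip (simple_calculus t u) (simple_calculus t' u) = l2dot (mu u) t t'.
  rewrite (ip_simple_calculus _ _ (D t)); first exact: l2dotC.
  exact/square_integrable_integrable/square_integrable_sfun.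
rewrite nsqB /nsq !ipE; congr (_%:E).
have LNs' := square_integrableN Ls'.
have LB := square_integrableB Ls Ls'.
have NE h : square_integrable (mu u) h ->
    l2dot (mu u) (fun x => - s' x) h = - l2dot (mu u) s' h.
  move=> Lh; rewrite -mulN1r -l2dotZl//; apply: eq_Rintegral => x _.
  by rewrite mulN1r.
rewrite (l2dotDl Ls LNs' LB) NE// !(l2dotC _ _ (fun x => s x - s' x)).
rewrite !(l2dotDl Ls LNs') ?NE// (l2dotC _ s' s); lra.
Qed.

Hypothesis complete : ncomplete ip.

(** A sequence that converges in L^2 of the spectral measure is Cauchy there; the isometry carries
    this to the vectors, and completeness supplies the limit. *)
Lemma spectral_calculus_approx f u (s : nat -> {sfun R >-> R}) :
  measurable_fun setT f ->
  (sqintegral (mu u) (fun x => (s n x - f x)%R) @[n --> \oo] --> 0%E) ->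
  exists w, ncvg ip (fun n => simple_calculus (s n) u) w.
Proof.
move=> mf sf; apply: complete => e e0.
have e4 : 0 < e / 4 by rewrite divr_gt0.
have [N _ HN] : \forall n \near \oo,
  (sqintegral (mu u) (fun x => (s n x - f x)%R) < (e / 4)%:E)%E by exact: cvge0_lt e4 sf.
have ms n := @measurable_funPT _ _ _ _ (s n).
have L n : (N <= n)%N -> square_integrable (mu u) (fun x => s n x - f x).
  move=> Nn; split; first exact: measurable_funB.
  exact: lt_trans (HN n Nn) (ltry _).
have L2 n (Nn : (N <= n)%N) := to_L2 (L n Nn).
exists N => i j Ni Nj; rewrite -lte_fin nsq_simple_calculusB.
have h : nsq (l2ip (mu u)) (to_L2 (L i Ni) - to_L2 (L j Nj)) < e.
  apply: le_lt_trans (nsqB_le _ _ 0 _) _; rewrite subr0 sub0r nsqN.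
  have := HN i Ni; have := HN j Nj.
  rewrite -(l2_nsqE (to_L2 (L i Ni))) -(l2_nsqE (to_L2 (L j Nj))) !lte_fin; lra.
rewrite -lte_fin l2_nsqE in h; apply: le_lt_trans h.
rewrite le_eqVlt; apply/orP; left; apply/eqP; apply: eq_integral => x _.
congr (_ ^+ 2)%:E.
have -> : (to_L2 (L i Ni) - to_L2 (L j Nj)) x = (s i x - f x) - (s j x - f x) by [].
by ring.
Qed.

Lemma spectral_calculus_exists f u : square_integrable (mu u) f ->
  exists w, spectral_calculus f u w.
Proof.
move=> Lf; have [mf _] := Lf; have [s [sf sc]] := sfun_approx mf.
have h := sfun_approx_l2 Lf sf sc.
by have [w sw] := spectral_calculus_approx mf h; exists w, s.
Qed.

(** The sequence provided by [spectral_calculus] depends on [u]. Replacing it by one built from [f]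
    alone gives a sequence common to two vectors, as the symmetry of the calculus demands. *)
Lemma spectral_calculus_canonical f u w (s : nat -> {sfun R >-> R}) :
  measurable_fun setT f -> (forall n x, `|s n x - f x| <= `|f x|) ->
  (forall x, s n x @[n --> \oo] --> f x) -> spectral_calculus f u w ->
  ncvg ip (fun n => simple_calculus (s n) u) w.
Proof.
move=> mf sf sc If; have h := sfun_approx_l2 (spectral_calculus_dom mf If) sf sc.
have [w' sw'] := spectral_calculus_approx mf h.
have If' : spectral_calculus f u w' by exists s.
apply: ncvg_nequiv (spectral_calculus_unique mf If' If) sw' => n.
exact: nequiv_refl.
Qed.

Lemma spectral_calculus_sym f u w v z : measurable_fun setT f ->
  spectral_calculus f u w -> spectral_calculus f v z -> ip w v = ip u z.
Proof.
move=> mf If Jf; have [s [sf sc]] := sfun_approx mf.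
have h1 := ncvg_ipl (k := v) (spectral_calculus_canonical mf sf sc If).
have h2 := ncvg_ipl (k := u) (spectral_calculus_canonical mf sf sc Jf).
rewrite (ipC ip u); apply: (cvg_unique _ h1 _) => //.
move: h2; apply: cvg_trans; apply: near_eq_cvg; near=> n.
by rewrite simple_calculus_sym ipC.
Unshelve. all: by end_near. Qed.

(** A criterion that requires no approximating sequence. If w0 is the integral of f applied to u,
    the density gives <w0, w> = |w0|^2 = |f|^2, and the norm bound gives |w|^2 <= |f|^2, so |w0 -
    w|^2 <= 0. *)
Lemma spectral_calculusP f u w : square_integrable (mu u) f ->
  spectral_density u w f -> nsq ip w <= l2dot (mu u) f f ->
  spectral_calculus f u w.
Proof.
move=> Lf Dw nw; have [mf _] := Lf.
have [w0 I0] := spectral_calculus_exists Lf.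
apply: spectral_calculus_nequiv (I0); apply/eqP; rewrite eq_le nsq_ge0 andbT.
rewrite nsqB {1}/nsq (spectral_calculus_ip mf mf I0 I0).
rewrite (ip_spectral_calculus mf I0 Lf Dw); lra.
Qed.

Lemma spectral_calculus_indic A u : measurable A -> spectral_calculus \1_A u (E A u).
Proof.
move=> mA; apply: spectral_calculusP.
- exact: square_integrable_indic.
- exact: spectral_density_indic.
- rewrite /nsq (spectral_density_indic u mA mA).
  exact: lexx.
Qed.

Lemma spectral_calculus1 u : spectral_calculus (cst 1) u u.
Proof.
apply: spectral_calculusP.
- by apply: (@square_integrable_bounded _ _ 1) => // x; rewrite normr1.
- exact: spectral_density_setT.
- rewrite -(nequiv_nsq (pv_setT HE u)) pv_nsq// ipC (spectral_density_setT _ measurableT).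
  rewrite /l2dot le_eqVlt; apply/orP; left; apply/eqP; apply: eq_Rintegral => x _.
  by rewrite indicT.
Qed.

Lemma spectral_calculus_mass f u v A : measurable_fun setT f ->
  spectral_calculus f u v -> measurable A ->
  (mu v A = \int[mu u]_x (\1_A x * f x ^+ 2)%:E)%E.
Proof.
move=> mf If mA; rewrite spectral_measureE /smass pv_nsq// ipC.
have Lf := spectral_calculus_dom mf If.
have Lg := square_integrable_indicM mA Lf.
rewrite (ip_spectral_calculus mf If Lg
  (spectral_density_E mA (spectral_calculus_density mf If))).
rewrite /l2dot /Rintegral fineK; last first.
  by apply: integrable_fin_num => //; exact: square_integrable_mul.
by apply: eq_integral => x _; rewrite mulrCA expr2.
Qed.

Lemma integral_spectral_calculus f u v (h : R -> \bar R) : measurable_fun setT f ->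
  spectral_calculus f u v -> measurable_fun setT h -> (forall x, 0 <= h x)%E ->
  (\int[mu v]_x h x = \int[mu u]_x (h x * (f x ^+ 2)%:E))%E.
Proof.
move=> mf If mh h0; apply: integral_density => //.
- exact: measurable_funX.
- by move=> x; exact: sqr_ge0.
- by move=> A mA; exact: spectral_calculus_mass.
Qed.

Lemma sqintegral_spectral_calculus f g u v : measurable_fun setT f ->
  measurable_fun setT g -> spectral_calculus f u v ->
  sqintegral (mu v) g = sqintegral (mu u) (fun x => g x * f x).
Proof.
move=> mf mg If; rewrite /sqintegral.
rewrite (integral_spectral_calculus mf If)//; last 2 first.
- exact: measurable_sq.
- by move=> x; rewrite lee_fin sqr_ge0.
by apply: eq_integral => x _; rewrite -EFinM exprMn.
Qed.

(** Multiplicativity of the calculus. Since the spectral measure of v has density f^2 with respect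
    to that of u, simple functions s_n -> g for v give s_n f -> g f for u; the density of w is found
    along this sequence, its norm by the isometry. *)
Lemma spectral_calculus_comp f g u v w : measurable_fun setT f ->
  measurable_fun setT g -> spectral_calculus f u v -> spectral_calculus g v w ->
  spectral_calculus (fun x => g x * f x) u w.
Proof.
move=> mf mg If Ig.
have Lf := spectral_calculus_dom mf If; have Lg := spectral_calculus_dom mg Ig.
have mgf : measurable_fun setT (fun x => g x * f x) by exact: measurable_funM.
have Lgf : square_integrable (mu u) (fun x => g x * f x).
  split => //; rewrite -(sqintegral_spectral_calculus mf mg If).
  by have [] := Lg.
apply: spectral_calculusP => //; last first.
  rewrite -lee_fin l2dotE// -(sqintegral_spectral_calculus mf mg If) -l2dotE//.
  by rewrite lee_fin /nsq (spectral_calculus_ip mg mg Ig Ig).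
move=> A mA; case: (Ig) => s [sg sw].
have h1 := ncvg_ipl (k := E A u) sw.
have Lsf n : square_integrable (mu u) (fun x => s n x * f x).
  have ms := @measurable_funPT _ _ _ _ (s n).
  split; first exact: measurable_funM.
  rewrite -(sqintegral_spectral_calculus mf ms If).
  by have [] := square_integrable_sfun v (s n).
have h2 : l2dot (mu u) (fun x => s n x * f x) \1_A @[n --> \oo] -->
    l2dot (mu u) (fun x => g x * f x) \1_A.
  apply: l2dot_cvg => //; first exact: square_integrable_indic.
  move: sg; apply: cvg_trans; apply: near_eq_cvg; near=> n.
  have ms := @measurable_funPT _ _ _ _ (s n).
  rewrite (sqintegral_spectral_calculus mf _ If); last exact: measurable_funB.
  by apply: eq_integral => x _; rewrite mulrBl.
transitivity (l2dot (mu u) (fun x => g x * f x) \1_A); last exact: l2dotC.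
apply: (cvg_unique _ h1 _) => //.
move: h2; apply: cvg_trans; apply: near_eq_cvg; near=> n.
rewrite simple_calculusE ip_suml l2dotC /l2dot.
have iAf : (mu u).-integrable setT (EFin \o (fun x => \1_A x * f x)).
  exact: integrable_indicM (square_integrable_integrable Lf).
transitivity (\int[mu u]_x (s n x * (\1_A x * f x))).
  by apply: eq_Rintegral => x _; rewrite mulrCA.
rewrite sfun_mulM// fsbig_finite; last exact: fimfunP.
apply: eq_bigr => c _; have mc := measurable_sfun_pre (s n) c.
rewrite [in RHS]ipZl (pv_sym HE)// -(nequiv_ipr _ (pv_setI HE u mc mA)).
rewrite (spectral_calculus_density mf If); last exact: measurableI.
by congr (_ * _); apply: eq_Rintegral => x _; rewrite indicI /= mulrA.
Unshelve. all: by end_near. Qed.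

End SpectralMeasure.

(** * The semigroup of a self-adjoint operator *)

Import HBSimple.

Section ExpBounds.
Variable R : realType.
Implicit Types x y : R.

Lemma expR_onem_le x : 1 - expR (- x) <= x.
Proof. by have := expR_ge1Dx (- x); lra. Qed.

Lemma mul_expRN_le1 x : x * expR (- x) <= 1.
Proof.
rewrite expRN ler_pdivrMr ?expR_gt0// mul1r.
by have := expR_ge1Dx x; lra.
Qed.

(** The remainder is at most x (1 - e^{-x}), because (1 + x) e^{-x} <= 1, and the factor 1 - e^{-x}
    is in turn of size |x| e^{|x|} for either sign of x. *)
Lemma expR_taylor2 x : `|expR (- x) - 1 + x| <= x ^+ 2 * expR `|x|.
Proof.
have h1 := expR_ge1Dx (- x).
rewrite ger0_norm; last by lra.
have h2 : expR (- x) - 1 + x <= x * (1 - expR (- x)).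
  have := expR_ge1Dx x; rewrite -(ler_pM2r (expR_gt0 (- x))) -expRD subrr expR0; lra.
apply: le_trans h2 _.
have [x0|x0] := leP 0 x.
  rewrite expr2 -mulrA ler_wpM2l//; apply: le_trans (expR_onem_le x) _.
  by rewrite -[leLHS]mulr1 ler_wpM2l// ger0_norm// -expR0 ler_expR.
rewrite ltr0_norm// expr2 -mulrA; apply: ler_wnM2l; first exact: ltW.
have h3 := expR_onem_le (- x); rewrite opprK in h3.
have h4 : (1 - expR x) * expR (- x) <= - x * expR (- x) by rewrite ler_wpM2r ?expR_ge0.
by move: h4; rewrite mulrBl mul1r -expRD subrr expR0; lra.
Qed.

End ExpBounds.

Section HeatSemigroup.
Variables (R : realType) (V : lmodType R) (ip : inner_product V).
Variable E : set R -> V -> V.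
Hypothesis HE : projection_valued ip E.
Hypothesis complete : ncomplete ip.
Implicit Types (u v w f : V).

Notation mu := (spectral_measure HE).
Notation sc := (spectral_calculus HE).

Lemma spectral_calculus_lin (a b : R) (f g : R -> R) u w z :
  measurable_fun setT f -> measurable_fun setT g ->
  sc f u w -> sc g u z -> sc (fun l => a * f l + b * g l) u (a *: w + b *: z).
Proof.
move=> mf mg If Ig.
have Lf := spectral_calculus_dom mf If; have Lg := spectral_calculus_dom mg Ig.
have Laf := square_integrableZ a Lf; have Lbg := square_integrableZ b Lg.
have L := square_integrableD Laf Lbg.
apply: spectral_calculusP => //.
  move=> A mA; rewrite ipDl !ipZl.
  rewrite (spectral_calculus_density mf If mA) (spectral_calculus_density mg Ig mA).
  have iA h : square_integrable (mu u) h ->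
      (mu u).-integrable setT (EFin \o (fun x => \1_A x * h x)).
    by move=> Lh; exact: integrable_indicM (square_integrable_integrable Lh).
  rewrite -!RintegralZl//; [|exact: iA|exact: iA].
  rewrite -RintegralD//; [|exact: integrable_scale (iA _ Lf)|exact: integrable_scale (iA _ Lg)].
  by apply: eq_Rintegral => x _; ring.
rewrite (l2dotDl Laf Lbg L) (l2dotZl a Lf L) (l2dotZl b Lg L).
rewrite !(l2dotC _ _ (fun x => a * f x + b * g x)).
rewrite !(l2dotDl Laf Lbg) // !(l2dotZl a Lf) // !(l2dotZl b Lg) //.
rewrite /nsq ipDl !ipDr !ipZl !ipZr (spectral_calculus_ip mf mf If If).
rewrite (spectral_calculus_ip mf mg If Ig) (spectral_calculus_ip mg mf Ig If).
rewrite (spectral_calculus_ip mg mg Ig Ig) (l2dotC _ g f); lra.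
Qed.

Variable B : V -> V -> Prop.
Hypothesis HB : forall u w, B u w <-> sc id u w.
Hypothesis gap : forall u w, B u w -> 2 * nsq ip u <= ip w u.

(** On the range of the projection of [-n, 1] the form <B v, v> is at most |v|^2, while the gap
    makes it at least 2 |v|^2; so v is null. The bound -n puts v in the domain of B, and any
    threshold below 2 could replace 1. *)
Lemma spectral_gap_itv n u : mu u `[- n%:R, 1]%classic = 0%E.
Proof.
set A := `[_, _]%classic.
have mA : measurable A by exact: measurable_itv.
have IA := spectral_calculus_indic HE complete u mA.
have mi : measurable_fun setT (\1_A : R -> R) by exact: measurable_indic.
have mid : measurable_fun setT (id : R -> R) by exact: measurable_id.
have Lid : square_integrable (mu (E A u)) id.
  split => //; rewrite (sqintegral_spectral_calculus mi mid IA).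
  have : square_integrable (mu u) (fun x => id x * \1_A x).
    apply: (@square_integrable_bounded _ _ _ _ _ _ _ (n%:R + 1)); first exact: measurable_funM.
    move=> x; rewrite indicE; case: (boolP (x \in A)) => [|_]; last first.
      by rewrite mulr0 normr0 addr_ge0.
    rewrite mulr1 inE /A/= in_itv/= => /andP[h1 h2].
    have n0 : (0 : R) <= n%:R by [].
    by rewrite ler_norml; apply/andP; split; lra.
  by case.
have [w Iw] := spectral_calculus_exists complete Lid.
have := gap ((HB _ _).2 Iw).
have Iw' := spectral_calculus_comp complete mi mid IA Iw.
have mM : measurable_fun setT (fun x : R => id x * \1_A x) by exact: measurable_funM.
rewrite (spectral_calculus_ip mM mi Iw' IA) /nsq (spectral_calculus_ip mi mi IA IA).
have LM := spectral_calculus_dom mM Iw'; have LA := spectral_calculus_dom mi IA.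
have h : l2dot (mu u) (fun x => id x * \1_A x) \1_A <= l2dot (mu u) \1_A \1_A.
  apply: le_Rintegral => //; [exact: square_integrable_mul..|].
  move=> x _; rewrite indicE; case: (boolP (x \in A)) => [|_]; last by rewrite !mulr0.
  by rewrite !mulr1 inE /A/= in_itv/= => /andP[h1 h2].
move=> h2; have h3 : l2dot (mu u) \1_A \1_A <= 0 by lra.
rewrite spectral_measureE /smass; congr (_%:E); apply/eqP.
by rewrite eq_le nsq_ge0 andbT /nsq (spectral_calculus_ip mi mi IA IA).
Qed.

Lemma spectral_gap u : {ae mu u, forall l, 1 < l}.
Proof.
exists (\bigcup_n `[- n%:R, 1]%classic); split.
- by apply: bigcupT_measurable => n; exact: measurable_itv.
- apply/eqP; rewrite eq_le measure_ge0 andbT.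
  apply: le_trans (measure_sigma_subadditive _ _ _ (@subset_refl _ _)) _ => //.
    by apply: bigcupT_measurable => n; exact: measurable_itv.
  by rewrite eseries0// => n _ _; exact: spectral_gap_itv.
- move=> l /= /negP; rewrite -leNgt => l1.
  exists (Num.trunc `|l|).+1 => //=; rewrite in_itv/= l1 andbT.
  rewrite lerNl; apply: le_trans (ler_norm _) _; rewrite normrN ltW//.
  exact: Num.Theory.truncnS_gt.
Qed.

Lemma sqintegral_le_gap u (g h : R -> R) : measurable_fun setT g ->
  measurable_fun setT h -> (forall l, 1 < l -> `|g l| <= `|h l|) ->
  (sqintegral (mu u) g <= sqintegral (mu u) h)%E.
Proof.
move=> mg mh gh; apply: ae_ge0_le_integral => //.
- by move=> x _; rewrite lee_fin sqr_ge0.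
- exact: measurable_sq.
- by move=> x _; rewrite lee_fin sqr_ge0.
- exact: measurable_sq.
- apply: filterS (spectral_gap u) => l l1 _; rewrite lee_fin.
  rewrite -[leLHS]real_normK ?num_real// -[leRHS]real_normK ?num_real//.
  by rewrite lerXn2r ?nnegrE//; exact: gh.
Qed.

Lemma square_integrable_gap u (g h : R -> R) : measurable_fun setT g ->
  (forall l, 1 < l -> `|g l| <= `|h l|) -> square_integrable (mu u) h ->
  square_integrable (mu u) g.
Proof.
move=> mg gh [mh h2]; split => //.
exact: le_lt_trans (sqintegral_le_gap u mg mh gh) h2.
Qed.

Lemma nsq_le_gap u w z (g h : R -> R) : measurable_fun setT g ->
  measurable_fun setT h -> (forall l, 1 < l -> `|g l| <= `|h l|) ->
  sc g u w -> sc h u z -> nsq ip w <= nsq ip z.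
Proof.
move=> mg mh gh Ig Ih; rewrite /nsq (spectral_calculus_ip mg mg Ig Ig).
rewrite (spectral_calculus_ip mh mh Ih Ih) -lee_fin.
rewrite !l2dotE; [|exact: spectral_calculus_dom Ih|exact: spectral_calculus_dom Ig].
exact: sqintegral_le_gap.
Qed.

Lemma nsq_le_const u w (g : R -> R) (M : R) : 0 <= M -> measurable_fun setT g ->
  (forall l, 1 < l -> `|g l| <= M) -> sc g u w -> nsq ip w <= M ^+ 2 * nsq ip u.
Proof.
move=> M0 mg gM Ig.
have I1 := spectral_calculus1 HE complete u.
have mc : measurable_fun setT (cst 1 : R -> R) by [].
have := spectral_calculus_lin M 0 mc mc I1 I1.
rewrite scale0r addr0 => IM.
rewrite -nsqZ; apply: (nsq_le_gap mg _ _ Ig IM).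
  by apply: measurable_funD; exact: measurable_funM.
by move=> l l1; rewrite /= mulr1 mul0r addr0 (ger0_norm M0); exact: gM.
Qed.

Definition heat (t l : R) := expR (- (t * l)).

Lemma measurable_heat t : measurable_fun setT (heat t).
Proof.
apply: continuous_measurable_fun => l.
apply: (@continuous_comp _ _ _ (fun l => - (t * l)) expR); last exact: continuous_expR.
by apply: cvgN; apply: cvgM; [exact: cvg_cst|exact: cvg_id].
Qed.
Hint Resolve measurable_heat : core.

Lemma heat_gt0 t l : 0 < heat t l. Proof. exact: expR_gt0. Qed.

Lemma heatD s t l : heat (s + t) l = heat s l * heat t l.
Proof. by rewrite /heat -expRD; congr expR; ring. Qed.

Lemma heat_le1 t l : 0 <= t -> 1 < l -> `|heat t l| <= 1.
Proof.
move=> t0 l1; rewrite gtr0_norm ?heat_gt0// -expR0 ler_expR oppr_le0.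
by rewrite mulr_ge0//; lra.
Qed.

Definition semigroup t u w := sc (heat t) u w.

Lemma square_integrable_heat t u : 0 <= t -> square_integrable (mu u) (heat t).
Proof.
move=> t0; apply: (@square_integrable_gap _ _ (cst 1)) => //.
  by move=> l l1; rewrite normr1; exact: heat_le1.
by apply: (@square_integrable_bounded _ _ _ _ _ _ _ 1) => // l; rewrite normr1.
Qed.

Lemma semigroup_exists t u : 0 <= t -> exists w, semigroup t u w.
Proof.
by move=> t0; apply: (spectral_calculus_exists complete); exact: square_integrable_heat.
Qed.

Lemma semigroup_unique t u w w' : semigroup t u w -> semigroup t u w' -> nequiv ip w w'.
Proof. exact: spectral_calculus_unique. Qed.

Lemma semigroupD s t u v w : semigroup s u v -> semigroup t v w ->
  semigroup (t + s) u w.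
Proof.
move=> Is It; have := spectral_calculus_comp complete (measurable_heat s)
  (measurable_heat t) Is It.
by rewrite /semigroup; congr spectral_calculus; apply/funext => l; rewrite heatD.
Qed.

Lemma semigroup_sym t u v w z : semigroup t u w -> semigroup t v z -> ip w v = ip u z.
Proof. exact: (spectral_calculus_sym complete). Qed.

Lemma semigroup0 u w : semigroup 0 u w -> nequiv ip w u.
Proof.
move=> I0; apply: (@semigroup_unique 0 u) => //.
have := spectral_calculus1 HE complete u.
by rewrite /semigroup; congr spectral_calculus; apply/funext => l;
  rewrite /heat mul0r oppr0 expR0.
Qed.

Lemma nsq_semigroup_le t u w : 0 <= t -> semigroup t u w -> nsq ip w <= nsq ip u.
Proof.
move=> t0 I; rewrite -[leRHS]mul1r -[X in X * _](expr1n R 2).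
by apply: nsq_le_const I => // l l1; exact: heat_le1.
Qed.

Lemma nsq_semigroup_nincr s t u v w : s <= t -> semigroup s u v -> semigroup t u w ->
  nsq ip w <= nsq ip v.
Proof.
move=> st Is It; apply: nsq_le_gap It Is => // l l1.
rewrite !gtr0_norm ?heat_gt0// ler_expR lerN2 ler_wpM2r//; lra.
Qed.

(** The time is split in two halves: one is left for smoothing, the other yields the factor e^{-t}
    because the spectrum lies above 1. *)
Lemma nsq_semigroup_decay t u v w : 0 <= t -> semigroup t u v ->
  semigroup (2 * t) u w -> nsq ip w <= expR (- t) ^+ 2 * nsq ip v.
Proof.
move=> t0 It I2t.
have [z Iz] := semigroup_exists v t0.
have I2t' : semigroup (2 * t) u z.
  by rewrite (_ : 2 * t = t + t); [exact: semigroupD It Iz|ring].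
rewrite (nequiv_nsq (semigroup_unique I2t I2t')).
apply: nsq_le_const Iz => //.
move=> l l1; rewrite gtr0_norm ?heat_gt0// ler_expR lerN2.
by rewrite -[leLHS]mulr1 ler_wpM2l// ltW.
Qed.

Lemma measurable_id_heat t : measurable_fun setT (fun l : R => l * heat t l).
Proof. by apply: measurable_funM. Qed.
Hint Resolve measurable_id_heat : core.

Lemma id_heat_le t l : 0 < t -> 1 < l -> 0 <= l * heat t l <= t^-1.
Proof.
move=> t0 l1; have h0 := heat_gt0 t l.
have h1 : 0 <= l * heat t l by apply: mulr_ge0; lra.
rewrite h1/=.
rewrite -[leRHS]mul1r ler_pdivlMr// mulrC mulrA.
exact: (mul_expRN_le1 (t * l)).
Qed.

(** As l e^{-t l} is bounded by 1/t on the spectrum, S_t maps every vector into the domain of B. *)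
Lemma semigroup_generator t u w : 0 < t -> semigroup t u w ->
  exists2 b, B w b & sc (fun l => l * heat t l) u b.
Proof.
move=> t0 It.
have mid : measurable_fun setT (id : R -> R) by exact: measurable_id.
have Lid : square_integrable (mu w) id.
  split => //; rewrite (sqintegral_spectral_calculus (measurable_heat t) mid It).
  suff [] : square_integrable (mu u) (fun x => id x * heat t x) by [].
  apply: (@square_integrable_gap _ _ (cst (t^-1))) => //.
    move=> l l1; have /andP[h1 h2] := id_heat_le t0 l1.
    by rewrite /= ger0_norm// (ger0_norm (ltW _)) ?invr_gt0.
  by apply: (@square_integrable_bounded _ _ _ _ _ _ _ `|t^-1|).
have [b Ib] := spectral_calculus_exists complete Lid.
exists b; first exact/HB.
exact: (spectral_calculus_comp complete (measurable_heat t) mid It Ib).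
Qed.

(** In the spectral measure of u the form is the integral of l e^{-2tl}, and l e^{-tl} <= 1/t leaves
    e^{-tl}, the square of the symbol at time t/2. This replaces the differential inequality of the
    classical Nash argument. *)
Lemma semigroup_energy t u v w b : 0 < t -> semigroup (t / 2) u v ->
  semigroup t u w -> B w b -> ip b w <= t^-1 * nsq ip v.
Proof.
move=> t0 Iv Iw /HB Ib.
have mid : measurable_fun setT (id : R -> R) by exact: measurable_id.
have Ib' : sc (fun l => l * heat t l) u b.
  exact: (spectral_calculus_comp complete (measurable_heat t) mid Iw Ib).
rewrite (spectral_calculus_ip (measurable_id_heat t) (measurable_heat t) Ib' Iw).
rewrite /nsq (spectral_calculus_ip (measurable_heat _) (measurable_heat _) Iv Iv).
have Lv := spectral_calculus_dom (measurable_heat _) Iv.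
have Lw := spectral_calculus_dom (measurable_heat _) Iw.
have Lb := spectral_calculus_dom (measurable_id_heat t) Ib'.
have i1 := square_integrable_mul Lb Lw.
have i2 := square_integrable_mul (square_integrableZ t^-1 Lv) Lv.
rewrite -(l2dotZl t^-1 Lv Lv) -lee_fin /l2dot /Rintegral.
rewrite (fineK (integrable_fin_num measurableT i1)) (fineK (integrable_fin_num measurableT i2)).
apply: le_trans (lee_abs _) _; apply: le_trans (le_abse_integral _ _ _) _ => //.
  by case/integrableP: i1.
apply: ae_ge0_le_integral => //.
- apply: measurableT_comp => //; by case/integrableP: i1.
- by move=> x _; rewrite lee_fin !mulr_ge0 ?ltW ?heat_gt0// invr_gt0.
- by case/integrableP: i2.
- apply: filterS (spectral_gap u) => l l1 _; rewrite abse_EFin lee_fin.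
  have /andP[h1 h2] := id_heat_le t0 l1.
  have -> : t^-1 * heat (t / 2) l * heat (t / 2) l = t^-1 * heat t l.
    by rewrite -mulrA -heatD -splitr.
  have hh := ltW (heat_gt0 t l).
  by rewrite ger0_norm; [exact: ler_wpM2r|exact: mulr_ge0].
Qed.

(** This is the square of x e^{-x} <= 1 at x = t l / 4, whence the 16. *)
Lemma sqr_mul_heat_le t l : 0 < t -> 0 <= l -> l ^+ 2 * heat (t / 2) l <= 16 / t ^+ 2.
Proof.
move=> t0 l0; have h := mul_expRN_le1 (t * l / 4).
have h0 : 0 <= t * l / 4 * expR (- (t * l / 4)).
  by rewrite mulr_ge0 ?expR_ge0// divr_ge0// mulr_ge0// ltW.
have : (t * l / 4 * expR (- (t * l / 4))) ^+ 2 <= 1 by rewrite expr_le1.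
have -> : heat (t / 2) l = expR (- (t * l / 4)) ^+ 2.
  by rewrite /heat expr2 -expRD; congr expR; field.
rewrite ler_pdivlMr ?exprn_gt0// exprMn.
have -> : (t * l / 4) ^+ 2 = t ^+ 2 * l ^+ 2 / 16 by field.
by set e := expR _; lra.
Qed.

(** The Taylor remainder at l is at most h^2 l^2 e^{-tl + |h| l}, and |h| <= t/2 keeps half of the
    decay to absorb l^2. The second-order error, uniform for t away from 0, gives both the time
    derivative and the commutation with translations. *)
Lemma semigroup_taylor t h u w v b : 0 < t -> `|h| <= t / 2 ->
  semigroup t u w -> semigroup (t + h) u v -> sc (fun l => l * heat t l) u b ->
  nsq ip (v - w + h *: b) <= (h ^+ 2 * (16 / t ^+ 2)) ^+ 2 * nsq ip u.
Proof.
move=> t0 ht Iw Iv Ib.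
have m1 := measurable_heat t; have m2 := measurable_heat (t + h).
have I1 := spectral_calculus_lin 1 (-1) m2 m1 Iv Iw.
have m3 : measurable_fun setT (fun l : R => 1 * heat (t + h) l + -1 * heat t l).
  by apply: measurable_funD; exact: measurable_funM.
have := spectral_calculus_lin 1 h m3 (measurable_id_heat t) I1 Ib.
rewrite scaleN1r !scale1r; apply: nsq_le_const.
- by rewrite mulr_ge0 ?sqr_ge0// divr_ge0// sqr_ge0.
- by apply: measurable_funD; exact: measurable_funM.
move=> l l1; have l0 : 0 <= l by lra.
have -> : 1 * (1 * heat (t + h) l + -1 * heat t l) + h * (l * heat t l) =
   heat t l * (expR (- (h * l)) - 1 + h * l) by rewrite heatD /heat; ring.
rewrite normrM gtr0_norm ?heat_gt0//.
apply: le_trans (ler_wpM2l (ltW (heat_gt0 _ _)) (expR_taylor2 _)) _.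
have -> : heat t l * ((h * l) ^+ 2 * expR `|h * l|) =
  h ^+ 2 * (l ^+ 2 * (heat t l * expR `|h * l|)) by ring.
apply: ler_wpM2l; first exact: sqr_ge0.
apply: le_trans (sqr_mul_heat_le t0 l0).
apply: ler_wpM2l; first exact: sqr_ge0.
rewrite /heat -expRD ler_expR normrM (ger0_norm l0).
have : `|h| * l <= t / 2 * l by rewrite ler_wpM2r.
lra.
Qed.

Lemma semigroup_cvg0 (t : nat -> R) u (w : nat -> V) : (forall n, 0 <= t n) ->
  t @ \oo --> 0 -> (forall n, semigroup (t n) u (w n)) -> ncvg ip w u.
Proof.
move=> tn0 t0 Iw; apply/ncvgP.
have I1 := spectral_calculus1 HE complete u.
have mc : measurable_fun setT (cst 1 : R -> R) by [].
have mt n : measurable_fun setT (fun l => 1 * heat (t n) l + -1 * cst 1 l).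
  by apply: measurable_funD; exact: measurable_funM.
have wE n : (nsq ip (w n - u))%:E = (\int[mu u]_l ((heat (t n) l - 1) ^+ 2)%:E)%E.
  have In := spectral_calculus_lin 1 (-1) (measurable_heat (t n)) mc (Iw n) I1.
  rewrite scale1r scaleN1r in In.
  rewrite /nsq (spectral_calculus_ip (mt n) (mt n) In In) l2dotE.
    by apply: eq_integral => l _; rewrite mul1r mulN1r.
  exact: spectral_calculus_dom In.
under eq_fun do rewrite wE.
have mt' n : measurable_fun setT (fun l => ((heat (t n) l - 1) ^+ 2)%:E).
  by apply: measurable_sq; exact: measurable_funB.
suff [_ _] : [/\ (mu u).-integrable setT (cst 0%E),
   [sequence \int[mu u]_x (`|((heat (t n) x - 1) ^+ 2)%:E - 0|)]_n @ \oo --> 0 &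
   [sequence \int[mu u]_x ((heat (t n) x - 1) ^+ 2)%:E]_n @ \oo --> \int[mu u]_x (cst 0 x)]%E.
  by rewrite integral0.
apply: (@dominated_convergence _ _ _ (mu u) setT measurableT _ _ (EFin \o cst 1) mt').
- exact: measurable_cst.
- apply: aeW => x _; apply: cvg_EFin; first exact: nearW.
  have -> : fine \o (fun n => ((heat (t n) x - 1) ^+ 2)%:E) =
      (fun n => (heat (t n) x - 1) * (heat (t n) x - 1)).
    by apply/funext => k; rewrite /= expr2.
  have h : heat (t n) x - 1 @[n --> \oo] --> expR (- (0 * x)) - 1.
    apply: cvgB; last exact: cvg_cst.
    have hh : - (t n * x) @[n --> \oo] --> - (0 * x).
      by apply: cvgN; apply: cvgM => //; exact: cvg_cst.
    exact: (cvg_comp _ _ hh (@continuous_expR R _)).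
  rewrite mul0r oppr0 expR0 subrr in h.
  by rewrite -(mulr0 0); exact: (cvgM h h).
- exact: integrable_cst.
- apply: filterS (spectral_gap u) => l l1 n _.
  rewrite /= lee_fin ger0_norm ?sqr_ge0//.
  have h1 := heat_gt0 (t n) l; have := heat_le1 (tn0 n) l1.
  by rewrite gtr0_norm// => h2; nra.
Qed.

Lemma semigroup_family u : exists X : R -> V, forall t, 0 <= t -> semigroup t u (X t).
Proof.
suff H : forall t, exists w, 0 <= t -> semigroup t u w.
  by have [X HX] := choice H; exists X.
move=> t; have [t0|t0] := leP 0 t; last by exists 0.
by have [w Iw] := semigroup_exists u t0; exists w.
Qed.

(** Summing n increments of length T/n gives at most C T^2 / n, which is arbitrarily small. This
    stands in for the vanishing of a derivative. *)
Lemma quadratic_increments (theta : R -> R) (T C d : R) : 0 <= T -> 0 < d ->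
  (forall t h, 0 <= t -> 0 < h -> h <= d -> t + h <= T ->
     `|theta (t + h) - theta t| <= C * h ^+ 2) -> theta T = theta 0.
Proof.
move=> T0 d0 H; move: T0; rewrite le_eqVlt => /predU1P[<-//|T0].
apply/eqP; rewrite -subr_eq0 -normr_le0; apply/ler_addgt0Pr => e e0.
have [n [n0 nd ne]] : exists n : nat, [/\ (0 < n)%N, T / n%:R <= d & C * T ^+ 2 / n%:R <= e].
  pose M := `|T / d| + `|C * T ^+ 2 / e|.
  exists (Num.trunc M).+1; have hM : M < (Num.trunc M).+1%:R.
    exact: Num.Theory.truncnS_gt.
  have n0 : 0 < (Num.trunc M).+1%:R :> R by [].
  have h1 : T / d < (Num.trunc M).+1%:R.
    by apply: le_lt_trans hM; apply: le_trans (ler_norm _) _; rewrite lerDl.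
  have h2 : C * T ^+ 2 / e < (Num.trunc M).+1%:R.
    by apply: le_lt_trans hM; apply: le_trans (ler_norm _) _; rewrite lerDr.
  split => //.
    by move: h1; rewrite ltr_pdivrMr// ler_pdivrMr// mulrC => /ltW.
  by move: h2; rewrite ltr_pdivrMr// ler_pdivrMr// (mulrC e) => /ltW.
have n0' : 0 < n%:R :> R by rewrite ltr0n.
have step k : (k <= n)%N -> `|theta (k%:R * (T / n%:R)) - theta 0| <= k%:R * (C * (T / n%:R) ^+ 2).
  elim: k => [_|k IH kn]; first by rewrite !mul0r subrr normr0.
  have -> : k.+1%:R * (T / n%:R) = k%:R * (T / n%:R) + T / n%:R.
    by rewrite -natr1 mulrDl mul1r.
  rewrite -(subrKA (theta (k%:R * (T / n%:R)))) -natr1 mulrDl mul1r addrC.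
  apply: le_trans (ler_normD _ _) _; apply: lerD; first exact/IH/ltnW.
  apply: H => //; [by rewrite mulr_ge0// divr_ge0// ltW|exact: divr_gt0|].
  rewrite -[X in _ + X]mul1r -mulrDl natr1 mulrCA -[leRHS]mulr1; apply: ler_wpM2l; first exact: ltW.
  by rewrite ler_pdivrMr// mul1r ler_nat.
have := step n (leqnn n); rewrite mulrC divfK ?gt_eqF// => /le_trans; apply.
rewrite add0r; apply: le_trans ne; rewrite le_eqVlt; apply/orP; left; apply/eqP.
by field; rewrite gt_eqF.
Qed.

(** * Isometries that commute with B commute with its semigroup *)

Section Commutation.
Variable U : V -> V.
Hypothesis UB : forall x y, U (x - y) = U x - U y.
Hypothesis UZ : forall a x, U (a *: x) = a *: U x.
Hypothesis Uiso : forall x, nsq ip (U x) = nsq ip x.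
Hypothesis UBop : forall u w, B u w -> B (U u) (U w).

Let ncvgU (x : nat -> V) l : ncvg ip x l -> ncvg ip (U \o x) (U l).
Proof. by move=> xl; rewrite /ncvg; under eq_fun do rewrite /= -UB Uiso. Qed.

Let UD x y : U (x + y) = U x + U y.
Proof.
have -> : x + y = x - (-1 *: y) by rewrite scaleN1r opprK.
by rewrite UB UZ scaleN1r opprK.
Qed.

Let taylor_le (d t h n m : R) : 0 < d -> d <= t ->
  n <= (h ^+ 2 * (16 / t ^+ 2)) ^+ 2 * m -> 0 <= m ->
  Num.sqrt n <= h ^+ 2 * (16 / d ^+ 2) * Num.sqrt m.
Proof.
move=> d0 dt nm m0.
have t0 : 0 < t by exact: lt_le_trans dt.
have h1 : h ^+ 2 * (16 / t ^+ 2) <= h ^+ 2 * (16 / d ^+ 2).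
  rewrite ler_wpM2l ?sqr_ge0// ler_wpM2l// lef_pV2 ?posrE ?exprn_gt0//.
  by rewrite lerXn2r// nnegrE; exact: ltW.
have h0 : 0 <= h ^+ 2 * (16 / t ^+ 2).
  by rewrite mulr_ge0 ?sqr_ge0// divr_ge0// sqr_ge0.
apply: le_trans (_ : h ^+ 2 * (16 / t ^+ 2) * Num.sqrt m <= _); last first.
  by rewrite ler_wpM2r// sqrtr_ge0.
rewrite -(ger0_norm h0) -sqrtr_sqr -sqrtrM ?sqr_ge0//.
by apply: ler_wsqrtr.
Qed.

(** The pairing of U S_{t+d} u with S_{T-t+d} g has increments of second order in t, hence is
    constant. The shift by d keeps all times at least d, where the Taylor bound is uniform. No
    uniqueness of the spectral resolution is involved. *)
Let semigroup_comm_shift (d T : R) u g (X Z : R -> V) : 0 < d -> 0 <= T ->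
  (forall t, 0 <= t -> semigroup t u (X t)) ->
  (forall t, 0 <= t -> semigroup t g (Z t)) ->
  ip (U (X (T + d))) (Z d) = ip (U (X d)) (Z (T + d)).
Proof.
move=> d0 T0 HX HZ.
pose theta t := ip (U (X (t + d))) (Z (T - t + d)).
suff : theta T = theta 0 by rewrite /theta subrr !add0r subr0.
apply: (@quadratic_increments _ _
  (16 / d ^+ 2 * Num.sqrt (nsq ip u) * Num.sqrt (nsq ip g) * 2) (d / 2) T0).
  exact: divr_gt0.
move=> t h t0 h0 hd thT.
have t1 : 0 < t + d by lra.
have s1 : 0 < T - (t + h) + d by lra.
have habs s : d <= s -> `|h| <= s / 2 by move=> ds; rewrite gtr0_norm//; lra.
have d1 : d <= t + d by lra.
have d2 : d <= T - (t + h) + d by lra.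
have [b Bb Ib] := semigroup_generator t1 (HX _ (ltW t1)).
have [c Bc Ic] := semigroup_generator s1 (HZ _ (ltW s1)).
have Ix : semigroup (t + d + h) u (X (t + h + d)).
  by rewrite (_ : t + d + h = t + h + d); [apply: HX; lra|ring].
have Iz : semigroup (T - (t + h) + d + h) g (Z (T - t + d)).
  by rewrite (_ : T - (t + h) + d + h = T - t + d); [apply: HZ; lra|ring].
have ex := semigroup_taylor t1 (habs _ d1) (HX _ (ltW t1)) Ix Ib.
have ez := semigroup_taylor s1 (habs _ d2) (HZ _ (ltW s1)) Iz Ic.
rewrite /theta; move: ex ez.
have nX := nsq_semigroup_le (ltW t1) (HX _ (ltW t1)).
have nZ := nsq_semigroup_le (ltW s1) (HZ _ (ltW s1)).
move: nX nZ Bb Bc.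
set x := X (t + d); set x' := X (t + h + d); set z := Z (T - (t + h) + d).
set z' := Z (T - t + d) => nX nZ Bb Bc.
set e := x' - x + h *: b; set e' := z' - z + h *: c => ex ez.
(* [U b] is B applied to [U x] and [c] is B applied to [z]: symmetry of B cancels the first-order
   terms. *)
have sym : ip (U b) z = ip (U x) c.
  have /HB I1 := UBop Bb; have /HB I2 := Bc.
  exact: (spectral_calculus_sym complete (@measurable_id _ _ setT) I1 I2).
have -> : ip (U x') z - ip (U x) z' = ip (U e) z - ip (U x) e'.
  rewrite /e /e' UD UB UZ !(ipDl, ipDr, ipNl, ipNr, ipZl, ipZr) sym; ring.
apply: le_trans (ler_normB _ _) _.
have hs y y' : nsq ip y <= nsq ip y' -> Num.sqrt (nsq ip y) <= Num.sqrt (nsq ip y').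
  by move=> yy; apply: ler_wsqrtr.
have b1 := taylor_le d0 d1 ex (nsq_ge0 ip u).
have b2 := taylor_le d0 d2 ez (nsq_ge0 ip g).
have a1 : `|ip (U e) z| <= h ^+ 2 * (16 / d ^+ 2) * Num.sqrt (nsq ip u) * Num.sqrt (nsq ip g).
  apply: le_trans (ip_abs_le _ _ _) _; rewrite Uiso.
  by apply: ler_pM; rewrite ?sqrtr_ge0//; exact: hs.
have a2 : `|ip (U x) e'| <= Num.sqrt (nsq ip u) * (h ^+ 2 * (16 / d ^+ 2) * Num.sqrt (nsq ip g)).
  apply: le_trans (ip_abs_le _ _ _) _; rewrite Uiso.
  by apply: ler_pM; rewrite ?sqrtr_ge0//; exact: hs.
lra.
Qed.

(** Strong continuity at time 0 removes the shift d = 1/(n+1) from both sides of the shifted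
    identity. *)
Lemma semigroup_comm t u w w' : 0 <= t ->
  semigroup t u w -> semigroup t (U u) w' -> nequiv ip (U w) w'.
Proof.
move=> t0 Iw Iw'; apply/nequivP => g.
have [X HX] := semigroup_family u; have [Z HZ] := semigroup_family g.
pose d (n : nat) : R := n.+1%:R^-1.
have d0 n : 0 < d n by rewrite invr_gt0.
have dcvg : d @ \oo --> 0 by exact: cvg_harmonic.
have shift v (Y : R -> V) y : (forall t, 0 <= t -> semigroup t v (Y t)) ->
    semigroup t v y -> ncvg ip (fun n => Y (t + d n)) y.
  move=> HY Iy; have [Q HQ] := semigroup_family y.
  apply: (@ncvg_nequiv _ _ _ (Q \o d) _ y _ _ (nequiv_refl _ _)).
    move=> n /=; apply: (@semigroup_unique (t + d n) v).
      by rewrite addrC; apply: semigroupD Iy _; apply: HQ; exact: ltW.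
    by apply: HY; rewrite addr_ge0// ltW.
  apply: (@semigroup_cvg0 d y) => // n; [exact: ltW|].
  by apply: HQ; exact: ltW.
have start v (Y : R -> V) : (forall t, 0 <= t -> semigroup t v (Y t)) ->
    ncvg ip (Y \o d) v.
  move=> HY; apply: (@semigroup_cvg0 d v) => // n; [exact: ltW|].
  by apply: HY; exact: ltW.
have h1 := ncvg_ip (ncvgU (shift u X w HX Iw)) (start g Z HZ).
have h2 := ncvg_ip (ncvgU (start u X HX)) (shift g Z (Z t) HZ (HZ t t0)).
rewrite (semigroup_sym Iw' (HZ t t0)).
apply: (cvg_unique _ h1 _) => //.
move: h2; apply: cvg_trans; apply: near_eq_cvg; near=> n.
by rewrite /= (semigroup_comm_shift (d0 n) t0 HX HZ).
Unshelve. all: by end_near. Qed.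

End Commutation.

Lemma le_halves (x y z : R) : (forall n, x <= (2^-1) ^+ n * y + z) -> x <= z.
Proof.
move=> H.
have h : (fun n : nat => (2^-1) ^+ n * y + z) @ \oo --> 0 * y + z.
  apply: cvgD; last exact: cvg_cst.
  apply: cvgM; last exact: cvg_cst.
  by apply: cvg_expr; rewrite ger0_norm// invf_lt1// ltr1n.
rewrite mul0r add0r in h; rewrite -(cvg_lim _ h)//.
by apply: limr_ge; [apply/cvg_ex; exists z|near=> n; exact: H].
Unshelve. all: by end_near. Qed.

(* A Nash type inequality along the orbit self-improves: rescaling time by 4
   contracts t^(5/2) |S_t f|^2 by a factor 2; the spectral gap then turns
   t^(-5/2) into t^(-9/2). *)
Lemma semigroup_smoothing f (c N : R) : 0 <= c -> 0 <= N ->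
  (forall t r w b, 0 < t -> 0 < r -> semigroup t f w -> B w b ->
     nsq ip w <= 10 * r ^+ 2 * ip b w + c * N / r ^+ 5) ->
  forall t w, 0 < t -> semigroup (2 * t ^+ 2) f w ->
  t ^+ 9 * nsq ip w <= 2 * (32 ^+ 5 * c * N).
Proof.
move=> c0 N0 H t w t0 Iw.
have [X HX] := semigroup_family f.
(* Times are written as squares: t^(5/2) becomes s^5, and halving [s] divides the time by 4. *)
pose A s := nsq ip (X (s ^+ 2)).
have half s : 0 < s -> s ^+ 5 * A s <= 2^-1 * ((s / 2) ^+ 5 * A (s / 2)) + 32 ^+ 5 * c * N.
  move=> s0; have s20 : 0 < s ^+ 2 by rewrite exprn_gt0.
  have Is := HX _ (ltW s20).
  have [b Bb _] := semigroup_generator s20 Is.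
  (* With r = s/32 the energy term is 10/1024 times the previous value. Since s^5 = 32 (s/2)^5 the
     contraction factor is 320/1024, below 1/2, and the other term contributes 32^5. *)
  have r0 : 0 < s / 32 by rewrite divr_gt0.
  have h1 := H _ _ _ _ s20 r0 Is Bb.
  have s22 : 0 <= s ^+ 2 / 2 by rewrite divr_ge0// ltW.
  have h2 := semigroup_energy s20 (HX _ s22) Is Bb.
  have h3 : nsq ip (X (s ^+ 2 / 2)) <= A (s / 2).
    rewrite /A; apply: (nsq_semigroup_nincr _ (HX _ _) (HX _ _)) => //; last exact: sqr_ge0.
    have -> : (s / 2) ^+ 2 = s ^+ 2 / 4 by field.
    lra.
  have h4 : nsq ip (X (s ^+ 2)) <= 10 * (s / 32) ^+ 2 * ((s ^+ 2)^-1 * A (s / 2)) + c * N / (s / 32) ^+ 5.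
    apply: le_trans h1 _; rewrite lerD2r; apply: ler_wpM2l.
      by have := sqr_ge0 (s / 32); lra.
    by apply: le_trans h2 _; rewrite ler_wpM2l// invr_ge0 ltW.
  have s5 : 0 <= s ^+ 5 by rewrite exprn_ge0// ltW.
  have := ler_wpM2l s5 h4; rewrite -/(A s) => /le_trans; apply.
  have sn0 : s != 0 by rewrite gt_eqF.
  have -> : s ^+ 5 * (10 * (s / 32) ^+ 2 * ((s ^+ 2)^-1 * A (s / 2)) + c * N / (s / 32) ^+ 5)
     = (320 / 1024) * ((s / 2) ^+ 5 * A (s / 2)) + 32 ^+ 5 * c * N by field.
  rewrite lerD2r; apply: ler_wpM2r; last by lra.
  by apply: mulr_ge0; [rewrite exprn_ge0//; lra|exact: nsq_ge0].
have cN : 0 <= 32 ^+ 5 * c * N by rewrite !mulr_ge0.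
(* With K the additive constant, 2 K is preserved by x -> x/2 + K. The initial term, finite because
   [f] is in L^2, dies out as n grows and leaves no trace of the L^2 norm. *)
have iter n s : 0 < s -> s ^+ 5 * A s <= (2^-1) ^+ n * (s ^+ 5 * nsq ip f) + 2 * (32 ^+ 5 * c * N).
  elim: n s => [|n IH] s s0.
    rewrite expr0 mul1r; apply: ler_wpDr; first by rewrite mulr_ge0.
    apply: ler_wpM2l; first by rewrite exprn_ge0// ltW.
    by apply: nsq_semigroup_le (HX _ _); exact: sqr_ge0.
  apply: le_trans (half s s0) _.
  have s2 : 0 < s / 2 by rewrite divr_gt0.
  have h := IH _ s2.
  have h5 : (s / 2) ^+ 5 * nsq ip f <= s ^+ 5 * nsq ip f.
    apply: ler_wpM2r; first exact: nsq_ge0.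
    by rewrite lerXn2r// ?nnegrE; lra.
  have h6 : (2^-1) ^+ n * ((s / 2) ^+ 5 * nsq ip f) <= (2^-1) ^+ n * (s ^+ 5 * nsq ip f).
    by rewrite ler_wpM2l// exprn_ge0// invr_ge0.
  rewrite [2^-1 ^+ n.+1]exprS -[X in _ <= X + _]mulrA; move: h h6.
  set P := (s / 2) ^+ 5 * A (s / 2); set K := 32 ^+ 5 * c * N.
  set Q := _ * ((s / 2) ^+ 5 * _); set W := _ * (s ^+ 5 * _) => h h6.
  lra.
have At : t ^+ 5 * A t <= 2 * (32 ^+ 5 * c * N).
  by apply: (@le_halves _ (t ^+ 5 * nsq ip f)) => n; exact: iter.
apply: le_trans At.
have t20 : 0 < t ^+ 2 by rewrite exprn_gt0.
have h := nsq_semigroup_decay (ltW t20) (HX _ (ltW t20)) Iw.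
have t9 : 0 <= t ^+ 9 by rewrite exprn_ge0// ltW.
apply: le_trans (ler_wpM2l t9 h) _; rewrite -/(A t).
(* The four extra powers of [t] go into (t^2 e^{-t^2})^2 <= 1: this is the passage from 5 to 9. *)
have -> : t ^+ 9 * (expR (- t ^+ 2) ^+ 2 * A t) =
  (t ^+ 2 * expR (- t ^+ 2)) ^+ 2 * (t ^+ 5 * A t) by ring.
rewrite -[leRHS]mul1r; apply: ler_wpM2r.
  by apply: mulr_ge0; [rewrite exprn_ge0//; lra|exact: nsq_ge0].
by rewrite expr_le1// ?mul_expRN_le1// mulr_ge0 ?expR_ge0// ltW.
Qed.

End HeatSemigroup.

(** * The Haar measure of the Cartan group *)

Section SigmaFiniteProduct.
Context (R : realType) d1 d2 (T1 : measurableType d1)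
    (T2 : measurableType d2) (m1 : {sigma_finite_measure set T1 -> \bar R})
    (m2 : {sigma_finite_measure set T2 -> \bar R}).
(** A separate name carries the sigma-finite structure, so that Tonelli can be iterated through the
    nested products that make up [haar]. *)
Definition sf_prod := (m1 \x m2)%E.
HB.instance Definition _ := Measure.on sf_prod.
Lemma sf_prod_sigma_finite : sigma_finite setT sf_prod.
Proof.
have /sigma_finiteP[F [TF ndF Foo]] := sigma_finiteT m1.
have /sigma_finiteP[G [TG ndG Goo]] := sigma_finiteT m2.
exists (fun n => F n `*` G n).
  rewrite -setXTT TF TG predeqE => -[x y]; split => [[/= [n _ Fx] [k _ Gy]]|[n _ []/= Fx Gy]].
    exists (maxn n k) => //; split.
      exact: (subsetPset _ _ (ndF _ _ (leq_maxl n k))).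
    exact: (subsetPset _ _ (ndG _ _ (leq_maxr n k))).
  by split; exists n.
move=> k; have [mF Fk] := Foo k; have [mG Gk] := Goo k.
split; first exact: measurableX.
by rewrite /sf_prod product_measure1E// lte_mul_pinfty// ge0_fin_numE.
Qed.
HB.instance Definition _ := Measure_isSigmaFinite.Build _ _ _ sf_prod sf_prod_sigma_finite.
Definition sigma_finite_prod : {sigma_finite_measure set (T1*T2)%type -> \bar R} := sf_prod.
End SigmaFiniteProduct.

Section MeasurePreserving.
Context {R : realType}.

(** Invariance is expressed by integrals of nonnegative functions and not by measures of preimages:
    this is the form in which it composes and enters Tonelli's theorem. *)
Definition preserves d (T : measurableType d) (m : set T -> \bar R)
    (phi : T -> T) := measurable_fun setT phi /\
  forall F : T -> \bar R, measurable_fun setT F -> (forall x, 0 <= F x)%E ->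
    (\int[m]_x F (phi x) = \int[m]_x F x)%E.

Lemma preserves_comp d (T : measurableType d) (m : {measure set T -> \bar R})
  (f g : T -> T) : preserves m f -> preserves m g -> preserves m (f \o g).
Proof.
move=> [mf pf] [mg pg]; split; first exact: measurableT_comp.
move=> F mF F0; rewrite -(pf F mF F0).
exact: (pg (F \o f) (measurableT_comp mF mf) (fun x => F0 _)).
Qed.

Lemma preserves_integral d (T : measurableType d) (m : {measure set T -> \bar R})
  (f : T -> \bar R) phi : preserves m phi -> measurable_fun setT f ->
  (\int[m]_x f (phi x) = \int[m]_x f x)%E.
Proof.
move=> [mp pp] mf; rewrite integralE [RHS]integralE.
have mfp : measurable_fun setT f^\+%E by exact: measurable_funepos.
have mfn : measurable_fun setT f^\-%E by exact: measurable_funeneg.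
rewrite -(pp f^\+%E mfp (funepos_ge0 _)) -(pp f^\-%E mfn (funeneg_ge0 _)).
by congr (_ - _)%E; apply: eq_integral => x _; rewrite !unlock.
Qed.

Lemma preserves_integrable d (T : measurableType d) (m : {measure set T -> \bar R})
  (f : T -> \bar R) phi : preserves m phi -> m.-integrable setT f ->
  m.-integrable setT (f \o phi).
Proof.
move=> pphi /integrableP[mf fi]; have [mp pp] := pphi; apply/integrableP; split.
  exact: measurableT_comp.
rewrite (pp (fun x => `|f x|%E))//; exact: measurableT_comp.
Qed.

(** By uniqueness of Lebesgue measure, the image measure need only be compared on half-open
    intervals. *)
Lemma lebesgue_preserves (phi : R -> R) :
  measurable_fun setT phi ->
  (forall X : set R, ocitv X -> lebesgue_measure (phi @^-1` X) = lebesgue_measure X) ->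
  preserves (@lebesgue_measure R) phi.
Proof.
move=> mp pX; split => // F mF F0.
have mp' : measurable_fun setT (phi : measurableTypeR R -> measurableTypeR R) by [].
pose mu := [the {measure set (measurableTypeR R) -> \bar R} of
  pushforward (@lebesgue_measure R) (phi : measurableTypeR R -> measurableTypeR R)].
have muE : forall A : set (measurableTypeR R), measurable A -> lebesgue_measure A = mu mp' A.
  move=> A mA; apply: lebesgue_measure_unique => // X oX.
  by rewrite /mu/= /pushforward pX.
have h := ge0_integral_pushforward mp' (@lebesgue_measure R) measurableT mF
  (fun y _ => F0 y).
rewrite preimage_setT in h; rewrite [LHS](_ : _ = (\int[lebesgue_measure]_x (F \o phi) x)%E)//.
rewrite -h; apply/esym; apply: eq_measure_integral => A mA _.
exact: muE.
Qed.

Lemma lebesgue_translation (a : R) :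
  preserves (@lebesgue_measure R) (fun s => s + a).
Proof.
apply: lebesgue_preserves => //.
  by apply: measurable_funD => //; exact: measurable_id.
move=> _ [[x y] /= xy <-].
rewrite (_ : _ @^-1` _ = `]x - a, y - a]%classic); last first.
  by apply/seteqP; split => s /=; rewrite !in_itv/= ltrBlDr lerBrDr.
rewrite !lebesgue_measure_itv/= !lte_fin ltrD2r; case: ifPn => // _.
by rewrite -!EFinB; congr (_%:E); ring.
Qed.

Lemma lebesgue_reflection : preserves (@lebesgue_measure R) (fun s => - s).
Proof.
apply: lebesgue_preserves => //.
  by apply: measurableT_comp => //; exact: measurable_id.
move=> X oX; rewrite -[RHS]lebesgue_measureN//.
by apply: sub_sigma_algebra.
Qed.

Lemma lebesgue_signed (b : bool) (a : R) :
  preserves (@lebesgue_measure R) (fun s => (-1) ^+ b * s + a).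
Proof.
have := lebesgue_translation a.
case: b => h; last first.
  by have -> : (fun s : R => (-1) ^+ false * s + a) = (fun s => s + a)
    by apply/funext => s; rewrite expr0 mul1r.
have -> : (fun s : R => (-1) ^+ true * s + a) = (fun s => s + a) \o (fun s => - s).
  by apply/funext => s /=; rewrite expr1 mulN1r.
exact: preserves_comp h lebesgue_reflection.
Qed.

(** For a fixed base point the last coordinate undergoes a translation or reflection; Tonelli then
    leaves the invariance of the base map [tau]. Repeating this adds one coordinate at a time. *)
Lemma preserves_shear d (T : measurableType d)
  (m : {sigma_finite_measure set T -> \bar R}) (tau : T -> T) (b : bool) (g : T -> R) :
  preserves m tau -> measurable_fun setT g ->
  preserves (m \x @lebesgue_measure R)%E
    (fun z => (tau z.1, (-1) ^+ b * z.2 + g z.1)).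
Proof.
move=> [mt pt] mg.
have mphi : measurable_fun setT (fun z : T * R => (tau z.1, (-1) ^+ b * z.2 + g z.1)).
  apply: measurable_fun_pair; first exact: measurableT_comp.
  by apply: measurable_funD; [apply: measurable_funM|exact: measurableT_comp].
split => // F mF F0.
rewrite (fubini_tonelli1 (fun z : T * measurableTypeR R => F (tau z.1, (-1) ^+ b * z.2 + g z.1)))//; last first.
  exact: (measurableT_comp mF mphi).
rewrite (fubini_tonelli1 F mF F0).
rewrite -[RHS](pt (fubini_F _ F)).
- apply: eq_integral => z _; rewrite /fubini_F/=.
  have [_ h] := lebesgue_signed b (g z).
  rewrite (h (fun s => F (tau z, s)))//.
  exact: (@measurable_fun_pair2 _ _ _ _ _ _ F).
- exact: measurable_fun_fubini_tonelli_F.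
- by move=> x; apply: integral_ge0 => y _.
Qed.

End MeasurePreserving.

Section MeasurableArith.
Context d1 d2 d3 (T1 : measurableType d1) (T2 : measurableType d2)
  (T : measurableType d3) (R : realType).

Lemma measurable_fun_fst (f : T -> T1 * T2) : measurable_fun setT f ->
  measurable_fun setT (fun x => (f x).1).
Proof. exact: measurableT_comp measurable_fst. Qed.

Lemma measurable_fun_snd (f : T -> T1 * T2) : measurable_fun setT f ->
  measurable_fun setT (fun x => (f x).2).
Proof. exact: measurableT_comp measurable_snd. Qed.

Lemma measurable_fun_opp (f : T -> R) : measurable_fun setT f ->
  measurable_fun setT (fun x => - f x).
Proof. by move=> mf; apply: measurableT_comp. Qed.

End MeasurableArith.

Ltac measurable_tac :=
  lazymatch goal with
  | |- measurable_fun _ (fun _ => ?c) => exact (measurable_cst c)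
  | |- measurable_fun _ (cst ?c) => exact (measurable_cst c)
  | |- measurable_fun _ (fun x => x) => exact (@measurable_id _ _ _)
  | |- measurable_fun _ (fun x => (@?f x, @?g x)) =>
      refine (measurable_fun_pair (f := f) (g := g) _ _); measurable_tac
  | |- measurable_fun _ (fun x => fst (@?f x)) =>
      refine (measurable_fun_fst (f := f) _); measurable_tac
  | |- measurable_fun _ (fun x => snd (@?f x)) =>
      refine (measurable_fun_snd (f := f) _); measurable_tac
  | |- measurable_fun _ (fun x => (@?f x - @?g x)%R) =>
      refine (measurable_funB (f := f) (g := g) _ _); measurable_tac
  | |- measurable_fun _ (fun x => (@?f x + @?g x)%R) =>
      refine (measurable_funD (f := f) (g := g) _ _); measurable_tac
  | |- measurable_fun _ (fun x => (@?f x * @?g x)%R) =>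
      refine (measurable_funM (f := f) (g := g) _ _); measurable_tac
  | |- measurable_fun _ (fun x => (- @?f x)%R) =>
      refine (measurable_fun_opp (f := f) _); measurable_tac
  | |- measurable_fun _ (fun x => (@?f x ^+ ?n)%R) =>
      refine (measurable_funX (f := f) n _); measurable_tac
  | |- _ => idtac
  end.

Section CartanHaar.
Variable R : realType.
Notation leb := (@lebesgue_measure R).
Implicit Types x y : B5 R.

Definition cartan_inv x : B5 R :=
  let: (x1, x2, x3, x4, x5) := x in
  (- x1, - x2, - x3 - x1 * x2, - x4 - x1 * x3 - x1 ^+ 2 * x2 / 2,
   - x5 - x2 * x3 - x1 * x2 ^+ 2 / 2).

Lemma cartan_mulA (a : B5 R) x y : cartan_mul a (cartan_mul x y) = cartan_mul (cartan_mul a x) y.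
Proof.
move: a x y => [[[[a1 a2] a3] a4] a5] [[[[x1 x2] x3] x4] x5] [[[[y1 y2] y3] y4] y5].
by rewrite /cartan_mul; do ! congr (_, _); field.
Qed.

Lemma cartan_mulVK (a : B5 R) x : cartan_mul (cartan_inv a) (cartan_mul a x) = x.
Proof.
move: a x => [[[[a1 a2] a3] a4] a5] [[[[x1 x2] x3] x4] x5].
by rewrite /cartan_mul /cartan_inv; do ! congr (_, _); field.
Qed.

(** Common shape of left translations, right translations and the map that left translation induces
    on the Fourier side: each coordinate is moved by a function of the earlier ones. In particular
    the group is unimodular. *)
Definition triangular (b : bool) (a : R) (g2 : R -> R) (g3 : R * R -> R)
    (g4 : R * R * R -> R) (g5 : R * R * R * R -> R) (x : B5 R) : B5 R :=
  let s := (-1) ^+ b in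
  (s * x.1.1.1.1 + a, s * x.1.1.1.2 + g2 x.1.1.1.1, s * x.1.1.2 + g3 x.1.1.1,
   s * x.1.2 + g4 x.1.1, s * x.2 + g5 x.1).

Lemma preserves_triangular b a g2 g3 g4 g5 :
  measurable_fun setT g2 -> measurable_fun setT g3 -> measurable_fun setT g4 ->
  measurable_fun setT g5 -> preserves (@haar R) (triangular b a g2 g3 g4 g5).
Proof.
move=> m2 m3 m4 m5.
have h1 := lebesgue_signed b a.
have h2 := @preserves_shear R _ _ leb _ b g2 h1 m2.
have h3 := @preserves_shear R _ _ (sigma_finite_prod leb leb) _ b g3 h2 m3.
have h4 := @preserves_shear R _ _
  (sigma_finite_prod (sigma_finite_prod leb leb) leb) _ b g4 h3 m4.
have h5 := @preserves_shear R _ _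
  (sigma_finite_prod (sigma_finite_prod (sigma_finite_prod leb leb) leb) leb) _ b g5 h4 m5.
exact: h5.
Qed.

Lemma haar_left (a : B5 R) : preserves (@haar R) (cartan_mul a).
Proof.
move: a => [[[[a1 a2] a3] a4] a5].
have -> : cartan_mul (a1, a2, a3, a4, a5) = triangular false a1 (cst a2)
   (fun p => a3 - a1 * p.2) (fun p => a4 + a1 ^+ 2 * p.1.2 / 2 - a1 * p.2)
   (fun p => a5 + a1 * p.1.1.2 ^+ 2 / 2 - a2 * p.1.2 + a1 * a2 * p.1.1.2).
  apply/funext => -[[[[x1 x2] x3] x4] x5]; rewrite /cartan_mul /triangular /=.
  by do ! congr (_, _); ring.
by apply: preserves_triangular; measurable_tac.
Qed.

Lemma haar_right y : preserves (@haar R) (fun x => cartan_mul x y).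
Proof.
move: y => [[[[y1 y2] y3] y4] y5].
have -> : (fun x => cartan_mul x (y1, y2, y3, y4, y5)) = triangular false y1 (cst y2)
   (fun p => y3 - p.1 * y2) (fun p => y4 + p.1.1 ^+ 2 * y2 / 2 - p.1.1 * y3)
   (fun p => y5 + p.1.1.1 * y2 ^+ 2 / 2 - p.1.1.2 * y3 + p.1.1.1 * p.1.1.2 * y2).
  apply/funext => -[[[[x1 x2] x3] x4] x5]; rewrite /cartan_mul /triangular /=.
  by do ! congr (_, _); ring.
by apply: preserves_triangular; measurable_tac.
Qed.

Lemma measurable_cartan_mul :
  measurable_fun setT (fun p : B5 R * B5 R => cartan_mul p.1 p.2).
Proof.
have -> : (fun p : B5 R * B5 R => cartan_mul p.1 p.2) = (fun p =>
  (p.1.1.1.1.1 + p.2.1.1.1.1, p.1.1.1.1.2 + p.2.1.1.1.2,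
   p.1.1.1.2 + p.2.1.1.2 - p.1.1.1.1.1 * p.2.1.1.1.2,
   p.1.1.2 + p.2.1.2 + p.1.1.1.1.1 ^+ 2 * p.2.1.1.1.2 / 2 - p.1.1.1.1.1 * p.2.1.1.2,
   p.1.2 + p.2.2 + p.1.1.1.1.1 * p.2.1.1.1.2 ^+ 2 / 2 - p.1.1.1.1.2 * p.2.1.1.2
     + p.1.1.1.1.1 * p.1.1.1.1.2 * p.2.1.1.1.2)).
  by apply/funext => -[[[[[x1 x2] x3] x4] x5] [[[[y1 y2] y3] y4] y5]].
by measurable_tac.
Qed.

End CartanHaar.

(** * Square integrable functions on the Cartan group *)

Import HBSimple.
Import HBNNSimple.

(** [spectral_mass] is a bare set function that agrees with a measure on measurable sets only.
    Integrals are built from simple functions, whose level sets are measurable, so this agreement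
    suffices. *)
Lemma eq_on_measurable_integral d (T : measurableType d) (R : realType)
    (m1 m2 : set T -> \bar R) (f : T -> \bar R) :
  (forall A, measurable A -> m1 A = m2 A) ->
  (\int[m1]_x f x = \int[m2]_x f x)%E.
Proof.
move=> m12.
have H (h : {nnsfun T >-> R}) : sintegral m1 h = sintegral m2 h.
  by rewrite /sintegral; apply: eq_fsbigr => r _; rewrite m12.
rewrite /integral; congr (ereal_sup _ - ereal_sup _)%E;
  by apply/seteqP; split => _ [h hf <-]; exists h => //; rewrite H.
Qed.

Section L2Cartan.
Variable R : realType.
Implicit Types f g : B5 R -> R[i].
Notation L2 := (LfunType (@haar R) (one_le_two R)).
Notation V := (L2 * L2)%type.

Lemma normc_sq (z : R[i]) :
  ComplexField.Normc.normc z ^+ 2 = complex.Re z ^+ 2 + complex.Im z ^+ 2.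
Proof. by case: z => a b /=; rewrite sqr_sqrtr// addr_ge0// sqr_ge0. Qed.

Lemma normcE (z : R[i]) : ComplexField.Normc.normc z =
  Num.sqrt (complex.Re z ^+ 2 + complex.Im z ^+ 2).
Proof. by case: z. Qed.

Lemma normc_ge0 (z : R[i]) : 0 <= ComplexField.Normc.normc z.
Proof. by rewrite normcE sqrtr_ge0. Qed.

Lemma measurable_normc d (T : measurableType d) (f : T -> R[i]) :
  measurable_fun setT (fun x => complex.Re (f x)) ->
  measurable_fun setT (fun x => complex.Im (f x)) ->
  measurable_fun setT (fun x => ComplexField.Normc.normc (f x)).
Proof.
move=> mr mi.
have -> : (fun x => ComplexField.Normc.normc (f x)) =
  Num.sqrt \o (fun x => complex.Re (f x) ^+ 2 + complex.Im (f x) ^+ 2).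
  by apply/funext => x /=; rewrite normcE.
apply: measurableT_comp.
  by apply: continuous_measurable_fun; exact: sqrt_continuous.
by apply: measurable_funD; apply: measurable_funX.
Qed.

Lemma Lp_norm2E f :
  Lp_norm 2 f = (sqintegral haar (fun x => ComplexField.Normc.normc (f x)) `^ 2^-1)%E.
Proof. exact: (Lnorm2E haar (fun x => ComplexField.Normc.normc (f x))). Qed.

Lemma sqintegral_normc f : measurable_fun setT (fun x => complex.Re (f x)) ->
  measurable_fun setT (fun x => complex.Im (f x)) ->
  (sqintegral haar (fun x => ComplexField.Normc.normc (f x)) =
   sqintegral haar (fun x => complex.Re (f x)) +
   sqintegral haar (fun x => complex.Im (f x)))%E.
Proof.
move=> mr mi; rewrite /sqintegral -ge0_integralD//.
- by apply: eq_integral => x _; rewrite normc_sq.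
- by move=> x _; rewrite lee_fin sqr_ge0.
- exact: measurable_sq.
- by move=> x _; rewrite lee_fin sqr_ge0.
- exact: measurable_sq.
Qed.

Lemma inLp2P f : inLp 2 f <-> square_integrable haar (fun x => complex.Re (f x)) /\
   square_integrable haar (fun x => complex.Im (f x)).
Proof.
split=> [[mr mi]|[[mr fr] [mi fi]]].
  rewrite Lp_norm2E poweR_ltyE ?sqintegral_ge0// sqintegral_normc// => h.
  split; split => //; apply: le_lt_trans h.
    by rewrite leeDl// sqintegral_ge0.
  by rewrite leeDr// sqintegral_ge0.
split => //; rewrite Lp_norm2E poweR_ltyE ?sqintegral_ge0// sqintegral_normc//.
exact: lte_add_pinfty.
Qed.

(** The real part of the Hermitian product, as [Re_L2_inner] shows. Real scalars suffice because
    only real functions of B occur. *)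
Definition vip : inner_product V.
Proof.
refine (@InnerProduct R V
  (fun u v => l2ip (@haar R) u.1 v.1 + l2ip (@haar R) u.2 v.2) _ _ _ _).
- move=> u v; exact: (congr2 +%R (ipC _ _ _) (ipC _ _ _)).
- move=> u v w; exact: (etrans (congr2 +%R (ipDl _ _ _ _) (ipDl _ _ _ _)) (addrACA _ _ _ _)).
- move=> a u v; exact: (etrans (congr2 +%R (ipZl _ _ _ _) (ipZl _ _ _ _)) (esym (mulrDr _ _ _))).
- by move=> u; rewrite addr_ge0// ip_ge0.
Defined.

Definition cfun (u : V) : B5 R -> R[i] := fun x => Complex (u.1 x) (u.2 x).

Lemma inLp_cfun u : inLp 2 (cfun u).
Proof. by apply/inLp2P; split; exact: L2P. Qed.

Definition vec f : V :=
  if pselect (inLp 2 f) is left h then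
    (to_L2 ((inLp2P f).1 h).1, to_L2 ((inLp2P f).1 h).2) else 0.

Lemma vecK f : inLp 2 f -> cfun (vec f) = f.
Proof.
move=> h; rewrite /vec; case: pselect => // h'; apply/funext => x.
change (Complex (complex.Re (f x)) (complex.Im (f x)) = f x).
by case: (f x).
Qed.

Lemma cfunB u v : cfun (u - v) = (fun x => cfun u x - cfun v x).
Proof. by apply/funext => x; rewrite /cfun. Qed.

Lemma cfunD u v : cfun (u + v) = (fun x => cfun u x + cfun v x).
Proof. by apply/funext => x; rewrite /cfun. Qed.

Lemma cfunZ a u : cfun (a *: u) = (fun x => a%:C%C * cfun u x).
Proof.
apply/funext => x; apply/eqP; rewrite eq_complex /=.
by rewrite !mul0r subr0 addr0 !eqxx.
Qed.

Lemma cfun_inj : injective cfun.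
Proof.
move=> [u1 u2] [v1 v2] uv; congr (_, _); apply/val_inj/funext => x.
  exact: (congr1 (fun h => complex.Re (h x)) uv).
exact: (congr1 (fun h => complex.Im (h x)) uv).
Qed.

Lemma cfunK u : vec (cfun u) = u.
Proof. exact: (cfun_inj (vecK (inLp_cfun u))). Qed.

Lemma nsq_sqintegral u :
  (nsq vip u)%:E = (sqintegral haar u.1 + sqintegral haar u.2)%E.
Proof. by rewrite -!l2_nsqE. Qed.

Lemma nsq_normc u :
  (nsq vip u)%:E = sqintegral haar (fun x => ComplexField.Normc.normc (cfun u x)).
Proof.
have [mr mi _] := inLp_cfun u.
by rewrite nsq_sqintegral sqintegral_normc.
Qed.

Lemma Lp_norm_cfun u : Lp_norm 2 (cfun u) = (Num.sqrt (nsq vip u))%:E.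
Proof. by rewrite Lp_norm2E -nsq_normc poweR_EFin powR12_sqrt// nsq_ge0. Qed.

Lemma Lp_norm_cvg0 (T : Type) (F : set_system T) {FF : ProperFilter F} (x : T -> V) :
  Lp_norm 2 (cfun (x t)) @[t --> F] --> 0%E <-> nsq vip (x t) @[t --> F] --> 0.
Proof.
have -> : (fun t => Lp_norm 2 (cfun (x t))) = EFin \o (fun t => Num.sqrt (nsq vip (x t))).
  by apply/funext => t; rewrite Lp_norm_cfun.
split=> h.
  have {}h : (fun t => Num.sqrt (nsq vip (x t))) @ F --> (0 : R) by exact: fine_cvg h.
  have -> : (fun t => nsq vip (x t)) =
      (fun t => Num.sqrt (nsq vip (x t)) * Num.sqrt (nsq vip (x t))).
    by apply/funext => t; rewrite -expr2 sqr_sqrtr// nsq_ge0.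
  by rewrite -(mulr0 0); exact: cvgM.
apply: cvg_EFin; first exact: nearW.
rewrite -(sqrtr0 R).
exact: (cvg_comp _ _ h (@sqrt_continuous R 0)).
Qed.

Lemma Lp_dist_cvg (x : nat -> V) y :
  Lp_dist 2 (cfun (x n)) (cfun y) @[n --> \oo] --> 0%E <-> ncvg vip x y.
Proof.
have -> : (fun n => Lp_dist 2 (cfun (x n)) (cfun y)) =
  (fun n => Lp_norm 2 (cfun (x n - y))).
  by apply/funext => n; rewrite cfunB.
exact: Lp_norm_cvg0.
Qed.

Lemma Lp_dist_vec (f : nat -> B5 R -> R[i]) g : (forall n, inLp 2 (f n)) -> inLp 2 g ->
  Lp_dist 2 (f n) g @[n --> \oo] --> 0%E <-> ncvg vip (fun n => vec (f n)) (vec g).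
Proof.
move=> Lf Lg; rewrite -Lp_dist_cvg vecK//.
have -> // : (fun n => Lp_dist 2 (f n) g) = (fun n => Lp_dist 2 (cfun (vec (f n))) g).
by apply/funext => n; rewrite vecK.
Qed.

Lemma sqintegral_eq0 d (T : measurableType d) (m : {measure set T -> \bar R})
    (f : T -> R) : measurable_fun setT f ->
  sqintegral m f = 0%E <-> {ae m, forall x, f x = 0}.
Proof.
move=> mf; rewrite /sqintegral.
have -> : (\int[m]_x (f x ^+ 2)%:E = \int[m]_x `|(f x ^+ 2)%:E|)%E.
  by apply: eq_integral => x _; rewrite gee0_abs// lee_fin sqr_ge0.
have /= -> := ae_eq_integral_abs m measurableT (measurable_sq mf).
split; apply: filterS => x /=.
  by move=> /(_ I) [] /eqP; rewrite sqrf_eq0 => /eqP.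
by move=> -> _; rewrite expr0n.
Qed.

Definition haar_sigma_finite :=
  let leb := @lebesgue_measure R in
  sigma_finite_prod (sigma_finite_prod (sigma_finite_prod
    (sigma_finite_prod leb leb) leb) leb) leb.

Lemma ae_haarS (P Q : B5 R -> Prop) : (forall x, P x -> Q x) ->
  {ae haar, forall x, P x} -> {ae haar, forall x, Q x}.
Proof.
move=> PQ h; have F := ae_filter_ringOfSetsType haar_sigma_finite.
exact: (@filterS _ _ F _ _ PQ h).
Qed.

Lemma nequiv_aeq u v : nequiv vip u v <-> aeq (cfun u) (cfun v).
Proof.
have [mr mi _] := inLp_cfun (u - v).
have E : (nsq vip (u - v))%:E = sqintegral haar (fun x =>
    ComplexField.Normc.normc (cfun (u - v) x)) by rewrite nsq_normc.
have mn := measurable_normc mr mi.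
rewrite /nequiv; split=> [h|h].
  have := (sqintegral_eq0 haar mn).1 (etrans (esym E) (congr1 EFin h)).
  apply: filterS => x; rewrite cfunB => /ComplexField.Normc.eq0_normc /eqP.
  by rewrite subr_eq0 => /eqP.
apply: EFin_inj; rewrite E; apply/sqintegral_eq0 => //.
move: h; apply: ae_haarS => x uv.
by rewrite cfunB uv subrr ComplexField.Normc.normc0.
Qed.

Lemma nequiv_vec f g : inLp 2 f -> inLp 2 g -> aeq f g <-> nequiv vip (vec f) (vec g).
Proof. by move=> Lf Lg; rewrite nequiv_aeq !vecK. Qed.

Lemma vcomplete : ncomplete vip.
Proof.
move=> x cx.
have c1 : ncauchy (l2ip haar) (fun n => (x n).1).
  move=> e e0; have [N h] := cx e e0; exists N => i j Ni Nj.
  apply: le_lt_trans (h i j Ni Nj); rewrite /nsq/= lerDl.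
  exact: (nsq_ge0 (l2ip (@haar R)) ((x i).2 - (x j).2)).
have c2 : ncauchy (l2ip haar) (fun n => (x n).2).
  move=> e e0; have [N h] := cx e e0; exists N => i j Ni Nj.
  apply: le_lt_trans (h i j Ni Nj); rewrite /nsq/= lerDr.
  exact: (nsq_ge0 (l2ip (@haar R)) ((x i).1 - (x j).1)).
have [l1 h1] := l2_complete c1; have [l2 h2] := l2_complete c2.
exists (l1, l2); rewrite /ncvg -(addr0 0).
exact: (cvgD h1 h2).
Qed.

Lemma cfun_sum (I : Type) (r : seq I) (P : pred I) (F : I -> V) :
  cfun (\sum_(i <- r | P i) F i) = (fun x => \sum_(i <- r | P i) cfun (F i) x).
Proof.
apply/funext => x; elim/big_ind2 : _ => //.
by move=> a b c e <- <-; rewrite cfunD.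
Qed.

Lemma Re_L2_inner u v : complex.Re (L2_inner (cfun u) (cfun v)) = vip u v.
Proof.
rewrite /L2_inner /cintegral /= /l2dot -RintegralD//.
- by apply: eq_Rintegral => x _ /=; rewrite mulrN opprK.
- exact: square_integrable_mul (L2P _) (L2P _).
- exact: square_integrable_mul (L2P _) (L2P _).
Qed.

(** * Spectral integrals of functions on the group as abstract spectral calculus *)

Section Bridge.
Variable E : set R -> (B5 R -> R[i]) -> B5 R -> R[i].
Hypothesis HE : projection_valued_measure E.

Definition vproj (A : set R) (u : V) : V := vec (E A (cfun u)).

Lemma inLp_proj A f : measurable A -> inLp 2 f -> inLp 2 (E A f).
Proof. by case: HE => h _ _ _ mA; have [+ _ _] := h A mA; apply. Qed.

Lemma cfun_vproj A u : measurable A -> cfun (vproj A u) = E A (cfun u).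
Proof. by move=> mA; exact: (vecK (inLp_proj mA (inLp_cfun u))). Qed.

Lemma vproj_projection_valued : projection_valued vip vproj.
Proof.
case: HE => hp hT hI hs; split.
- move=> A u v mA; rewrite -!Re_L2_inner !cfun_vproj//.
  by have [_ _ h] := hp A mA; exact: (congr1 (@complex.Re R) (h _ _ (inLp_cfun u) (inLp_cfun v))).
- move=> u; apply/nequiv_aeq; rewrite cfun_vproj//; apply: hT; exact: inLp_cfun.
- move=> A B u mA mB; apply/nequiv_aeq; rewrite !cfun_vproj//; last exact: measurableI.
  exact: (hI _ _ _ mA mB (inLp_cfun u)).
- move=> F u mF tF; apply/Lp_dist_cvg.
  have := hs F (cfun u) mF tF (inLp_cfun u).
  rewrite cfun_vproj//; last exact: bigcupT_measurable.
  set a := (X in X @ _ --> _ -> _); set b := (X in _ -> X @ _ --> _).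
  suff -> : a = b by [].
  apply/funext => n; rewrite /a /b cfun_sum; congr Lp_dist; apply/funext => x.
  by apply: eq_bigr => k _; rewrite cfun_vproj.
Qed.

Lemma spectral_massE u A : measurable A ->
  spectral_mass E (cfun u) A = smass vip vproj u A.
Proof.
move=> mA; rewrite /spectral_mass -cfun_vproj// Lp_norm_cfun /smass -EFin_expe.
by rewrite sqr_sqrtr// nsq_ge0.
Qed.

Lemma simple_spectral_integralE (s : {sfun R >-> R}) u :
  simple_spectral_integral E s (cfun u) = cfun (simple_calculus vproj s u).
Proof.
rewrite simple_calculusE cfun_sum; apply/funext => x.
rewrite /simple_spectral_integral fsbig_finite/=; last exact: fimfunP.
by apply: eq_bigr => c _; rewrite cfunZ cfun_vproj//; exact: measurable_sfun_pre.
Qed.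

Lemma spectral_integralE (f : R -> R) u w :
  spectral_integral E f (cfun u) (cfun w) <->
  spectral_calculus vproj_projection_valued f u w.
Proof.
have H (s : {sfun R >-> R}) :
  (\int[spectral_mass E (cfun u)]_l ((s l - f l) ^+ 2)%:E =
   sqintegral (spectral_measure vproj_projection_valued u) (fun x => (s x - f x)%R))%E.
  apply: eq_on_measurable_integral => A mA; rewrite spectral_massE//.
split=> [[_ _ [s [h1 h2]]]|[s [h1 h2]]].
  exists s; split; first by rewrite -(eq_cvg _ _ (fun n => H (s n))).
  apply/Lp_dist_cvg; move: h2; rewrite (eq_cvg _ _ (g := fun n => Lp_dist 2
    (cfun (simple_calculus vproj (s n) u)) (cfun w)))//.
  by move=> n; rewrite simple_spectral_integralE.
split; [exact: inLp_cfun|exact: inLp_cfun|exists s; split].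
  by rewrite (eq_cvg _ _ (fun n => H (s n))).
move/Lp_dist_cvg : h2; rewrite (eq_cvg _ _ (g := fun n => Lp_dist 2
    (simple_spectral_integral E (s n) (cfun u)) (cfun w)))//.
by move=> n; rewrite simple_spectral_integralE.
Qed.

End Bridge.
End L2Cartan.

(** * Derivatives and Schwartz functions *)

Section RealDerivatives.
Variable R : realType.
Implicit Types f g : B5 R -> R.

Lemma is_deriveE (W : normedModType R) (f : W -> R) x v l : is_derive x v f l <->
  h^-1 * (f (h *: v + x) - f x) @[h --> 0^'] --> l.
Proof.
split=> [[d <-]|h]; first exact: d.
by split; [apply: cvgP h|exact: cvg_lim h].
Qed.

Lemma is_derive_eq_fun (W : normedModType R) (f g : W -> R) x v l : f =1 g ->
  is_derive x v f l -> is_derive x v g l.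
Proof. by move=> /funext ->. Qed.

Lemma squeeze_dist (F : set_system R) {FF : Filter F} (c u : R -> R) l :
  (forall h, `|c h - l| <= `|u h - l|) -> u @ F --> l -> c @ F --> l.
Proof.
move=> cu ul; apply/cvgrPdist_le => e e0.
move/cvgrPdist_le : ul => /(_ e e0); apply: filterS => h.
by rewrite distrC (distrC l); apply: le_trans.
Qed.

Lemma mvt_between (g g' : R -> R) (a b : R) : (forall x : R, is_derive x 1 g (g' x)) ->
  exists2 c, `|c - a| <= `|b - a| & g b - g a = g' c * (b - a).
Proof.
move=> dg.
have cg : continuous g.
  by move=> x; apply: differentiable_continuous; apply/derivable1_diffP; have [] := dg x.
have [ab|ba] := leP a b.
  have [c + gab] := MVT_segment ab (fun x _ => dg x) (continuous_subspaceT cg).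
  rewrite in_itv/= => /andP[ac cb]; exists c => //.
  by rewrite !ger0_norm ?subr_ge0// lerD2r.
have [c + gab] := MVT_segment (ltW ba) (fun x _ => dg x) (continuous_subspaceT cg).
rewrite in_itv/= => /andP[bc ca]; exists c => //.
  rewrite !ler0_norm ?subr_le0// ?(ltW ba)// lerN2 lerD2r//.
by rewrite -(opprB (g a)) gab -mulrN opprB.
Qed.

Definition rpart (j : nat) f : B5 R -> R := fun x => 'D_(basis_vec R j) f x.

Definition rparts (s : seq nat) f : B5 R -> R := foldr rpart f s.

Definition C1 f := forall j, continuous (rpart j f) /\
  forall x, derivable f x (basis_vec R j).

Lemma line1 (h y1 y2 y3 y4 y5 : R) :
  h *: basis_vec R 1 + (y1, y2, y3, y4, y5) = (h *: (1 : R) + y1, y2, y3, y4, y5).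
Proof. by do 4 ?[congr (_, _)]; rewrite /= ?scaler0 ?add0r. Qed.
Lemma line2 (h y1 y2 y3 y4 y5 : R) :
  h *: basis_vec R 2 + (y1, y2, y3, y4, y5) = (y1, h *: (1 : R) + y2, y3, y4, y5).
Proof. by do 4 ?[congr (_, _)]; rewrite /= ?scaler0 ?add0r. Qed.
Lemma line3 (h y1 y2 y3 y4 y5 : R) :
  h *: basis_vec R 3 + (y1, y2, y3, y4, y5) = (y1, y2, h *: (1 : R) + y3, y4, y5).
Proof. by do 4 ?[congr (_, _)]; rewrite /= ?scaler0 ?add0r. Qed.
Lemma line4 (h y1 y2 y3 y4 y5 : R) :
  h *: basis_vec R 4 + (y1, y2, y3, y4, y5) = (y1, y2, y3, h *: (1 : R) + y4, y5).
Proof. by do 4 ?[congr (_, _)]; rewrite /= ?scaler0 ?add0r. Qed.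
Lemma line5 (h y1 y2 y3 y4 y5 : R) :
  h *: basis_vec R 5 + (y1, y2, y3, y4, y5) = (y1, y2, y3, y4, h *: (1 : R) + y5).
Proof. by do 4 ?[congr (_, _)]; rewrite /= ?scaler0 ?add0r. Qed.
Lemma line0 (j : nat) (h : R) x : (5 < j)%N \/ j = 0%N ->
  h *: basis_vec R j + x = x.
Proof.
move=> hj; have -> : basis_vec R j = 0.
  by case: hj => [|->//]; case: j => [|[|[|[|[|[|j]]]]]].
by rewrite scaler0 add0r.
Qed.

Lemma C1_is_derive f j x : C1 f -> is_derive x (basis_vec R j) f (rpart j f x).
Proof. by move=> /(_ j) [_ /(_ x) d]; split. Qed.

Lemma coord_derive f (p1 p2 p3 p4 p5 : R) : C1 f -> [/\
  is_derive p1 1 (fun s => f (s, p2, p3, p4, p5)) (rpart 1 f (p1, p2, p3, p4, p5)),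
  is_derive p2 1 (fun s => f (p1, s, p3, p4, p5)) (rpart 2 f (p1, p2, p3, p4, p5)),
  is_derive p3 1 (fun s => f (p1, p2, s, p4, p5)) (rpart 3 f (p1, p2, p3, p4, p5)),
  is_derive p4 1 (fun s => f (p1, p2, p3, s, p5)) (rpart 4 f (p1, p2, p3, p4, p5))
& is_derive p5 1 (fun s => f (p1, p2, p3, p4, s)) (rpart 5 f (p1, p2, p3, p4, p5))].
Proof.
move=> cf; have D j := @C1_is_derive f j (p1, p2, p3, p4, p5) cf.
split; apply/is_deriveE.
- have /is_deriveE := D 1%N; rewrite (_ : (fun h => _) =
    (fun h => h^-1 * (f (h *: (1:R) + p1, p2, p3, p4, p5) - f (p1, p2, p3, p4, p5))))//.
  by apply/funext => h; rewrite line1.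
- have /is_deriveE := D 2%N; rewrite (_ : (fun h => _) =
    (fun h => h^-1 * (f (p1, h *: (1:R) + p2, p3, p4, p5) - f (p1, p2, p3, p4, p5))))//.
  by apply/funext => h; rewrite line2.
- have /is_deriveE := D 3%N; rewrite (_ : (fun h => _) =
    (fun h => h^-1 * (f (p1, p2, h *: (1:R) + p3, p4, p5) - f (p1, p2, p3, p4, p5))))//.
  by apply/funext => h; rewrite line3.
- have /is_deriveE := D 4%N; rewrite (_ : (fun h => _) =
    (fun h => h^-1 * (f (p1, p2, p3, h *: (1:R) + p4, p5) - f (p1, p2, p3, p4, p5))))//.
  by apply/funext => h; rewrite line4.
- have /is_deriveE := D 5%N; rewrite (_ : (fun h => _) =
    (fun h => h^-1 * (f (p1, p2, p3, p4, h *: (1:R) + p5) - f (p1, p2, p3, p4, p5))))//.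
  by apply/funext => h; rewrite line5.
Qed.

(** The increment is telescoped through one coordinate at a time, with the mean value theorem in
    each. The tuple [c] only stores five unrelated intermediate values. *)
Lemma mean_value5 f (y1 y2 y3 y4 y5 z1 z2 z3 z4 z5 : R) : C1 f ->
  exists c : B5 R, [/\ `|c.1.1.1.1 - y1| <= `|z1 - y1|, `|c.1.1.1.2 - y2| <= `|z2 - y2|,
    `|c.1.1.2 - y3| <= `|z3 - y3|, `|c.1.2 - y4| <= `|z4 - y4| & `|c.2 - y5| <= `|z5 - y5|]
  /\ f (z1, z2, z3, z4, z5) - f (y1, y2, y3, y4, y5) =
   rpart 1 f (c.1.1.1.1, y2, y3, y4, y5) * (z1 - y1) +
   rpart 2 f (z1, c.1.1.1.2, y3, y4, y5) * (z2 - y2) +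
   rpart 3 f (z1, z2, c.1.1.2, y4, y5) * (z3 - y3) +
   rpart 4 f (z1, z2, z3, c.1.2, y5) * (z4 - y4) +
   rpart 5 f (z1, z2, z3, z4, c.2) * (z5 - y5).
Proof.
move=> cf.
have [c1 h1 e1] := @mvt_between (fun s => f (s, y2, y3, y4, y5))
  (fun s => rpart 1 f (s, y2, y3, y4, y5)) y1 z1
  (fun s => (fun h => h) (match coord_derive s y2 y3 y4 y5 cf with And5 h _ _ _ _ => h end)).
have [c2 h2 e2] := @mvt_between (fun s => f (z1, s, y3, y4, y5))
  (fun s => rpart 2 f (z1, s, y3, y4, y5)) y2 z2
  (fun s => (fun h => h) (match coord_derive z1 s y3 y4 y5 cf with And5 _ h _ _ _ => h end)).
have [c3 h3 e3] := @mvt_between (fun s => f (z1, z2, s, y4, y5))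
  (fun s => rpart 3 f (z1, z2, s, y4, y5)) y3 z3
  (fun s => (fun h => h) (match coord_derive z1 z2 s y4 y5 cf with And5 _ _ h _ _ => h end)).
have [c4 h4 e4] := @mvt_between (fun s => f (z1, z2, z3, s, y5))
  (fun s => rpart 4 f (z1, z2, z3, s, y5)) y4 z4
  (fun s => (fun h => h) (match coord_derive z1 z2 z3 s y5 cf with And5 _ _ _ h _ => h end)).
have [c5 h5 e5] := @mvt_between (fun s => f (z1, z2, z3, z4, s))
  (fun s => rpart 5 f (z1, z2, z3, z4, s)) y5 z5
  (fun s => (fun h => h) (match coord_derive z1 z2 z3 z4 s cf with And5 _ _ _ _ h => h end)).
exists (c1, c2, c3, c4, c5); split => //=.
by rewrite -e1 -e2 -e3 -e4 -e5; ring.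
Qed.

Lemma cvg_tuple5 (T : Type) (F : set_system T) {FF : Filter F} (a b c d e : T -> R)
    (a0 b0 c0 d0 e0 : R) :
  a @ F --> a0 -> b @ F --> b0 -> c @ F --> c0 -> d @ F --> d0 -> e @ F --> e0 ->
  (a t, b t, c t, d t, e t) @[t --> F] --> ((a0, b0, c0, d0, e0) : B5 R).
Proof.
by move=> h1 h2 h3 h4 h5; exact: (cvg_pair (cvg_pair (cvg_pair (cvg_pair h1 h2) h3) h4) h5).
Qed.

Let scale_sum5 (h a1 a2 a3 a4 a5 b1 b2 b3 b4 b5 : R) :
  h * (a1 * b1 + a2 * b2 + a3 * b3 + a4 * b4 + a5 * b5) =
  a1 * (h * b1) + a2 * (h * b2) + a3 * (h * b3) + a4 * (h * b4) + a5 * (h * b5).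
Proof. ring. Qed.

(** Chain rule from continuous partial derivatives, with no total derivative: the intermediate
    points of [mean_value5] are squeezed to the base point as h tends to 0. *)
Lemma chain5 f (u1 u2 u3 u4 u5 : R -> R) (t d1 d2 d3 d4 d5 : R) : C1 f ->
  is_derive t 1 u1 d1 -> is_derive t 1 u2 d2 -> is_derive t 1 u3 d3 ->
  is_derive t 1 u4 d4 -> is_derive t 1 u5 d5 ->
  is_derive t 1 (fun s => f (u1 s, u2 s, u3 s, u4 s, u5 s))
   (let y := (u1 t, u2 t, u3 t, u4 t, u5 t) in rpart 1 f y * d1 + rpart 2 f y * d2 +
    rpart 3 f y * d3 + rpart 4 f y * d4 + rpart 5 f y * d5).
Proof.
move=> cf D1 D2 D3 D4 D5 /=; set y := (_, _, _, _, _).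
have cu (u : R -> R) d : is_derive t 1 u d -> u (h *: 1 + t) @[h --> 0^'] --> u t.
  move=> [du _].
  have cc : {for t, continuous u}.
    by apply: differentiable_continuous; apply/derivable1_diffP.
  apply: (cvg_comp (fun h : R => h *: (1:R) + t) u _ cc).
  have : (fun h : R => h *: (1:R) + t) @ 0^' --> 0 *: (1:R) + t.
    apply: cvgD; last exact: cvg_cst.
    by apply: cvgZr_tmp; apply: cvg_within.
  by rewrite scale0r add0r.
have [c Hc] := choice (fun h : R => @mean_value5 f (u1 t) (u2 t) (u3 t) (u4 t) (u5 t)
  (u1 (h *: 1 + t)) (u2 (h *: 1 + t)) (u3 (h *: 1 + t)) (u4 (h *: 1 + t)) (u5 (h *: 1 + t)) cf).
have C1' := cu _ _ D1; have C2' := cu _ _ D2; have C3' := cu _ _ D3.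
have C4' := cu _ _ D4; have C5' := cu _ _ D5.
have k1 : (c h).1.1.1.1 @[h --> 0^'] --> u1 t.
  by apply: squeeze_dist C1' => h; have [[]] := Hc h.
have k2 : (c h).1.1.1.2 @[h --> 0^'] --> u2 t.
  by apply: squeeze_dist C2' => h; have [[]] := Hc h.
have k3 : (c h).1.1.2 @[h --> 0^'] --> u3 t.
  by apply: squeeze_dist C3' => h; have [[]] := Hc h.
have k4 : (c h).1.2 @[h --> 0^'] --> u4 t.
  by apply: squeeze_dist C4' => h; have [[]] := Hc h.
have k5 : (c h).2 @[h --> 0^'] --> u5 t.
  by apply: squeeze_dist C5' => h; have [[]] := Hc h.
have cc (v : R) : (fun _ : R => v) @ 0^' --> v by exact: cvg_cst.
have cp j (a : R -> B5 R) : a @ 0^' --> y -> rpart j f (a h) @[h --> 0^'] --> rpart j f y.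
  by move=> ay; apply: (cvg_comp a _ ay); have [h _] := cf j; exact: h.
apply/is_deriveE.
rewrite (_ : (fun h => _) = (fun h =>
   rpart 1 f ((c h).1.1.1.1, u2 t, u3 t, u4 t, u5 t) * (h^-1 * (u1 (h *: 1 + t) - u1 t)) +
   rpart 2 f (u1 (h *: 1 + t), (c h).1.1.1.2, u3 t, u4 t, u5 t)
     * (h^-1 * (u2 (h *: 1 + t) - u2 t)) +
   rpart 3 f (u1 (h *: 1 + t), u2 (h *: 1 + t), (c h).1.1.2, u4 t, u5 t)
     * (h^-1 * (u3 (h *: 1 + t) - u3 t)) +
   rpart 4 f (u1 (h *: 1 + t), u2 (h *: 1 + t), u3 (h *: 1 + t), (c h).1.2, u5 t)
     * (h^-1 * (u4 (h *: 1 + t) - u4 t)) +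
   rpart 5 f (u1 (h *: 1 + t), u2 (h *: 1 + t), u3 (h *: 1 + t), u4 (h *: 1 + t), (c h).2)
     * (h^-1 * (u5 (h *: 1 + t) - u5 t)))); last first.
  apply/funext => h; have [_ ->] := Hc h.
  exact: scale_sum5.
apply: cvgD; [apply: cvgD; [apply: cvgD; [apply: cvgD|]|]|]; apply: cvgM.
- exact: (cp 1%N _ (cvg_tuple5 k1 (cc _) (cc _) (cc _) (cc _))).
- exact/is_deriveE.
- exact: (cp 2%N _ (cvg_tuple5 C1' k2 (cc _) (cc _) (cc _))).
- exact/is_deriveE.
- exact: (cp 3%N _ (cvg_tuple5 C1' C2' k3 (cc _) (cc _))).
- exact/is_deriveE.
- exact: (cp 4%N _ (cvg_tuple5 C1' C2' C3' k4 (cc _))).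
- exact/is_deriveE.
- exact: (cp 5%N _ (cvg_tuple5 C1' C2' C3' C4' k5)).
- exact/is_deriveE.
Qed.

End RealDerivatives.

Ltac generalize_parts := repeat match goal with
  | |- context [rpart ?j ?f ?y] => let r := fresh "r" in generalize (rpart j f y); intro r
  end.

(** * Schwartz functions under left translation *)

Section Schwartz.
Variable R : realType.
Implicit Types f g : B5 R -> R.
Implicit Types x y a : B5 R.

Lemma norm5_le x (M : R) : `|x| <= M <-> [/\ `|x.1.1.1.1| <= M, `|x.1.1.1.2| <= M,
  `|x.1.1.2| <= M, `|x.1.2| <= M & `|x.2| <= M].
Proof.
rewrite !prod_normE !ge_max; split=> [/andP[/andP[/andP[/andP[-> ->] ->] ->] ->]//|].
by move=> [-> -> -> -> ->].
Qed.

Lemma coord_le x : [/\ `|x.1.1.1.1| <= `|x|, `|x.1.1.1.2| <= `|x|,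
  `|x.1.1.2| <= `|x|, `|x.1.2| <= `|x| & `|x.2| <= `|x|].
Proof. exact/norm5_le. Qed.

Lemma cartan_mul_norm a y : `|cartan_mul a y| <= (1 + `|a|) ^+ 3 * (1 + `|y|) ^+ 3.
Proof.
have := coord_le a; have := coord_le y.
have A0 := normr_ge0 a; have Y0 := normr_ge0 y.
move: `|a| `|y| A0 Y0 => A Y A0 Y0.
case: a y => [[[[a1 a2] a3] a4] a5] [[[[y1 y2] y3] y4] y5] /= [h1 h2 h3 h4 h5] [k1 k2 k3 k4 k5].
have AY : 0 <= A * Y by exact: mulr_ge0.
have P (u v U W : R) : `|u| <= U -> `|v| <= W -> `|u * v| <= U * W.
  by move=> uU vW; rewrite normrM; apply: ler_pM.
have D (u v U W : R) : `|u| <= U -> `|v| <= W -> `|u + v| <= U + W.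
  by move=> uU vW; apply: le_trans (ler_normD _ _) _; exact: lerD.
have B (u v U W : R) : `|u| <= U -> `|v| <= W -> `|u - v| <= U + W.
  by move=> uU vW; apply: D; rewrite ?normrN.
have H (u U : R) : `|u| <= U -> `|u / 2| <= U.
  by move=> uU; rewrite normrM [ `|2^-1|]gtr0_norm; have := normr_ge0 u; lra.
have e1 : A + Y <= (1 + A) ^+ 3 * (1 + Y) ^+ 3.
  have : 0 <= (1 + A) ^+ 3 * (1 + Y) ^+ 3 - (A + Y) - 1.
    rewrite (_ : _ - 1 = (2 * A + 3 * A ^+ 2 + A ^+ 3) * (1 + Y) ^+ 3
       + A * (3 * Y + 3 * Y ^+ 2 + Y ^+ 3) + (2 * Y + 3 * Y ^+ 2 + Y ^+ 3)); last by ring.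
    by rewrite !(addr_ge0, mulr_ge0, exprn_ge0).
  lra.
have e2 : A + Y + A * A * Y + A * Y * Y + A * Y + A * A * Y <= (1 + A) ^+ 3 * (1 + Y) ^+ 3.
  rewrite -subr_ge0 (_ : _ - _ = 1 + 2 * A + 3 * A ^+ 2 + A ^+ 3 + 2 * Y + 3 * Y ^+ 2 + Y ^+ 3
     + A * (8 * Y + 8 * Y ^+ 2 + 3 * Y ^+ 3) + A ^+ 2 * (7 * Y + 9 * Y ^+ 2 + 3 * Y ^+ 3)
     + A ^+ 3 * (3 * Y + 3 * Y ^+ 2 + Y ^+ 3)); last by ring.
  by rewrite !(addr_ge0, mulr_ge0, exprn_ge0, ler01).
have e3 : A + Y + A * Y <= (1 + A) ^+ 3 * (1 + Y) ^+ 3.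
  by apply: le_trans e2; rewrite -subr_ge0 (_ : _ - _ = A * A * Y + A * Y * Y + A * A * Y);
    [rewrite !(addr_ge0, mulr_ge0)|ring].
have e4 : A + Y + A * A * Y + A * Y <= (1 + A) ^+ 3 * (1 + Y) ^+ 3.
  by apply: le_trans e2; rewrite -subr_ge0 (_ : _ - _ = A * Y * Y + A * A * Y);
    [rewrite !(addr_ge0, mulr_ge0)|ring].
have e5 : A + Y + A * Y * Y + A * Y + A * A * Y <= (1 + A) ^+ 3 * (1 + Y) ^+ 3.
  by apply: le_trans e2; rewrite -subr_ge0 (_ : _ - _ = A * A * Y);
    [rewrite !(addr_ge0, mulr_ge0)|ring].
apply/norm5_le; split => /=.
- exact: le_trans (D _ _ _ _ k1 h1) e1.
- exact: le_trans (D _ _ _ _ k2 h2) e1.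
- by apply: le_trans e3; apply: B; [exact: D|exact: P].
- apply: le_trans e4; apply: B; last exact: P.
  by apply: (D _ _ _ _ (D _ _ _ _ k4 h4)); apply: H; rewrite expr2; apply: (P) => //; exact: P.
- apply: le_trans e5; apply: (D); last by apply: (P) => //; exact: P.
  apply: B; last exact: P.
  by apply: (D _ _ _ _ (D _ _ _ _ k5 h5)); apply: H; rewrite expr2 mulrA; apply: (P) => //; exact: P.
Qed.

(** The polynomial growth of the product is applied to x = a^{-1} (a x). Hence translating a rapidly
    decreasing function costs three times as many powers, and no more. *)
Lemma left_norm a : exists2 C : R, 0 < C &
  forall x, 1 + `|x| <= C * (1 + `|cartan_mul a x|) ^+ 3.
Proof.
pose b := cartan_inv a; exists (2 * (1 + `|b|) ^+ 3).
  by rewrite mulr_gt0// exprn_gt0// ltr_wpDr.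
move=> x; have := cartan_mul_norm b (cartan_mul a x); rewrite cartan_mulVK => h.
have h1 : 1 <= (1 + `|b|) ^+ 3 * (1 + `|cartan_mul a x|) ^+ 3.
  by rewrite -exprMn exprn_ege1// -[leLHS]mulr1 ler_pM// lerDl.
rewrite -mulrA; move: (_ * _) h h1 => Z h h1.
by rewrite mulr2n mulrDl mul1r lerD.
Qed.

Definition rapid f := forall k : nat, exists M : R, forall x, (1 + `|x|) ^+ k * `|f x| <= M.

Definition rschwartz f := (forall s : seq nat, C1 (rparts s f) /\ continuous (rparts s f)) /\
  forall s : seq nat, rapid (rparts s f).

Lemma rapid_left f a : rapid f -> rapid (fun x => f (cartan_mul a x)).
Proof.
move=> rf k; have [C C0 hC] := left_norm a; have [M hM] := rf (3 * k)%N.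
exists (C ^+ k * M) => x.
apply: le_trans (_ : (C * (1 + `|cartan_mul a x|) ^+ 3) ^+ k * `|f (cartan_mul a x)| <= _).
  by apply: ler_wpM2r => //; rewrite lerXn2r// nnegrE ?addr_ge0// (le_trans _ (hC x))// addr_ge0.
rewrite exprMn -exprM -mulrA; apply: ler_wpM2l; last exact: hM.
by rewrite exprn_ge0// ltW.
Qed.

Definition crd (b : bool) x := if b then x.1.1.1.2 else x.1.1.1.1.

Lemma crd_le b x : `|crd b x| <= `|x|.
Proof. by have [] := coord_le x; case: b. Qed.

Lemma rapidD f g : rapid f -> rapid g -> rapid (fun x => f x + g x).
Proof.
move=> rf rg k; have [M hM] := rf k; have [N hN] := rg k; exists (M + N) => x.
apply: le_trans (lerD (hM x) (hN x)); rewrite -mulrDr; apply: ler_wpM2l.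
  by rewrite exprn_ge0// addr_ge0.
exact: ler_normD.
Qed.

Lemma rapidZ c f : rapid f -> rapid (fun x => c * f x).
Proof.
move=> rf k; have [M hM] := rf k; exists (`|c| * M) => x.
by rewrite normrM mulrCA; apply: ler_wpM2l.
Qed.

Lemma rapid_crd b f : rapid f -> rapid (fun x => crd b x * f x).
Proof.
move=> rf k; have [M hM] := rf k.+1; exists M => x.
apply: le_trans (hM x); rewrite normrM mulrA; apply: ler_wpM2r => //.
rewrite [leRHS]exprSr; apply: ler_wpM2l; first by rewrite exprn_ge0// addr_ge0.
by apply: le_trans (crd_le b x) _; rewrite lerDr.
Qed.

Lemma quad_derive (u : R -> R) (t c0 c1 c2 : R) :
  (forall s, u s = c0 + c1 * s + c2 * s ^+ 2) -> is_derive t 1 u (c1 + 2 * c2 * t).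
Proof.
move=> /funext ->; apply/is_deriveE.
rewrite (_ : (fun h => _) = (fun h : R => h^-1 * (h * (c1 + 2 * c2 * t + c2 * h)))); last first.
  by apply/funext => h; congr (_ * _); rewrite /GRing.scale /=; ring.
have : (fun h : R => c1 + 2 * c2 * t + c2 * h) @ 0^' --> c1 + 2 * c2 * t + c2 * 0.
  apply: cvgD; first exact: cvg_cst.
  by apply: cvgM; [exact: cvg_cst|exact: cvg_within].
rewrite mulr0 addr0; apply: cvg_trans; apply: near_eq_cvg.
near=> h; rewrite mulKf//; near: h.
exact: nbhs_dnbhs_neq.
Unshelve. all: by end_near. Qed.

(** Coordinate lines moved by a left translation, and orbits x (t e_j), have coordinates of degree
    at most two; the square occurs for j = 2, in the fifth coordinate. *)
Definition quad_curve (p q r : B5 R) (h : R) : B5 R :=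
  (p.1.1.1.1 + q.1.1.1.1 * h + r.1.1.1.1 * h ^+ 2,
   p.1.1.1.2 + q.1.1.1.2 * h + r.1.1.1.2 * h ^+ 2,
   p.1.1.2 + q.1.1.2 * h + r.1.1.2 * h ^+ 2,
   p.1.2 + q.1.2 * h + r.1.2 * h ^+ 2, p.2 + q.2 * h + r.2 * h ^+ 2).

Lemma quad_curve_derive f (p q r : B5 R) (t : R) : C1 f ->
  is_derive t 1 (fun s => f (quad_curve p q r s))
   (rpart 1 f (quad_curve p q r t) * (q.1.1.1.1 + 2 * r.1.1.1.1 * t) +
    rpart 2 f (quad_curve p q r t) * (q.1.1.1.2 + 2 * r.1.1.1.2 * t) +
    rpart 3 f (quad_curve p q r t) * (q.1.1.2 + 2 * r.1.1.2 * t) +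
    rpart 4 f (quad_curve p q r t) * (q.1.2 + 2 * r.1.2 * t) +
    rpart 5 f (quad_curve p q r t) * (q.2 + 2 * r.2 * t)).
Proof.
move=> cf.
have Q (c0 c1 c2 : R) :
    is_derive t 1 (fun s => c0 + c1 * s + c2 * s ^+ 2) (c1 + 2 * c2 * t).
  exact: quad_derive.
exact: (chain5 cf (Q _ _ _) (Q _ _ _) (Q _ _ _) (Q _ _ _) (Q _ _ _)).
Qed.

(** The chain rule for x |-> f (a x). The one variable coefficient, in direction 2, comes from the
    term a1 x2^2 / 2 of the fifth coordinate of a x. *)
Definition left_part (j : nat) a f x : R :=
  let: (a1, a2, a3, a4, a5) := a in let y := cartan_mul a x in
  match j with
  | 1%N => rpart 1 f y
  | 2%N => rpart 2 f y - a1 * rpart 3 f y + a1 ^+ 2 / 2 * rpart 4 f y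
           + (a1 * crd true x + a1 * a2) * rpart 5 f y
  | 3%N => rpart 3 f y - a1 * rpart 4 f y - a2 * rpart 5 f y
  | 4%N => rpart 4 f y
  | 5%N => rpart 5 f y
  | _ => 0
  end.

Lemma left_derive j a f x : C1 f ->
  is_derive x (basis_vec R j) (fun x => f (cartan_mul a x)) (left_part j a f x).
Proof.
move=> cf; have [j0|jn0] := eqVneq j 0%N.
  apply/is_deriveE; rewrite (_ : (fun h => _) = cst 0).
    by rewrite j0; case: a => [[[[a1 a2] a3] a4] a5]; exact: cvg_cst.
  by apply/funext => h; rewrite line0 ?subrr ?mulr0//; right.
have [j5|j5] := ltnP 5 j.
  apply/is_deriveE; rewrite (_ : (fun h => _) = cst 0).
    move: j5; case: a => [[[[a1 a2] a3] a4] a5].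
    by case: j jn0 => [|[|[|[|[|[|j]]]]]] // _ _; exact: cvg_cst.
  by apply/funext => h; rewrite line0 ?subrr ?mulr0//; left.
case: a x => [[[[a1 a2] a3] a4] a5] [[[[x1 x2] x3] x4] x5].
apply/is_deriveE.
have K p q r l : (forall h, cartan_mul (a1, a2, a3, a4, a5)
      (h *: basis_vec R j + (x1, x2, x3, x4, x5)) = quad_curve p q r h) ->
    (let y := cartan_mul (a1, a2, a3, a4, a5) (x1, x2, x3, x4, x5) in
     rpart 1 f y * q.1.1.1.1 + rpart 2 f y * q.1.1.1.2 + rpart 3 f y * q.1.1.2 +
     rpart 4 f y * q.1.2 + rpart 5 f y * q.2) = l ->
  h^-1 * (f (cartan_mul (a1, a2, a3, a4, a5) (h *: basis_vec R j + (x1, x2, x3, x4, x5)))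
    - f (cartan_mul (a1, a2, a3, a4, a5) (x1, x2, x3, x4, x5))) @[h --> 0^'] --> l.
  move=> E <-; have /is_deriveE := quad_curve_derive p q r 0 cf.
  have := E 0; rewrite scale0r add0r => E0; rewrite -E0 !mulr0 !addr0.
  rewrite (eq_cvg _ _ (g := fun h => h^-1 * (f (cartan_mul (a1, a2, a3, a4, a5)
    (h *: basis_vec R j + (x1, x2, x3, x4, x5))) -
    f (cartan_mul (a1, a2, a3, a4, a5) (x1, x2, x3, x4, x5)))))//.
  move=> h; change (h^-1 * (f (quad_curve p q r (h * 1 + 0)) -
    f (cartan_mul (a1, a2, a3, a4, a5) (x1, x2, x3, x4, x5))) =
    h^-1 * (f (cartan_mul (a1, a2, a3, a4, a5) (h *: basis_vec R j + (x1, x2, x3, x4, x5))) -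
    f (cartan_mul (a1, a2, a3, a4, a5) (x1, x2, x3, x4, x5)))).
  by rewrite E mulr1 addr0.
case: j jn0 j5 K => [|[|[|[|[|[|j]]]]]] // _ _ K.
- apply: (K (a1 + x1, a2 + x2, a3 + x3 - a1 * x2, a4 + x4 + a1 ^+ 2 * x2 / 2 - a1 * x3,
    a5 + x5 + a1 * x2 ^+ 2 / 2 - a2 * x3 + a1 * a2 * x2) (1, 0, 0, 0, 0) 0).
    by move=> h; rewrite line1 /quad_curve /cartan_mul /GRing.scale /=; do ! congr (_, _); ring.
  by rewrite /left_part; move: (cartan_mul _ _) => y /=; generalize_parts; ring.
- apply: (K (a1 + x1, a2 + x2, a3 + x3 - a1 * x2, a4 + x4 + a1 ^+ 2 * x2 / 2 - a1 * x3,
    a5 + x5 + a1 * x2 ^+ 2 / 2 - a2 * x3 + a1 * a2 * x2)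
    (0, 1, - a1, a1 ^+ 2 / 2, a1 * x2 + a1 * a2) (0, 0, 0, 0, a1 / 2)).
    by move=> h; rewrite line2 /quad_curve /cartan_mul /GRing.scale /=; do ! congr (_, _); field.
  by rewrite /left_part; move: (cartan_mul _ _) => y /=; generalize_parts; ring.
- apply: (K (a1 + x1, a2 + x2, a3 + x3 - a1 * x2, a4 + x4 + a1 ^+ 2 * x2 / 2 - a1 * x3,
    a5 + x5 + a1 * x2 ^+ 2 / 2 - a2 * x3 + a1 * a2 * x2) (0, 0, 1, - a1, - a2) 0).
    by move=> h; rewrite line3 /quad_curve /cartan_mul /GRing.scale /=; do ! congr (_, _); ring.
  by rewrite /left_part; move: (cartan_mul _ _) => y /=; generalize_parts; ring.
- apply: (K (a1 + x1, a2 + x2, a3 + x3 - a1 * x2, a4 + x4 + a1 ^+ 2 * x2 / 2 - a1 * x3,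
    a5 + x5 + a1 * x2 ^+ 2 / 2 - a2 * x3 + a1 * a2 * x2) (0, 0, 0, 1, 0) 0).
    by move=> h; rewrite line4 /quad_curve /cartan_mul /GRing.scale /=; do ! congr (_, _); ring.
  by rewrite /left_part; move: (cartan_mul _ _) => y /=; generalize_parts; ring.
- apply: (K (a1 + x1, a2 + x2, a3 + x3 - a1 * x2, a4 + x4 + a1 ^+ 2 * x2 / 2 - a1 * x3,
    a5 + x5 + a1 * x2 ^+ 2 / 2 - a2 * x3 + a1 * a2 * x2) (0, 0, 0, 0, 1) 0).
    by move=> h; rewrite line5 /quad_curve /cartan_mul /GRing.scale /=; do ! congr (_, _); ring.
  by rewrite /left_part; move: (cartan_mul _ _) => y /=; generalize_parts; ring.
Qed.

(** Differentiating a left translate brings out a factor x2, so left translates of partial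
    derivatives do not form a class closed under derivation. Adding multiplication by x1 and x2
    closes it, and iterated derivatives need no explicit formula; x1 also occurs in the
    left-invariant fields. *)
Inductive schwartz_class : (B5 R -> R) -> Prop :=
| class_left f a : rschwartz f -> schwartz_class (fun x => f (cartan_mul a x))
| class_add f g : schwartz_class f -> schwartz_class g ->
    schwartz_class (fun x => f x + g x)
| class_scale c f : schwartz_class f -> schwartz_class (fun x => c * f x)
| class_crd b f : schwartz_class f -> schwartz_class (fun x => crd b x * f x).

Lemma class_rapid f : schwartz_class f -> rapid f.
Proof.
elim=> [g a [_ /(_ [::])]||c g _|b g _]; [exact: rapid_left|..].
- by move=> g h _ rg _; exact: rapidD.
- exact: rapidZ.
- exact: rapid_crd.
Qed.

Lemma coord_cvg x : [/\ (fun y : B5 R => y.1.1.1.1) @ x --> x.1.1.1.1,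
  (fun y : B5 R => y.1.1.1.2) @ x --> x.1.1.1.2,
  (fun y : B5 R => y.1.1.2) @ x --> x.1.1.2, (fun y : B5 R => y.1.2) @ x --> x.1.2
  & (fun y : B5 R => y.2) @ x --> x.2].
Proof.
have c0 : (fun y : B5 R => y) @ x --> x by exact: cvg_id.
have c5 : (fun y : B5 R => y.2) @ x --> x.2 by apply: cvg_comp c0 _; exact: cvg_snd.
have d4 : (fun y : B5 R => y.1) @ x --> x.1 by apply: cvg_comp c0 _; exact: cvg_fst.
have c4 : (fun y : B5 R => y.1.2) @ x --> x.1.2 by apply: cvg_comp d4 _; exact: cvg_snd.
have d3 : (fun y : B5 R => y.1.1) @ x --> x.1.1 by apply: cvg_comp d4 _; exact: cvg_fst.
have c3 : (fun y : B5 R => y.1.1.2) @ x --> x.1.1.2 by apply: cvg_comp d3 _; exact: cvg_snd.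
have d2 : (fun y : B5 R => y.1.1.1) @ x --> x.1.1.1 by apply: cvg_comp d3 _; exact: cvg_fst.
have c2 : (fun y : B5 R => y.1.1.1.2) @ x --> x.1.1.1.2 by apply: cvg_comp d2 _; exact: cvg_snd.
have c1 : (fun y : B5 R => y.1.1.1.1) @ x --> x.1.1.1.1 by apply: cvg_comp d2 _; exact: cvg_fst.
by split.
Qed.

Lemma continuous_left a : continuous (cartan_mul a).
Proof.
move: a => [[[[a1 a2] a3] a4] a5].
have -> : cartan_mul (a1, a2, a3, a4, a5) = (fun x =>
  (a1 + x.1.1.1.1, a2 + x.1.1.1.2, a3 + x.1.1.2 - a1 * x.1.1.1.2,
   a4 + x.1.2 + a1 ^+ 2 * x.1.1.1.2 / 2 - a1 * x.1.1.2,
   a5 + x.2 + a1 * (x.1.1.1.2 * x.1.1.1.2) / 2 - a2 * x.1.1.2 + a1 * a2 * x.1.1.1.2)).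
  by apply/funext => -[[[[x1 x2] x3] x4] x5]; rewrite -expr2.
move=> x.
have [c1 c2 c3 c4 c5] := coord_cvg x.
have cc (c : R) : (fun _ : B5 R => c) @ x --> c by exact: cvg_cst.
apply: cvg_tuple5.
- exact: cvgD.
- exact: cvgD.
- by apply: cvgB; [exact: cvgD|exact: cvgM].
- apply: cvgB; last exact: cvgM.
  by apply: cvgD; [exact: cvgD|do 2 apply: cvgM => //].
- apply: cvgD; last exact: cvgM.
  apply: cvgB; last exact: cvgM.
  by apply: cvgD; [exact: cvgD|apply: cvgM => //; apply: cvgM => //; exact: cvgM].
Qed.

Lemma continuous_crd b : continuous (crd b).
Proof.
by move=> x; have [c1 c2 _ _ _] := coord_cvg x; case: b.
Qed.

Lemma class_continuous f : schwartz_class f -> continuous f.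
Proof.
elim=> [g a [/(_ [::]) [_ cg] _]|g h _ cg _ ch|c g _ cg|b g _ cg] x.
- by apply: (continuous_comp (@continuous_left a x)); exact: cg.
- by apply: cvgD; [exact: cg|exact: ch].
- by apply: cvgM; [exact: cvg_cst|exact: cg].
- by apply: cvgM; [exact: continuous_crd|exact: cg].
Qed.

Lemma crd_derive b j x :
  is_derive x (basis_vec R j) (crd b) ((j == if b then 2%N else 1%N)%:R).
Proof.
apply/is_deriveE.
have E h : crd b (h *: basis_vec R j + x) - crd b x = h * (j == if b then 2%N else 1%N)%:R.
  by rewrite /crd; case: b; rewrite /= addrK.
under eq_cvg do rewrite E.
have : (fun _ : R => (j == if b then 2%N else 1%N)%:R : R) @ 0^' -->
   ((j == if b then 2%N else 1%N)%:R : R) by exact: cvg_cst.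
apply: cvg_trans; apply: near_eq_cvg; near=> h; rewrite mulKf//; near: h.
exact: nbhs_dnbhs_neq.
Unshelve. all: by end_near. Qed.

Lemma rschwartz_part f j : rschwartz f -> rschwartz (rpart j f).
Proof.
move=> [h1 h2]; split=> s.
  by have := h1 (rcons s j); rewrite /rparts foldr_rcons.
by have := h2 (rcons s j); rewrite /rparts foldr_rcons.
Qed.

Lemma class_left_part f a j : rschwartz f -> schwartz_class (left_part j a f).
Proof.
move=> Sf; have P k : schwartz_class (fun x => rpart k f (cartan_mul a x)).
  by apply: class_left; exact: rschwartz_part.
case: a P => [[[[a1 a2] a3] a4] a5]; set L := cartan_mul _ => P.
have Q u v : u =1 v -> schwartz_class u -> schwartz_class v by move=> /funext ->.
case: j => [|[|[|[|[|[|j]]]]]]; try exact: P.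
- apply: (Q (fun x => 0 * rpart 1 f (L x))); last exact: class_scale.
  by move=> x; rewrite mul0r.
- apply: (Q (fun x => ((rpart 2 f (L x) + - a1 * rpart 3 f (L x)) +
      a1 ^+ 2 / 2 * rpart 4 f (L x)) + (a1 * (crd true x * rpart 5 f (L x)) +
      (a1 * a2) * rpart 5 f (L x)))).
    move=> x; have E : ((rpart 2 f (L x) + - a1 * rpart 3 f (L x)) +
      a1 ^+ 2 / 2 * rpart 4 f (L x)) + (a1 * (crd true x * rpart 5 f (L x)) +
      (a1 * a2) * rpart 5 f (L x)) = rpart 2 f (L x) - a1 * rpart 3 f (L x)
      + a1 ^+ 2 / 2 * rpart 4 f (L x) + (a1 * crd true x + a1 * a2) * rpart 5 f (L x).
      by generalize_parts; ring.
    exact: E.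
  apply: class_add; first apply: class_add; first apply: class_add.
  - exact: P.
  - by apply: class_scale; exact: P.
  - by apply: class_scale; exact: P.
  - apply: class_add; last by apply: class_scale; exact: P.
    by apply: class_scale; apply: class_crd; exact: P.
- apply: (Q (fun x => (rpart 3 f (L x) + - a1 * rpart 4 f (L x)) +
      - a2 * rpart 5 f (L x))).
    move=> x; have E : (rpart 3 f (L x) + - a1 * rpart 4 f (L x)) +
      - a2 * rpart 5 f (L x) = rpart 3 f (L x) - a1 * rpart 4 f (L x)
      - a2 * rpart 5 f (L x) by generalize_parts; ring.
    exact: E.
  apply: class_add; first apply: class_add.
  - exact: P.
  - by apply: class_scale; exact: P.
  - by apply: class_scale; exact: P.
- apply: (Q (fun x => 0 * rpart 1 f (L x))); last exact: class_scale.
  by move=> x; rewrite mul0r.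
Qed.

Lemma class_derive f : schwartz_class f -> forall j, exists2 g, schwartz_class g &
  forall x, is_derive x (basis_vec R j) f (g x).
Proof.
elim=> [g a Sg|g h _ ig _ ih|c g Sg ig|b g Sg ig] j.
- exists (left_part j a g); first exact: class_left_part.
  by move=> x; apply: left_derive; have [/(_ [::]) []] := Sg.
- have [g' cg dg] := ig j; have [h' ch dh] := ih j.
  by exists (fun x => g' x + h' x); [exact: class_add|move=> x; exact: is_deriveD].
- have [g' cg dg] := ig j; exists (fun x => c * g' x); first exact: class_scale.
  by move=> x; apply: is_deriveZ.
- have [g' cg dg] := ig j.
  exists (fun x => crd b x * g' x + (j == if b then 2%N else 1%N)%:R * g x).
    by apply: class_add; [exact: class_crd|exact: class_scale].
  move=> x; have D := is_deriveM (crd_derive b j x) (dg x).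
  apply: is_derive_eq D _ => /=; rewrite /GRing.scale /=; ring.
Qed.

Lemma class_rschwartz f : schwartz_class f -> rschwartz f.
Proof.
move=> cf; have H s : schwartz_class (rparts s f).
  elim: s => [//|j s ih] /=.
  have [g cg dg] := class_derive ih j.
  suff -> : rpart j (rparts s f) = g by [].
  by apply/funext => x; have [] := dg x.
split=> s; last exact: class_rapid.
split; last exact: class_continuous.
move=> j; split; last by move=> x; have [g _ dg] := class_derive (H s) j; have [] := dg x.
exact: (class_continuous (H (j :: s))).
Qed.

End Schwartz.

(** * Flows of the left-invariant fields *)

Section Caratheodory.
Context d (T : measurableType d) (R : realType).

(* Discretising [s] to [floor (n s) / n] makes the joint function a countable
   gluing of measurable functions. *)
Lemma measurable_caratheodory (f : T * R -> R) :
  (forall s, measurable_fun setT (fun x => f (x, s))) ->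
  (forall x, continuous (fun s => f (x, s))) -> measurable_fun setT f.
Proof.
move=> mf cf.
pose q (n : nat) (s : R) : R := (Num.floor (n.+1%:R * s))%:~R / n.+1%:R.
have qs s : q n s @[n --> \oo] --> s.
  apply/cvgrPdist_le => e e0; near=> n.
  have n0 : 0 < n.+1%:R :> R by rewrite ltr0n.
  have /andP[h1 h2] : (Num.floor (n.+1%:R * s))%:~R <= n.+1%:R * s
      < (Num.floor (n.+1%:R * s) + 1)%:~R by rewrite Num.Theory.floor_le_tmp Num.Theory.floorD1_gt.
  rewrite intrD in h2.
  have -> : s - q n s = (n.+1%:R * s - (Num.floor (n.+1%:R * s))%:~R) / n.+1%:R.
    by rewrite mulrBl mulrAC divff ?mul1r// gt_eqF.
  rewrite ger0_norm; last by rewrite divr_ge0 ?subr_ge0// ltW.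
  apply: le_trans (_ : 1 / n.+1%:R <= _).
    by apply: ler_wpM2r; [rewrite invr_ge0 ltW|rewrite lerBlDl ltW].
  rewrite mul1r; near: n.
  have /cvgrPdist_le/(_ e e0) := @cvg_harmonic R.
  by apply: filterS => n /=; rewrite sub0r normrN ger0_norm// invr_ge0.
apply: (@measurable_fun_cvg _ _ _ setT (fun n z => f (z.1, q n z.2))); last first.
  move=> [x s] _ /=; apply: (cvg_comp (q ^~ s) (fun s => f (x, s)) (qs s)); exact: cf.
move=> n.
pose E (i : nat) := [set z : T * R | choice.unpickle i = Some (Num.floor (n.+1%:R * z.2))].
have ET : \bigcup_i E i = setT.
  apply/seteqP; split => // z _; exists (choice.pickle (Num.floor (n.+1%:R * z.2))) => //.
  by rewrite /E /= choice.pickleK.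
have mE i : measurable (E i).
  rewrite /E; case: (choice.unpickle i) => [k|]; last first.
    by rewrite (_ : [set _ | _] = set0)//; apply/seteqP; split.
  rewrite (_ : [set _ | _] = setT `&` (fun z : T * R => n.+1%:R * z.2) @^-1` `[k%:~R, (k + 1)%:~R[%classic).
    have : measurable_fun setT (fun z : T * R => n.+1%:R * z.2).
      by apply: measurable_funM => //; exact: measurable_snd.
    by apply => //; exact: measurable_itv.
  rewrite setTI; apply/seteqP; split=> z /=; rewrite in_itv/=.
    by move=> [->]; rewrite Num.Theory.floor_le_tmp Num.Theory.floorD1_gt.
  by move=> h; congr Some; apply/esym/Num.Theory.floor_def.
rewrite -ET; apply/measurable_fun_bigcup => // i.
rewrite /E; case: (choice.unpickle i) => [k|]; last first.
  by rewrite (_ : [set _ | _] = set0); [exact: measurable_fun_set0|apply/seteqP; split].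
apply: (@eq_measurable_fun _ _ _ _ _ (fun z => f (z.1, k%:~R / n.+1%:R))).
  by move=> z; rewrite inE /= => -[->].
apply: measurable_funTS.
exact: (measurableT_comp (mf (k%:~R / n.+1%:R)) measurable_fst).
Unshelve. all: by end_near. Qed.

End Caratheodory.

Section Flows.
Variable R : realType.
Implicit Types f g : B5 R -> R.
Implicit Types x y a : B5 R.
Notation leb := (@lebesgue_measure R).

(** The sigma-algebra is that of an iterated product, so measurability is gained one coordinate at a
    time, from measurability in the others and continuity in that one. *)
Lemma continuous_measurable5 f : continuous f -> measurable_fun setT f.
Proof.
move=> cf; have H (a b c d e : R -> R) s : {for s, continuous a} -> {for s, continuous b} ->
   {for s, continuous c} -> {for s, continuous d} -> {for s, continuous e} ->
   {for s, continuous (fun s => f (a s, b s, c s, d s, e s))}.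
  move=> ca cb cc cd ce; apply: (cvg_comp (fun s => (a s, b s, c s, d s, e s)) f _ (cf _)).
  exact: cvg_tuple5.
have K (c : R) s : {for s, continuous (fun _ : R => c)} by exact: cvg_cst.
have I s : {for s, continuous (fun s : R => s)} by exact: cvg_id.
apply: (measurable_caratheodory (f := f)) => [x5|[[[x1 x2] x3] x4] s]; last exact: H.
apply: (measurable_caratheodory (f := fun z => f (z, x5))) => [x4|[[x1 x2] x3] s]; last exact: H.
apply: (measurable_caratheodory (f := fun z => f (z, x4, x5))) => [x3|[x1 x2] s]; last exact: H.
apply: (measurable_caratheodory (f := fun z => f (z, x3, x4, x5))) => [x2|x1 s]; last exact: H.
by apply: continuous_measurable_fun => s; exact: H.
Qed.

Lemma oneDsqr_fin : (\int[leb]_s ((oneDsqr s)^-1)%:E = pi%:E)%E.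
Proof.
rewrite ge0_symfun_integralT.
- rewrite (_ : [set x | _] = `[0, +oo[%classic); last first.
    by apply/seteqP; split => x/=; rewrite in_itv/= andbT.
  by rewrite integral0y_oneDsqr -EFinM mulrCA divff// mulr1.
- by move=> x; rewrite invr_ge0 (le_trans _ (oneDsqr_ge1 x)).
- exact: continuous_oneDsqrV.
- by move=> x /=; rewrite /oneDsqr sqrrN.
Qed.

Lemma prod_integral_fin d (T : measurableType d) (m : {sigma_finite_measure set T -> \bar R})
   (u : T -> R) (v : R -> R) :
  measurable_fun setT u -> (forall t, 0 <= u t) -> (\int[m]_t (u t)%:E < +oo)%E ->
  measurable_fun setT v -> (forall s, 0 <= v s) -> (\int[leb]_s (v s)%:E < +oo)%E ->
  (\int[(m \x leb)%E]_z (u z.1 * v z.2)%:E < +oo)%E.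
Proof.
move=> mu u0 ufin mv v0 vfin.
rewrite (fubini_tonelli1 (fun z : T * measurableTypeR R => (u z.1 * v z.2)%:E)); last 2 first.
- by apply/measurable_EFinP; apply: measurable_funM; exact: measurableT_comp.
- by move=> z; rewrite lee_fin mulr_ge0.
rewrite /fubini_F /=.
have Ev : (\int[leb]_x (v x)%:E)%E \is a fin_num.
  by rewrite ge0_fin_numE// integral_ge0// => x _; rewrite lee_fin.
have E t : (\int[leb]_s (u t * v s)%:E = (u t)%:E * \int[leb]_s (v s)%:E)%E.
  under eq_integral do rewrite EFinM.
  by rewrite ge0_integralZl//; [exact/measurable_EFinP|move=> s _; rewrite lee_fin|rewrite lee_fin].
under eq_integral do rewrite E.
have Eu : (\int[m]_x (u x)%:E)%E \is a fin_num.
  by rewrite ge0_fin_numE// integral_ge0// => x _; rewrite lee_fin.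
rewrite /= -(fineK Ev) ge0_integralZr//.
- by rewrite -(fineK Eu) -EFinM ltry.
- exact/measurable_EFinP.
- by move=> x _; rewrite lee_fin.
- by rewrite lee_fin fine_ge0// integral_ge0// => x _; rewrite lee_fin.
Qed.

(** A product of Cauchy kernels: an explicit integrable function that dominates every rapidly
    decreasing one. *)
Definition weight x : R := (oneDsqr x.1.1.1.1)^-1 * (oneDsqr x.1.1.1.2)^-1
  * (oneDsqr x.1.1.2)^-1 * (oneDsqr x.1.2)^-1 * (oneDsqr x.2)^-1.

Lemma oneDsqrV_ge0 (s : R) : 0 <= (oneDsqr s)^-1.
Proof. by rewrite invr_ge0 (le_trans _ (oneDsqr_ge1 s)). Qed.

Lemma measurable_oneDsqrV : measurable_fun setT (fun s : R => (oneDsqr s)^-1).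
Proof. by apply: continuous_measurable_fun; exact: continuous_oneDsqrV. Qed.

Lemma weight_ge0 x : 0 <= weight x.
Proof. by rewrite !mulr_ge0// oneDsqrV_ge0. Qed.

Lemma weight_integrable : (@haar R).-integrable setT (EFin \o weight).
Proof.
have V1 := measurable_oneDsqrV; have V0 := oneDsqrV_ge0.
have VF : (\int[leb]_s ((oneDsqr s)^-1)%:E < +oo)%E by rewrite oneDsqr_fin ltry.
have F1 := @prod_integral_fin _ _ leb _ _ V1 V0 VF V1 V0 VF.
have m2 : measurable_fun setT (fun z : R * R => (oneDsqr z.1)^-1 * (oneDsqr z.2)^-1).
  by apply: measurable_funM; exact: measurableT_comp V1 _.
have p2 (z : R * R) : 0 <= (oneDsqr z.1)^-1 * (oneDsqr z.2)^-1 by rewrite mulr_ge0.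
have F2 := @prod_integral_fin _ _ (sigma_finite_prod leb leb) _ _ m2 p2 F1 V1 V0 VF.
have m3 : measurable_fun setT (fun z : R * R * R =>
    (oneDsqr z.1.1)^-1 * (oneDsqr z.1.2)^-1 * (oneDsqr z.2)^-1).
  by apply: measurable_funM; [exact: measurableT_comp m2 _|exact: measurableT_comp V1 _].
have p3 (z : R * R * R) : 0 <= (oneDsqr z.1.1)^-1 * (oneDsqr z.1.2)^-1 * (oneDsqr z.2)^-1.
  by rewrite !mulr_ge0.
have F3 := @prod_integral_fin _ _ (sigma_finite_prod (sigma_finite_prod leb leb) leb)
  _ _ m3 p3 F2 V1 V0 VF.
have m4 : measurable_fun setT (fun z : R * R * R * R => (oneDsqr z.1.1.1)^-1 *
    (oneDsqr z.1.1.2)^-1 * (oneDsqr z.1.2)^-1 * (oneDsqr z.2)^-1).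
  by apply: measurable_funM; [exact: measurableT_comp m3 _|exact: measurableT_comp V1 _].
have p4 (z : R * R * R * R) : 0 <= (oneDsqr z.1.1.1)^-1 *
    (oneDsqr z.1.1.2)^-1 * (oneDsqr z.1.2)^-1 * (oneDsqr z.2)^-1.
  by rewrite !mulr_ge0.
have F4 := @prod_integral_fin _ _
  (sigma_finite_prod (sigma_finite_prod (sigma_finite_prod leb leb) leb) leb)
  _ _ m4 p4 F3 V1 V0 VF.
have m5 : measurable_fun setT weight.
  by apply: measurable_funM; [exact: measurableT_comp m4 _|exact: measurableT_comp V1 _].
apply/integrableP; split; first exact/measurable_EFinP.
rewrite (_ : (fun x => _) = EFin \o weight)//.
by apply/funext => x /=; rewrite ger0_norm// weight_ge0.
Qed.

Lemma rapid_weight f : rapid f -> exists2 M : R, 0 <= M & forall x, `|f x| <= M * weight x.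
Proof.
(* Ten powers of decay: two for each of the five quadratic factors of [weight]. *)
move=> /(_ 10%N)[M hM]; exists M.
  by apply: le_trans (hM 0); rewrite mulr_ge0// exprn_ge0// addr_ge0.
move=> x; rewrite -ler_pdivrMr; last first.
  by rewrite /weight !mulr_gt0// invr_gt0 (lt_le_trans _ (oneDsqr_ge1 _)).
apply: le_trans (hM x); rewrite mulrC; apply: ler_wpM2r => //.
rewrite /weight !invfM !invrK.
have h (s : R) : `|s| <= `|x| -> 0 <= oneDsqr s <= (1 + `|x|) ^+ 2.
  move=> sx; rewrite (le_trans _ (oneDsqr_ge1 s))//= /oneDsqr.
  have : s ^+ 2 <= `|x| ^+ 2 by rewrite -(real_normK (num_real s)) lerXn2r// nnegrE.
  by have := normr_ge0 x; nra.
have [h1 h2 h3 h4 h5] := coord_le x.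
have [/andP[? ?] /andP[? ?]] := (h _ h1, h _ h2).
have [/andP[? ?] /andP[? ?]] := (h _ h3, h _ h4).
have /andP[? ?] := h _ h5.
rewrite (_ : (1 + `|x|) ^+ 10 = (1 + `|x|) ^+ 2 * (1 + `|x|) ^+ 2 * (1 + `|x|) ^+ 2 *
  (1 + `|x|) ^+ 2 * (1 + `|x|) ^+ 2); last by rewrite -!exprD.
by do 4 (apply: ler_pM => //; rewrite ?mulr_ge0//).
Qed.

Lemma rapid_integrable f : measurable_fun setT f -> rapid f ->
  (@haar R).-integrable setT (EFin \o f).
Proof.
move=> mf /rapid_weight[M M0 hM].
exact: (@integrable_le _ _ R (@haar R) f (fun x => M * weight x) mf
  (integrable_scale M weight_integrable) hM).
Qed.

Lemma rapid_mul_bounded f g (N : R) : 0 <= N -> (forall x, `|g x| <= N) -> rapid f ->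
  rapid (fun x => f x * g x).
Proof.
move=> N0 gN rf k; have [M hM] := rf k; exists (M * N) => x.
by rewrite normrM mulrA; apply: ler_pM.
Qed.

Lemma rapid_bounded f : rapid f -> exists2 M : R, 0 <= M & forall x, `|f x| <= M.
Proof.
move=> /(_ 0%N)[M hM]; exists M; last by move=> x; have := hM x; rewrite expr0 mul1r.
by apply: le_trans (hM 0); rewrite mulr_ge0// exprn_ge0// addr_ge0.
Qed.

Lemma rapidM f g : rapid f -> rapid g -> rapid (fun x => f x * g x).
Proof. by move=> rf /rapid_bounded[N N0 gN]; exact: rapid_mul_bounded gN rf. Qed.

Lemma rapid_square_integrable f : measurable_fun setT f -> rapid f ->
  square_integrable (@haar R) f.
Proof.
move=> mf rf; apply: square_integrableP => //; apply: rapid_integrable.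
  exact: measurable_funX.
by under eq_fun do rewrite expr2; exact: rapidM.
Qed.

Definition flow (j : nat) (t : R) x : B5 R := cartan_mul x (t *: basis_vec R j).

Definition rX (j : nat) f x : R :=
  match j with
  | 1%N => rpart 1 f x
  | 2%N => rpart 2 f x - crd false x * rpart 3 f x + crd false x ^+ 2 / 2 * rpart 4 f x
           + crd false x * crd true x * rpart 5 f x
  | 3%N => rpart 3 f x - crd false x * rpart 4 f x - crd true x * rpart 5 f x
  | 4%N => rpart 4 f x
  | 5%N => rpart 5 f x
  | _ => 0
  end.

Lemma flow0 j x : flow j 0 x = x.
Proof.
rewrite /flow scale0r; case: x => [[[[x1 x2] x3] x4] x5].
by rewrite /cartan_mul; do ! congr (_, _); ring.
Qed.

Lemma flow_scale (j : nat) (t : R) : t *: basis_vec R j = (t * (j == 1%N)%:R,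
  t * (j == 2%N)%:R, t * (j == 3%N)%:R, t * (j == 4%N)%:R, t * (j == 5%N)%:R).
Proof. by []. Qed.

Lemma basis_vec0 j : (5 < j)%N || (j == 0%N) -> basis_vec R j = 0.
Proof. by case: j => [|[|[|[|[|[|j]]]]]]. Qed.

(** The orbit is an integral curve of the field: its velocity paired with the gradient of f is
    [rX j f] at the current point, for all times at once. *)
Lemma flow_quad j x : exists q r, (forall t, flow j t x = quad_curve x q r t) /\
  forall f t, let y := quad_curve x q r t in
   rpart 1 f y * (q.1.1.1.1 + 2 * r.1.1.1.1 * t) +
    rpart 2 f y * (q.1.1.1.2 + 2 * r.1.1.1.2 * t) +
    rpart 3 f y * (q.1.1.2 + 2 * r.1.1.2 * t) +
    rpart 4 f y * (q.1.2 + 2 * r.1.2 * t) +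
    rpart 5 f y * (q.2 + 2 * r.2 * t) = rX j f y.
Proof.
case: x => [[[[x1 x2] x3] x4] x5].
have [j0|jn] := boolP ((5 < j)%N || (j == 0%N)).
  exists 0, 0; split=> [t|f t].
    rewrite /flow (basis_vec0 j0) scaler0 /quad_curve /cartan_mul /=.
    by do ! congr (_, _); ring.
  cbv zeta; move: (quad_curve _ _ _ _) => y.
  have -> : rX j f y = 0 by case: j j0 => [|[|[|[|[|[|j]]]]]].
  by rewrite /=; generalize_parts; ring.
case: j jn => [|[|[|[|[|[|j]]]]]] // _.
- exists (1, 0, 0, 0, 0), 0; split=> [t|f t].
    by rewrite /flow flow_scale /quad_curve /cartan_mul /=; do ! congr (_, _); ring.
  by cbv zeta; move: (quad_curve _ _ _ _) => y; rewrite /=; generalize_parts; ring.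
- exists (0, 1, - x1, x1 ^+ 2 / 2, x1 * x2), (0, 0, 0, 0, x1 / 2); split=> [t|f t].
    by rewrite /flow flow_scale /quad_curve /cartan_mul /=; do ! congr (_, _); field.
  cbv zeta; rewrite /rX /crd.
  have -> : (quad_curve (x1, x2, x3, x4, x5) (0, 1, - x1, x1 ^+ 2 / 2, x1 * x2)
     (0, 0, 0, 0, x1 / 2) t).1.1.1.1 = x1 by rewrite /quad_curve /= !mul0r !addr0.
  have -> : (quad_curve (x1, x2, x3, x4, x5) (0, 1, - x1, x1 ^+ 2 / 2, x1 * x2)
     (0, 0, 0, 0, x1 / 2) t).1.1.1.2 = x2 + t by rewrite /quad_curve /= !mul0r !addr0 mul1r.
  by move: (quad_curve _ _ _ _) => y; rewrite /=; generalize_parts; field.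
- exists (0, 0, 1, - x1, - x2), 0; split=> [t|f t].
    by rewrite /flow flow_scale /quad_curve /cartan_mul /=; do ! congr (_, _); ring.
  cbv zeta; rewrite /rX /crd.
  have -> : (quad_curve (x1, x2, x3, x4, x5) (0, 0, 1, - x1, - x2) 0 t).1.1.1.1 = x1.
    by rewrite /quad_curve /= !mul0r !addr0.
  have -> : (quad_curve (x1, x2, x3, x4, x5) (0, 0, 1, - x1, - x2) 0 t).1.1.1.2 = x2.
    by rewrite /quad_curve /= !mul0r !addr0.
  by move: (quad_curve _ _ _ _) => y; rewrite /=; generalize_parts; ring.
- exists (0, 0, 0, 1, 0), 0; split=> [t|f t].
    by rewrite /flow flow_scale /quad_curve /cartan_mul /=; do ! congr (_, _); ring.
  by cbv zeta; move: (quad_curve _ _ _ _) => y; rewrite /=; generalize_parts; ring.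
- exists (0, 0, 0, 0, 1), 0; split=> [t|f t].
    by rewrite /flow flow_scale /quad_curve /cartan_mul /=; do ! congr (_, _); ring.
  by cbv zeta; move: (quad_curve _ _ _ _) => y; rewrite /=; generalize_parts; ring.
Qed.

Definition flow_diff j f f' := forall x (t : R),
  is_derive t 1 (fun s => f (flow j s x)) (f' (flow j t x)).

Lemma flow_diffX j f : C1 f -> flow_diff j f (rX j f).
Proof.
move=> cf x t; have [q [r [E H]]] := flow_quad j x.
have := quad_curve_derive x q r t cf; rewrite H E.
by apply: is_derive_eq_fun => s; rewrite E.
Qed.

Lemma flow_diffM j f f' g g' : flow_diff j f f' -> flow_diff j g g' ->
  flow_diff j (fun x => f x * g x) (fun x => f' x * g x + f x * g' x).
Proof.
move=> df dg x t; apply: is_derive_eq (is_deriveM (df x t) (dg x t)) _.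
by rewrite /GRing.scale /= addrC (mulrC (g _)).
Qed.

Lemma left_flow a j t x : cartan_mul a (flow j t x) = flow j t (cartan_mul a x).
Proof. by rewrite /flow cartan_mulA. Qed.

(** The field is the derivative along right translations, and these commute with left ones by
    associativity; no computation with coefficients takes place. *)
Lemma rX_left a j f x : C1 f -> C1 (fun x => f (cartan_mul a x)) ->
  rX j (fun x => f (cartan_mul a x)) x = rX j f (cartan_mul a x).
Proof.
move=> cf cg; have [_ h1] := flow_diffX j cg x 0.
have [_ h2] := flow_diffX j cf (cartan_mul a x) 0.
move: h1 h2; rewrite !flow0 => <- <-; congr ('D_(1 : R) _ 0); apply/funext => s.
by rewrite left_flow.
Qed.

Lemma flow_preserves j t : preserves (@haar R) (flow j t).
Proof. exact: haar_right. Qed.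

Lemma measurable_flow j f : measurable_fun setT f ->
  measurable_fun setT (fun z : B5 R * R => f (flow j z.2 z.1)).
Proof.
move=> mf; apply: (measurableT_comp mf).
have h : measurable_fun setT (fun z : B5 R * R => (z.1, z.2 *: basis_vec R j)).
  have -> : (fun z : B5 R * R => (z.1, z.2 *: basis_vec R j)) = (fun z : B5 R * R =>
    (z.1, (z.2 * (j == 1%N)%:R, z.2 * (j == 2%N)%:R, z.2 * (j == 3%N)%:R,
     z.2 * (j == 4%N)%:R, z.2 * (j == 5%N)%:R))) by [].
  by measurable_tac.
exact: (measurableT_comp (@measurable_cartan_mul R) h).
Qed.

Lemma continuous_flow j f x : continuous f -> continuous (fun t => f (flow j t x)).
Proof.
move=> cf t; have [q [r [E _]]] := flow_quad j x.
under eq_fun do rewrite E.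
have Q (c0 c1 c2 : R) : (fun s => c0 + c1 * s + c2 * s ^+ 2) @ t --> c0 + c1 * t + c2 * t ^+ 2.
  apply: cvgD; last by apply: cvgM; [exact: cvg_cst|exact: exprn_continuous].
  by apply: cvgD; [exact: cvg_cst|apply: cvgM; [exact: cvg_cst|exact: cvg_id]].
apply: (cvg_comp (quad_curve x q r) f _ (cf _)).
by apply: cvg_tuple5; exact: Q.
Qed.

Lemma flow_FTC j f f' (r : R) x : 0 < r -> flow_diff j f f' -> continuous f' ->
  (\int[leb]_(s in `[0%R, r]) (f' (flow j s x))%:E = (f (flow j r x) - f x)%:E)%E.
Proof.
move=> r0 df cf'.
have cf : continuous (fun s => f (flow j s x)).
  by move=> t; apply: differentiable_continuous; apply/derivable1_diffP; have [] := df x t.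
rewrite (@continuous_FTC2 _ _ (fun s => f (flow j s x)))// ?flow0//.
- by apply: continuous_subspaceT; exact: continuous_flow.
- split.
  + by move=> s _; have [] := df x s.
  + by apply: cvg_at_right_filter; exact: cf.
  + by apply: cvg_at_left_filter; exact: cf.
- by move=> s _; rewrite derive1E; have [_ ->] := df x s.
Qed.

Lemma haar_integral_preserved (phi : B5 R -> B5 R) (f : B5 R -> \bar R) :
  preserves (@haar R) phi -> measurable_fun setT f ->
  (\int[haar]_x f (phi x) = \int[haar]_x f x)%E.
Proof. exact: (@preserves_integral R _ _ (haar_sigma_finite R)). Qed.

Lemma flow_integralZ j (c s : R) (G : B5 R -> \bar R) : 0 <= c ->
  measurable_fun setT G -> (forall x, 0 <= G x)%E ->
  (\int[haar]_x (c%:E * G (flow j s x)) = c%:E * \int[haar]_x G x)%E.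
Proof.
move=> c0 mG G0; have mc := measurable_funeM c%:E mG.
have c1 : (0 <= c%:E)%E by rewrite lee_fin.
rewrite ((flow_preserves j s).2 (fun x => c%:E * G x)%E mc (fun x => mule_ge0 c1 (G0 x))).
by apply: (@ge0_integralZl _ _ R (haar_sigma_finite R) setT measurableT G mG c%:E).
Qed.

Lemma indicator_itv (r : R) (h : R -> \bar R) :
  (\int[leb]_(s in `[0%R, r]) h s = \int[leb]_s ((\1_(`[0, r]) s)%:E * h s))%E.
Proof.
rewrite integral_mkcond; apply: eq_integral => s _; rewrite /patch indicE.
by case: ifPn => _; rewrite ?mul1e// mul0e.
Qed.

Lemma indicator_total (r : R) (c : \bar R) : 0 <= r ->
  (\int[leb]_s ((\1_(`[0, r]) s)%:E * c) = r%:E * c)%E.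
Proof.
move=> r0; rewrite -(indicator_itv r (cst c)) integral_cst//= lebesgue_measure_itv/= lte_fin.
case: ltP => [_|r1]; first by rewrite sube0 muleC.
have -> : r = 0 by apply/eqP; rewrite eq_le r1.
by rewrite mule0 mul0e.
Qed.

(* Integrating the increments of [h] along the flow, which preserves the Haar
   measure, shows that a derivative along the flow has integral zero. *)
Lemma flow_integral0 j h h' : flow_diff j h h' -> continuous h -> continuous h' ->
  (@haar R).-integrable setT (EFin \o h) -> (@haar R).-integrable setT (EFin \o h') ->
  (\int[haar]_x (h' x)%:E = 0)%E.
Proof.
move=> dh ch ch' ih ih'.
have mh' := continuous_measurable5 ch'.
have mF := measurable_flow j mh'.
have mI : measurable_fun setT (\1_(`[0, 1]) : R -> R) by exact: measurable_indic.
pose F (z : B5 R * R) : \bar R := ((\1_(`[0, 1]) z.2)%:E * (h' (flow j z.2 z.1))%:E)%E.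
have mFF : measurable_fun setT F.
  apply: emeasurable_funM; last exact/measurable_EFinP.
  apply/measurable_EFinP; exact: measurableT_comp mI measurable_snd.
have iF : (haar_sigma_finite R \x leb)%E.-integrable setT F.
  apply/integrable21ltyP => //.
  rewrite (_ : (\int[leb]_y _)%E =
      (\int[leb]_s ((\1_(`[0, 1]) s)%:E * \int[haar]_x `|(h' x)%:E|))%E); last first.
    apply: eq_integral => s _.
    have c0 : 0 <= \1_(`[0, 1]) s :> R by rewrite indicE.
    have ma : measurable_fun setT (fun x => `|(h' x)%:E|%E).
      by apply: measurableT_comp => //; exact/measurable_EFinP.
    rewrite -(flow_integralZ j s c0 ma)//.
    by apply: eq_integral => x _; rewrite /F abseM gee0_abs// lee_fin.
  rewrite indicator_total// mul1e.
  by have /integrableP[] := ih'.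
have := Fubini iF.
rewrite (_ : (\int[leb]_y _)%E =
   (\int[leb]_s ((\1_(`[0, 1]) s)%:E * \int[haar]_x (h' x)%:E))%E); last first.
  apply: eq_integral => s _; rewrite /F /=.
  rewrite integralZl//; last exact: (preserves_integrable (flow_preserves j s) ih').
  congr (_ * _)%E; have mE : measurable_fun setT (EFin \o h') by exact/measurable_EFinP.
  exact: (haar_integral_preserved (flow_preserves j s) mE).
rewrite indicator_total// mul1e => <-.
rewrite (_ : (fun x => _) = (fun x => (h (flow j 1 x))%:E - (h x)%:E)%E); last first.
  apply/funext => x; rewrite /F /= -(indicator_itv 1 (fun s => (h' (flow j s x))%:E)).
  by rewrite (flow_FTC x ltr01 dh ch').
rewrite integralB_EFin//; last exact: (preserves_integrable (flow_preserves j 1) ih).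
rewrite (haar_integral_preserved (flow_preserves j 1) (f := fun x => (h x)%:E)); last first.
  by apply/measurable_EFinP; exact: continuous_measurable5.
by rewrite subee//; exact: integrable_fin_num.
Qed.

Lemma flow_increment j f f' (r : R) x : 0 < r -> flow_diff j f f' -> continuous f' ->
  (((f (flow j r x) - f x) ^+ 2)%:E <=
   r%:E * \int[leb]_(s in `[0%R, r]) ((f' (flow j s x)) ^+ 2)%:E)%E.
Proof.
move=> r0 df cf'; set I := f _ - f x.
have cg : continuous (fun s => f' (flow j s x)) by exact: continuous_flow.
have mg := continuous_measurable_fun cg.
have ig (g : R -> R) : continuous g -> leb.-integrable `[0, r] (EFin \o g).
  move=> cg'; apply: continuous_compact_integrable; first exact: segment_compact.
  exact: continuous_subspaceT.
have cg2 : continuous (fun s => f' (flow j s x) ^+ 2).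
  move=> s; apply: (cvg_comp (fun s => f' (flow j s x)) (fun y : R => y ^+ 2) (cg s)).
  exact: exprn_continuous.
have i2 := ig _ cg2.
(* [c] is the mean slope: integrating (f' - c)^2 >= 0 over [0, r] amounts to the Cauchy-Schwarz
   inequality. *)
pose c := I / r.
have cl : continuous (fun s => (2 * c) * f' (flow j s x) - c ^+ 2).
  move=> s; apply: cvgB; last exact: cvg_cst.
  by apply: cvgM; [exact: cvg_cst|exact: cg].
have H : ((I ^+ 2 / r)%:E <= \int[leb]_(s in `[0%R, r]) ((f' (flow j s x)) ^+ 2)%:E)%E.
  apply: le_trans (_ : (\int[leb]_(s in `[0%R, r])
     ((2 * c) * f' (flow j s x) - c ^+ 2)%:E <= _)%E); last first.
    apply: le_integral => //; first exact: ig.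
    move=> s _; rewrite lee_fin -subr_ge0.
    by rewrite (_ : _ - _ = (f' (flow j s x) - c) ^+ 2) ?sqr_ge0//; ring.
  rewrite le_eqVlt; apply/orP; left; apply/eqP.
  under eq_integral do rewrite EFinB EFinM.
  rewrite integralB//; last 2 first.
  - have := ig _ cg; exact: integrableZl.
  - exact: (ig (cst (c ^+ 2)) (fun s => cvg_cst _)).
  rewrite integralZl//; last exact: (ig _ cg).
  rewrite (flow_FTC x r0 df cf') integral_cst//= lebesgue_measure_itv/= lte_fin r0 sube0 -!EFinM -EFinB.
  by congr (_%:E); rewrite -/I /c; field; rewrite gt_eqF.
have := lee_pmul (x1 := r%:E) _ _ (le_refl _) H.
rewrite !lee_fin divr_ge0 ?sqr_ge0 ?(ltW r0)// -EFinM => /(_ isT isT).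
by rewrite mulrC divfK// gt_eqF.
Qed.

(** The pointwise bound along an orbit is integrated over the starting point. After Tonelli,
    invariance makes the contribution of each time in [0, r] the same; this gives the second factor
    r. *)
Lemma flow_nash j f f' (r : R) : 0 <= r -> flow_diff j f f' -> continuous f -> continuous f' ->
  (sqintegral haar (fun x => (f (flow j r x) - f x)%R) <= (r ^+ 2)%:E * sqintegral haar f')%E.
Proof.
rewrite le_eqVlt => /predU1P[<-|r0] df cf cf'.
  rewrite expr0n mul0e /sqintegral.
  by under eq_integral do rewrite flow0 subrr expr0n; rewrite integral0.
have mf' := continuous_measurable5 cf'.
have mf := continuous_measurable5 cf.
have m2 := measurable_sq mf'.
have mI : measurable_fun setT (\1_(`[0, r]) : R -> R) by exact: measurable_indic.
pose F (z : B5 R * R) : \bar R := ((\1_(`[0, r]) z.2)%:E * ((f' (flow j z.2 z.1)) ^+ 2)%:E)%E.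
have mFF : measurable_fun setT F.
  apply: emeasurable_funM.
    apply/measurable_EFinP; exact: measurableT_comp mI measurable_snd.
  apply/measurable_EFinP; apply: measurable_funX; exact: measurable_flow.
have F0 z : (0 <= F z)%E by rewrite mule_ge0// lee_fin// sqr_ge0.
apply: le_trans (_ : (\int[haar]_x (r%:E * \int[leb]_s F (x, s)) <= _)%E).
  rewrite /sqintegral; apply: ge0_le_integral => //.
  - by move=> x _; rewrite lee_fin sqr_ge0.
  - apply: measurable_sq; apply: measurable_funB => //.
    exact: measurableT_comp mf (flow_preserves j r).1.
  - apply: measurable_funeM.
    exact: (measurable_fun_fubini_tonelli_F (m2 := leb) F mFF).
  - move=> x _; apply: le_trans (flow_increment x r0 df cf') _.
    by rewrite indicator_itv.
rewrite ge0_integralZl//; last 3 first.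
- exact: (measurable_fun_fubini_tonelli_F (m2 := leb) F mFF).
- by move=> x _; exact: integral_ge0.
- by rewrite lee_fin ltW.
rewrite (fubini_tonelli (m1 := haar_sigma_finite R) (m2 := leb) F mFF F0).
rewrite (_ : (\int[leb]_y _)%E =
   (\int[leb]_s ((\1_(`[0, r]) s)%:E * sqintegral haar f'))%E); last first.
  apply: eq_integral => s _; rewrite /F.
  have c0 : 0 <= \1_(`[0, r]) s :> R by rewrite indicE.
  have p2 x : (0 <= ((f' x) ^+ 2)%:E)%E by rewrite lee_fin sqr_ge0.
  exact: (flow_integralZ j s c0 m2 p2).
by rewrite indicator_total ?(ltW r0)// muleA -EFinM -expr2.
Qed.

End Flows.

Lemma sum5_sq (R : realFieldType) (a b c d e : R) :
  (a + b + c + d + e) ^+ 2 <= 5 * (a ^+ 2 + b ^+ 2 + c ^+ 2 + d ^+ 2 + e ^+ 2).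
Proof.
rewrite -subr_ge0 (_ : _ - _ = (a - b) ^+ 2 + (a - c) ^+ 2 + (a - d) ^+ 2 + (a - e) ^+ 2
  + (b - c) ^+ 2 + (b - d) ^+ 2 + (b - e) ^+ 2 + (c - d) ^+ 2 + (c - e) ^+ 2 + (d - e) ^+ 2).
  by rewrite !addr_ge0// sqr_ge0.
by ring.
Qed.

Lemma sqintegral_sum5 d (T : measurableType d) (R : realType)
    (m : {measure set T -> \bar R}) (f g h k l : T -> R) :
  measurable_fun setT f -> measurable_fun setT g -> measurable_fun setT h ->
  measurable_fun setT k -> measurable_fun setT l ->
  (sqintegral m (fun x => (f x + g x + h x + k x + l x)%R) <=
   5%:E * (sqintegral m f + sqintegral m g + sqintegral m h + sqintegral m k
    + sqintegral m l))%E.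
Proof.
move=> mf mg mh mk ml.
have F0 (u : T -> R) x : setT x -> (0 <= (u x ^+ 2)%:E)%E by rewrite lee_fin sqr_ge0.
have M (u : T -> R) : measurable_fun setT u -> measurable_fun setT (fun x => (u x ^+ 2)%:E).
  exact: measurable_sq.
have D (u v : T -> \bar R) : (forall x, setT x -> 0 <= u x)%E -> (forall x, setT x -> 0 <= v x)%E ->
  (forall x, setT x -> 0 <= u x + v x)%E by move=> u0 v0 x Tx; rewrite adde_ge0// ?u0// v0.
pose A2 := emeasurable_funD (M _ mf) (M _ mg); pose A3 := emeasurable_funD A2 (M _ mh).
pose A4 := emeasurable_funD A3 (M _ mk); pose A5 := emeasurable_funD A4 (M _ ml).
have P2 := D _ _ (F0 f) (F0 g); have P3 := D _ _ P2 (F0 h).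
have P4 := D _ _ P3 (F0 k); have P5 := D _ _ P4 (F0 l).
rewrite /sqintegral.
rewrite -(@ge0_integralD _ _ _ m setT measurableT _ _ (F0 f) (M _ mf) (F0 g) (M _ mg)).
rewrite -(@ge0_integralD _ _ _ m setT measurableT _ _ P2 A2 (F0 h) (M _ mh)).
rewrite -(@ge0_integralD _ _ _ m setT measurableT _ _ P3 A3 (F0 k) (M _ mk)).
rewrite -(@ge0_integralD _ _ _ m setT measurableT _ _ P4 A4 (F0 l) (M _ ml)).
have c5 : (0 <= 5%:E :> \bar R)%E by rewrite lee_fin.
have -> : (5%:E * \int[m]_x ((f x ^+ 2)%:E + (g x ^+ 2)%:E + (h x ^+ 2)%:E + (k x ^+ 2)%:E
    + (l x ^+ 2)%:E) = \int[m]_x (5%:E * ((f x ^+ 2)%:E + (g x ^+ 2)%:E + (h x ^+ 2)%:E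
    + (k x ^+ 2)%:E + (l x ^+ 2)%:E)))%E by rewrite (ge0_integralZl m measurableT A5 P5 c5).
apply: ge0_le_integral => //.
- exact: (F0 (fun x => f x + g x + h x + k x + l x)).
- by apply: measurable_sq; do ! apply: measurable_funD => //.
- exact: measurable_funeM.
- by move=> x _; rewrite -!EFinD -EFinM lee_fin sum5_sq.
Qed.

(** * Integration by parts and the energy of Schwartz functions *)

Section SchwartzAlgebra.
Variable R : realType.
Implicit Types f g : B5 R -> R.
Implicit Types x y a : B5 R.

Lemma cartan_mul0 x : cartan_mul 0 x = x.
Proof.
case: x => [[[[x1 x2] x3] x4] x5].
by rewrite /cartan_mul; do ! congr (_, _); ring.
Qed.

Lemma rschwartz_class f : rschwartz f -> schwartz_class f.
Proof.
move=> Sf; have := class_left 0 Sf.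
by rewrite (_ : (fun x => f (cartan_mul 0 x)) = f)//; apply/funext => x; rewrite cartan_mul0.
Qed.

Lemma rschwartzD f g : rschwartz f -> rschwartz g -> rschwartz (fun x => f x + g x).
Proof.
by move=> /rschwartz_class Sf /rschwartz_class Sg; apply: class_rschwartz; exact: class_add.
Qed.

Lemma rschwartzZ c f : rschwartz f -> rschwartz (fun x => c * f x).
Proof. by move=> /rschwartz_class Sf; apply: class_rschwartz; exact: class_scale. Qed.

Lemma rschwartz_crd b f : rschwartz f -> rschwartz (fun x => crd b x * f x).
Proof. by move=> /rschwartz_class Sf; apply: class_rschwartz; exact: class_crd. Qed.

Lemma rschwartz_left a f : rschwartz f -> rschwartz (fun x => f (cartan_mul a x)).
Proof. by move=> Sf; apply: class_rschwartz; exact: class_left. Qed.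

Lemma rschwartzN f : rschwartz f -> rschwartz (fun x => - f x).
Proof. by move=> /(rschwartzZ (-1)); under eq_fun do rewrite mulN1r. Qed.

Lemma rschwartzB f g : rschwartz f -> rschwartz g -> rschwartz (fun x => f x - g x).
Proof. by move=> Sf /rschwartzN; exact: rschwartzD. Qed.

Lemma rschwartz0 f : rschwartz f -> rschwartz (fun _ : B5 R => 0 : R).
Proof. by move=> /(rschwartzZ 0); under eq_fun do rewrite mul0r. Qed.

Lemma rschwartz_C1 f : rschwartz f -> C1 f.
Proof. by move=> [/(_ [::]) []]. Qed.

Lemma rschwartz_continuous f : rschwartz f -> continuous f.
Proof. by move=> [/(_ [::]) []]. Qed.

Lemma rschwartz_rapid f : rschwartz f -> rapid f.
Proof. by move=> [_ /(_ [::])]. Qed.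

Lemma rschwartz_measurable f : rschwartz f -> measurable_fun setT f.
Proof. by move=> /rschwartz_continuous; exact: continuous_measurable5. Qed.

Lemma rschwartz_sq f : rschwartz f -> square_integrable (@haar R) f.
Proof.
move=> Sf; apply: rapid_square_integrable; first exact: rschwartz_measurable.
exact: rschwartz_rapid.
Qed.

Lemma rschwartz_X j f : rschwartz f -> rschwartz (rX j f).
Proof.
move=> Sf; have P k := rschwartz_part k Sf; have C b k := rschwartz_crd b (P k).
case: j => [|[|[|[|[|[|j]]]]]].
- exact: (rschwartz0 Sf).
- exact: P 1%N.
- have := rschwartzD (rschwartzD (rschwartzB (P 2%N) (C false 3%N))
     (rschwartzZ (2^-1) (rschwartz_crd false (C false 4%N))))
     (rschwartz_crd false (C true 5%N)).
  congr rschwartz; apply/funext => x; cbv beta delta [rX] iota.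
  by generalize_parts; move: (crd _ _) (crd _ _) => *; ring.
- exact: (rschwartzB (rschwartzB (P 3%N) (C false 4%N)) (C true 5%N)).
- exact: P 4%N.
- exact: P 5%N.
- exact: (rschwartz0 Sf).
Qed.

(** The derivative of f g along the flow has integral zero, because right translations preserve the
    measure. *)
Lemma integral_by_parts j f g : rschwartz f -> rschwartz g ->
  l2dot (@haar R) (rX j f) g = - l2dot (@haar R) f (rX j g).
Proof.
move=> Sf Sg; have SXf := rschwartz_X j Sf; have SXg := rschwartz_X j Sg.
have D := flow_diffM (flow_diffX j (rschwartz_C1 Sf)) (flow_diffX j (rschwartz_C1 Sg)).
have cM u v : rschwartz u -> rschwartz v -> continuous (fun x => u x * v x).
  by move=> Su Sv x; apply: cvgM; exact: rschwartz_continuous.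
have iM u v : rschwartz u -> rschwartz v ->
    (@haar R).-integrable setT (EFin \o (fun x => u x * v x)).
  by move=> Su Sv; exact: square_integrable_mul (rschwartz_sq Su) (rschwartz_sq Sv).
have := flow_integral0 D (cM _ _ Sf Sg) _ (iM _ _ Sf Sg) _.
have cc : continuous (fun x => rX j f x * g x + f x * rX j g x).
  by move=> x; apply: cvgD; exact: cM.
have ii : (@haar R).-integrable setT (EFin \o (fun x => rX j f x * g x + f x * rX j g x)).
  exact: integrable_add (iM _ _ SXf Sg) (iM _ _ Sf SXg).
move=> /(_ cc ii) h.
apply/eqP; rewrite -addr_eq0; apply/eqP.
rewrite /l2dot -RintegralD//; [|exact: iM|exact: iM].
by rewrite /Rintegral h.
Qed.

Definition indices : seq nat := [:: 1; 2; 3; 4; 5]%N.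

Lemma sum_indices (F : nat -> R) :
  \sum_(j <- indices) F j = F 1%N + F 2%N + F 3%N + F 4%N + F 5%N.
Proof. by rewrite /indices !big_cons big_nil addr0 !addrA. Qed.

Definition rlap f x : R := - (rX 1 (rX 1 f) x + rX 2 (rX 2 f) x + rX 3 (rX 3 f) x
  + rX 4 (rX 4 f) x + rX 5 (rX 5 f) x).

Definition renergy f : R := \sum_(j <- indices) l2dot (@haar R) (rX j f) (rX j f).

Lemma rschwartz_lap f : rschwartz f -> rschwartz (rlap f).
Proof.
move=> Sf; have X j : rschwartz (rX j (rX j f)) by do 2 apply: rschwartz_X.
by apply: rschwartzN; do 4 (apply: rschwartzD => //).
Qed.

Lemma l2dot_sum_fun (I : Type) (s : seq I) (F : I -> B5 R -> R) g :
  (forall i, rschwartz (F i)) -> rschwartz g ->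
  l2dot (@haar R) (fun x => \sum_(i <- s) F i x) g = \sum_(i <- s) l2dot (@haar R) (F i) g.
Proof.
move=> SF Sg; elim: s => [|i s ih].
  rewrite big_nil /l2dot; under eq_Rintegral do rewrite big_nil mul0r.
  by rewrite Rintegral_cst// mul0r.
rewrite big_cons -ih -l2dotDl; last first.
- exact: rschwartz_sq.
- elim: s {ih} => [|k s ihs].
    by under eq_fun do rewrite big_nil; exact: rschwartz_sq (rschwartz0 Sg).
  by under eq_fun do rewrite big_cons; exact: square_integrableD (rschwartz_sq (SF k)) ihs.
- exact: rschwartz_sq.
by congr l2dot; apply/funext => x; rewrite big_cons.
Qed.

Lemma l2dot_lap f : rschwartz f -> l2dot (@haar R) (rlap f) f = renergy f.
Proof.
move=> Sf; have X j : rschwartz (rX j (rX j f)) by do 2 apply: rschwartz_X.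
have -> : rlap f = (fun x => -1 * \sum_(j <- indices) rX j (rX j f) x).
  by apply/funext => x; rewrite (sum_indices (fun j => rX j (rX j f) x)) mulN1r.
rewrite l2dotZl; last 2 first.
- have := rschwartz_sq (rschwartzN (rschwartz_lap Sf)).
  congr square_integrable; apply/funext => x.
  by rewrite (sum_indices (fun j => rX j (rX j f) x)) opprK.
- exact: rschwartz_sq.
rewrite l2dot_sum_fun// mulr_sumr; apply: eq_bigr => j _.
by rewrite integral_by_parts//; [rewrite mulN1r opprK|exact: rschwartz_X].
Qed.

Lemma lap_left f a x : rschwartz f -> rlap (fun x => f (cartan_mul a x)) x = rlap f (cartan_mul a x).
Proof.
move=> Sf; have L g : rschwartz g -> C1 (fun x => g (cartan_mul a x)).
  by move=> Sg; apply: rschwartz_C1; exact: rschwartz_left.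
have H j : rX j (rX j (fun x => f (cartan_mul a x))) x = rX j (rX j f) (cartan_mul a x).
  have -> : rX j (fun x => f (cartan_mul a x)) = (fun x => rX j f (cartan_mul a x)).
    by apply/funext => z; rewrite rX_left//; [exact: rschwartz_C1|exact: L].
  have SX := rschwartz_X j Sf.
  by rewrite rX_left//; [exact: rschwartz_C1|exact: L].
by rewrite /rlap !H.
Qed.

(** Coordinates of the second kind: in this order, and with the fifth flow acting first, the flow
    times are exactly the coordinates of the right factor. *)
Lemma cartan_factor x (y1 y2 y3 y4 y5 : R) : cartan_mul x (y1, y2, y3, y4, y5) =
  flow 1 y1 (flow 2 y2 (flow 3 y3 (flow 4 y4 (flow 5 y5 x)))).
Proof.
case: x => [[[[x1 x2] x3] x4] x5].
by rewrite /flow !flow_scale /cartan_mul /=; do ! congr (_, _); field.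
Qed.

Lemma haar_sqintegral_preserved (phi : B5 R -> B5 R) f : preserves (@haar R) phi ->
  measurable_fun setT f -> sqintegral haar (fun x => f (phi x)) = sqintegral haar f.
Proof.
by move=> pphi /measurable_sq; exact: (haar_integral_preserved pphi).
Qed.

(** The increment telescopes along the five flows. Each piece is an increment along one flow taken
    at a point moved by the others, which preserve the measure, so it has the same norm as at x; the
    5 is the cost of squaring a sum of five terms. *)
Lemma nash_schwartz f (r : R) (y : B5 R) : rschwartz f ->
  [/\ 0 <= y.1.1.1.1 <= r, 0 <= y.1.1.1.2 <= r, 0 <= y.1.1.2 <= r, 0 <= y.1.2 <= r
    & 0 <= y.2 <= r] ->
  (sqintegral haar (fun x => (f (cartan_mul x y) - f x)%R) <=
   (5 * r ^+ 2 * renergy f)%:E)%E.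
Proof.
case: y => [[[[y1 y2] y3] y4] y5] Sf [/= h1 h2 h3 h4 h5].
have mf := rschwartz_measurable Sf.
pose D j (s : R) x := f (flow j s x) - f x.
have mD j s : measurable_fun setT (D j s).
  by apply: measurable_funB => //; exact: measurableT_comp mf (flow_preserves j s).1.
have N j s : 0 <= s <= r -> (sqintegral haar (D j s) <=
    (r ^+ 2)%:E * (l2dot haar (rX j f) (rX j f))%:E)%E.
  move=> /andP[s0 sr]; rewrite /D.
  have := flow_nash s0 (flow_diffX j (rschwartz_C1 Sf)) (rschwartz_continuous Sf)
    (rschwartz_continuous (rschwartz_X j Sf)).
  move=> h; apply: le_trans h _; rewrite -l2dotE; last exact: rschwartz_sq (rschwartz_X j Sf).
  rewrite -!EFinM lee_fin; apply: ler_wpM2r; first exact: l2dot_ge0.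
  by rewrite lerXn2r// nnegrE// (le_trans s0).
have DE j s x : D j s x = f (flow j s x) - f x by [].
clearbody D.
pose q4 x := flow 5 y5 x; pose q3 x := flow 4 y4 (q4 x); pose q2 x := flow 3 y3 (q3 x).
pose q1 x := flow 2 y2 (q2 x).
have p4 : preserves (@haar R) q4 by exact: flow_preserves.
have p3 : preserves (@haar R) q3 by exact: (preserves_comp (flow_preserves 4 y4) p4).
have p2 : preserves (@haar R) q2 by exact: (preserves_comp (flow_preserves 3 y3) p3).
have p1 : preserves (@haar R) q1 by exact: (preserves_comp (flow_preserves 2 y2) p2).
have E x : f (cartan_mul x (y1, y2, y3, y4, y5)) - f x = D 1%N y1 (q1 x) + D 2%N y2 (q2 x)
    + D 3%N y3 (q3 x) + D 4%N y4 (q4 x) + D 5%N y5 x.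
  rewrite cartan_factor !DE -/(q4 x) -/(q3 x) -/(q2 x) -/(q1 x).
  by move: (f _) (f _) (f _) (f _) (f _) (f _) => *; ring.
clearbody q1 q2 q3 q4.
have S j s (q : B5 R -> B5 R) : preserves (@haar R) q -> sqintegral haar (fun x => D j s (q x)) =
    sqintegral haar (D j s).
  by move=> pq; apply: haar_sqintegral_preserved.
have mDq j s (q : B5 R -> B5 R) : preserves (@haar R) q -> measurable_fun setT (fun x => D j s (q x)).
  by move=> [mq _]; exact: (measurableT_comp (mD j s) mq).
have h : (sqintegral haar (fun x => D 1%N y1 (q1 x) + D 2%N y2 (q2 x)
    + D 3%N y3 (q3 x) + D 4%N y4 (q4 x) + D 5%N y5 x)%R <=
    5%:E * (sqintegral haar (fun x => D 1%N y1 (q1 x)) + sqintegral haar (fun x => D 2%N y2 (q2 x))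
    + sqintegral haar (fun x => D 3%N y3 (q3 x)) + sqintegral haar (fun x => D 4%N y4 (q4 x))
    + sqintegral haar (D 5%N y5)))%E.
  apply: sqintegral_sum5; [exact: (mDq _ _ _ p1)|exact: (mDq _ _ _ p2)|
    exact: (mDq _ _ _ p3)|exact: (mDq _ _ _ p4)|exact: mD].
rewrite (S _ _ _ p1) (S _ _ _ p2) (S _ _ _ p3) (S _ _ _ p4) in h.
rewrite (_ : (fun x => f _ - f x) = (fun x => D 1%N y1 (q1 x) + D 2%N y2 (q2 x) + D 3%N y3 (q3 x)
   + D 4%N y4 (q4 x) + D 5%N y5 x)); last by apply/funext => x; rewrite E.
apply: le_trans h _.
rewrite EFinM [in leRHS]EFinM -muleA; apply: lee_wpmul2l; first by rewrite lee_fin.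
rewrite /renergy (sum_indices (fun j => l2dot haar (rX j f) (rX j f))) -EFinM !mulrDr !EFinD.
by do 4 (apply: leeD; last exact: N); exact: N.
Qed.

End SchwartzAlgebra.

(** * The Laplacian and left translations *)

Ltac generalize_derive := repeat match goal with
  | |- context [derive ?f ?y ?v] => let r := fresh "r" in generalize (derive f y v); intro r
  end.

Section ComplexSchwartz.
Variable R : realType.
Implicit Types f g phi : B5 R -> R[i].
Implicit Types x y a : B5 R.
Notation L2 := (LfunType (@haar R) (one_le_two R)).
Notation V := (L2 * L2)%type.
Implicit Types u w : V.

Definition Ref f : B5 R -> R := fun x => complex.Re (f x).
Definition Imf f : B5 R -> R := fun x => complex.Im (f x).

Lemma partials_components s f :
  Ref (partials s f) = rparts s (Ref f) /\ Imf (partials s f) = rparts s (Imf f).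
Proof.
elim: s => [//|j s [h1 h2]]; split; apply/funext => x; rewrite /Ref /Imf /=.
  by rewrite /rpart -h1.
by rewrite /rpart -h2.
Qed.

Lemma Re_le_normc (z : R[i]) : `|complex.Re z| <= ComplexField.Normc.normc z.
Proof.
by rewrite normcE -sqrtr_sqr; apply: ler_wsqrtr; rewrite lerDl sqr_ge0.
Qed.

Lemma Im_le_normc (z : R[i]) : `|complex.Im z| <= ComplexField.Normc.normc z.
Proof.
by rewrite normcE -sqrtr_sqr; apply: ler_wsqrtr; rewrite lerDr sqr_ge0.
Qed.

Lemma normc_le_add (z : R[i]) : ComplexField.Normc.normc z <=
  `|complex.Re z| + `|complex.Im z|.
Proof.
rewrite -[leRHS]ger0_norm ?addr_ge0// -sqrtr_sqr normcE; apply: ler_wsqrtr.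
rewrite sqrrD !real_normK ?num_real//.
by rewrite addrAC lerDl mulrn_wge0// mulr_ge0.
Qed.

Lemma schwartzP f : schwartz f <-> rschwartz (Ref f) /\ rschwartz (Imf f).
Proof.
split=> [[sm bd]|[[c1 b1] [c2 b2]]].
  have B s : rapid (rparts s (Ref f)) /\ rapid (rparts s (Imf f)).
    have [h1 h2] := partials_components s f.
    rewrite -h1 -h2; split=> k; have [M hM] := bd s k; exists M => x.
      apply: le_trans (hM x); apply: ler_wpM2l; first by rewrite exprn_ge0// addr_ge0.
      exact: Re_le_normc.
    apply: le_trans (hM x); apply: ler_wpM2l; first by rewrite exprn_ge0// addr_ge0.
    exact: Im_le_normc.
  have cR s : continuous (rparts s (Ref f)).
    by have [h _] := partials_components s f; have [c _ _] := sm s; rewrite -h.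
  have cI s : continuous (rparts s (Imf f)).
    by have [_ h] := partials_components s f; have [_ c _] := sm s; rewrite -h.
  split; split=> s; try by have [] := B s.
    have [h1 _] := partials_components s f; have [_ _ d] := sm s.
    split=> [j|]; last exact: cR; split; first exact: (cR (j :: s)).
    rewrite -h1 => x; exact: (proj1 (d j x)).
  have [_ h1] := partials_components s f; have [_ _ d] := sm s.
  split=> [j|]; last exact: cI; split; first exact: (cI (j :: s)).
  rewrite -h1 => x; exact: (proj2 (d j x)).
split=> s.
  have [h1 h2] := partials_components s f.
  have [C c] := c1 s; have [D d] := c2 s.
  rewrite -/(Ref (partials s f)) -/(Imf (partials s f)) h1 h2; split => // j x.
  by split; [have [_] := C j|have [_] := D j]; apply.
move=> k; have [h1 h2] := partials_components s f.
have [M hM] := b1 s k; have [N hN] := b2 s k; exists (M + N) => x.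
apply: le_trans (lerD (hM x) (hN x)); rewrite -mulrDr; apply: ler_wpM2l.
  by rewrite exprn_ge0// addr_ge0.
apply: le_trans (normc_le_add _) _.
by rewrite -[complex.Re _]/(Ref (partials s f) x) -[complex.Im _]/(Imf (partials s f) x) h1 h2.
Qed.

Definition cX (j : nat) : (B5 R -> R[i]) -> B5 R -> R[i] := match j with
  | 1%N => @X1 R | 2%N => @X2 R | 3%N => @X3 R | 4%N => @X4 R | 5%N => @X5 R
  | _ => fun _ _ => 0 end.

Lemma cX_components j f : Ref (cX j f) = rX j (Ref f) /\ Imf (cX j f) = rX j (Imf f).
Proof.
case: j => [|[|[|[|[|[|j]]]]]] //.
- split; apply/funext => -[[[[x1 x2] x3] x4] x5]; rewrite /Ref /Imf /cX /X2 /partial /rX /rpart /crd /=.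
    by generalize_derive; ring.
  by generalize_derive; ring.
- split; apply/funext => -[[[[x1 x2] x3] x4] x5]; rewrite /Ref /Imf /cX /X3 /partial /rX /rpart /crd /=.
    by generalize_derive; ring.
  by generalize_derive; ring.
Qed.

Lemma laplacian_components f :
  Ref (neg_laplacian f) = rlap (Ref f) /\ Imf (neg_laplacian f) = rlap (Imf f).
Proof.
have H j : Ref (cX j (cX j f)) = rX j (rX j (Ref f)) /\ Imf (cX j (cX j f)) = rX j (rX j (Imf f)).
  have [h1 h2] := cX_components j (cX j f); have [k1 k2] := cX_components j f.
  by rewrite h1 h2 k1 k2.
have A (a b c d e : R[i]) : complex.Re (- (a + b + c + d + e)) = - (complex.Re a + complex.Re b
    + complex.Re c + complex.Re d + complex.Re e) /\
    complex.Im (- (a + b + c + d + e)) = - (complex.Im a + complex.Im b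
    + complex.Im c + complex.Im d + complex.Im e).
  by case: a b c d e => [? ?] [? ?] [? ?] [? ?] [? ?].
split; apply/funext => x; rewrite /rlap.
  have E j : rX j (rX j (Ref f)) x = complex.Re (cX j (cX j f) x) by have [<- _] := H j.
  rewrite (E 1%N) (E 2%N) (E 3%N) (E 4%N) (E 5%N).
  by have [+ _] := A (cX 1 (cX 1 f) x) (cX 2 (cX 2 f) x) (cX 3 (cX 3 f) x) (cX 4 (cX 4 f) x)
    (cX 5 (cX 5 f) x); apply.
have E j : rX j (rX j (Imf f)) x = complex.Im (cX j (cX j f) x) by have [_ <-] := H j.
rewrite (E 1%N) (E 2%N) (E 3%N) (E 4%N) (E 5%N).
by have [_] := A (cX 1 (cX 1 f) x) (cX 2 (cX 2 f) x) (cX 3 (cX 3 f) x) (cX 4 (cX 4 f) x)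
  (cX 5 (cX 5 f) x); apply.
Qed.

Lemma Re_laplacian f x : complex.Re (neg_laplacian f x) = rlap (Ref f) x.
Proof. exact: (congr1 (fun h => h x) (laplacian_components f).1). Qed.

Lemma Im_laplacian f x : complex.Im (neg_laplacian f x) = rlap (Imf f) x.
Proof. exact: (congr1 (fun h => h x) (laplacian_components f).2). Qed.

Opaque rX rlap neg_laplacian.

Lemma schwartz_L2 f : schwartz f -> inLp 2 f.
Proof. by move=> /schwartzP[h1 h2]; apply/inLp2P; split; exact: rschwartz_sq. Qed.

Lemma schwartz_laplacian f : schwartz f -> schwartz (neg_laplacian f).
Proof.
move=> /schwartzP[h1 h2]; apply/schwartzP; have [-> ->] := laplacian_components f.
by split; exact: rschwartz_lap.
Qed.

Lemma vip_vec f g : inLp 2 f -> inLp 2 g ->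
  vip R (vec f) (vec g) = l2dot haar (Ref f) (Ref g) + l2dot haar (Imf f) (Imf g).
Proof.
move=> Lf Lg; rewrite -Re_L2_inner !vecK// -{1}(vecK Lf) -{1}(vecK Lg) Re_L2_inner.
have E h : inLp 2 h -> (vec h).1 = Ref h :> (B5 R -> R) /\ (vec h).2 = Imf h :> (B5 R -> R).
  by move=> Lh; split; rewrite -[in RHS](vecK Lh).
have [f1 f2] := E _ Lf; have [g1 g2] := E _ Lg.
exact: (congr2 +%R (congr2 (l2dot haar) f1 g1) (congr2 (l2dot haar) f2 g2)).
Qed.

Definition energy f : R := renergy (Ref f) + renergy (Imf f).

Lemma vip_laplacian f : schwartz f -> vip R (vec (neg_laplacian f)) (vec f) = energy f.
Proof.
move=> Sf; have [S1 S2] := (schwartzP f).1 Sf.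
rewrite vip_vec; [|exact: schwartz_L2 (schwartz_laplacian Sf)|exact: schwartz_L2].
have e1 := l2dot_lap S1; have e2 := l2dot_lap S2.
have k1 := (laplacian_components f).1; have k2 := (laplacian_components f).2.
by rewrite /energy -e1 -e2 k1 k2.
Qed.

Lemma renergy_ge (j : nat) (h : B5 R -> R) : j \in indices ->
  l2dot haar (rX j h) (rX j h) <= renergy h.
Proof.
move=> jI; rewrite /renergy (bigD1_seq j)//= lerDl.
by apply: sumr_ge0 => i _; exact: l2dot_ge0.
Qed.

Lemma eq_ncvg (x y : nat -> V) l : x =1 y -> ncvg (vip R) x l -> ncvg (vip R) y l.
Proof. by move=> /funext ->. Qed.

Lemma ReB (a b : R[i]) : complex.Re (a - b) = complex.Re a - complex.Re b.
Proof. by case: a b => [? ?] [? ?]. Qed.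

Lemma ImB (a b : R[i]) : complex.Im (a - b) = complex.Im a - complex.Im b.
Proof. by case: a b => [? ?] [? ?]. Qed.

Section Composition.
Variable T : B5 R -> B5 R.
Hypothesis pT : preserves (@haar R) T.

Lemma square_integrable_comp (h : B5 R -> R) : square_integrable (@haar R) h ->
  square_integrable (@haar R) (fun x => h (T x)).
Proof.
move=> [mh fh]; split; first exact: (measurableT_comp mh pT.1).
by rewrite (haar_sqintegral_preserved pT mh).
Qed.

Lemma inLp_comp f : inLp 2 f -> inLp 2 (fun x => f (T x)).
Proof.
move=> Lf; have [h1 h2] := (inLp2P f).1 Lf; apply/inLp2P.
have k1 := square_integrable_comp (h := fun x => complex.Re (f x)) h1.
have k2 := square_integrable_comp (h := fun x => complex.Im (f x)) h2.
exact: (conj k1 k2).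
Qed.

Definition vcomp u : V := vec (fun x => cfun u (T x)).

Lemma cfun_vcomp u : cfun (vcomp u) = (fun x => cfun u (T x)).
Proof. exact: (vecK (inLp_comp (inLp_cfun u))). Qed.

Lemma vcomp_vec f : inLp 2 f -> vcomp (vec f) = vec (fun x => f (T x)).
Proof. by move=> Lf; rewrite /vcomp vecK. Qed.

Lemma vcompB u w : vcomp (u - w) = vcomp u - vcomp w.
Proof. by apply: cfun_inj; rewrite cfunB !cfun_vcomp cfunB. Qed.

Lemma vcompZ c u : vcomp (c *: u) = c *: vcomp u.
Proof. by apply: cfun_inj; rewrite cfunZ !cfun_vcomp cfunZ. Qed.

Lemma nsq_vcomp u : nsq (vip R) (vcomp u) = nsq (vip R) u.
Proof.
apply: EFin_inj; rewrite !nsq_normc cfun_vcomp.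
have [mr mi _] := inLp_cfun u.
exact: (haar_sqintegral_preserved pT (f := fun x => ComplexField.Normc.normc (cfun u x))
  (measurable_normc mr mi)).
Qed.

Lemma vcomp_cvg (x : nat -> V) l : ncvg (vip R) x l -> ncvg (vip R) (vcomp \o x) (vcomp l).
Proof.
by rewrite /ncvg; under eq_fun do rewrite -(nsq_vcomp (_ - _)) vcompB.
Qed.

Lemma vcomp_aeq f g : aeq f g -> aeq (fun x => f (T x)) (fun x => g (T x)).
Proof.
move=> [N [mN N0 sN]]; exists (T @^-1` N); split.
- by rewrite -(setTI (T @^-1` N)); exact: pT.1.
- have mTN : measurable (T @^-1` N) by rewrite -(setTI (T @^-1` N)); exact: pT.1.
  have H (A : set (B5 R)) : measurable A -> haar A = (\int[haar]_x (\1_A x)%:E)%E.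
    move=> mA.
    exact: (etrans (congr1 haar (esym (setIT A))) (esym (integral_indic haar measurableT mA))).
  rewrite H// -[RHS]N0 H//.
  apply: (haar_integral_preserved pT (f := fun x => (\1_N x)%:E)).
  by apply/measurable_EFinP; exact: measurable_indic.
- by move=> x /= h; exact: (sN (T x)).
Qed.

End Composition.

Lemma schwartz_left a f : schwartz f -> schwartz (fun x => f (cartan_mul a x)).
Proof.
move=> /schwartzP[h1 h2]; apply/schwartzP.
by split; [exact: (rschwartz_left a h1)|exact: (rschwartz_left a h2)].
Qed.

Lemma laplacian_left a f : schwartz f ->
  neg_laplacian (fun x => f (cartan_mul a x)) = (fun x => neg_laplacian f (cartan_mul a x)).
Proof.
move=> /schwartzP[h1 h2]; apply/funext => x; apply/eqP; rewrite eq_complex.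
rewrite (Re_laplacian f (cartan_mul a x)) (Im_laplacian f (cartan_mul a x)).
rewrite (Re_laplacian (fun x => f (cartan_mul a x)) x).
rewrite (Im_laplacian (fun x => f (cartan_mul a x)) x).
apply/andP; split; apply/eqP; [exact: (lap_left a x h1)|exact: (lap_left a x h2)].
Qed.

Lemma closureP (T : (B5 R -> R[i]) -> B5 R -> R[i]) u w :
  (forall f, schwartz f -> inLp 2 (T f)) ->
  schwartz_closure T (cfun u) (cfun w) <-> exists phi : nat -> B5 R -> R[i],
    [/\ forall n, schwartz (phi n), ncvg (vip R) (fun n => vec (phi n)) u
      & ncvg (vip R) (fun n => vec (T (phi n))) w].
Proof.
move=> LT; split=> [[_ _ [phi [Sp h1 h2]]]|[phi [Sp h1 h2]]].
  exists phi; split => //.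
    have /Lp_dist_vec : forall n, inLp 2 (phi n) by move=> n; exact: schwartz_L2.
    by move=> /(_ _ (inLp_cfun u))[/(_ h1)]; rewrite cfunK.
  have /Lp_dist_vec : forall n, inLp 2 (T (phi n)) by move=> n; exact: LT.
  by move=> /(_ _ (inLp_cfun w))[/(_ h2)]; rewrite cfunK.
split; [exact: inLp_cfun|exact: inLp_cfun|exists phi; split => //].
  have /Lp_dist_vec : forall n, inLp 2 (phi n) by move=> n; exact: schwartz_L2.
  by move=> /(_ _ (inLp_cfun u))[_]; apply; rewrite cfunK.
have /Lp_dist_vec : forall n, inLp 2 (T (phi n)) by move=> n; exact: LT.
by move=> /(_ _ (inLp_cfun w))[_]; apply; rewrite cfunK.
Qed.

Lemma laplace_opP u w : laplace_op (cfun u) (cfun w) <-> exists phi : nat -> B5 R -> R[i],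
    [/\ forall n, schwartz (phi n), ncvg (vip R) (fun n => vec (phi n)) u
      & ncvg (vip R) (fun n => vec (neg_laplacian (phi n))) w].
Proof. by apply: closureP => f Sf; exact: schwartz_L2 (schwartz_laplacian Sf). Qed.

Lemma laplace_op_left a u w : laplace_op (cfun u) (cfun w) ->
  laplace_op (cfun (vcomp (cartan_mul a) u)) (cfun (vcomp (cartan_mul a) w)).
Proof.
have pT := haar_left a.
move=> /laplace_opP[phi [Sp h1 h2]]; apply/laplace_opP.
exists (fun n x => phi n (cartan_mul a x)); split.
- by move=> n; exact: schwartz_left.
- apply: (eq_ncvg _ (vcomp_cvg pT h1)) => n.
  exact: (vcomp_vec _ (schwartz_L2 (Sp n))).
- apply: (eq_ncvg _ (vcomp_cvg pT h2)) => n; rewrite (laplacian_left a (Sp n)).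
  exact: (vcomp_vec _ (schwartz_L2 (schwartz_laplacian (Sp n)))).
Qed.

Definition in_box (r : R) y := [/\ 0 <= y.1.1.1.1 <= r, 0 <= y.1.1.1.2 <= r,
  0 <= y.1.1.2 <= r, 0 <= y.1.2 <= r & 0 <= y.2 <= r].

(** Both sides are continuous along a sequence of Schwartz functions converging in the graph norm,
    where <a, u> is the limit of the energies. Both the box estimate and the estimate along a single
    flow reach the domain of the closure in this way. *)
Lemma increment_laplace (c : R) y u (a : V) :
  (forall f : B5 R -> R, rschwartz f ->
    (sqintegral haar (fun x => (f (cartan_mul x y) - f x)%R) <= (c * renergy f)%:E)%E) ->
  laplace_op (cfun u) (cfun a) ->
  nsq (vip R) (vcomp (fun x => cartan_mul x y) u - u) <= c * vip R a u.
Proof.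
have pT := haar_right y.
move=> hy /laplace_opP[phi [Sp h1 h2]].
have N n : nsq (vip R) (vcomp (fun x => cartan_mul x y) (vec (phi n)) - vec (phi n)) <=
    c * vip R (vec (neg_laplacian (phi n))) (vec (phi n)).
  have [S1 S2] := (schwartzP (phi n)).1 (Sp n); have L := schwartz_L2 (Sp n).
  have Ln := inLp_comp pT L.
  rewrite (vip_laplacian (Sp n)) (vcomp_vec _ L) /energy mulrDr.
  have [[m1 _] [m2 _]] := (inLp2P _).1 (inLp_cfun (vec (fun x => phi n (cartan_mul x y)) - vec (phi n))).
  rewrite -lee_fin nsq_normc (sqintegral_normc m1 m2) cfunB (vecK Ln) (vecK L) EFinD.
  have -> : (fun x => complex.Re (phi n (cartan_mul x y) - phi n x)) =
      (fun x => Ref (phi n) (cartan_mul x y) - Ref (phi n) x) by apply/funext => x; exact: ReB.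
  have -> : (fun x => complex.Im (phi n (cartan_mul x y) - phi n x)) =
      (fun x => Imf (phi n) (cartan_mul x y) - Imf (phi n) x) by apply/funext => x; exact: ImB.
  exact: (leeD (hy _ S1) (hy _ S2)).
have l1 : nsq (vip R) (vcomp (fun x => cartan_mul x y) (vec (phi n)) - vec (phi n)) @[n --> \oo]
    --> nsq (vip R) (vcomp (fun x => cartan_mul x y) u - u).
  apply: ncvg_nsq; have := ncvgD (vcomp_cvg pT h1) (ncvgZ (-1) h1).
  by rewrite scaleN1r; apply: eq_ncvg => n; rewrite scaleN1r.
have l2 : c * vip R (vec (neg_laplacian (phi n))) (vec (phi n)) @[n --> \oo]
    --> c * vip R a u.
  by apply: cvgM; [exact: cvg_cst|exact: ncvg_ip].
by apply: (ler_cvg_to l1 l2); exact: nearW.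
Qed.

Lemma nash_laplace (r : R) y u (a : V) : in_box r y -> laplace_op (cfun u) (cfun a) ->
  nsq (vip R) (vcomp (fun x => cartan_mul x y) u - u) <= 5 * r ^+ 2 * vip R a u.
Proof. by move=> hy; apply: increment_laplace => f Sf; exact: nash_schwartz. Qed.

Lemma increment_flow j (t : R) u (a : V) : j \in indices -> 0 <= t ->
  laplace_op (cfun u) (cfun a) ->
  nsq (vip R) (vcomp (flow j t) u - u) <= t ^+ 2 * vip R a u.
Proof.
move=> jI t0; apply: (increment_laplace (y := t *: basis_vec R j)) => f Sf.
apply: le_trans (flow_nash t0 (flow_diffX j (rschwartz_C1 Sf)) (rschwartz_continuous Sf)
  (rschwartz_continuous (rschwartz_X j Sf))) _.
rewrite -(l2dotE (rschwartz_sq (rschwartz_X j Sf))) -EFinM lee_fin.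
by apply: ler_wpM2l; [exact: sqr_ge0|exact: renergy_ge].
Qed.

End ComplexSchwartz.

(** * The Plancherel theorem *)

Section Fubini.
Context d1 d2 (T1 : measurableType d1) (T2 : measurableType d2) (R : realType).
Variables (m1 : {sigma_finite_measure set T1 -> \bar R})
  (m2 : {sigma_finite_measure set T2 -> \bar R}).

Lemma measurable_Rintegral (f : T1 * T2 -> R) : measurable_fun setT f ->
  measurable_fun setT (fun x => \int[m2]_y f (x, y)).
Proof.
move=> mf; have mE : measurable_fun setT (EFin \o f) by exact/measurable_EFinP.
have mp : measurable_fun setT (EFin \o f)^\+%E by exact: measurable_funepos.
have mn : measurable_fun setT (EFin \o f)^\-%E by exact: measurable_funeneg.
have Mp := measurable_fun_fubini_tonelli_F (m2 := m2) _ mp (funepos_ge0 _).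
have Mn := measurable_fun_fubini_tonelli_F (m2 := m2) _ mn (funeneg_ge0 _).
apply: (measurableT_comp (f := fine)) => //.
rewrite (_ : (fun x => _) = (fubini_F m2 (EFin \o f)^\+ \- fubini_F m2 (EFin \o f)^\-)%E).
  exact: emeasurable_funB.
apply/funext => x; rewrite [LHS]integralE /fubini_F.
by congr (_ - _)%E; apply: eq_integral => y _; rewrite !unlock.
Qed.

Lemma Rintegral_fubini (f : T1 * T2 -> R) :
  (m1 \x m2)%E.-integrable setT (EFin \o f) ->
  (forall x, m2.-integrable setT (fun y => (f (x, y))%:E)) ->
  (forall y, m1.-integrable setT (fun x => (f (x, y))%:E)) ->
  \int[m1]_x \int[m2]_y f (x, y) = \int[m2]_y \int[m1]_x f (x, y).
Proof.
move=> fi f2 f1; rewrite /Rintegral; congr fine; have := Fubini fi.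
have E1 x : (fine (\int[m2]_y (f (x, y))%:E))%:E = (\int[m2]_y (f (x, y))%:E)%E.
  by rewrite fineK//; exact: integrable_fin_num.
have E2 y : (fine (\int[m1]_x (f (x, y))%:E))%:E = (\int[m1]_x (f (x, y))%:E)%E.
  by rewrite fineK//; exact: integrable_fin_num.
move=> H; under eq_integral do rewrite E1.
by under [RHS]eq_integral do rewrite E2.
Qed.

Lemma Rintegral_product (f : T1 * T2 -> R) :
  (m1 \x m2)%E.-integrable setT (EFin \o f) ->
  (forall x, m2.-integrable setT (fun y => (f (x, y))%:E)) ->
  \int[(m1 \x m2)%E]_z f z = \int[m1]_x \int[m2]_y f (x, y).
Proof.
move=> fi f2; rewrite /Rintegral; congr fine; rewrite -(integral12_prod_meas1 fi).
by apply: eq_integral => x _; rewrite fineK//; exact: integrable_fin_num.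
Qed.

Lemma integrable_tensor (f : T1 * T2 -> R) (u : T1 -> R) (v : T2 -> R) :
  measurable_fun setT f -> m1.-integrable setT (EFin \o u) -> m2.-integrable setT (EFin \o v) ->
  (forall z, `|f z| <= u z.1 * v z.2) -> (forall x, 0 <= u x) -> (forall y, 0 <= v y) ->
  (m1 \x m2)%E.-integrable setT (EFin \o f).
Proof.
move=> mf iu iv fuv u0 v0.
have /integrableP[/measurable_EFinP mu fu] := iu.
have /integrableP[/measurable_EFinP mv fv] := iv.
apply/integrable12ltyP; first exact/measurable_EFinP.
have mf2 x : measurable_fun setT (fun y => f (x, y)).
  exact: (measurable_fun_pair2 (f := f)).
apply: le_lt_trans (_ : (\int[m1]_x ((u x)%:E * \int[m2]_y (v y)%:E) < +oo)%E).
  apply: ge0_le_integral => //.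
  - by move=> x _; apply: integral_ge0 => y _.
  - have := measurable_fun_fubini_tonelli_F (m2 := m2) (fun z => `|(f z)%:E|%E).
    by apply; [apply: measurableT_comp => //; exact/measurable_EFinP|].
  - apply: emeasurable_funM; [exact/measurable_EFinP|exact: measurable_cst].
  - move=> x _; rewrite -ge0_integralZl//.
    + apply: ge0_le_integral => //.
      * apply: measurableT_comp => //; exact/measurable_EFinP.
      * by apply: measurable_funeM; exact/measurable_EFinP.
      * by move=> y _; rewrite lee_fin.
    + exact/measurable_EFinP.
    + by move=> y _; rewrite lee_fin.
    + by rewrite lee_fin.
have Fv : (\int[m2]_y (v y)%:E)%E \is a fin_num by exact: integrable_fin_num.
have Fu : (\int[m1]_y (u y)%:E)%E \is a fin_num by exact: integrable_fin_num.
rewrite -(fineK Fv) ge0_integralZr//.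
- by rewrite -(fineK Fu) -EFinM ltry.
- exact/measurable_EFinP.
- by move=> x _; rewrite lee_fin.
- by rewrite lee_fin fine_ge0// integral_ge0// => y _; rewrite lee_fin.
Qed.

End Fubini.

Lemma Rintegral_dominated d (T : measurableType d) (R : realType)
    (m : {measure set T -> \bar R}) (F : nat -> T -> R) (f g : T -> R) :
  (forall n, measurable_fun setT (F n)) -> measurable_fun setT f ->
  m.-integrable setT (EFin \o g) -> (forall x, F n x @[n --> \oo] --> f x) ->
  (forall n x, `|F n x| <= g x) ->
  \int[m]_x F n x @[n --> \oo] --> \int[m]_x f x.
Proof.
move=> mF mf gi Ff Fg.
have [i0 _ h] := @dominated_convergence _ _ _ m setT measurableT (fun n => EFin \o F n)
  (EFin \o f) (EFin \o g) (fun n => proj2 (measurable_EFinP _ _) (mF n))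
  (proj2 (measurable_EFinP _ _) mf)
  (aeW _ (fun x _ => cvg_EFin (nearW _ (fun n => isT : (F n x)%:E \is a fin_num)) (Ff x))) gi
  (aeW _ (fun x n _ => Fg n x)).
have fin := integrable_fin_num measurableT i0.
by apply: fine_cvg; rewrite fineK.
Qed.

(** * Parseval's identity on the line *)

Section Parseval.
Variable R : realType.
Notation leb := (@lebesgue_measure R).
Implicit Types f g : R -> R.

Lemma lebesgue_scaling (a : R) (F : R -> \bar R) : 0 < a -> measurable_fun setT F ->
  (forall x, 0 <= F x)%E ->
  (\int[leb]_x F x = a%:E * \int[leb]_x F (a * x)%R)%E.
Proof.
move=> a0 mF F0.
have mp : measurable_fun setT ((fun s => a * s) : measurableTypeR R -> measurableTypeR R).
  by apply: measurable_funM => //; exact: measurable_id.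
pose mu := [the {measure set (measurableTypeR R) -> \bar R} of
  pushforward leb ((fun s => a * s) : measurableTypeR R -> measurableTypeR R)].
have mu' := mu mp.
pose k : {nonneg R} := NngNum (ltW a0).
pose nu := [the {measure set (measurableTypeR R) -> \bar R} of mscale k (mu mp)].
have muE : forall A : set (measurableTypeR R), measurable A -> leb A = nu A.
  move=> A mA; apply: lebesgue_measure_unique => // _ [[x y] /= xy <-].
  rewrite /mscale/= /pushforward.
  rewrite (_ : _ @^-1` _ = `]x / a, y / a]%classic); last first.
    by apply/seteqP; split => s /=; rewrite !in_itv/= ltr_pdivrMr// ler_pdivlMr// mulrC.
  rewrite !lebesgue_measure_itv/= !lte_fin ltr_pM2r ?invr_gt0//; case: ifPn => _; last by rewrite mule0.
  by rewrite -!EFinB -EFinM; congr (_%:E); rewrite -mulrBl mulrCA divff ?mulr1// gt_eqF.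
have h := ge0_integral_pushforward mp leb measurableT mF (fun y _ => F0 y).
rewrite preimage_setT in h.
rewrite -[X in (_ * X)%E]/(\int[leb]_x (F \o (fun s : R => (a * s)%R)) x)%E.
rewrite -h -[a%:E]/(k%:num%:E) -ge0_integral_mscale//.
by apply: eq_measure_integral => A mA _; exact: muE.
Qed.

(** Boundedness and integrability give square integrability and dominate the autocorrelation;
    continuity gives the limit of the latter at 0. *)
Definition nice f := [/\ continuous f, exists M : R, forall x, `|f x| <= M
  & leb.-integrable setT (EFin \o f)].

Lemma nice_measurable f : nice f -> measurable_fun setT f.
Proof. by move=> [cf _ _]; exact: continuous_measurable_fun. Qed.

Lemma integrable_bounded_mul f (h : R -> R) (N : R) : leb.-integrable setT (EFin \o f) ->
  measurable_fun setT f -> measurable_fun setT h -> (forall x, `|h x| <= N) ->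
  leb.-integrable setT (EFin \o (fun x => f x * h x)).
Proof.
move=> fi mf mh hN.
have ia : leb.-integrable setT (EFin \o (fun x => N * `|f x|)).
  by apply: integrable_scale; exact: (integrable_norm fi).
apply: (@integrable_le _ _ R leb (fun x => f x * h x) _ (measurable_funM mf mh) ia) => x.
by rewrite normrM mulrC; apply: ler_wpM2r.
Qed.

Definition Ct f (l : R) : R := \int[leb]_x (f x * cos (l * x)).
Definition St f (l : R) : R := \int[leb]_x (f x * sin (l * x)).

Definition autocorrelation f (u : R) : R := \int[leb]_y (f y * f (y + u)).

Lemma measurable_shift f : measurable_fun setT f ->
  measurable_fun setT (fun z : measurableTypeR R * measurableTypeR R => f z.2 * f (z.2 + z.1)).
Proof.
move=> mf; apply: measurable_funM; first exact: measurableT_comp mf measurable_snd.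
by apply: (measurableT_comp mf); measurable_tac.
Qed.

Lemma measurable_autocorrelation f : nice f -> measurable_fun setT (autocorrelation f).
Proof.
move=> /nice_measurable/measurable_shift h.
exact: (@measurable_Rintegral _ _ (measurableTypeR R) (measurableTypeR R) R leb _ h).
Qed.

Lemma integrable_shift f (u : R) : leb.-integrable setT (EFin \o f) ->
  leb.-integrable setT (EFin \o (fun y => f (y + u))).
Proof. exact: (preserves_integrable (lebesgue_translation u)). Qed.

Lemma integrable_autocorrelation2 f (h : R -> R) (N : R) : nice f -> measurable_fun setT h ->
  (forall x, `|h x| <= N) ->
  (leb \x leb)%E.-integrable setT
    (EFin \o (fun z : R * R => f z.2 * f (z.2 + z.1) * h z.1)).
Proof.
move=> nf mh hN; have mf := nice_measurable nf; have [cf [M fM] fi] := nf.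
have mF : measurable_fun setT (fun z : R * R => f z.2 * f (z.2 + z.1) * h z.1).
  by apply: measurable_funM; [exact: measurable_shift|exact: measurableT_comp mh measurable_fst].
have fia := integrable_norm fi.
apply/integrable21ltyP; first exact/measurable_EFinP.
have N0 : 0 <= N by exact: le_trans (normr_ge0 _) (hN 0).
have K0 : (0 <= \int[leb]_x (`|f x|)%:E)%E by apply: integral_ge0 => x _; rewrite lee_fin.
apply: le_lt_trans (_ : (\int[leb]_y ((N * `|f y|)%:E * \int[leb]_x (`|f x|)%:E) < +oo)%E).
  apply: ge0_le_integral => //.
  - by move=> y _; apply: integral_ge0.
  - have := measurable_fun_fubini_tonelli_G (m1 := leb) (fun z : measurableTypeR R * measurableTypeR R =>
       `|(f z.2 * f (z.2 + z.1) * h z.1)%:E|%E).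
    by apply; [apply: measurableT_comp => //; exact/measurable_EFinP|].
  - apply: emeasurable_funM; last exact: measurable_cst.
    by apply/measurable_EFinP; apply: measurable_funM => //; exact: measurableT_comp.
  - move=> y _.
    have mfa : measurable_fun setT (fun x => (`|f x|)%:E).
      by apply/measurable_EFinP; exact: measurableT_comp.
    have -> : (\int[leb]_x (`|f x|)%:E = \int[leb]_x (`|f (y + x)|)%:E)%E.
      have [_ H] := lebesgue_translation y; rewrite -(H _ mfa)//.
      by apply: eq_integral => x _; rewrite addrC.
    have mfy : measurable_fun setT (fun x => (`|f (y + x)|)%:E).
      apply/measurable_EFinP; apply: measurableT_comp => //; apply: (measurableT_comp mf).
      exact: (measurable_funD (measurable_cst y) (@measurable_id _ _ _)).
    rewrite -ge0_integralZl//; last by rewrite lee_fin mulr_ge0.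
    apply: ge0_le_integral => //.
    + apply: measurableT_comp => //; apply/measurable_EFinP.
      exact: (measurable_fun_pair1 (f := fun z : R * R => f z.2 * f (z.2 + z.1) * h z.1)).
    + exact: measurable_funeM.
    + move=> x _; rewrite -EFinM lee_fin !normrM.
      rewrite /= mulrC -mulrA.
      by apply: ler_wpM2r; [rewrite mulr_ge0|exact: hN].
have FK : (\int[leb]_x (`|f x|)%:E)%E \is a fin_num by exact: integrable_fin_num.
rewrite -(fineK FK) ge0_integralZr//.
- have FN : (\int[leb]_x (N * `|f x|)%:E)%E \is a fin_num.
    by apply: integrable_fin_num => //; exact: (integrable_scale N fia).
  by rewrite -(fineK FN) -EFinM ltry.
- by apply/measurable_EFinP; apply: measurable_funM => //; exact: measurableT_comp.
- by move=> x _; rewrite lee_fin mulr_ge0.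
- by rewrite lee_fin fine_ge0.
Qed.

Lemma cos_bound (x : R) : `|cos x| <= 1.
Proof. by rewrite ler_norml cos_geN1 cos_le1. Qed.

Lemma sin_bound (x : R) : `|sin x| <= 1.
Proof. by rewrite ler_norml sin_geN1 sin_le1. Qed.

Lemma continuous_cosr (u : R) : continuous (fun x : R => cos (x * u)).
Proof.
by move=> x; apply: continuous_comp; [exact: mulrr_continuous|exact: continuous_cos].
Qed.

Lemma measurable_cosl (l : R) : measurable_fun setT (fun x => cos (l * x)).
Proof.
apply: continuous_measurable_fun => x; apply: (continuous_comp (f := fun x => l * x)).
  exact: mulrl_continuous.
exact: continuous_cos.
Qed.

Lemma measurable_sinl (l : R) : measurable_fun setT (fun x => sin (l * x)).
Proof.
apply: continuous_measurable_fun => x; apply: (continuous_comp (f := fun x => l * x)).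
  exact: mulrl_continuous.
exact: continuous_sin.
Qed.

Lemma integrable_cosl f (l : R) : nice f -> leb.-integrable setT (EFin \o (fun x => f x * cos (l * x))).
Proof.
move=> nf; have [_ _ fi] := nf.
exact: (integrable_bounded_mul fi (nice_measurable nf) (measurable_cosl l) (fun x => cos_bound _)).
Qed.

Lemma integrable_sinl f (l : R) : nice f -> leb.-integrable setT (EFin \o (fun x => f x * sin (l * x))).
Proof.
move=> nf; have [_ _ fi] := nf.
exact: (integrable_bounded_mul fi (nice_measurable nf) (measurable_sinl l) (fun x => sin_bound _)).
Qed.

Lemma Rintegral_translation f (a : R) : measurable_fun setT f ->
  \int[leb]_x f (x + a) = \int[leb]_x f x.
Proof.
move=> /measurable_EFinP mf; rewrite /Rintegral; congr fine.
exact: (preserves_integral (lebesgue_translation a) mf).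
Qed.

(** Wiener-Khinchin: the two squares, written as double integrals, combine through the addition
    formula for cos (l (x - y)), and x = y + u brings in the autocorrelation. *)
Lemma square_spectrum f (l : R) : nice f ->
  Ct f l ^+ 2 + St f l ^+ 2 = \int[leb]_u (autocorrelation f u * cos (l * u)).
Proof.
move=> nf; have mf := nice_measurable nf; have [_ [M fM] fi] := nf.
have ic := integrable_cosl l nf; have is' := integrable_sinl l nf.
have mc := measurable_cosl l.
have E1 y : f y * cos (l * y) * Ct f l + f y * sin (l * y) * St f l =
    \int[leb]_u (f y * f (y + u) * cos (l * u)).
  rewrite /Ct /St -!RintegralZl//.
  rewrite -RintegralD//; [|exact: integrable_scale ic|exact: integrable_scale is'].
  have m0 : measurable_fun setT (fun x => f y * f x * cos (l * (x - y))).
    apply: measurable_funM; first exact: measurable_funM.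
    by apply: (measurableT_comp mc); exact: (measurable_funB (@measurable_id _ _ _) (measurable_cst y)).
  have := Rintegral_translation y m0.
  rewrite (_ : \int[leb]_x (f y * f (x + y) * cos (l * (x + y - y))) =
    \int[leb]_u (f y * f (y + u) * cos (l * u))); last first.
    by apply: eq_Rintegral => x _; rewrite addrK (addrC x).
  by move=> ->; apply: eq_Rintegral => x _; rewrite mulrBr cosB; ring.
have i2 := integrable_autocorrelation2 nf mc (fun x => cos_bound (l * x)).
have i1 y : leb.-integrable setT (EFin \o (fun u => f y * f (y + u) * cos (l * u))).
  have h := integrable_scale (f y) (integrable_shift y fi).
  have h' : leb.-integrable setT (EFin \o (fun u => f y * f (y + u))).
    have -> // : (fun u => f y * f (y + u)) = (fun u => f y * f (u + y)).
    by apply/funext => x; rewrite addrC.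
  apply: (integrable_bounded_mul h' _ mc (fun x => cos_bound _)).
  by apply: measurable_funM => //; apply: (measurableT_comp mf);
    exact: (measurable_funD (measurable_cst y) (@measurable_id _ _ _)).
have j1 u : leb.-integrable setT (EFin \o (fun y => f y * f (y + u))).
  by apply: (integrable_bounded_mul fi mf _ (fun x => fM _)); apply: (measurableT_comp mf);
    exact: (measurable_funD (@measurable_id _ _ _) (measurable_cst u)).
have j2 u : leb.-integrable setT (EFin \o (fun y => f y * f (y + u) * cos (l * u))).
  have -> : (fun y => f y * f (y + u) * cos (l * u)) = (fun y => cos (l * u) * (f y * f (y + u))).
    by apply/funext => y; rewrite mulrC.
  exact: integrable_scale.
have := Rintegral_fubini i2 j2 i1.
move=> H; transitivity (\int[leb]_y \int[leb]_u (f y * f (y + u) * cos (l * u))); last first.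
  rewrite -H; apply: eq_Rintegral => u _; rewrite /autocorrelation -RintegralZr//.
under [RHS]eq_Rintegral do rewrite -E1.
rewrite RintegralD; [|exact: measurableT| |]; last 2 first.
- by have := integrable_scale (Ct f l) ic; under eq_fun do rewrite mulrC.
- by have := integrable_scale (St f l) is'; under eq_fun do rewrite mulrC.
by rewrite !RintegralZr// !expr2.
Qed.

(** Abel damping in frequency, chosen because its cosine transform is elementary: the Cauchy
    kernel. *)
Definition poisson (e l : R) := expR (- (e * `|l|)).

Lemma measurable_poisson e : measurable_fun setT (poisson e).
Proof.
apply: measurableT_comp => //; apply: measurable_fun_opp; exact: measurable_funM.
Qed.

Lemma continuous_damped (e u : R) :
  continuous (fun x : R => expR (- (e * x)) * (1 + cos (x * u))).
Proof.
move=> x; apply: cvgM.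
  apply: (continuous_comp (f := fun x => - (e * x))); last exact: continuous_expR.
  by apply: cvgN; exact: mulrl_continuous.
by apply: cvgD; [exact: cvg_cst|exact: (@continuous_cosr u x)].
Qed.

(** Replacing cos by 1 + cos makes the integrand nonnegative, so that the fundamental theorem on a
    half-line applies to an explicit antiderivative. The added 1 is subtracted again in
    [poisson_cos]. *)
Lemma poisson_half (e u : R) : 0 < e ->
  (\int[leb]_(l in `[0%R, +oo[) (expR (- (e * l)) * (1 + cos (l * u)))%:E =
   (e^-1 + e / (e ^+ 2 + u ^+ 2))%:E)%E.
Proof.
move=> e0; have D0 : 0 < e ^+ 2 + u ^+ 2 by rewrite ltr_pwDl ?sqr_ge0// exprn_gt0.
pose F (l : R) := expR (- (e * l)) * ((u * sin (l * u) - e * cos (l * u)) / (e ^+ 2 + u ^+ 2) - e^-1).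
have dF (l : R) : is_derive l 1 F (expR (- (e * l)) * (1 + cos (l * u))).
  have d1 : is_derive l 1 (fun x : R => - (e * x)) (- e).
    have -> : - e = - e + 2 * 0 * l by rewrite mulr0 mul0r addr0.
    by apply: (@quad_derive R _ l 0 (- e) 0) => s; ring.
  have d2 : is_derive l 1 (fun x : R => x * u) u.
    have -> : u = u + 2 * 0 * l by rewrite mulr0 mul0r addr0.
    by apply: (@quad_derive R _ l 0 u 0) => s; ring.
  have d3 := is_derive1_comp (f := expR) (g := fun x : R => - (e * x)) (is_derive_expR (- (e * l))) d1.
  have d4 := is_derive1_comp (f := cos) (g := fun x : R => x * u) (is_derive_cos (l * u)) d2.
  have d5 := is_derive1_comp (f := sin) (g := fun x : R => x * u) (is_derive_sin (l * u)) d2.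
  have d6 : is_derive l 1 (fun x : R => (u * sin (x * u) - e * cos (x * u)) / (e ^+ 2 + u ^+ 2) - e^-1)
     ((u * (cos (l * u) * u) + e * (sin (l * u) * u)) / (e ^+ 2 + u ^+ 2)).
    have h1 := is_deriveZ (u / (e ^+ 2 + u ^+ 2)) d5.
    have h2 := is_deriveZ (- e / (e ^+ 2 + u ^+ 2)) d4.
    have h3 := is_deriveD (is_deriveD h1 h2) (is_derive_cst (- e^-1) l 1).
    apply: is_derive_eq_fun (is_derive_eq h3 _) => [x|].
      change (u / (e ^+ 2 + u ^+ 2) * sin (x * u) + (- e / (e ^+ 2 + u ^+ 2)) * cos (x * u) + - e^-1 =
        (u * sin (x * u) - e * cos (x * u)) / (e ^+ 2 + u ^+ 2) - e^-1); ring.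
    by rewrite /GRing.scale /=; ring.
  apply: is_derive_eq (is_deriveM d3 d6) _.
  by rewrite /GRing.scale /=; field; rewrite !gt_eqF.
have F0 : F 0 = - (e^-1 + e / (e ^+ 2 + u ^+ 2)).
  by rewrite /F mulr0 oppr0 expR0 mul0r sin0 cos0; ring.
have bF l : `|F l| <= ((`|u| + e) / (e ^+ 2 + u ^+ 2) + e^-1) * expR (- (e * l)).
  rewrite /F normrM mulrC [ `|expR _|]ger0_norm ?expR_ge0//; apply: ler_wpM2r; first exact: expR_ge0.
  apply: le_trans (ler_normB _ _) _; apply: lerD; last by rewrite ger0_norm// invr_ge0 ltW.
  rewrite normrM [ `|_^-1|]ger0_norm ?invr_ge0 ?(ltW D0)//; apply: ler_wpM2r; first by rewrite invr_ge0 ltW.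
  apply: le_trans (ler_normB _ _) _; rewrite !normrM (gtr0_norm e0).
  by apply: lerD; [rewrite -[leRHS]mulr1|rewrite -[leRHS]mulr1]; apply: ler_wpM2l => //;
    rewrite ?sin_bound ?cos_bound// ltW.
have Fy : F l @[l --> +oo] --> 0.
  have E0 : ((`|u| + e) / (e ^+ 2 + u ^+ 2) + e^-1) * expR (- (e * l)) @[l --> +oo] --> 0.
    rewrite -[X in _ --> X](mulr0 ((`|u| + e) / (e ^+ 2 + u ^+ 2) + e^-1)).
    apply: cvgM; first exact: cvg_cst.
    apply: (cvg_comp (fun l : R => e * l) (fun x : R => expR (- x)) _ (@cvgr_expR R)).
    by apply: gt0_cvgMry => //; exact: cvg_id.
  apply/norm_cvg0P; apply: (squeeze_cvgr _ (cvg_cst 0) E0).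
  by apply: nearW => l; rewrite normr_ge0 bF.
rewrite (@ge0_continuous_FTC2y _ _ F 0 0) ?F0 ?sub0e ?opprK//.
- by rewrite -EFinN opprK.
- exact/continuous_subspaceT/continuous_damped.
- rewrite -F0; apply: cvg_at_right_filter; apply: differentiable_continuous; apply/derivable1_diffP.
  by have [] := dF 0.
- by move=> x _; rewrite derive1E; have [_ ->] := dF x.
Qed.

Lemma continuous_poisson (e u : R) : continuous (fun x : R => poisson e x * (1 + cos (x * u))).
Proof.
move=> x; apply: cvgM.
  apply: (continuous_comp (f := fun x => - (e * `|x|))); last exact: continuous_expR.
  by apply: cvgN; apply: cvgM; [exact: cvg_cst|exact: norm_continuous].
by apply: cvgD; [exact: cvg_cst|exact: (@continuous_cosr u x)].
Qed.

Lemma poisson_full (e u : R) : 0 < e ->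
  (\int[leb]_l (poisson e l * (1 + cos (l * u)))%:E =
   (2 * (e^-1 + e / (e ^+ 2 + u ^+ 2)))%:E)%E.
Proof.
move=> e0; rewrite ge0_symfun_integralT.
- have := poisson_half u e0; rewrite EFinM => <-; congr (_ * _)%E.
  rewrite (_ : [set x | _] = `[0, +oo[%classic); last first.
    by apply/seteqP; split => x/=; rewrite in_itv/= andbT.
  apply: eq_integral => x; rewrite inE /= in_itv/= andbT => x0.
  by rewrite /poisson ger0_norm.
- by move=> x; rewrite mulr_ge0 ?expR_ge0// -lerBlDl sub0r cos_geN1.
- exact: continuous_poisson.
- by move=> x /=; rewrite /poisson normrN mulNr cosN.
Qed.

Lemma poisson_integrable (e : R) : 0 < e -> leb.-integrable setT (EFin \o poisson e).
Proof.
move=> e0; apply/integrableP; split; first by apply/measurable_EFinP; exact: measurable_poisson.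
have := poisson_full 0 e0.
under eq_integral do rewrite mulr0 cos0.
move=> h; apply: le_lt_trans (ltry (2 * (e^-1 + e / (e ^+ 2 + 0 ^+ 2)))); rewrite -h.
apply: ge0_le_integral => //.
- by apply: measurableT_comp => //; apply/measurable_EFinP; exact: measurable_poisson.
- by apply/measurable_EFinP; apply: measurable_funM => //; exact: measurable_poisson.
- move=> x _; rewrite lee_fin ger0_norm ?expR_ge0// ler_peMr ?expR_ge0//.
  by rewrite lerDl.
Qed.

Lemma poisson_cos (e u : R) : 0 < e ->
  \int[leb]_l (poisson e l * cos (l * u)) = 2 * (e / (e ^+ 2 + u ^+ 2)).
Proof.
move=> e0; have ip := poisson_integrable e0; have mp := measurable_poisson e.
have ic : leb.-integrable setT (EFin \o (fun l => poisson e l * cos (l * u))).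
  apply: (integrable_bounded_mul ip mp _ (fun x => cos_bound _)).
  by have := measurable_cosl u; under eq_fun do rewrite mulrC.
have h0 : \int[leb]_l (poisson e l * (1 + cos (l * u))) = 2 * (e^-1 + e / (e ^+ 2 + u ^+ 2)).
  by rewrite /Rintegral poisson_full.
(* At u = 0 the integrand of [poisson_full] is twice the damping factor. *)
have h1 : \int[leb]_l (poisson e l) = 2 * e^-1.
  have : \int[leb]_l (poisson e l * (1 + cos (l * 0))) = 2 * (e^-1 + e / (e ^+ 2 + 0 ^+ 2)).
    by rewrite /Rintegral poisson_full.
  under eq_Rintegral do rewrite mulr0 cos0.
  rewrite RintegralZr// => h; have n2 : (1 + 1 : R) != 0 by rewrite -[1 + 1]/(2%:R) pnatr_eq0.
  by apply: (mulIf n2); rewrite h; field; rewrite gt_eqF.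
move: h0; rewrite (_ : \int[leb]_l _ = \int[leb]_l (poisson e l) + \int[leb]_l (poisson e l * cos (l * u))).
  by rewrite h1 mulrDr => /addrI.
by rewrite -RintegralD//; apply: eq_Rintegral => l _; rewrite mulrDr mulr1.
Qed.

Lemma oneDsqrV_integrable : leb.-integrable setT (EFin \o (fun s : R => (oneDsqr s)^-1)).
Proof.
apply/integrableP; split; first by apply/measurable_EFinP; exact: measurable_oneDsqrV.
apply: le_lt_trans (ltry pi); rewrite -oneDsqr_fin; apply: ge0_le_integral => //.
- by apply: measurableT_comp => //; apply/measurable_EFinP; exact: measurable_oneDsqrV.
- by apply/measurable_EFinP; exact: measurable_oneDsqrV.
- by move=> x _; rewrite lee_fin ger0_norm// oneDsqrV_ge0.
Qed.

Lemma Rintegral_scaling (a : R) f : 0 < a -> leb.-integrable setT (EFin \o f) ->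
  \int[leb]_x f x = a * \int[leb]_x f (a * x).
Proof.
move=> a0 fi; have /integrableP[mf _] := fi.
have mp := measurable_funepos mf; have mn := measurable_funeneg mf.
have Ep := lebesgue_scaling a0 mp (funepos_ge0 _).
have En := lebesgue_scaling a0 mn (funeneg_ge0 _).
have Fp := integrable_pos_fin_num measurableT fi.
have Fn := integrable_neg_fin_num measurableT fi.
have F1 (x : \bar R) : (a%:E * x)%E \is a fin_num -> x \is a fin_num.
  have aE : (0 < a%:E)%E by rewrite lte_fin.
  by case: x => [r//||]; rewrite ?gt0_muley ?gt0_muleNy.
rewrite /Rintegral integralE Ep En [in RHS]integralE.
set P := (\int[leb]_x (EFin \o f)^\+ (a * x)%R)%E.
set N := (\int[leb]_x (EFin \o f)^\- (a * x)%R)%E.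
have -> : (\int[leb]_x (fun x => (f (a * x))%:E)^\+ x)%E = P.
  by apply: eq_integral => x _; rewrite !unlock.
have -> : (\int[leb]_x (fun x => (f (a * x))%:E)^\- x)%E = N.
  by apply: eq_integral => x _; rewrite !unlock.
have PF : P \is a fin_num by apply: F1; rewrite -Ep.
have NF : N \is a fin_num by apply: F1; rewrite -En.
by rewrite -(fineK PF) -(fineK NF) -!EFinM -!EFinB /= mulrBr.
Qed.

Lemma autocorrelation_bound f (M : R) u : nice f -> (forall x, `|f x| <= M) ->
  `|autocorrelation f u| <= M * \int[leb]_x `|f x|.
Proof.
move=> nf fM; have mf := nice_measurable nf; have [_ _ fi] := nf.
have j1 : leb.-integrable setT (EFin \o (fun y => f y * f (y + u))).
  by apply: (integrable_bounded_mul fi mf _ (fun x => fM _)); apply: (measurableT_comp mf);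
    exact: (measurable_funD (@measurable_id _ _ _) (measurable_cst u)).
apply: le_trans (le_normr_Rintegral _ j1) _ => //.
rewrite -RintegralZl//; last exact: integrable_norm.
apply: le_Rintegral => //; [exact: integrable_norm|exact: integrable_scale (integrable_norm _)|].
by move=> x _; rewrite normrM mulrC ler_wpM2r.
Qed.

Lemma integrable_autocorrelation f : nice f ->
  leb.-integrable setT (EFin \o autocorrelation f).
Proof.
move=> nf; have mf := nice_measurable nf; have [_ [M fM] fi] := nf.
have n1 : forall x : R, `|(fun=> 1 : R) x| <= 1 by move=> x; rewrite normr1.
have i2 := integrable_autocorrelation2 nf (measurable_cst (1 : R)) n1.
have i3 := integrable_fubini_F i2.
apply: eq_integrable i3 => // u _; rewrite /fubini_F /= /autocorrelation.
under eq_integral do rewrite mulr1.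
rewrite /Rintegral fineK//; apply: integrable_fin_num => //.
by apply: (integrable_bounded_mul fi mf _ (fun x => fM _)); apply: (measurableT_comp mf);
    exact: (measurable_funD (@measurable_id _ _ _) (measurable_cst u)).
Qed.

(** Fubini turns the damping into the Cauchy kernel of width e, and the substitution u = e v removes
    e from the kernel: the right side can then be dominated uniformly as e tends to 0. *)
Lemma poisson_spectrum f e : nice f -> 0 < e ->
  \int[leb]_l (poisson e l * (Ct f l ^+ 2 + St f l ^+ 2)) =
  \int[leb]_v (autocorrelation f (e * v) * (2 * (oneDsqr v)^-1)).
Proof.
move=> nf e0; have iA := integrable_autocorrelation nf.
have mA := measurable_autocorrelation nf; have mp := measurable_poisson e.
have ip := poisson_integrable e0.
have ic l : leb.-integrable setT (EFin \o (fun u => autocorrelation f u * cos (l * u))).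
  exact: (integrable_bounded_mul iA mA (measurable_cosl l) (fun x => cos_bound _)).
have icr u : leb.-integrable setT (EFin \o (fun l => poisson e l * cos (l * u))).
  apply: (integrable_bounded_mul ip mp _ (fun x => cos_bound _)).
  by have := measurable_cosl u; under eq_fun do rewrite mulrC.
transitivity (\int[leb]_l \int[leb]_u (poisson e l * (autocorrelation f u * cos (l * u)))).
  by apply: eq_Rintegral => l _; rewrite square_spectrum// RintegralZl.
pose G (z : R * R) := poisson e z.1 * (autocorrelation f z.2 * cos (z.1 * z.2)).
have mG : measurable_fun setT (G : measurableTypeR R * measurableTypeR R -> R).
  apply: measurable_funM; first exact: measurableT_comp mp measurable_fst.
  apply: measurable_funM; first exact: measurableT_comp mA measurable_snd.
  apply: (measurableT_comp (f := cos)); first exact: (continuous_measurable_fun (@continuous_cos R)).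
  exact: measurable_funM.
have iG : (leb \x leb)%E.-integrable setT (EFin \o G).
  apply: (@integrable_tensor _ _ (measurableTypeR R) (measurableTypeR R) R leb leb G (poisson e)
    (fun u => `|autocorrelation f u|)) => //.
  - exact: integrable_norm.
  - move=> z; rewrite /G !normrM ger0_norm ?expR_ge0// ler_wpM2l ?expR_ge0//.
    by rewrite ler_piMr// cos_bound.
  - by move=> x; exact: expR_ge0.
rewrite (Rintegral_fubini iG); last 2 first.
- by move=> l; have := integrable_scale (poisson e l) (ic l).
- move=> u; have := integrable_scale (autocorrelation f u) (icr u).
  by apply: eq_integrable => // l _; rewrite /= /G mulrCA.
transitivity (\int[leb]_u (autocorrelation f u * (2 * (e / (e ^+ 2 + u ^+ 2))))).
  apply: eq_Rintegral => u _; rewrite -poisson_cos// -RintegralZl//.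
  by apply: eq_Rintegral => l _; rewrite /G mulrCA.
rewrite (Rintegral_scaling e0); last first.
  apply: (@integrable_bounded_mul _ _ (2 * e^-1)) => //.
    apply: measurable_funM => //; apply: measurable_funM => //.
    apply: continuous_measurable_fun => u; apply: cvgV.
      by rewrite gt_eqF// ltr_pwDl ?sqr_ge0// exprn_gt0.
    by apply: cvgD; [exact: cvg_cst|exact: exprn_continuous].
  move=> u; have D0 : 0 < e ^+ 2 + u ^+ 2 by rewrite ltr_pwDl ?sqr_ge0// exprn_gt0.
  rewrite ger0_norm; last by rewrite mulr_ge0// divr_ge0 ?ltW.
  rewrite ler_wpM2l// ler_pdivrMr// mulrDr expr2 mulKf ?gt_eqF// lerDl.
  by rewrite mulr_ge0 ?sqr_ge0// invr_ge0 ltW.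
have -> : \int[leb]_u (autocorrelation f (e * u) * (2 * (e / (e ^+ 2 + (e * u) ^+ 2)))) =
    \int[leb]_v (e^-1 * (autocorrelation f (e * v) * (2 * (oneDsqr v)^-1))).
  apply: eq_Rintegral => v _; rewrite /oneDsqr.
  have D1 : 0 < 1 + v ^+ 2 by rewrite ltr_pwDl ?sqr_ge0.
  have D2 : e ^+ 2 + (e * v) ^+ 2 = e ^+ 2 * (1 + v ^+ 2) by ring.
  by rewrite D2; field; rewrite (gt_eqF D1) (gt_eqF e0).
rewrite RintegralZl//; first by rewrite mulrA mulfV ?mul1r// gt_eqF.
have [M fM] : exists M, forall x, `|f x| <= M by case: nf.
have mo : measurable_fun setT (fun v : R => 2 * (oneDsqr v)^-1).
  by apply: measurable_funM => //; exact: measurable_oneDsqrV.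
have ms : measurable_fun setT (fun v => autocorrelation f (e * v)).
  apply: (measurableT_comp mA).
  exact: (measurable_funM (measurable_cst e) (@measurable_id _ _ _)).
have h := integrable_bounded_mul (integrable_scale 2 oneDsqrV_integrable) mo ms
  (fun v => autocorrelation_bound (e * v) nf fM).
by apply: eq_integrable h => // v _ /=; rewrite mulrC.
Qed.

Lemma cvg_harmonic_shift (y u : R) : y + (n.+1%:R)^-1 * u @[n --> \oo] --> y.
Proof.
rewrite -[X in _ --> X]addr0 -[X in _ + X](mul0r u); apply: cvgD; first exact: cvg_cst.
by apply: cvgM; [exact: cvg_harmonic|exact: cvg_cst].
Qed.

Lemma autocorrelation_cvg f v : nice f ->
  autocorrelation f ((n.+1%:R)^-1 * v) @[n --> \oo] --> \int[leb]_y (f y ^+ 2).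
Proof.
move=> nf; have mf := nice_measurable nf; have [cf [M fM] fi] := nf.
have ma u : measurable_fun setT (fun y => f y * f (y + u)).
  by apply: measurable_funM => //; apply: (measurableT_comp mf);
    exact: (measurable_funD (@measurable_id _ _ _) (measurable_cst u)).
have gi := integrable_scale M (integrable_norm fi).
have cvgf (y : R) : f y * f (y + (n.+1%:R)^-1 * v) @[n --> \oo] --> f y ^+ 2.
  rewrite expr2; apply: cvgM; first exact: cvg_cst.
  exact: (cvg_comp _ _ (@cvg_harmonic_shift y v) (cf y)).
apply: (@Rintegral_dominated _ _ _ leb (fun n y => f y * f (y + (n.+1%:R)^-1 * v)) _ _
  (fun n => ma _) (measurable_funX 2 mf) gi).
  exact: cvgf.
by move=> n y; rewrite normrM mulrC ler_wpM2r.
Qed.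

(** Along e = 1/(n+1) the damped left side increases to the wanted integral. The right side tends by
    domination to the autocorrelation at 0, that is the integral of f^2, times the integral 2 pi of
    2/(1 + v^2). *)
Lemma parseval_line f : nice f ->
  (\int[leb]_l (Ct f l ^+ 2 + St f l ^+ 2)%:E = (2 * pi * \int[leb]_y (f y ^+ 2))%:E)%E.
Proof.
move=> nf; have mf := nice_measurable nf; have [cf [M fM] fi] := nf.
have mA := measurable_autocorrelation nf.
pose e n : R := n.+1%:R^-1; have e0 n : 0 < e n by rewrite invr_gt0 ltr0n.
pose h l := Ct f l ^+ 2 + St f l ^+ 2; have h0 l : 0 <= h l by rewrite addr_ge0 ?sqr_ge0.
have mh : measurable_fun setT h.
  have mz : measurable_fun setT (fun z : measurableTypeR R * measurableTypeR R => z.1 * z.2).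
    exact: measurable_funM.
  have mf2 : measurable_fun setT (fun z : measurableTypeR R * measurableTypeR R => f z.2).
    exact: measurableT_comp mf measurable_snd.
  have mc := measurable_funM mf2 (measurableT_comp (continuous_measurable_fun (@continuous_cos R)) mz).
  have ms := measurable_funM mf2 (measurableT_comp (continuous_measurable_fun (@continuous_sin R)) mz).
  have mC := @measurable_Rintegral _ _ (measurableTypeR R) (measurableTypeR R) R leb _ mc.
  have mS := @measurable_Rintegral _ _ (measurableTypeR R) (measurableTypeR R) R leb _ ms.
  exact: (measurable_funD (measurable_funX 2 mC) (measurable_funX 2 mS)).
have nd l : nondecreasing_seq (fun n => (poisson (e n) l * h l)%:E).
  move=> m n mn; rewrite lee_fin ler_wpM2r// ler_expR lerN2 ler_wpM2r//.
  by rewrite lef_pV2 ?posrE ?ltr0n// ler_nat.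
have mp n : measurable_fun setT (fun l => (poisson (e n) l * h l)%:E).
  by apply/measurable_EFinP; apply: measurable_funM => //; exact: measurable_poisson.
have p0 n l : (0 <= (poisson (e n) l * h l)%:E)%E by rewrite lee_fin mulr_ge0// expR_ge0.
have L1 := @cvg_monotone_convergence _ _ _ leb setT measurableT (fun n l => (poisson (e n) l * h l)%:E)
  mp (fun n l _ => p0 n l) (fun l _ => nd l).
have lim1 l : limn (fun n => (poisson (e n) l * h l)%:E) = (h l)%:E.
  apply/cvg_lim => //; apply: cvg_EFin; first exact: nearW.
  rewrite -[X in _ --> X]mul1r; apply: cvgM; last exact: cvg_cst.
  rewrite -expR0; apply: continuous_cvg; first exact: continuous_expR.
  rewrite -oppr0; apply: cvgN; rewrite -(mul0r `|l|); apply: cvgM; [exact: cvg_harmonic|exact: cvg_cst].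
have E1 : (\int[leb]_l limn (fun n => (poisson (e n) l * h l)%:E) = \int[leb]_l (h l)%:E)%E.
  by apply: eq_integral => l _; exact: lim1.
rewrite E1 in L1.
have iA := integrable_autocorrelation nf.
have ic n : leb.-integrable setT (EFin \o (fun l => poisson (e n) l * h l)).
  have ip := poisson_integrable (e0 n).
  have B0 x : `|cos x| <= (1 : R) by exact: cos_bound.
  apply: (integrable_bounded_mul ip (measurable_poisson _) mh (N := \int[leb]_u `|autocorrelation f u|)) => l.
  rewrite /h square_spectrum//; have mc := measurable_cosl l.
  have ia := integrable_bounded_mul iA mA mc (fun x => cos_bound _).
  apply: le_trans (le_normr_Rintegral _ ia) _ => //.
  apply: le_Rintegral => //; [exact: integrable_norm|exact: integrable_norm|].
  by move=> x _; rewrite normrM ler_piMr// cos_bound.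
have R1 n : (\int[leb]_l (poisson (e n) l * h l)%:E =
    (\int[leb]_v (autocorrelation f (e n * v) * (2 * (oneDsqr v)^-1)))%:E)%E.
  have FN := integrable_fin_num measurableT (ic n).
  rewrite -poisson_spectrum// /Rintegral -[LHS]fineK; [by []|exact: FN].
have L2 : \int[leb]_v (autocorrelation f (e n * v) * (2 * (oneDsqr v)^-1)) @[n --> \oo] -->
    \int[leb]_v (\int[leb]_y (f y ^+ 2) * (2 * (oneDsqr v)^-1)).
  have mo : measurable_fun setT (fun v : R => 2 * (oneDsqr v)^-1).
    by apply: measurable_funM => //; exact: measurable_oneDsqrV.
  apply: (@Rintegral_dominated _ _ _ leb (fun n v => autocorrelation f (e n * v) * (2 * (oneDsqr v)^-1)) _
    (fun v => (M * \int[leb]_x `|f x|) * (2 * (oneDsqr v)^-1))).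
  - move=> n; apply: measurable_funM => //; apply: (measurableT_comp mA).
    exact: (measurable_funM (measurable_cst _) (@measurable_id _ _ _)).
  - exact: measurable_funM.
  - exact: integrable_scale (integrable_scale 2 oneDsqrV_integrable).
  - by move=> v; apply: cvgM; [exact: autocorrelation_cvg|exact: cvg_cst].
  - move=> n v; rewrite normrM [ `|2 * _|]ger0_norm ?mulr_ge0 ?oneDsqrV_ge0//.
    by rewrite ler_wpM2r ?mulr_ge0 ?oneDsqrV_ge0//; exact: autocorrelation_bound.
have PI : \int[leb]_v (oneDsqr v)^-1 = pi :> R by rewrite /Rintegral oneDsqr_fin.
rewrite RintegralZl// in L2.
rewrite RintegralZl// in L2.
rewrite PI mulrC in L2.
have L3 : (\int[leb]_v (autocorrelation f (e n * v) * (2 * (oneDsqr v)^-1)))%:E @[n --> \oo] -->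
    (2 * pi * \int[leb]_y (f y ^+ 2))%:E by apply: cvg_EFin; [exact: nearW|exact: L2].
- rewrite (eq_cvg _ _ R1) in L1.
  exact: (cvg_unique (@ereal_hausdorff R) L1 L3).
- exact: oneDsqrV_integrable.
- by have := integrable_scale 2 oneDsqrV_integrable.
Qed.
End Parseval.

(** * Fourier transform and Plancherel identity in the plane *)

Section PlaneFourier.
Variable R : realType.
Notation leb := (@lebesgue_measure R).
Implicit Types g h : R -> R.

(* Real part of the Fourier integral of g + i h; the imaginary part is
   [line_fourier h (\- g)]. *)
Definition line_fourier g h (l : R) : R := \int[leb]_z (g z * cos (l * z) + h z * sin (l * z)).

Lemma niceN g : nice g -> nice (\- g).
Proof.
move=> [cg [M gM] gi]; split.
- by move=> x; apply: cvgN; exact: cg.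
- by exists M => x; rewrite /= normrN.
- by have := integrable_scale (-1) gi; under eq_fun do rewrite mulN1r.
Qed.

Lemma line_fourierE g h l : nice g -> nice h -> line_fourier g h l = Ct g l + St h l.
Proof.
move=> ng nh; rewrite /line_fourier RintegralD//; [exact: integrable_cosl|exact: integrable_sinl].
Qed.

Lemma StN g l : nice g -> St (\- g) l = - St g l.
Proof.
move=> ng; rewrite /St -mulN1r -RintegralZl//; last exact: integrable_sinl.
by apply: eq_Rintegral => x _; rewrite mulN1r mulNr.
Qed.

Lemma CtN g l : nice g -> Ct (\- g) l = - Ct g l.
Proof.
move=> ng; rewrite /Ct -mulN1r -RintegralZl//; last exact: integrable_cosl.
by apply: eq_Rintegral => x _; rewrite mulN1r mulNr.
Qed.

Lemma line_fourierN g h l : nice g -> nice h ->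
  line_fourier (\- g) (\- h) l = - line_fourier g h l.
Proof.
move=> ng nh; have [ng' nh'] := (niceN ng, niceN nh).
by rewrite !line_fourierE// CtN// StN// opprD.
Qed.

Lemma oneDsqrV_scaled (c : R) : leb.-integrable setT (EFin \o (fun x => c * (oneDsqr x)^-1)).
Proof. by have := integrable_scale c (@oneDsqrV_integrable R). Qed.

Lemma square_integral_fin g : nice g ->
  (\int[leb]_y (g y ^+ 2)%:E = (\int[leb]_y (g y ^+ 2))%:E)%E.
Proof.
move=> ng; have mg := nice_measurable ng; have [_ [M gM] gi] := ng.
have := integrable_bounded_mul gi mg mg gM => i2.
by rewrite /Rintegral fineK//; exact: (integrable_fin_num measurableT i2).
Qed.

Lemma measurable_CtSt g : nice g -> measurable_fun setT (Ct g) /\ measurable_fun setT (St g).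
Proof.
move=> ng; have mg := nice_measurable ng.
have mz : measurable_fun setT (fun z : measurableTypeR R * measurableTypeR R => z.1 * z.2).
  exact: measurable_funM.
have mf2 : measurable_fun setT (fun z : measurableTypeR R * measurableTypeR R => g z.2).
  exact: measurableT_comp mg measurable_snd.
have mc := measurable_funM mf2 (measurableT_comp (continuous_measurable_fun (@continuous_cos R)) mz).
have ms := measurable_funM mf2 (measurableT_comp (continuous_measurable_fun (@continuous_sin R)) mz).
by split; [exact: (@measurable_Rintegral _ _ (measurableTypeR R) (measurableTypeR R) R leb _ mc)|
  exact: (@measurable_Rintegral _ _ (measurableTypeR R) (measurableTypeR R) R leb _ ms)].
Qed.

(** Reflection shows that both integrals have the same double. Working in [0, +oo] discards the odd
    part of F without first knowing that it is integrable. *)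
Lemma integral_even_part (F u : R -> R) : measurable_fun setT F -> measurable_fun setT u ->
  (forall l, 0 <= F l) -> (forall l, 0 <= u l) -> (forall l, F l + F (- l) = u l + u l) ->
  (\int[leb]_l (F l)%:E = \int[leb]_l (u l)%:E)%E.
Proof.
move=> mF mu F0 u0 H; have [mN RF] := @lebesgue_reflection R.
have mFE : measurable_fun setT (EFin \o F) by exact/measurable_EFinP.
have muE : measurable_fun setT (EFin \o u) by exact/measurable_EFinP.
have mNE : measurable_fun setT ((fun l => (F (- l))%:E) : R -> \bar R)
  by exact: measurableT_comp mFE mN.
have E1 := RF (EFin \o F) mFE F0.
have D1 := ge0_integralD leb measurableT (fun l _ => F0 l : (0 <= (EFin \o F) l)%E) mFE
  (fun l _ => F0 (- l) : (0 <= (F (- l))%:E)%E) mNE.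
have D2 := ge0_integralD leb measurableT (fun l _ => u0 l : (0 <= (EFin \o u) l)%E) muE
  (fun l _ => u0 l : (0 <= (EFin \o u) l)%E) muE.
have E3 : (\int[leb]_l ((EFin \o F) l + (F (- l))%:E) = \int[leb]_l ((EFin \o u) l + (EFin \o u) l))%E.
  by apply: eq_integral => l _; rewrite /= -!EFinD H.
move: E3; rewrite D1 D2 [X in (_ + X)%E]E1.
have P1 : (0 <= \int[leb]_l (F l)%:E)%E by apply: integral_ge0 => l _; exact: F0.
have P2 : (0 <= \int[leb]_l (u l)%:E)%E by apply: integral_ge0 => l _; exact: u0.
rewrite /comp; move: P1 P2.
case: (\int[leb]_l (F l)%:E)%E => [r| |]; case: (\int[leb]_l (u l)%:E)%E => [s| |] //= _ _.
rewrite -!EFinD => -[h]; congr (_%:E); have n2 : (2 : R) != 0 by rewrite pnatr_eq0.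
by apply: (mulfI n2); rewrite !mulr_natl !mulr2n.
Qed.

(* The cross term of the square modulus is odd in the frequency. *)
Lemma parseval_line2 g h : nice g -> nice h ->
  (\int[leb]_l (line_fourier g h l ^+ 2 + line_fourier h (\- g) l ^+ 2)%:E =
   (2 * pi)%:E * \int[leb]_y (g y ^+ 2 + h y ^+ 2)%:E)%E.
Proof.
move=> ng nh; have nn := niceN ng.
have [mc ms] := measurable_CtSt ng; have [mc' ms'] := measurable_CtSt nh.
have mg := nice_measurable ng; have mh := nice_measurable nh.
pose u l := Ct g l ^+ 2 + St g l ^+ 2; pose v l := Ct h l ^+ 2 + St h l ^+ 2.
have m1 : measurable_fun setT u by exact: (measurable_funD (measurable_funX 2 mc) (measurable_funX 2 ms)).
have m2 : measurable_fun setT v by exact: (measurable_funD (measurable_funX 2 mc') (measurable_funX 2 ms')).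
pose F l := line_fourier g h l ^+ 2 + line_fourier h (\- g) l ^+ 2.
have FE l : F l = u l + v l + 2 * (Ct g l * St h l - Ct h l * St g l).
  by rewrite /F !line_fourierE// StN// /u /v; ring.
have mF : measurable_fun setT F.
  rewrite (_ : F = fun l => u l + v l + 2 * (Ct g l * St h l - Ct h l * St g l)); last exact/funext.
  exact: (measurable_funD (measurable_funD m1 m2) (measurable_funM (measurable_cst (2 : R))
    (measurable_funB (measurable_funM mc ms') (measurable_funM mc' ms)))).
have F0 l : 0 <= F l by rewrite addr_ge0 ?sqr_ge0.
have CN (f : R -> R) l : Ct f (- l) = Ct f l by apply: eq_Rintegral => x _; rewrite mulNr cosN.
have SN (f : R -> R) l : nice f -> St f (- l) = - St f l.
  by move=> nf; rewrite -StN; [apply: eq_Rintegral => x _; rewrite mulNr sinN mulrN /= mulNr|].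
have u0 l : 0 <= u l by rewrite addr_ge0 ?sqr_ge0.
have v0 l : 0 <= v l by rewrite addr_ge0 ?sqr_ge0.
have E2 : (\int[leb]_l (F l)%:E = \int[leb]_l (u l)%:E + \int[leb]_l (v l)%:E)%E.
  have muE : measurable_fun setT (EFin \o u) by exact/measurable_EFinP.
  have mvE : measurable_fun setT (EFin \o v) by exact/measurable_EFinP.
  have D := ge0_integralD leb measurableT (fun l _ => u0 l : (0 <= (EFin \o u) l)%E) muE
    (fun l _ => v0 l : (0 <= (EFin \o v) l)%E) mvE.
  apply: (eq_trans _ D).
  apply: (@integral_even_part F (fun l => u l + v l)) => //.
  - exact: measurable_funD.
  - by move=> l; exact: addr_ge0.
  - by move=> l; rewrite !FE /u /v !CN !SN//; ring.
have gI := square_integral_fin ng; have hI := square_integral_fin nh.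
rewrite [X in (_ * X)%E](_ : _ = (\int[leb]_y (g y ^+ 2))%:E + (\int[leb]_y (h y ^+ 2))%:E)%E; last first.
  rewrite -gI -hI -(ge0_integralD leb measurableT)//.
  - by move=> y _; rewrite lee_fin sqr_ge0.
  - by apply/measurable_EFinP; exact: (measurable_funX 2 mg).
  - by move=> y _; rewrite lee_fin sqr_ge0.
  - by apply/measurable_EFinP; exact: (measurable_funX 2 mh).
apply: (eq_trans E2); have -> := parseval_line ng; have -> := parseval_line nh.
by rewrite muleDr// !EFinM.
Qed.

(** Separate continuity and a product bound are inherited by slices and by partial transforms, so
    the identity on the line applies in each variable in turn. *)
Definition plane_nice (g : R * R -> R) :=
  [/\ measurable_fun setT (g : measurableTypeR R * measurableTypeR R -> R),
      (forall y, continuous (fun z => g (y, z))) /\ (forall z, continuous (fun y => g (y, z)))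
    & exists2 M, 0 <= M & forall z, `|g z| <= M * ((oneDsqr z.1)^-1 * (oneDsqr z.2)^-1)].

Lemma plane_niceN (g : R * R -> R) : plane_nice g -> plane_nice (\- g).
Proof.
move=> [mg [c1 c2] [M M0 gM]]; split.
- exact: measurableT_comp.
- by split=> y x; apply: cvgN; [exact: c1|exact: c2].
- by exists M => // z; rewrite /= normrN.
Qed.

Lemma oneDsqrV_le1 (s : R) : (oneDsqr s)^-1 <= 1.
Proof. by rewrite invf_le1 ?oneDsqr_ge1// (lt_le_trans _ (oneDsqr_ge1 _)). Qed.

Lemma nice_weighted (f : R -> R) (M : R) : continuous f -> (forall x, `|f x| <= M * (oneDsqr x)^-1) -> nice f.
Proof.
move=> cf fM; have mf := continuous_measurable_fun cf; split => //.
  exists M => x; apply: le_trans (fM x) _; rewrite ler_piMr ?oneDsqrV_le1//.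
  by have := le_trans (normr_ge0 _) (fM x); rewrite pmulr_lge0// invr_gt0 (lt_le_trans _ (oneDsqr_ge1 _)).
exact: (@integrable_le _ _ R leb f (fun x => M * (oneDsqr x)^-1) mf (oneDsqrV_scaled M) fM).
Qed.

Lemma plane_slice (g : R * R -> R) y : plane_nice g -> nice (fun z => g (y, z)).
Proof.
move=> [_ [c1 _] [M M0 gM]]; apply: (@nice_weighted _ M) => [|z]; first exact: c1.
apply: le_trans (gM (y, z)) _; rewrite /= mulrA ler_wpM2r ?oneDsqrV_ge0//.
by rewrite ler_piMr ?oneDsqrV_le1.
Qed.

Lemma kernel_bound (g h : R -> R) (l M : R) : nice g -> nice h -> 
  (forall z, `|g z| <= M * (oneDsqr z)^-1) -> (forall z, `|h z| <= M * (oneDsqr z)^-1) ->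
  `|line_fourier g h l| <= 2 * M * pi.
Proof.
move=> ng nh gM hM.
have i0 : leb.-integrable setT (EFin \o (fun z => g z * cos (l * z) + h z * sin (l * z))).
  by apply: integrable_add; [exact: integrable_cosl|exact: integrable_sinl].
apply: le_trans (le_normr_Rintegral _ i0) _ => //.
have -> : 2 * M * pi = \int[leb]_z (2 * M * (oneDsqr z)^-1).
  rewrite RintegralZl//; last exact: oneDsqrV_integrable.
  by rewrite /Rintegral oneDsqr_fin.
apply: le_Rintegral => //; first exact: integrable_norm.
  exact: oneDsqrV_scaled.
move=> z _; apply: le_trans (ler_normD _ _) _; rewrite !normrM -mulrA mulr_natl mulr2n.
by apply: lerD; [apply: le_trans (gM z)|apply: le_trans (hM z)];
  rewrite ler_piMr// ?cos_bound ?sin_bound.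
Qed.

(** The factor in y of the bound survives the integration in z; continuity in y is tested on
    sequences, with dominated convergence. *)
Lemma partial_line (g h : R * R -> R) m : plane_nice g -> plane_nice h ->
  nice (fun y => line_fourier (fun z => g (y, z)) (fun z => h (y, z)) m).
Proof.
move=> ng nh; have [mg [cg1 cg2] [M M0 gM]] := ng; have [mh [ch1 ch2] [N N0 hN]] := nh.
have gB y z : `|g (y, z)| <= Num.max M N * (oneDsqr y)^-1 * (oneDsqr z)^-1.
  apply: le_trans (gM _) _; rewrite -mulrA ler_wpM2r ?mulr_ge0 ?oneDsqrV_ge0//.
  by rewrite le_max lexx.
have hB y z : `|h (y, z)| <= Num.max M N * (oneDsqr y)^-1 * (oneDsqr z)^-1.
  apply: le_trans (hN _) _; rewrite -mulrA ler_wpM2r ?mulr_ge0 ?oneDsqrV_ge0//.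
  by rewrite le_max lexx orbT.
have K0 : 0 <= Num.max M N by rewrite le_max M0.
apply: (@nice_weighted _ (2 * Num.max M N * pi)) => [y|y]; last first.
  rewrite mulrAC -mulrA mulrA -[2 * _ / _]mulrA.
  by apply: kernel_bound; [exact: plane_slice|exact: plane_slice|exact: gB|exact: hB].
apply/(@cvg_nbhsP _ R^o) => w wy.
have mk (u : R) : measurable_fun setT (fun z => g (u, z) * cos (m * z) + h (u, z) * sin (m * z)).
  by have [/measurable_EFinP h0 _] := integrableP _ _ _ (integrable_add (integrable_cosl m (plane_slice u ng))
    (integrable_sinl m (plane_slice u nh))).
apply: (@Rintegral_dominated _ _ _ leb (fun n z => g (w n, z) * cos (m * z) + h (w n, z) * sin (m * z)) _
  (fun z => (2 * Num.max M N) * (oneDsqr z)^-1)).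
- by move=> n; exact: mk.
- exact: mk.
- exact: oneDsqrV_scaled.
- move=> z; apply: cvgD; (apply: cvgM; last exact: cvg_cst).
    exact: (cvg_comp w (fun y => g (y, z)) wy (cg2 z y)).
  exact: (cvg_comp w (fun y => h (y, z)) wy (ch2 z y)).
- move=> n z; apply: le_trans (ler_normD _ _) _; rewrite !normrM -mulrA mulr_natl mulr2n.
  have P (a c : R) : `|a| <= Num.max M N * (oneDsqr (w n))^-1 * (oneDsqr z)^-1 -> `|c| <= 1 ->
     `|a| * `|c| <= Num.max M N * (oneDsqr z)^-1.
    move=> ha hc; apply: le_trans (_ : `|a| <= _); first by rewrite ler_piMr.
    apply: le_trans ha _; rewrite ler_wpM2r ?oneDsqrV_ge0//.
    by rewrite ler_piMr ?oneDsqrV_le1.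
  by apply: lerD; apply: P; rewrite ?cos_bound ?sin_bound//.
Qed.

(** Real part of the unnormalized Fourier integral of g + i h; the imaginary part is that of the
    pair (h, -g). *)
Definition plane_fourier (g h : R * R -> R) (l m : R) : R :=
  \int[(leb \x leb)%E]_yz (g yz * cos (l * yz.1 + m * yz.2) + h yz * sin (l * yz.1 + m * yz.2)).

Definition plane_kernel (g h : R * R -> R) (l m : R) (yz : R * R) : R :=
  g yz * cos (l * yz.1 + m * yz.2) + h yz * sin (l * yz.1 + m * yz.2).

Lemma measurable_cosc d (T : measurableType d) (f : T -> R) : measurable_fun setT f ->
  measurable_fun setT (fun x => cos (f x)).
Proof. exact: measurableT_comp (continuous_measurable_fun (@continuous_cos R)). Qed.

Lemma measurable_sinc d (T : measurableType d) (f : T -> R) : measurable_fun setT f ->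
  measurable_fun setT (fun x => sin (f x)).
Proof. exact: measurableT_comp (continuous_measurable_fun (@continuous_sin R)). Qed.

Lemma plane_kernel_integrable (g h : R * R -> R) (l m : R) : plane_nice g -> plane_nice h ->
  (leb \x leb)%E.-integrable setT (EFin \o plane_kernel g h l m).
Proof.
move=> [mg _ [M M0 gM]] [mh _ [N N0 hN]].
have mt : measurable_fun setT (fun yz : measurableTypeR R * measurableTypeR R => l * yz.1 + m * yz.2).
  by measurable_tac.
have mK := measurable_funD (measurable_funM mg (measurable_cosc mt)) (measurable_funM mh (measurable_sinc mt)).
apply: (@integrable_tensor _ _ (measurableTypeR R) (measurableTypeR R) R leb leb _
  (fun y => (M + N) * (oneDsqr y)^-1) (fun z => (oneDsqr z)^-1) mK).
- exact: oneDsqrV_scaled.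
- exact: oneDsqrV_integrable.
- move=> z; apply: le_trans (ler_normD _ _) _; rewrite !normrM -mulrA mulrDl.
  apply: lerD; [apply: le_trans (gM z)|apply: le_trans (hN z)];
  by rewrite ler_piMr// ?cos_bound ?sin_bound.
- by move=> y; rewrite mulr_ge0 ?oneDsqrV_ge0// addr_ge0.
- by move=> y; exact: oneDsqrV_ge0.
Qed.

(** The addition formulas split the exponential into factors in y and z; the inner pair consists of
    the real and imaginary parts of the transform in z. *)
Lemma plane_fourier_iterated (g h : R * R -> R) (l m : R) : plane_nice g -> plane_nice h ->
  plane_fourier g h l m =
  line_fourier (fun y => line_fourier (fun z => g (y, z)) (fun z => h (y, z)) m)
    (fun y => line_fourier (fun z => h (y, z)) (fun z => - g (y, z)) m) l.
Proof.
move=> ng nh; have iK := plane_kernel_integrable l m ng nh.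
have i1 y : leb.-integrable setT (EFin \o (fun z =>
    g (y, z) * cos (m * z) + h (y, z) * sin (m * z))).
  by apply: integrable_add; [exact: (integrable_cosl m (plane_slice y ng))|exact: (integrable_sinl m (plane_slice y nh))].
have i2 y : leb.-integrable setT (EFin \o (fun z =>
    h (y, z) * cos (m * z) + - g (y, z) * sin (m * z))).
  by apply: integrable_add; [exact: (integrable_cosl m (plane_slice y nh))|
    exact: (integrable_sinl m (plane_slice y (plane_niceN ng)))].
have E y z : plane_kernel g h l m (y, z) =
    cos (l * y) * (g (y, z) * cos (m * z) + h (y, z) * sin (m * z)) +
    sin (l * y) * (h (y, z) * cos (m * z) + - g (y, z) * sin (m * z)).
  by rewrite /plane_kernel /= cosD sinD; ring.
have iE y : leb.-integrable setT (fun z => (plane_kernel g h l m (y, z))%:E).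
  under eq_fun do rewrite E.
  by apply: integrable_add; exact: integrable_scale.
rewrite /plane_fourier (@Rintegral_product _ _ (measurableTypeR R) (measurableTypeR R) R leb leb _ iK iE).
apply: eq_Rintegral => y _; under eq_Rintegral do rewrite E.
rewrite RintegralD//; [|exact: integrable_scale|exact: integrable_scale].
by rewrite !RintegralZl// /line_fourier; congr (_ + _); rewrite mulrC.
Qed.

Lemma measurable_iterated (g h : R * R -> R) : plane_nice g -> plane_nice h ->
  measurable_fun setT (fun z : measurableTypeR R * measurableTypeR R =>
    line_fourier (fun t => g (z.2, t)) (fun t => h (z.2, t)) z.1).
Proof.
move=> [mg _ _] [mh _ _].
have mp : measurable_fun setT (fun z : (measurableTypeR R * measurableTypeR R) * measurableTypeR R => (z.1.2, z.2)).
  by measurable_tac.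
have mt : measurable_fun setT (fun z : (measurableTypeR R * measurableTypeR R) * measurableTypeR R => z.1.1 * z.2).
  by measurable_tac.
have mK := measurable_funD (measurable_funM (measurableT_comp mg mp) (measurable_cosc mt))
  (measurable_funM (measurableT_comp mh mp) (measurable_sinc mt)).
exact: (@measurable_Rintegral _ _ _ (measurableTypeR R) R leb _ mK).
Qed.

Lemma measurable_plane_fourier (g h : R * R -> R) : plane_nice g -> plane_nice h ->
  measurable_fun setT (fun z : measurableTypeR R * measurableTypeR R => plane_fourier g h z.1 z.2).
Proof.
move=> [mg _ _] [mh _ _].
pose P := (measurableTypeR R * measurableTypeR R)%type.
have mt : measurable_fun setT (fun z : P * P => z.1.1 * z.2.1 + z.1.2 * z.2.2).
  by measurable_tac.
have mK := measurable_funD (measurable_funM (measurableT_comp mg (@measurable_snd _ _ P P)) (measurable_cosc mt))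
  (measurable_funM (measurableT_comp mh (@measurable_snd _ _ P P)) (measurable_sinc mt)).
have H := @measurable_Rintegral _ _ P P R (sf_prod leb leb) _ mK; exact: H.
Qed.

Lemma twopi_ge0 : (0 <= (2 * pi)%:E :> \bar R)%E.
Proof. by rewrite lee_fin mulr_ge0// pi_ge0. Qed.

(** Parseval on the line is used twice, in y with m fixed and then in z with y fixed, and Tonelli
    exchanges the order before each use. *)
Lemma plancherel_plane (g h : R * R -> R) : plane_nice g -> plane_nice h ->
  (\int[leb]_l \int[leb]_m (plane_fourier g h l m ^+ 2 + plane_fourier h (\- g) l m ^+ 2)%:E =
   ((2 * pi) ^+ 2)%:E * \int[leb]_y \int[leb]_z (g (y, z) ^+ 2 + h (y, z) ^+ 2)%:E)%E.
Proof.
move=> ng nh; have nn := plane_niceN ng.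
pose W z := plane_fourier g h z.1 z.2 ^+ 2 + plane_fourier h (\- g) z.1 z.2 ^+ 2.
have mW : measurable_fun setT (EFin \o W : measurableTypeR R * measurableTypeR R -> \bar R).
  apply/measurable_EFinP.
  exact: (measurable_funD (measurable_funX 2 (measurable_plane_fourier ng nh))
     (measurable_funX 2 (measurable_plane_fourier nh nn))).
have W0 z : (0 <= (EFin \o W) z)%E by rewrite lee_fin addr_ge0 ?sqr_ge0.
have T1 := @fubini_tonelli _ _ (measurableTypeR R) (measurableTypeR R) R leb leb _ mW W0.
apply: (eq_trans T1).
pose P m y := line_fourier (fun z => g (y, z)) (fun z => h (y, z)) m.
pose Q m y := line_fourier (fun z => h (y, z)) (fun z => - g (y, z)) m.
have nP m : nice (P m) by exact: partial_line.
have nQ m : nice (Q m) by exact: (partial_line m nh nn).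
have PN m : \- P m = fun y => line_fourier (fun z => (\- g) (y, z)) (fun z => - h (y, z)) m.
  apply/funext => y.
  exact: (esym (line_fourierN m (plane_slice y ng) (plane_slice y nh))).
have QN m l : line_fourier (Q m) (\- P m) l = plane_fourier h (\- g) l m.
  rewrite PN; exact: (esym (plane_fourier_iterated l m nh nn)).
have PQ m l : line_fourier (P m) (Q m) l = plane_fourier g h l m.
  exact: (esym (plane_fourier_iterated l m ng nh)).
have E1 m : (\int[leb]_l (W (l, m))%:E = (2 * pi)%:E * \int[leb]_y (P m y ^+ 2 + Q m y ^+ 2)%:E)%E.
  have H := parseval_line2 (nP m) (nQ m); apply: (eq_trans _ H).
  by apply: eq_integral => l _; rewrite QN PQ.
pose Y z := P z.1 z.2 ^+ 2 + Q z.1 z.2 ^+ 2.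
have mY : measurable_fun setT (EFin \o Y : measurableTypeR R * measurableTypeR R -> \bar R).
  apply/measurable_EFinP.
  exact: (measurable_funD (measurable_funX 2 (measurable_iterated ng nh))
     (measurable_funX 2 (measurable_iterated nh nn))).
have Y0 z : (0 <= (EFin \o Y) z)%E by rewrite lee_fin addr_ge0 ?sqr_ge0.
have p0 := twopi_ge0.
have T2 := @fubini_tonelli _ _ (measurableTypeR R) (measurableTypeR R) R leb leb _ mY Y0.
transitivity (\int[leb]_m ((2 * pi)%:E * \int[leb]_y (EFin \o Y) (m, y)))%E.
  by apply: eq_integral => m _; exact: E1.
have mY1 := measurable_fun_fubini_tonelli_F (m2 := leb) _ mY Y0.
have i0 m : (0 <= \int[leb]_y (EFin \o Y) (m, y))%E by apply: integral_ge0.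
rewrite (ge0_integralZl leb measurableT mY1 (fun m _ => i0 m) p0) T2.
have E2 y : (\int[leb]_m (EFin \o Y) (m, y) = (2 * pi)%:E * \int[leb]_z (g (y, z) ^+ 2 + h (y, z) ^+ 2)%:E)%E.
  exact: (parseval_line2 (plane_slice y ng) (plane_slice y nh)).
transitivity ((2 * pi)%:E * \int[leb]_y ((2 * pi)%:E * \int[leb]_z (g (y, z) ^+ 2 + h (y, z) ^+ 2)%:E))%E.
  by congr (_ * _)%E; apply: eq_integral => y _; exact: E2.
have [mg _ _] := ng; have [mh _ _] := nh.
have mG : measurable_fun setT ((fun z => (g z ^+ 2 + h z ^+ 2)%:E) : measurableTypeR R * measurableTypeR R -> \bar R).
  by apply/measurable_EFinP; exact: (measurable_funD (measurable_funX 2 mg) (measurable_funX 2 mh)).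
have G0 z : (0 <= (g z ^+ 2 + h z ^+ 2)%:E)%E by rewrite lee_fin addr_ge0 ?sqr_ge0.
have mG1 := measurable_fun_fubini_tonelli_F (m2 := leb) _ mG G0.
rewrite (ge0_integralZl leb measurableT mG1 _ p0).
  by rewrite muleA -EFinM -expr2.
by move=> y _; apply: integral_ge0 => z _; exact: G0.
Qed.

End PlaneFourier.

(** * The partial Fourier transform on the group *)

Section CartanFourier.
Variable R : realType.
Notation leb := (@lebesgue_measure R).
Notation leb3 := (leb \x leb \x leb)%E.
Notation F := (@partial_fourier R).
Implicit Types (p q : B5 R -> R) (f g : B5 R -> R[i]) (x : B5 R) (z : R * R * R).

Lemma haar_iterated (h : B5 R -> \bar R) : measurable_fun setT h -> (forall x, 0 <= h x)%E ->
  (\int[haar]_x h x = \int[leb3]_z \int[leb]_l \int[leb]_m h (z, l, m))%E.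
Proof.
move=> mh h0; pose s2 := sf_prod leb leb; pose s3 := sf_prod s2 leb; pose s4 := sf_prod s3 leb.
have E1 := @fubini_tonelli1 _ _ _ _ R s4 leb h mh h0.
apply: (eq_trans E1).
have mF := @measurable_fun_fubini_tonelli_F _ _ _ _ R leb h mh h0.
have F0 y : (0 <= fubini_F leb h y)%E by apply: integral_ge0 => m _; exact: h0.
exact: (@fubini_tonelli1 _ _ _ _ R s3 leb _ mF F0).
Qed.

Definition slice p z : R * R -> R := fun yz => p (z, yz.1, yz.2).

Lemma measurable_slice p z : measurable_fun setT p ->
  measurable_fun setT (slice p z : measurableTypeR R * measurableTypeR R -> R).
Proof.
move=> mp; apply: (measurableT_comp mp).
exact: (measurable_fun_pair (measurable_fun_pair (measurable_cst z) measurable_fst) measurable_snd).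
Qed.

Lemma slice_nice p z : rschwartz p -> plane_nice (slice p z).
Proof.
move=> Sp; have cp := rschwartz_continuous Sp; have [M M0 hM] := rapid_weight (rschwartz_rapid Sp).
case: z => [[a b] c]; split.
- exact: measurable_slice (rschwartz_measurable Sp).
- split=> y x; apply: (cvg_comp _ p _ (cp _)); apply: cvg_tuple5; (exact: cvg_cst || exact: cvg_id).
- exists M => // -[y y']; apply: le_trans (hM _) _; rewrite ler_wpM2l// /weight /= -mulrA.
  have V0 := @oneDsqrV_ge0 R; have V1 := @oneDsqrV_le1 R.
  rewrite ler_piMl ?mulr_ge0//; apply: mulr_ile1; rewrite ?mulr_ge0//.
  by apply: mulr_ile1.
Qed.

Lemma fourier_components f z l m :
  Ref (F f) (z, l, m) = (2 * pi)^-1 * plane_fourier (slice (Ref f) z) (slice (Imf f) z) l m /\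
  Imf (F f) (z, l, m) = (2 * pi)^-1 * plane_fourier (slice (Imf f) z) (\- slice (Ref f) z) l m.
Proof.
case: z => [[a b] c]; rewrite /Ref /Imf /partial_fourier /cintegral /plane_fourier /slice /=.
rewrite !mul0r subr0 addr0; split; congr (_ * _); apply: eq_Rintegral => y _.
  by case: (f _) => u v /=; ring.
by case: (f _) => u v /=; ring.
Qed.

Lemma measurable_fourier_component p q : rschwartz p -> rschwartz q ->
  measurable_fun setT (fun x : B5 R => plane_fourier (slice p x.1.1) (slice q x.1.1) x.1.2 x.2).
Proof.
move=> Sp Sq; have mp := rschwartz_measurable Sp; have mq := rschwartz_measurable Sq.
pose P := (measurableTypeR R * measurableTypeR R)%type.
pose Q := (measurableTypeR R * measurableTypeR R * measurableTypeR R * measurableTypeR R * measurableTypeR R)%type.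
have mt : measurable_fun setT (fun w : Q * P => w.1.1.2 * w.2.1 + w.1.2 * w.2.2).
  by measurable_tac.
have ms : measurable_fun setT (fun w : Q * P => (w.1.1.1, w.2.1, w.2.2)).
  by measurable_tac.
have mK := measurable_funD (measurable_funM (measurableT_comp mp ms) (measurable_cosc mt))
  (measurable_funM (measurableT_comp mq ms) (measurable_sinc mt)).
have H := @measurable_Rintegral _ _ Q P R (sf_prod leb leb) _ mK; exact: H.
Qed.

Lemma rschwartz_opp p : rschwartz p -> rschwartz (\- p).
Proof. exact: rschwartzN. Qed.

Lemma measurable_fourier f : schwartz f ->
  measurable_fun setT (Ref (F f)) /\ measurable_fun setT (Imf (F f)).
Proof.
move=> /schwartzP[S1 S2]; have m1 := measurable_fourier_component S1 S2.
have m2 := measurable_fourier_component S2 (rschwartz_opp S1).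
split.
  rewrite (_ : Ref _ = fun x => (2 * pi)^-1 * plane_fourier (slice (Ref f) x.1.1) (slice (Imf f) x.1.1) x.1.2 x.2).
    exact: (measurable_funM (measurable_cst _) m1).
  by apply/funext => -[[z l] m]; have [] := fourier_components f z l m.
rewrite (_ : Imf _ = fun x => (2 * pi)^-1 * plane_fourier (slice (Imf f) x.1.1) (slice (\- Ref f) x.1.1) x.1.2 x.2).
  exact: (measurable_funM (measurable_cst _) m2).
by apply/funext => -[[z l] m]; have [] := fourier_components f z l m.
Qed.

Lemma sqintegralD p q : measurable_fun setT p -> measurable_fun setT q ->
  (sqintegral haar p + sqintegral haar q = \int[haar]_x (p x ^+ 2 + q x ^+ 2)%:E)%E.
Proof.
move=> mp mq; rewrite /sqintegral -ge0_integralD//.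
- by move=> x _; rewrite lee_fin sqr_ge0.
- by apply/measurable_EFinP; exact: (measurable_funX 2 mp).
- by move=> x _; rewrite lee_fin sqr_ge0.
- by apply/measurable_EFinP; exact: (measurable_funX 2 mq).
Qed.

Lemma twopi_neq0 : (2 * pi : R) != 0.
Proof. by rewrite mulf_neq0 ?pnatr_eq0// gt_eqF// pi_gt0. Qed.

Lemma plancherel f : schwartz f ->
  (sqintegral haar (Ref (F f)) + sqintegral haar (Imf (F f)) =
   sqintegral haar (Ref f) + sqintegral haar (Imf f))%E.
Proof.
move=> Sf; have [m1 m2] := measurable_fourier Sf; have [S1 S2] := (schwartzP f).1 Sf.
have n1 := rschwartz_measurable S1; have n2 := rschwartz_measurable S2.
rewrite !sqintegralD// !haar_iterated; last 4 first.
- by apply/measurable_EFinP; exact: (measurable_funD (measurable_funX 2 n1) (measurable_funX 2 n2)).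
- by move=> x; rewrite lee_fin addr_ge0 ?sqr_ge0.
- by apply/measurable_EFinP; exact: (measurable_funD (measurable_funX 2 m1) (measurable_funX 2 m2)).
- by move=> x; rewrite lee_fin addr_ge0 ?sqr_ge0.
apply: eq_integral => z _; have N1 := slice_nice z S1; have N2 := slice_nice z S2.
have H := plancherel_plane N1 N2.
pose c : R := ((2 * pi) ^+ 2)^-1.
have c0 : (0 <= c%:E :> \bar R)%E by rewrite lee_fin invr_ge0 sqr_ge0.
pose W (w : R * R) := plane_fourier (slice (Ref f) z) (slice (Imf f) z) w.1 w.2 ^+ 2 +
  plane_fourier (slice (Imf f) z) (\- slice (Ref f) z) w.1 w.2 ^+ 2.
have mW : measurable_fun setT (EFin \o W : measurableTypeR R * measurableTypeR R -> \bar R).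
  apply/measurable_EFinP.
  exact: (measurable_funD (measurable_funX 2 (measurable_plane_fourier N1 N2))
     (measurable_funX 2 (measurable_plane_fourier N2 (plane_niceN N1)))).
have W0 w : (0 <= (EFin \o W) w)%E by rewrite lee_fin addr_ge0 ?sqr_ge0.
have E l m : (Ref (F f) (z, l, m) ^+ 2 + Imf (F f) (z, l, m) ^+ 2)%:E = (c%:E * (EFin \o W) (l, m))%E.
  have [-> ->] := fourier_components f z l m; rewrite -EFinM; congr (_%:E).
  by rewrite /c -exprVn /W /=; ring.
have mW1 := measurable_fun_fubini_tonelli_F (m2 := leb) _ mW W0.
have mW2 l : measurable_fun setT (fun m => (EFin \o W) (l, m)).
  exact: (measurable_fun_pair2 (f := EFin \o W)).
transitivity (\int[leb]_l (c%:E * \int[leb]_m (EFin \o W) (l, m)))%E.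
  apply: eq_integral => l _; under eq_integral do rewrite E.
  exact: (ge0_integralZl leb measurableT (mW2 l) (fun m _ => W0 (l, m)) c0).
have i0 l : (0 <= \int[leb]_m (EFin \o W) (l, m))%E by apply: integral_ge0 => m _; exact: W0.
rewrite (ge0_integralZl leb measurableT mW1 (fun l _ => i0 l) c0).
apply: (eq_trans (congr1 (fun u => c%:E * u)%E H)).
by rewrite muleA -EFinM mulVf ?mul1e// expf_neq0// twopi_neq0.
Qed.

Lemma fourier_L2 f : schwartz f -> inLp 2 (F f).
Proof.
move=> Sf; have [m1 m2] := measurable_fourier Sf; have [S1 S2] := (schwartzP f).1 Sf.
have [_ s1] := rschwartz_sq S1; have [_ s2] := rschwartz_sq S2.
have fin : (sqintegral haar (Ref (F f)) + sqintegral haar (Imf (F f)) < +oo)%E.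
  by rewrite plancherel// lte_add_pinfty.
apply/inLp2P; split; split => //; apply: le_lt_trans fin.
  by rewrite leeDl// sqintegral_ge0.
by rewrite leeDr// sqintegral_ge0.
Qed.

Lemma nsq_fourier f : schwartz f -> nsq (vip R) (vec (F f)) = nsq (vip R) (vec f).
Proof.
move=> Sf; have LF := fourier_L2 Sf; have Lf := schwartz_L2 Sf.
have mf := (inLp2P _).1 LF; have mf' := (inLp2P _).1 Lf.
apply: EFin_inj; rewrite !nsq_normc !vecK// !sqintegral_normc; first exact: plancherel.
- by have [[]] := mf'.
- by have [_ []] := mf'.
- by have [[]] := mf.
- by have [_ []] := mf.
Qed.

Lemma plane_fourierB (a b a' b' : R * R -> R) (l m : R) : plane_nice a -> plane_nice b ->
  plane_nice a' -> plane_nice b' ->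
  plane_fourier (fun w => a w - a' w) (fun w => b w - b' w) l m =
  plane_fourier a b l m - plane_fourier a' b' l m.
Proof.
move=> ng nh ng' nh'; rewrite /plane_fourier -RintegralB//.
- by apply: eq_Rintegral => w _; ring.
- exact: (plane_kernel_integrable l m ng nh).
- exact: (plane_kernel_integrable l m ng' nh').
Qed.

Lemma fourierB f g : schwartz f -> schwartz g ->
  F (fun x => f x - g x) = (fun x => F f x - F g x).
Proof.
move=> /schwartzP[S1 S2] /schwartzP[T1 T2]; apply/funext => -[[z l] m]; apply/eqP.
rewrite eq_complex ReB ImB; apply/andP; rewrite -!/(Ref _ _) -!/(Imf _ _).
have [-> ->] := fourier_components (fun x => f x - g x) z l m.
have [-> ->] := fourier_components f z l m; have [-> ->] := fourier_components g z l m.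
have A1 := slice_nice z S1; have A2 := slice_nice z S2.
have B1 := slice_nice z T1; have B2 := slice_nice z T2.
have eR : slice (Ref (fun x => f x - g x)) z = fun w => slice (Ref f) z w - slice (Ref g) z w.
  by apply/funext => w; exact: ReB.
have eI : slice (Imf (fun x => f x - g x)) z = fun w => slice (Imf f) z w - slice (Imf g) z w.
  by apply/funext => w; exact: ImB.
have eN : \- slice (Ref (fun x => f x - g x)) z =
    fun w => (\- slice (Ref f) z) w - (\- slice (Ref g) z) w.
  by rewrite eR; apply/funext => w /=; rewrite opprB opprK addrC.
rewrite eN eR eI (plane_fourierB l m A1 A2 B1 B2).
by rewrite (plane_fourierB l m A2 (plane_niceN A1) B2 (plane_niceN B1)) !mulrBr.
Qed.

Definition cis (t : R) : R[i] := Complex (cos t) (sin t).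

Lemma normc_cis t : ComplexField.Normc.normc (cis t) = 1.
Proof. by rewrite /cis /= cos2Dsin2 sqrtr1. Qed.

(** The directions of x4 and x5 are central: left translation moves these two coordinates by amounts
    that depend on x1, x2, x3 alone. After the partial Fourier transform the move is a phase, and
    the frequencies stay put. *)
Definition shift4 (a : B5 R) z : R := let: (a1, _, _, a4, _) := a in let: (x1, x2, x3) := z in
  a4 + a1 ^+ 2 * x2 / 2 - a1 * x3.
Definition shift5 (a : B5 R) z : R := let: (a1, a2, _, _, a5) := a in let: (x1, x2, x3) := z in
  a5 + a1 * x2 ^+ 2 / 2 - a2 * x3 + a1 * a2 * x2.
Definition base_left (a : B5 R) z : R * R * R := let: (a1, a2, a3, _, _) := a in
  let: (x1, x2, x3) := z in (a1 + x1, a2 + x2, a3 + x3 - a1 * x2).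

Lemma cartan_mul_slice (a : B5 R) z y t :
  cartan_mul a (z, y, t) = (base_left a z, y + shift4 a z, t + shift5 a z).
Proof.
case: a => [[[[a1 a2] a3] a4] a5]; case: z => [[x1 x2] x3].
by rewrite /cartan_mul /=; do !congr (_, _); ring.
Qed.

Lemma preserves_plane (s t : R) :
  preserves (leb \x leb)%E (fun w : R * R => (w.1 + s, w.2 + t)).
Proof.
have := preserves_shear (m := leb) false (lebesgue_translation s) (measurable_cst t).
by rewrite (_ : (fun z : R * R => _) = (fun w : R * R => (w.1 + s, w.2 + t)))//; apply/funext => w;
  rewrite expr0 mul1r.
Qed.

Lemma Rintegral_plane (f : R * R -> R) (s t : R) :
  measurable_fun setT (f : measurableTypeR R * measurableTypeR R -> R) ->
  \int[(leb \x leb)%E]_w f (w.1 + s, w.2 + t) = \int[(leb \x leb)%E]_w f w.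
Proof.
move=> mf; rewrite /Rintegral; congr fine.
have mE : measurable_fun setT (EFin \o f : measurableTypeR R * measurableTypeR R -> \bar R).
  exact/measurable_EFinP.
exact: (preserves_integral (m := sf_prod leb leb) (preserves_plane s t) mE).
Qed.

Lemma plane_fourier_shift (g h : R * R -> R) l m s t : plane_nice g -> plane_nice h ->
  plane_fourier (fun w => g (w.1 + s, w.2 + t)) (fun w => h (w.1 + s, w.2 + t)) l m =
  cos (l * s + m * t) * plane_fourier g h l m - sin (l * s + m * t) * plane_fourier h (\- g) l m.
Proof.
move=> ng nh; have nn := plane_niceN ng.
have i1 := plane_kernel_integrable l m ng nh; have i2 := plane_kernel_integrable l m nh nn.
have [mg _ _] := ng; have [mh _ _] := nh.
rewrite /plane_fourier -!RintegralZl// -RintegralB//; last 2 first.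
- exact: integrable_scale i1.
- exact: integrable_scale i2.
pose th : R := l * s + m * t.
pose W (w : R * R) := g w * cos (l * w.1 + m * w.2 - th) + h w * sin (l * w.1 + m * w.2 - th).
have mt : measurable_fun setT (fun yz : measurableTypeR R * measurableTypeR R => l * yz.1 + m * yz.2 - th).
  by measurable_tac.
have mW : measurable_fun setT (W : measurableTypeR R * measurableTypeR R -> R).
  exact: (measurable_funD (measurable_funM mg (measurable_cosc mt)) (measurable_funM mh (measurable_sinc mt))).
apply: (eq_trans _ (eq_trans (Rintegral_plane s t mW) _)).
  apply: eq_Rintegral => w _; rewrite /W /th /=.
  have -> : l * (w.1 + s) + m * (w.2 + t) - (l * s + m * t) = l * w.1 + m * w.2 by ring.
  by [].
by apply: eq_Rintegral => w _; rewrite /W cosB sinB /=; ring.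
Qed.

Lemma fourier_left (a : B5 R) f z l m : schwartz f ->
  F (fun x => f (cartan_mul a x)) (z, l, m) =
  cis (l * shift4 a z + m * shift5 a z) * F f (base_left a z, l, m).
Proof.
move=> /schwartzP[S1 S2]; apply/eqP; rewrite eq_complex; apply/andP.
set th := l * _ + _; set w := base_left a z.
have -> : complex.Re (cis th * F f (w, l, m)) = cos th * Ref (F f) (w, l, m) - sin th * Imf (F f) (w, l, m).
  by rewrite /Ref /Imf; case: (F f _).
have -> : complex.Im (cis th * F f (w, l, m)) = cos th * Imf (F f) (w, l, m) + sin th * Ref (F f) (w, l, m).
  by rewrite /Ref /Imf; case: (F f _).
rewrite -!/(Ref _ _) -!/(Imf _ _).
have [-> ->] := fourier_components (fun x => f (cartan_mul a x)) z l m.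
have [-> ->] := fourier_components f w l m.
have sl p : slice (fun x => p (cartan_mul a x)) z = fun v => slice p w (v.1 + shift4 a z, v.2 + shift5 a z).
  by apply/funext => v; rewrite /slice cartan_mul_slice.
have A1 := slice_nice w S1; have A2 := slice_nice w S2.
have -> : Ref (fun x => f (cartan_mul a x)) = fun x => Ref f (cartan_mul a x) by [].
have -> : Imf (fun x => f (cartan_mul a x)) = fun x => Imf f (cartan_mul a x) by [].
rewrite !sl; split; apply/eqP.
  by rewrite plane_fourier_shift//; ring.
have := plane_fourier_shift l m (shift4 a z) (shift5 a z) A2 (plane_niceN A1).
set P := plane_fourier (\- _) _ _ _; move=> /= ->.
have -> : P = - plane_fourier (slice (Ref f) w) (slice (Imf f) w) l m.
  rewrite /P /plane_fourier -mulN1r -RintegralZl//; last exact: (plane_kernel_integrable l m A1 A2).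
  by apply: eq_Rintegral => v _ /=; ring.
rewrite -/th; ring.
Qed.

End CartanFourier.

(** * The operator B on the Fourier side *)

Section FourierOperators.
Variable R : realType.
Notation V := (LfunType (@haar R) (one_le_two R) * LfunType (@haar R) (one_le_two R))%type.
Notation F := (@partial_fourier R).
Notation normc := ComplexField.Normc.normc.
Implicit Types (f g : B5 R -> R[i]) (x a : B5 R) (u v w : V).

Definition fourier_rel u uh := L2_fourier (cfun u) (cfun uh).

Lemma fourier_relP u uh : fourier_rel u uh <-> exists phi : nat -> B5 R -> R[i],
    [/\ forall n, schwartz (phi n), ncvg (vip R) (fun n => vec (phi n)) u
      & ncvg (vip R) (fun n => vec (F (phi n))) uh].
Proof. by apply: closureP => f Sf; exact: fourier_L2. Qed.

Lemma vecB f g : inLp 2 f -> inLp 2 g -> vec (fun x => f x - g x) = vec f - vec g.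
Proof.
move=> Lf Lg; rewrite -[RHS]cfunK; congr vec.
by rewrite cfunB !vecK.
Qed.

Lemma schwartzB f g : schwartz f -> schwartz g -> schwartz (fun x => f x - g x).
Proof.
move=> /schwartzP[f1 f2] /schwartzP[g1 g2]; apply/schwartzP.
have -> : Ref (fun x => f x - g x) = fun x => Ref f x - Ref g x by apply/funext => x; exact: ReB.
have -> : Imf (fun x => f x - g x) = fun x => Imf f x - Imf g x by apply/funext => x; exact: ImB.
by split; exact: rschwartzB.
Qed.

Lemma ncvgB (x y : nat -> V) l k : ncvg (vip R) x l -> ncvg (vip R) y k ->
  ncvg (vip R) (fun n => x n - y n) (l - k).
Proof.
move=> xl yk; have := ncvgD xl (ncvgZ (-1) yk).
by rewrite scaleN1r; apply: eq_ncvg => n; rewrite scaleN1r.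
Qed.

Lemma fourier_relB u uh v vh : fourier_rel u uh -> fourier_rel v vh ->
  fourier_rel (u - v) (uh - vh).
Proof.
move=> /fourier_relP[p [Sp p1 p2]] /fourier_relP[q [Sq q1 q2]]; apply/fourier_relP.
exists (fun n x => p n x - q n x); split.
- by move=> n; exact: schwartzB.
- apply: (eq_ncvg _ (ncvgB p1 q1)) => n.
  by rewrite (vecB (schwartz_L2 (Sp n)) (schwartz_L2 (Sq n))).
- apply: (eq_ncvg _ (ncvgB p2 q2)) => n.
  by rewrite (fourierB (Sp n) (Sq n)) (vecB (fourier_L2 (Sp n)) (fourier_L2 (Sq n))).
Qed.

Lemma nsq_fourier_rel u uh : fourier_rel u uh -> nsq (vip R) u = nsq (vip R) uh.
Proof.
move=> /fourier_relP[p [Sp p1 p2]].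
have h1 := ncvg_nsq p1; have h2 := ncvg_nsq p2.
rewrite (eq_cvg _ _ (fun n => nsq_fourier (Sp n))) in h2.
exact: (cvg_unique (@Rhausdorff R) h1 h2).
Qed.

Let ip_half (a b c d : R) : a - 2 * c + b = a - 2 * d + b -> c = d.
Proof. by move=> H; lra. Qed.

(** Polarization: isometry at [u], [v] and [u - v]. *)
Lemma ip_fourier_rel u uh v vh : fourier_rel u uh -> fourier_rel v vh ->
  vip R u v = vip R uh vh.
Proof.
move=> hu hv; have := nsq_fourier_rel (fourier_relB hu hv).
rewrite !nsqB (nsq_fourier_rel hu) (nsq_fourier_rel hv) => H.
exact: (ip_half H).
Qed.

Definition dual_map a x : B5 R := (base_left a x.1.1, x.1.2, x.2).

Lemma dual_map_preserves a : preserves (@haar R) (dual_map a).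
Proof.
case: a => [[[[a1 a2] a3] a4] a5].
have h := @preserves_triangular R false a1 (fun=> a2) (fun t => a3 - a1 * t.2) (fun=> 0) (fun=> 0).
rewrite (_ : dual_map _ = triangular false a1 (fun=> a2) (fun t => a3 - a1 * t.2) (fun=> 0) (fun=> 0)).
  by apply: h; measurable_tac.
apply/funext => -[[[[x1 x2] x3] x4] x5].
by rewrite /dual_map /triangular /= expr0 !mul1r !addr0; do !congr (_, _); ring.
Qed.

Definition phase a x := x.1.2 * shift4 a x.1.1 + x.2 * shift5 a x.1.1.

Lemma measurable_phase a : measurable_fun setT (phase a).
Proof.
case: a => [[[[a1 a2] a3] a4] a5].
rewrite (_ : phase _ = fun x : B5 R =>
   x.1.2 * (a4 + a1 ^+ 2 * x.1.1.1.2 / 2 - a1 * x.1.1.2) +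
   x.2 * (a5 + a1 * x.1.1.1.2 ^+ 2 / 2 - a2 * x.1.1.2 + a1 * a2 * x.1.1.1.2)).
  by measurable_tac.
by apply/funext => -[[[[x1 x2] x3] x4] x5].
Qed.

(** Left translation as seen after the partial Fourier transform: a measure-preserving change of the
    first three coordinates and a factor of modulus one. *)
Definition dual_left a f x : R[i] := cis (phase a x) * f (dual_map a x).

Lemma normc_dual_left a f x : normc (dual_left a f x) = normc (f (dual_map a x)).
Proof. by rewrite /dual_left ComplexField.Normc.normcM normc_cis mul1r. Qed.

Lemma dual_left_L2 a f : inLp 2 f -> inLp 2 (dual_left a f).
Proof.
move=> Lf; have pT := dual_map_preserves a; have [m1 m2 h] := inLp_comp pT Lf.
have mc := measurable_cosc (measurable_phase a); have ms := measurable_sinc (measurable_phase a).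
split.
- rewrite (_ : (fun x => complex.Re _) = fun x => cos (phase a x) * complex.Re (f (dual_map a x))
     - sin (phase a x) * complex.Im (f (dual_map a x))).
    exact: (measurable_funB (measurable_funM mc m1) (measurable_funM ms m2)).
  by apply/funext => x; rewrite /dual_left; case: (f _).
- rewrite (_ : (fun x => complex.Im _) = fun x => cos (phase a x) * complex.Im (f (dual_map a x))
     + sin (phase a x) * complex.Re (f (dual_map a x))).
    exact: (measurable_funD (measurable_funM mc m2) (measurable_funM ms m1)).
  by apply/funext => x; rewrite /dual_left; case: (f _).
- move: h; rewrite !Lp_norm2E.
  have -> // : (fun x => normc (dual_left a f x)) = fun x => normc (f (dual_map a x)).
  by apply/funext => x; rewrite normc_dual_left.
Qed.

Definition dual_vec a u : V := vec (dual_left a (cfun u)).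

Lemma cfun_dual_vec a u : cfun (dual_vec a u) = dual_left a (cfun u).
Proof. exact: (vecK (dual_left_L2 a (inLp_cfun u))). Qed.

Lemma dual_vecB a u v : dual_vec a (u - v) = dual_vec a u - dual_vec a v.
Proof.
apply: cfun_inj; rewrite cfunB !cfun_dual_vec cfunB; apply/funext => x.
by rewrite /dual_left mulrBr.
Qed.

Lemma nsq_dual_vec a u : nsq (vip R) (dual_vec a u) = nsq (vip R) u.
Proof.
rewrite -(nsq_vcomp (dual_map_preserves a) u); apply: EFin_inj.
rewrite (nsq_normc (dual_vec a u)) cfun_dual_vec (nsq_normc (vcomp _ u)) (cfun_vcomp (dual_map_preserves a)).
by apply: eq_integral => x _; rewrite normc_dual_left.
Qed.

Lemma dual_vec_cvg a (x : nat -> V) l : ncvg (vip R) x l -> ncvg (vip R) (dual_vec a \o x) (dual_vec a l).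
Proof. by rewrite /ncvg; under eq_fun do rewrite -(nsq_dual_vec a (_ - _)) dual_vecB. Qed.

Lemma fourier_rel_left a u uh : fourier_rel u uh ->
  fourier_rel (vcomp (cartan_mul a) u) (dual_vec a uh).
Proof.
have pT := haar_left a.
move=> /fourier_relP[p [Sp p1 p2]]; apply/fourier_relP; exists (fun n x => p n (cartan_mul a x)); split.
- by move=> n; exact: schwartz_left.
- apply: (eq_ncvg _ (vcomp_cvg pT p1)) => n.
  exact: (vcomp_vec _ (schwartz_L2 (Sp n))).
- apply: (eq_ncvg _ (dual_vec_cvg a p2)) => n.
  rewrite /dual_vec /= (vecK (fourier_L2 (Sp n))); congr vec.
  by apply/funext => -[[z l] m]; rewrite (fourier_left a z l m (Sp n)).
Qed.

(** The inverse of 0 is 0 here, which affects only the null sets where a frequency vanishes. *)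
Definition inverse_symbol x : R := x.1.2 ^- 2 + x.2 ^- 2.

Lemma measurable_inverse_symbol : measurable_fun setT inverse_symbol.
Proof.
have h : measurable_fun setT (fun s : R => s ^- 2).
  rewrite (_ : (fun s : R => s ^- 2) = (fun s => (s ^+ 2) `^ (-1))).
    exact: (measurableT_comp (measurable_powR (-1)) (measurable_funX 2 (@measurable_id _ _ _))).
  by apply/funext => s; rewrite powR_inv1// sqr_ge0.
have m1 : measurable_fun setT (fun x : B5 R => x.1.2) by measurable_tac.
have m2 : measurable_fun setT (fun x : B5 R => x.2) by measurable_tac.
exact: (measurable_funD (measurableT_comp h m1) (measurableT_comp h m2)).
Qed.

Lemma inverse_opP u m : inverse_op (cfun u) (cfun m) <-> exists uh mh : V,
  [/\ fourier_rel u uh, fourier_rel m mh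
    & aeq (cfun mh) (fun x => (inverse_symbol x)%:C%C * cfun uh x)].
Proof.
have E (f : B5 R -> R[i]) : (fun x : B5 R => let: (x1, x2, x3, lam, mu) := x in
   (lam ^- 2 + mu ^- 2)%:C%C * f (x1, x2, x3, lam, mu)) = (fun x => (inverse_symbol x)%:C%C * f x).
  by apply/funext => -[[[[x1 x2] x3] lam] mu].
split=> [[uh [mh [h1 h2 h3]]]|[uh [mh [h1 h2 h3]]]].
  have [_ Lu _] := h1; have [_ Lm _] := h2; exists (vec uh), (vec mh).
  by rewrite /fourier_rel !vecK//; split => //; rewrite -E.
by exists (cfun uh), (cfun mh); split=> //; rewrite E.
Qed.

(** The symbol depends on the frequencies only, and these are fixed by [dual_map]; hence it commutes
    with the phase and the change of base. *)
Lemma inverse_op_left a u m : inverse_op (cfun u) (cfun m) ->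
  inverse_op (cfun (vcomp (cartan_mul a) u)) (cfun (vcomp (cartan_mul a) m)).
Proof.
move=> /inverse_opP[uh [mh [h1 h2 h3]]]; apply/inverse_opP.
exists (dual_vec a uh), (dual_vec a mh); split; [exact: fourier_rel_left|exact: fourier_rel_left|].
rewrite !cfun_dual_vec; have := vcomp_aeq (dual_map_preserves a) h3.
by apply: ae_haarS => x hx; rewrite /dual_left hx mulrCA.
Qed.

Lemma B_op_left a u w : B_op (cfun u) (cfun w) ->
  B_op (cfun (vcomp (cartan_mul a) u)) (cfun (vcomp (cartan_mul a) w)).
Proof.
have pT := haar_left a.
move=> [_ [b [m [h1 h2 h3]]]]; split; first exact: inLp_cfun.
have [_ Lb _] := h1; have [uh [mh [_ [Lm _ _] _]]] := h2.
move: h1 h2 h3; rewrite -(vecK Lb) -(vecK Lm) => h1 h2 h3.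
exists (cfun (vcomp (cartan_mul a) (vec b))), (cfun (vcomp (cartan_mul a) (vec m))).
split; [exact: laplace_op_left|exact: inverse_op_left|].
rewrite !(cfun_vcomp pT); exact: (vcomp_aeq pT h3).
Qed.

Lemma B_opP u w : B_op (cfun u) (cfun w) -> exists b m : V,
  [/\ laplace_op (cfun u) (cfun b), inverse_op (cfun u) (cfun m)
    & nequiv (vip R) w (b + m)].
Proof.
move=> [_ [b [m [h1 h2 h3]]]].
have [_ Lb _] := h1; have [uh [mh [_ [Lm _ _] _]]] := h2.
exists (vec b), (vec m); rewrite !vecK//; split => //.
by apply/nequiv_aeq; rewrite cfunD !vecK.
Qed.

Lemma L2_measurable (h : LfunType (@haar R) (one_le_two R)) : measurable_fun setT (h : B5 R -> R).
Proof. exact: (L2P h).1. Qed.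

Lemma vip_integrable u v : haar.-integrable setT (EFin \o (fun x => u.1 x * v.1 x + u.2 x * v.2 x)).
Proof.
exact: integrable_add (square_integrable_mul (L2P u.1) (L2P v.1)) (square_integrable_mul (L2P u.2) (L2P v.2)).
Qed.

Lemma vip_Rintegral u v : vip R u v = \int[haar]_x (u.1 x * v.1 x + u.2 x * v.2 x).
Proof.
have i1 := square_integrable_mul (L2P u.1) (L2P v.1).
exact: (esym (RintegralD measurableT i1 (square_integrable_mul (L2P u.2) (L2P v.2)))).
Qed.

Lemma haar_ae_eq_integral (f g : B5 R -> \bar R) : measurable_fun setT f -> measurable_fun setT g ->
  {ae haar, forall x, f x = g x} -> (\int[haar]_x f x = \int[haar]_x g x)%E.
Proof.
move=> mf mg [N [mN N0 sN]].
have fg : ae_eq haar setT f g.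
  by exists N; split=> // x /= h; apply: sN => /= e; apply: h => _.
exact: (@ae_eq_integral _ _ R haar setT g f measurableT mf mg fg).
Qed.

Let multiplier_point (c : R) v w x : cfun w x = c%:C%C * cfun v x ->
  w.1 x * v.1 x + w.2 x * v.2 x = c * normc (cfun v x) ^+ 2.
Proof.
move=> hx; have e1 := congr1 (@complex.Re R) hx; have e2 := congr1 (@complex.Im R) hx.
rewrite normc_sq; move: e1 e2; rewrite /= => -> ->; ring.
Qed.

Lemma vip_multiplier (s : B5 R -> R) v w : measurable_fun setT s ->
  aeq (cfun w) (fun x => (s x)%:C%C * cfun v x) ->
  ((vip R w v)%:E = \int[haar]_x (s x * normc (cfun v x) ^+ 2)%:E)%E.
Proof.
move=> ms h.
rewrite vip_Rintegral /Rintegral (fineK (integrable_fin_num measurableT (vip_integrable w v))).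
apply: haar_ae_eq_integral.
- exact: (measurable_int _ (vip_integrable w v)).
- have [m1 m2 _] := inLp_cfun v; apply/measurable_EFinP.
  exact: (measurable_funM ms (measurable_funX 2 (measurable_normc m1 m2))).
- exact: (ae_haarS (fun x hx => congr1 EFin (multiplier_point hx)) h).
Qed.

Lemma nsq_normcE u : ((nsq (vip R) u)%:E = \int[haar]_x (normc (cfun u x) ^+ 2)%:E)%E.
Proof. exact: nsq_normc. Qed.

Lemma measurable_modulus u : measurable_fun setT (fun x => normc (cfun u x)).
Proof. by have [m1 m2 _] := inLp_cfun u; exact: measurable_normc. Qed.

Definition central (t : R) : B5 R := (0, 0, 0, t, 0).

(** By centrality the flow of X_4, a right translation, is also a left translation, so its action on
    the Fourier side is already known to be a phase. *)
Lemma flow4 t x : flow 4 t x = cartan_mul (central t) x.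
Proof.
case: x => [[[[x1 x2] x3] x4] x5].
rewrite /flow /central /cartan_mul /basis_vec /GRing.scale /= /GRing.scale /=.
by do !congr (_, _); ring.
Qed.

Lemma dual_left_central t f x : dual_left (central t) f x = cis (x.1.2 * t) * f x.
Proof.
case: x => [[[[x1 x2] x3] x4] x5]; rewrite /dual_left /phase /dual_map /central /=.
by congr (cis _ * f _); [ring|do !congr (_, _); ring].
Qed.

Lemma normc_cisB1 (s : R) (z : R[i]) :
  normc (cis s * z - z) ^+ 2 = ((cos s - 1) ^+ 2 + sin s ^+ 2) * normc z ^+ 2.
Proof. by rewrite !normc_sq; case: z => p q /=; ring. Qed.

(** The squared modulus of the difference quotient of e^{i s t} at t = 0, along t = 1/(n+1). *)
Lemma difference_quotient_cvg (s : R) :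
  (n.+1%:R) ^+ 2 * ((cos (s * n.+1%:R^-1) - 1) ^+ 2 + sin (s * n.+1%:R^-1) ^+ 2)
    @[n --> \oo] --> s ^+ 2.
Proof.
have dl : is_derive (0 : R) 1 (fun t : R => s * t) s.
  have -> : s = s + 2 * 0 * 0 by rewrite mulr0 addr0.
  by apply: (@quad_derive R _ 0 0 s 0) => t; ring.
have d1 := is_derive1_comp (f := cos) (g := fun t : R => s * t) (is_derive_cos (s * 0)) dl.
have d2 := is_derive1_comp (f := sin) (g := fun t : R => s * t) (is_derive_sin (s * 0)) dl.
have /is_deriveE c1 := d1; have /is_deriveE c2 := d2.
have H : n.+1%:R^-1 @[n --> \oo] --> (0 : R)^'.
  move=> P; rewrite /dnbhs /within /= => hP; 
  have h : \forall n \near \oo, (n.+1%:R^-1 : R) != 0 -> P (n.+1%:R^-1) by exact: (@cvg_harmonic R _ hP).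
  change (\forall n \near \oo, P (n.+1%:R^-1)).
  by apply: filterS h => n; apply; rewrite invr_eq0 pnatr_eq0.
have k1 : n.+1%:R * (cos (s * n.+1%:R^-1) - 1) @[n --> \oo] --> 0.
  have := cvg_comp _ _ H c1; rewrite mulr0 sin0 oppr0 mul0r.
  apply: cvg_trans; apply: near_eq_cvg; apply: nearW => n /=.
  by rewrite /GRing.scale /= mulr1 addr0 mulr0 cos0 invrK.
have k2 : n.+1%:R * sin (s * n.+1%:R^-1) @[n --> \oo] --> s.
  have := cvg_comp _ _ H c2; rewrite mulr0 cos0 mul1r.
  apply: cvg_trans; apply: near_eq_cvg; apply: nearW => n /=.
  by rewrite /GRing.scale /= mulr1 addr0 mulr0 sin0 subr0 invrK.
have k3 : n.+1%:R * (cos (s * n.+1%:R^-1) - 1) * (n.+1%:R * (cos (s * n.+1%:R^-1) - 1)) +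
    n.+1%:R * sin (s * n.+1%:R^-1) * (n.+1%:R * sin (s * n.+1%:R^-1)) @[n --> \oo] --> 0 * 0 + s * s.
  by apply: cvgD; exact: cvgM.
move: k3; rewrite mul0r add0r -expr2.
apply: cvg_trans; apply: near_eq_cvg; apply: nearW => n /=.
by rewrite -!expr2 !exprMn -mulrDr.
Qed.

Lemma haar_integralZl (k : R) (f : B5 R -> \bar R) : 0 <= k -> measurable_fun setT f ->
  (forall x, 0 <= f x)%E -> (\int[haar]_x (k%:E * f x) = k%:E * \int[haar]_x f x)%E.
Proof. by move=> k0 mf f0; rewrite ge0_integralZl. Qed.

Let cancel_scale (t N K W : R) : t ^+ 2 * N ^+ 2 = 1 -> K * W = t ^+ 2 * (N ^+ 2 * K * W).
Proof. by move=> h; rewrite -[LHS]mul1r -h; ring. Qed.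

Let two_le (s : R) : s != 0 -> 2 <= s ^+ 2 + s ^- 2.
Proof.
move=> s0; have := sqr_ge0 (s - s^-1); rewrite -exprVn.
have -> : (s - s^-1) ^+ 2 = s ^+ 2 + s^-1 ^+ 2 - 2 * (s / s) by ring.
by rewrite mulfV//; lra.
Qed.

(** No rule for the transform of a derivative is required. The increment of u along X_4 over time t
    has squared norm at most t^2 <b, u>; on the Fourier side it is the integral of |e^{i lambda t} -
    1|^2 |uh|^2, and Fatou's lemma takes the limit of the quotient by t^2. *)
Lemma frequency_bound u (b uh : V) : laplace_op (cfun u) (cfun b) -> fourier_rel u uh ->
  (\int[haar]_x (x.1.2 ^+ 2 * normc (cfun uh x) ^+ 2)%:E <= (vip R b u)%:E)%E.
Proof.
move=> Hb Hu; have mW := measurable_funX 2 (measurable_modulus uh).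
pose T (n : nat) : R := n.+1%:R^-1.
pose c n (s : R) := (n.+1%:R) ^+ 2 * ((cos (s * T n) - 1) ^+ 2 + sin (s * T n) ^+ 2).
have ml n : measurable_fun setT (fun x : B5 R => x.1.2 * T n) by measurable_tac.
have mc n : measurable_fun setT (fun x : B5 R => c n x.1.2).
  have k1 := measurable_funB (measurable_cosc (ml n)) (measurable_cst (1 : R)).
  exact: (measurable_funM (measurable_cst _) (measurable_funD (measurable_funX 2 k1)
     (measurable_funX 2 (measurable_sinc (ml n))))).
pose G n x := (c n x.1.2 * normc (cfun uh x) ^+ 2)%:E.
have c0 n s : 0 <= c n s by rewrite mulr_ge0 ?sqr_ge0// addr_ge0 ?sqr_ge0.
have mG n : measurable_fun setT (G n).
  by apply/measurable_EFinP; exact: (measurable_funM (mc n) mW).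
have G0 n x : (0 <= G n x)%E by rewrite lee_fin mulr_ge0 ?c0 ?sqr_ge0.
have GI n : (\int[haar]_x G n x <= (vip R b u)%:E)%E.
  have T0 : 0 <= T n by rewrite invr_ge0 ler0n.
  have j4 : 4%N \in indices by [].
  have := increment_flow j4 T0 Hb.
  have -> : flow 4 (T n) = cartan_mul (central (T n)) by apply/funext => x; exact: flow4.
  have Hd := fourier_relB (fourier_rel_left (central (T n)) Hu) Hu.
  rewrite (nsq_fourier_rel Hd) -lee_fin nsq_normcE cfunB cfun_dual_vec => h.
  have E x : (normc (dual_left (central (T n)) (cfun uh) x - cfun uh x) ^+ 2)%:E =
     ((T n ^+ 2)%:E * G n x)%E.
    rewrite dual_left_central normc_cisB1 /G -EFinM; congr (_%:E).
    have TN : T n ^+ 2 * n.+1%:R ^+ 2 = 1 by rewrite -exprMn mulVf ?pnatr_eq0// expr1n.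
    exact: cancel_scale TN.
  have Tp : 0 < T n ^+ 2 by rewrite exprn_gt0// invr_gt0 ltr0n.
  have EI : (\int[haar]_x (normc (dual_left (central (T n)) (cfun uh) x - cfun uh x) ^+ 2)%:E =
     (T n ^+ 2)%:E * \int[haar]_x G n x)%E.
    rewrite -(haar_integralZl (ltW Tp) (mG n) (G0 n)).
    by apply: eq_integral => x _; rewrite E.
  by move: h; rewrite EI (EFinM (T n ^+ 2) (vip R b u)) lee_pmul2l ?lte_fin.
have Gl x : G n x @[n --> \oo] --> (x.1.2 ^+ 2 * normc (cfun uh x) ^+ 2)%:E.
  apply: cvg_EFin; first exact: nearW.
  by apply: cvgM; [exact: difference_quotient_cvg|exact: cvg_cst].
have FT := @fatou _ _ R haar setT measurableT G mG (fun n x _ => G0 n x).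
apply: le_trans (_ : (limn_einf (fun n => \int[haar]_x G n x) <= _)%E).
  apply: le_trans FT; rewrite le_eqVlt; apply/orP; left; apply/eqP; apply: eq_integral => x _.
  by rewrite is_cvg_limn_einfE; [apply/esym/cvg_lim|apply: cvgP (Gl x)].
rewrite limn_einf_lim; apply: lime_le; first exact: is_cvg_einfs.
apply: nearW => n; apply: le_trans (GI n).
by apply: ereal_inf_lbound; exists n => /=.
Qed.

Lemma frequency_neq0 : {ae (@haar R), forall x, x.1.2 != 0}.
Proof.
pose leb := @lebesgue_measure R.
pose s2 := sf_prod leb leb; pose s3 := sf_prod s2 leb.
pose A : set (R * R * R * R) := setT `*` [set 0].
have mA : measurable A by apply: measurableX => //; exact: measurable_set1.
exists (A `*` setT); split.
- exact: measurableX.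
- rewrite [LHS](_ : _ = (sf_prod s3 leb A * leb setT)%E); last first.
    exact: (@product_measure1E _ _ _ _ R (sf_prod s3 leb) leb A setT mA measurableT).
  rewrite [X in (X * _)%E](_ : _ = (s3 setT * leb [set 0%R])%E); last first.
    exact: (@product_measure1E _ _ _ _ R s3 leb setT [set 0] measurableT (measurable_set1 _)).
  have -> : leb [set 0%R] = 0%E by exact: lebesgue_measure_set1.
  by rewrite mule0 mul0e.
- by move=> -[[z l] m] /= /negP; rewrite negbK => /eqP ->.
Qed.

Lemma inverse_op_ge0 u m : inverse_op (cfun u) (cfun m) -> 0 <= vip R m u.
Proof.
move=> /inverse_opP[uh [mh [h1 h2 h3]]]; rewrite (ip_fourier_rel h2 h1) -lee_fin.
rewrite (vip_multiplier _ h3).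
  apply: integral_ge0 => x _; rewrite lee_fin mulr_ge0 ?sqr_ge0//.
  by rewrite addr_ge0// invr_ge0 sqr_ge0.
exact: measurable_inverse_symbol.
Qed.

Lemma energy_gap u w : B_op (cfun u) (cfun w) -> 2 * nsq (vip R) u <= vip R w u.
Proof.
move=> /B_opP[b [m [Hb Hm Hw]]]; rewrite (nequiv_ipl _ Hw) ipDl.
have /inverse_opP[uh [mh [h1 h2 h3]]] := Hm.
have FB := frequency_bound Hb h1.
have mW := measurable_funX 2 (measurable_modulus uh).
have ms := measurable_inverse_symbol.
have E1 := vip_multiplier ms h3; rewrite -(ip_fourier_rel h2 h1) in E1.
have s0 x : 0 <= inverse_symbol x by rewrite addr_ge0// invr_ge0 sqr_ge0.
have ml : measurable_fun setT (fun x : B5 R => x.1.2 ^+ 2) by measurable_tac.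
suff key : (2%:E * \int[haar]_x (normc (cfun uh x) ^+ 2)%:E <= (vip R b u)%:E +
    \int[haar]_x (inverse_symbol x * normc (cfun uh x) ^+ 2)%:E)%E.
  by move: key; rewrite -nsq_normcE -E1 -(nsq_fourier_rel h1) -lee_fin.
apply: le_trans (leeD2r _ FB).
have mWE : measurable_fun setT (fun x => (normc (cfun uh x) ^+ 2)%:E) by exact/measurable_EFinP.
have m1 : measurable_fun setT (fun x => (x.1.2 ^+ 2 * normc (cfun uh x) ^+ 2)%:E).
  by apply/measurable_EFinP; exact: (measurable_funM ml mW).
have m2 : measurable_fun setT (fun x => (inverse_symbol x * normc (cfun uh x) ^+ 2)%:E).
  by apply/measurable_EFinP; exact: (measurable_funM ms mW).
have p1 x : (0 <= (x.1.2 ^+ 2 * normc (cfun uh x) ^+ 2)%:E)%E by rewrite lee_fin mulr_ge0 ?sqr_ge0.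
have p2 x : (0 <= (inverse_symbol x * normc (cfun uh x) ^+ 2)%:E)%E.
  by rewrite lee_fin mulr_ge0 ?sqr_ge0.
rewrite -ge0_integralZl//; last by move=> x _; rewrite lee_fin sqr_ge0.
rewrite -ge0_integralD//.
apply: ae_ge0_le_integral => //.
- by move=> x _; rewrite -EFinM lee_fin mulr_ge0 ?sqr_ge0.
- exact: measurable_funeM.
- by move=> x _; rewrite adde_ge0.
- exact: emeasurable_funD.
- move: frequency_neq0; apply: ae_haarS => x l0 _; rewrite -EFinM -EFinD lee_fin -mulrDl.
  apply: ler_wpM2r; first exact: sqr_ge0.
  (* The nonnegative term of the second frequency is dropped; a single frequency already yields the
     gap. *)
  rewrite /inverse_symbol addrA; apply: le_trans (_ : x.1.2 ^+ 2 + x.1.2 ^- 2 <= _); last first.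
    by rewrite lerDl invr_ge0 sqr_ge0.
  exact: two_le.
Qed.

End FourierOperators.

(** * The Nash inequality and smoothing *)

Section Smoothing.
Variable R : realType.
Notation V := (LfunType (@haar R) (one_le_two R) * LfunType (@haar R) (one_le_two R))%type.
Notation normc := ComplexField.Normc.normc.
Notation leb := (@lebesgue_measure R).
Implicit Types (f g : B5 R -> R[i]) (h k : B5 R -> R) (x y a : B5 R) (u v w : V).

Definition sf_haar := sf_prod (sf_prod (sf_prod (sf_prod leb leb) leb) leb) leb.

Lemma haar_tonelli (F : B5 R * B5 R -> \bar R) : measurable_fun setT F -> (forall z, 0 <= F z)%E ->
  (\int[haar]_x \int[haar]_y F (x, y) = \int[haar]_y \int[haar]_x F (x, y))%E.
Proof. by move=> mF F0; exact: (@fubini_tonelli _ _ _ _ R sf_haar sf_haar F mF F0). Qed.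

Lemma measurable_haar_inner (F : B5 R * B5 R -> \bar R) : measurable_fun setT F ->
  (forall z, 0 <= F z)%E -> measurable_fun setT (fun x => \int[haar]_y F (x, y))%E.
Proof. by move=> mF F0; exact: (@measurable_fun_fubini_tonelli_F _ _ _ _ R sf_haar F mF F0). Qed.

Lemma haar_le_integral (f g : B5 R -> \bar R) : measurable_fun setT f -> measurable_fun setT g ->
  (forall x, 0 <= f x)%E -> (forall x, f x <= g x)%E -> (\int[haar]_x f x <= \int[haar]_x g x)%E.
Proof.
by move=> mf mg f0 fg; apply: ge0_le_integral => //.
Qed.

Lemma haar_integralD (f g : B5 R -> \bar R) : measurable_fun setT f -> measurable_fun setT g ->
  (forall x, 0 <= f x)%E -> (forall x, 0 <= g x)%E ->
  (\int[haar]_x f x + \int[haar]_x g x = \int[haar]_x (f x + g x))%E.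
Proof. by move=> mf mg f0 g0; rewrite -ge0_integralD. Qed.

Lemma measurable_haar_Rintegral (F : B5 R * B5 R -> R) : measurable_fun setT F ->
  measurable_fun setT (fun x => \int[haar]_y F (x, y)).
Proof.
move=> mF; have mE : measurable_fun setT (EFin \o F) by exact/measurable_EFinP.
have Mp := measurable_haar_inner (measurable_funepos mE) (funepos_ge0 _).
have Mn := measurable_haar_inner (measurable_funeneg mE) (funeneg_ge0 _).
apply: (measurableT_comp (fine_measurable measurableT)).
rewrite (_ : (fun x => _) = ((fun x => \int[haar]_y (EFin \o F)^\+ (x, y)) \-
   (fun x => \int[haar]_y (EFin \o F)^\- (x, y)))%E).
  exact: emeasurable_funB.
apply/funext => x; rewrite [LHS]integralE.
by congr (_ - _)%E; apply: eq_integral => y _; rewrite !unlock.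
Qed.

Lemma measurable_convolution h k : measurable_fun setT h -> measurable_fun setT k ->
  measurable_fun setT (fun z : B5 R * B5 R => h (cartan_mul z.1 z.2) * k z.2).
Proof.
move=> mh mk; apply: measurable_funM; last exact: measurableT_comp mk measurable_snd.
exact: (measurableT_comp mh (@measurable_cartan_mul R)).
Qed.

Definition modulus u x : R := normc (cfun u x).

Lemma modulus_ge0 u x : 0 <= modulus u x. Proof. exact: normc_ge0. Qed.

Lemma modulus_square_integrable u : square_integrable haar (modulus u).
Proof.
split; first exact: measurable_modulus.
by rewrite -[X in (X < _)%E]nsq_normc ltry.
Qed.

Let cauchy_plane (p q r s A B : R) : 0 <= A -> 0 <= B -> A ^+ 2 = p ^+ 2 + q ^+ 2 ->
  B ^+ 2 = r ^+ 2 + s ^+ 2 -> `|p * r + q * s| <= A * B.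
Proof.
move=> A0 B0 Ae Be; rewrite -(@ler_pXn2r _ 2)// ?nnegrE ?mulr_ge0// real_normK ?num_real//.
rewrite exprMn Ae Be; have -> : (p ^+ 2 + q ^+ 2) * (r ^+ 2 + s ^+ 2) =
  (p * r + q * s) ^+ 2 + (p * s - q * r) ^+ 2 by ring.
by rewrite lerDl sqr_ge0.
Qed.

Lemma vip_le_modulus u v : `|vip R u v| <= l2dot haar (modulus u) (modulus v).
Proof.
have i3 := vip_integrable u v.
have i4 := square_integrable_mul (modulus_square_integrable u) (modulus_square_integrable v).
rewrite vip_Rintegral.
apply: le_trans (le_normr_Rintegral measurableT i3) _.
apply: (le_Rintegral measurableT (integrable_norm i3) i4) => x _.
by apply: cauchy_plane; rewrite ?modulus_ge0// /modulus normc_sq.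
Qed.

Lemma vcomp_coord u (T : B5 R -> B5 R) : preserves (@haar R) T -> forall y,
  (vcomp T u).1 y = u.1 (T y) /\ (vcomp T u).2 y = u.2 (T y).
Proof.
move=> pT y; have e := congr1 (fun t : B5 R -> R[i] => t y) (cfun_vcomp pT u).
by split; [have := congr1 (@complex.Re R) e|have := congr1 (@complex.Im R) e].
Qed.

Let quotient_bound (P s Q : R) : 0 < P -> 0 <= (s / P) ^+ 2 * P - 2 * (s / P) * s + Q -> s ^+ 2 <= P * Q.
Proof.
move=> P0 H; have Pn : P != 0 by rewrite gt_eqF.
have -> : s ^+ 2 = P * (s ^+ 2 / P) by field.
apply: ler_wpM2l; first exact: ltW.
have E : (s / P) ^+ 2 * P - 2 * (s / P) * s + Q = Q - s ^+ 2 / P by field.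
by rewrite E subr_ge0 in H.
Qed.

(** Cauchy-Schwarz for the measure h dx, obtained by integrating h (c - k)^2 >= 0 with c = (integral
    of h k) / P. An infinite right side makes the claim trivial. *)
Lemma weighted_cauchy h k (P : R) : 0 < P -> square_integrable haar h -> square_integrable haar k ->
  (forall y, 0 <= h y) -> (\int[haar]_y (h y)%:E <= P%:E)%E ->
  ((l2dot haar h k ^+ 2)%:E <= P%:E * \int[haar]_y (h y * k y ^+ 2)%:E)%E.
Proof.
move=> P0 Lh Lk h0 hP; have [mh _] := Lh; have [mk _] := Lk.
have q0 y : 0 <= h y * k y ^+ 2 by rewrite mulr_ge0 ?sqr_ge0.
have mq : measurable_fun setT (fun y => h y * k y ^+ 2).
  by apply: measurable_funM => //; exact: measurable_funX.
have [Qf|] := boolP ((\int[haar]_y (h y * k y ^+ 2)%:E)%E \is a fin_num); last first.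
  rewrite ge0_fin_numE; last by apply: integral_ge0 => y _; rewrite lee_fin.
  by rewrite -leNgt leye_eq => /eqP ->; rewrite gt0_muley ?leey// lte_fin.
have ih : haar.-integrable setT (EFin \o h).
  apply/integrableP; split; first exact/measurable_EFinP.
  apply: le_lt_trans (ltry P); apply: le_trans hP; rewrite le_eqVlt; apply/orP; left; apply/eqP.
  by apply: eq_integral => y _; rewrite /= ger0_norm.
have iq : haar.-integrable setT (EFin \o (fun y => h y * k y ^+ 2)).
  apply/integrableP; split; first exact/measurable_EFinP.
  rewrite (_ : (\int[haar]_x _)%E = (\int[haar]_y (h y * k y ^+ 2)%:E)%E).
    by rewrite -ge0_fin_numE//; apply: integral_ge0 => y _; rewrite lee_fin.
  by apply: eq_integral => y _; rewrite /= ger0_norm.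
have im := square_integrable_mul Lh Lk.
rewrite -(fineK Qf) -EFinM lee_fin; apply: quotient_bound => //.
set s := l2dot haar h k; set c := s / P.
have hp : \int[haar]_y h y <= P.
  by rewrite -lee_fin /Rintegral fineK//; exact: (integrable_fin_num measurableT ih).
apply: le_trans (_ : c ^+ 2 * (\int[haar]_y h y) - 2 * c * s + fine (\int[haar]_y (h y * k y ^+ 2)%:E) <= _); last first.
  by rewrite !lerD2r ler_wpM2l// sqr_ge0.
have i1 := integrable_scale (c ^+ 2) ih; have i2 := integrable_scale (- (2 * c)) im.
have i3 := integrable_add i1 i2.
have -> : c ^+ 2 * (\int[haar]_y h y) - 2 * c * s + fine (\int[haar]_y (h y * k y ^+ 2)%:E) =
    \int[haar]_y (c ^+ 2 * h y + - (2 * c) * (h y * k y) + h y * k y ^+ 2).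
  rewrite (RintegralD measurableT i3 iq) (RintegralD measurableT i1 i2).
  by rewrite (RintegralZl _ measurableT ih) (RintegralZl _ measurableT im) mulNr.
apply: Rintegral_ge0 => y _.
have -> : c ^+ 2 * h y + - (2 * c) * (h y * k y) + h y * k y ^+ 2 = h y * (c - k y) ^+ 2 by ring.
by rewrite mulr_ge0 ?sqr_ge0.
Qed.

Lemma haar_integral_left (F : B5 R -> \bar R) x : measurable_fun setT F -> (forall y, 0 <= F y)%E ->
  (\int[haar]_y F (cartan_mul x y) = \int[haar]_y F y)%E.
Proof. by move=> mF F0; have [_ h] := haar_left x; exact: h. Qed.

Lemma haar_integral_right (F : B5 R -> \bar R) y : measurable_fun setT F -> (forall x, 0 <= F x)%E ->
  (\int[haar]_x F (cartan_mul x y) = \int[haar]_x F x)%E.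
Proof. by move=> mF F0; have [_ h] := haar_right y; exact: h. Qed.

(** A Young inequality of type L^1, L^2 to L^2. For fixed x the weight |u(x y)| has mass at most P
    by left invariance; after Tonelli, right invariance bounds its integral in x by a second factor
    P. *)
Lemma convolution_bound u v (P : R) : 0 < P -> (\int[haar]_y (modulus u y)%:E <= P%:E)%E ->
  (\int[haar]_x ((vip R (vcomp (cartan_mul x) u) v) ^+ 2)%:E <= (P ^+ 2 * nsq (vip R) v)%:E)%E.
Proof.
move=> P0 uP; have mu := measurable_modulus u; have mv := measurable_modulus v.
have muE : measurable_fun setT (fun y => (modulus u y)%:E) by exact/measurable_EFinP.
have u0E y : (0 <= (modulus u y)%:E)%E by rewrite lee_fin modulus_ge0.
pose Q (z : B5 R * B5 R) := (modulus u (cartan_mul z.1 z.2) * modulus v z.2 ^+ 2)%:E.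
have mQ : measurable_fun setT Q.
  by apply/measurable_EFinP; exact: (measurable_convolution mu (measurable_funX 2 mv)).
have Q0 z : (0 <= Q z)%E by rewrite lee_fin mulr_ge0 ?modulus_ge0 ?sqr_ge0.
have cm x : modulus (vcomp (cartan_mul x) u) = fun y => modulus u (cartan_mul x y).
  by apply/funext => y; rewrite /modulus (cfun_vcomp (haar_left x)).
have pt x : (((vip R (vcomp (cartan_mul x) u) v) ^+ 2)%:E <= P%:E * \int[haar]_y Q (x, y))%E.
  apply: le_trans (_ : ((l2dot haar (modulus (vcomp (cartan_mul x) u)) (modulus v)) ^+ 2)%:E <= _)%E.
    rewrite lee_fin -[leLHS]real_normK ?num_real// ler_sqr ?nnegrE//; last first.
      by apply: le_trans (vip_le_modulus (vcomp (cartan_mul x) u) v).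
    exact: vip_le_modulus.
  have := weighted_cauchy P0 (modulus_square_integrable (vcomp (cartan_mul x) u))
    (modulus_square_integrable v) (modulus_ge0 _); rewrite !cm; apply.
  by rewrite (haar_integral_left x muE u0E).
have mI := measurable_haar_inner mQ Q0.
have P0' : 0 <= P by exact: ltW.
have I0 x : (0 <= \int[haar]_y Q (x, y))%E by apply: integral_ge0.
have mP : measurable_fun setT (fun x => ((vip R (vcomp (cartan_mul x) u) v) ^+ 2)%:E).
  have mK := measurable_funD (measurable_convolution (L2_measurable u.1) (L2_measurable v.1))
    (measurable_convolution (L2_measurable u.2) (L2_measurable v.2)).
  apply/measurable_EFinP; apply: measurable_funX.
  rewrite (_ : (fun x => _) = fun x => \int[haar]_y (u.1 (cartan_mul x y) * v.1 y + u.2 (cartan_mul x y) * v.2 y)).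
    exact: (measurable_haar_Rintegral mK).
  apply/funext => x; rewrite vip_Rintegral.
  by apply: eq_Rintegral => y _; have [-> ->] := vcomp_coord u (haar_left x) y.
apply: le_trans (_ : (\int[haar]_x (P%:E * \int[haar]_y Q (x, y)) <= _)%E).
  by apply: (haar_le_integral mP (measurable_funeM _ mI)) => x; [rewrite lee_fin sqr_ge0|exact: pt].
rewrite (haar_integralZl P0' mI I0) (haar_tonelli mQ Q0).
have E y : (\int[haar]_x Q (x, y) <= P%:E * (modulus v y ^+ 2)%:E)%E.
  have -> : (\int[haar]_x Q (x, y) = \int[haar]_x ((modulus v y ^+ 2)%:E * (modulus u (cartan_mul x y))%:E))%E.
    by apply: eq_integral => x _; rewrite /Q /= mulrC EFinM.
  have mr : measurable_fun setT (fun x => (modulus u (cartan_mul x y))%:E).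
    by apply/measurable_EFinP; apply: (measurableT_comp mu); have [] := haar_right y.
  rewrite (haar_integralZl (sqr_ge0 _) mr (fun x => u0E _)).
  rewrite (haar_integral_right y muE u0E) muleC; apply: lee_wpmul2r => //.
  by rewrite lee_fin sqr_ge0.
have mv2 : measurable_fun setT (fun y => (modulus v y ^+ 2)%:E).
  by apply/measurable_EFinP; exact: measurable_funX.
apply: le_trans (_ : (P%:E * \int[haar]_y (P%:E * (modulus v y ^+ 2)%:E) <= _)%E).
  apply: lee_wpmul2l; first by rewrite lee_fin.
  have mQ' : measurable_fun setT (fun z : B5 R * B5 R => Q (z.2, z.1)).
    by apply: (measurableT_comp mQ); exact: (measurable_fun_pair measurable_snd measurable_fst).
  apply: (haar_le_integral (measurable_haar_inner mQ' (fun z => Q0 _)) (measurable_funeM _ mv2)).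
    by move=> y; apply: integral_ge0 => x _; exact: Q0.
  exact: E.
have v20 y : (0 <= (modulus v y ^+ 2)%:E)%E by rewrite lee_fin sqr_ge0.
rewrite (haar_integralZl P0' mv2 v20).
by rewrite -[(\int[haar]_y (modulus v y ^+ 2)%:E)%E]nsq_normcE -!EFinM lee_fin mulrA expr2.
Qed.

(** * Averages over right translates against a bounded probability density *)

Section Density.
Variables (k : B5 R -> R) (K : R).
Hypothesis Lk : square_integrable haar k.
Hypothesis k0 : forall y, 0 <= k y.
Hypothesis kK : forall y, k y <= K.
Hypothesis ik : haar.-integrable setT (EFin \o k).
Hypothesis k1 : \int[haar]_y k y = 1.

Let double_two (M : R) : 2 * M + 2 * M <= 4 * M.
Proof. by lra. Qed.

Let le_sq (a b : R) : 0 <= a ^+ 2 - 2 * a * a + b -> a ^+ 2 <= b.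
Proof. by rewrite expr2; lra. Qed.

Let average_le (c m q : R) : m ^+ 2 <= q -> c ^+ 2 <= 2 * (c ^+ 2 - 2 * c * m + q) + 2 * m ^+ 2.
Proof. by move=> mq; have := sqr_ge0 (c - 2 * m); nra. Qed.

(** h(x) is compared with the mean m of y |-> h(x y) under k. Jensen gives (h(x) - m)^2 <= mean of
    (h(x) - h(x y))^2, and h(x)^2 <= 2 (h(x) - m)^2 + 2 m^2. The bound on k makes the second moment
    finite. *)
Lemma density_pointwise h x : square_integrable haar h ->
  ((h x ^+ 2)%:E <= 2%:E * \int[haar]_y (k y * (h x - h (cartan_mul x y)) ^+ 2)%:E
     + (2 * l2dot haar (fun y => h (cartan_mul x y)) k ^+ 2)%:E)%E.
Proof.
move=> Lh; pose g y := h (cartan_mul x y); pose c := h x.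
have Lg : square_integrable haar g by exact: (square_integrable_comp (haar_left x) Lh).
have [mg _] := Lg; have [mk _] := Lk.
have igk := square_integrable_mul Lg Lk.
have iq : haar.-integrable setT (EFin \o (fun y => k y * g y ^+ 2)).
  have iK := integrable_scale K (square_integrable_sq Lg).
  apply: (@integrable_le _ _ R haar _ (fun y => K * g y ^+ 2) (measurable_funM mk (measurable_funX 2 mg)) iK) => y.
  have t0 : 0 <= k y * g y ^+ 2 by apply: mulr_ge0; [exact: k0|exact: sqr_ge0].
  rewrite (ger0_norm t0); change (k y * g y ^+ 2 <= K * g y ^+ 2).
  by apply: ler_wpM2r; [exact: sqr_ge0|exact: kK].
pose m := l2dot haar g k; pose q := \int[haar]_y (k y * g y ^+ 2).
have key (d : R) : haar.-integrable setT (EFin \o (fun y => k y * (d - g y) ^+ 2)) /\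
    \int[haar]_y (k y * (d - g y) ^+ 2) = d ^+ 2 - 2 * d * m + q.
  have E : (fun y => k y * (d - g y) ^+ 2) =
      (fun y => d ^+ 2 * k y + - (2 * d) * (g y * k y) + k y * g y ^+ 2).
    by apply/funext => y; ring.
  have i1 := integrable_scale (d ^+ 2) ik; have i2 := integrable_scale (- (2 * d)) igk.
  have i3 := integrable_add i1 i2; rewrite E; split; first exact: (integrable_add i3 iq).
  rewrite (RintegralD measurableT i3 iq) (RintegralD measurableT i1 i2).
  by rewrite (RintegralZl _ measurableT ik) (RintegralZl _ measurableT igk) k1 mulr1 mulNr.
have mq : m ^+ 2 <= q.
  have [_ h2] := key m; apply: le_sq.
  by rewrite -h2; apply: Rintegral_ge0 => y _; rewrite mulr_ge0 ?sqr_ge0.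
have [h1 h2] := key c.
have -> : (\int[haar]_y (k y * (h x - h (cartan_mul x y)) ^+ 2)%:E = (c ^+ 2 - 2 * c * m + q)%:E)%E.
  by rewrite -h2 /Rintegral fineK//; exact: (integrable_fin_num measurableT h1).
rewrite -EFinM -EFinD lee_fin; exact: average_le.
Qed.

Lemma density_average h (M : R) : square_integrable haar h ->
  (\int[haar]_x ((l2dot haar (fun y => h (cartan_mul x y)) k) ^+ 2)%:E <= M%:E)%E ->
  (sqintegral haar h <= 2%:E * (\int[haar]_y ((k y)%:E * sqintegral haar (fun x => (h (cartan_mul x y) - h x)%R)))
     + (2 * M)%:E)%E.
Proof.
move=> Lh hM; have [mh _] := Lh; have [mk _] := Lk.
pose J (z : B5 R * B5 R) := (k z.2 * (h z.1 - h (cartan_mul z.1 z.2)) ^+ 2)%:E.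
have mc := measurableT_comp mh (@measurable_cartan_mul R).
have m1 : measurable_fun setT (fun z : B5 R * B5 R => h z.1) by exact: measurableT_comp mh measurable_fst.
have m2 : measurable_fun setT (fun z : B5 R * B5 R => k z.2) by exact: measurableT_comp mk measurable_snd.
have mJ : measurable_fun setT J.
  by apply/measurable_EFinP; exact: (measurable_funM m2 (measurable_funX 2 (measurable_funB m1 mc))).
have J0 z : (0 <= J z)%E by rewrite lee_fin mulr_ge0 ?sqr_ge0.
have mI := measurable_haar_inner mJ J0.
have I0 x : (0 <= \int[haar]_y J (x, y))%E by apply: integral_ge0.
have E : (\int[haar]_x \int[haar]_y J (x, y) = \int[haar]_y ((k y)%:E * sqintegral haar (fun x => (h (cartan_mul x y) - h x)%R)))%E.
  rewrite (haar_tonelli mJ J0); apply: eq_integral => y _; rewrite /sqintegral -haar_integralZl//.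
  - by apply: eq_integral => x _; rewrite /J -EFinM /= -sqrrN opprB.
  - apply/measurable_EFinP; apply: measurable_funX; apply: measurable_funB => //.
    by apply: (measurableT_comp mh); have [] := haar_right y.
  - by move=> x; rewrite lee_fin sqr_ge0.
have ml : measurable_fun setT (fun x => l2dot haar (fun y => h (cartan_mul x y)) k).
  exact: (measurable_haar_Rintegral (measurable_convolution mh mk)).
have mlE : measurable_fun setT (fun x => ((l2dot haar (fun y => h (cartan_mul x y)) k) ^+ 2)%:E).
  by apply/measurable_EFinP; exact: measurable_funX.
have l0 x : (0 <= ((l2dot haar (fun y => h (cartan_mul x y)) k) ^+ 2)%:E)%E by rewrite lee_fin sqr_ge0.
have two0 : (0 : R) <= 2 by [].
have mI2 : measurable_fun setT (fun x => 2%:E * \int[haar]_y J (x, y))%E by exact: measurable_funeM.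
have ml2 : measurable_fun setT (fun x => 2%:E * ((l2dot haar (fun y => h (cartan_mul x y)) k) ^+ 2)%:E)%E.
  exact: measurable_funeM.
have I20 x : (0 <= 2%:E * \int[haar]_y J (x, y))%E by rewrite mule_ge0// lee_fin.
have l20 x : (0 <= 2%:E * ((l2dot haar (fun y => h (cartan_mul x y)) k) ^+ 2)%:E)%E.
  by rewrite mule_ge0// lee_fin.
rewrite -E -(haar_integralZl two0 mI I0).
apply: le_trans (_ : (\int[haar]_x (2%:E * \int[haar]_y J (x, y)) +
   \int[haar]_x (2%:E * ((l2dot haar (fun y => h (cartan_mul x y)) k) ^+ 2)%:E) <= _)%E).
  rewrite (haar_integralD mI2 ml2 I20 l20).
  apply: (haar_le_integral (measurable_sq mh) (emeasurable_funD mI2 ml2)) => x.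
    by rewrite lee_fin sqr_ge0.
  exact: density_pointwise.
by rewrite leeD2l// (haar_integralZl two0 mlE l0) EFinM lee_wpmul2l// lee_fin.
Qed.

Lemma right_increment u y (C : R) :
  nsq (vip R) (vcomp (fun x => cartan_mul x y) u - u) <= C ->
  (sqintegral haar (fun x => (u.1 (cartan_mul x y) - u.1 x)%R) +
   sqintegral haar (fun x => (u.2 (cartan_mul x y) - u.2 x)%R) <= C%:E)%E.
Proof.
rewrite -lee_fin nsq_sqintegral; apply: le_trans; have ee := vcomp_coord u (haar_right y).
have s1 : (fun x => u.1 (cartan_mul x y) - u.1 x) = ((vcomp (fun x => cartan_mul x y) u - u).1 : B5 R -> R).
  by apply/funext => x; rewrite -(ee x).1.
have s2 : (fun x => u.2 (cartan_mul x y) - u.2 x) = ((vcomp (fun x => cartan_mul x y) u - u).2 : B5 R -> R).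
  by apply/funext => x; rewrite -(ee x).2.
by rewrite s1 s2.
Qed.

(** The averaging is done on real and imaginary parts, whose means are pairings with the two test
    vectors. The two increments add up to one squared norm, giving 2 C, while each mean costs 2
    M. *)
Lemma density_nash u (k1' k2' : V) (M C : R) : 0 <= C ->
  (forall x, vip R (vcomp (cartan_mul x) u) k1' = l2dot haar (fun y => u.1 (cartan_mul x y)) k) ->
  (forall x, vip R (vcomp (cartan_mul x) u) k2' = l2dot haar (fun y => u.2 (cartan_mul x y)) k) ->
  (\int[haar]_x ((vip R (vcomp (cartan_mul x) u) k1') ^+ 2)%:E <= M%:E)%E ->
  (\int[haar]_x ((vip R (vcomp (cartan_mul x) u) k2') ^+ 2)%:E <= M%:E)%E ->
  (forall y, k y != 0 -> nsq (vip R) (vcomp (fun x => cartan_mul x y) u - u) <= C) ->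
  nsq (vip R) u <= 2 * C + 4 * M.
Proof.
move=> C0 e1 e2 h1 h2 hC; have [mk _] := Lk.
have f1 : (\int[haar]_x ((l2dot haar (fun y => u.1 (cartan_mul x y)) k) ^+ 2)%:E <= M%:E)%E.
  by apply: le_trans h1; under eq_integral do rewrite -e1.
have f2 : (\int[haar]_x ((l2dot haar (fun y => u.2 (cartan_mul x y)) k) ^+ 2)%:E <= M%:E)%E.
  by apply: le_trans h2; under eq_integral do rewrite -e2.
have d1 := density_average (L2P u.1) f1; have d2 := density_average (L2P u.2) f2.
rewrite -lee_fin nsq_sqintegral; apply: le_trans (leeD d1 d2) _.
pose D (h : B5 R -> R) y := ((k y)%:E * sqintegral haar (fun x => (h (cartan_mul x y) - h x)%R))%E.
have D0 (h : B5 R -> R) y : (0 <= D h y)%E by rewrite mule_ge0 ?lee_fin ?sqintegral_ge0.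
have mD (h : B5 R -> R) : measurable_fun setT h -> measurable_fun setT (D h).
  move=> mh; have m0 : measurable_fun setT (fun z : B5 R * B5 R => ((h (cartan_mul z.1 z.2) - h z.1) ^+ 2)%:E).
    apply/measurable_EFinP; apply: measurable_funX; apply: measurable_funB.
      exact: (measurableT_comp mh (@measurable_cartan_mul R)).
    exact: measurableT_comp mh measurable_fst.
  have mJ := measurableT_comp m0 (measurable_fun_pair (@measurable_snd _ _ (B5 R) (B5 R)) measurable_fst).
  apply: emeasurable_funM; first exact/measurable_EFinP.
  by apply: (measurable_haar_inner mJ) => z; rewrite lee_fin sqr_ge0.
have mu1 := L2_measurable u.1; have mu2 := L2_measurable u.2.
have key : (\int[haar]_y D u.1 y + \int[haar]_y D u.2 y <= C%:E)%E.
  rewrite (haar_integralD (mD _ mu1) (mD _ mu2) (D0 _) (D0 _)).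
  have mkE : measurable_fun setT (fun y => (k y)%:E) by exact/measurable_EFinP.
  have k0E y : (0 <= (k y)%:E)%E by rewrite lee_fin.
  apply: le_trans (_ : (\int[haar]_y (C%:E * (k y)%:E) <= _)%E); last first.
    rewrite (haar_integralZl C0 mkE k0E).
    have -> : (\int[haar]_y (k y)%:E = 1%:E)%E.
      by rewrite -k1 /Rintegral fineK//; exact: (integrable_fin_num measurableT ik).
    by rewrite mule1.
  apply: (haar_le_integral (emeasurable_funD (mD _ mu1) (mD _ mu2)) (measurable_funeM _ mkE)).
  - by move=> y; apply: adde_ge0; exact: D0.
  - move=> y; rewrite /D -ge0_muleDr ?sqintegral_ge0// muleC.
    have [->|ky] := eqVneq (k y) 0; first by rewrite !mule0.
    apply: (lee_wpmul2r (k0E y)).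
    exact: (right_increment (hC y ky)).
rewrite addeACA -EFinD -ge0_muleDr; last 2 first.
- by apply: integral_ge0 => y _; exact: D0.
- by apply: integral_ge0 => y _; exact: D0.
rewrite [leRHS]EFinD; apply: leeD; first by rewrite EFinM lee_wpmul2l.
by rewrite lee_fin double_two.
Qed.

End Density.

(** * The normalized indicator of a box *)

Section Box.
Variable r : R.
Hypothesis r0 : 0 < r.

Let I : set R := `[0, r]%classic.
Definition box : set (B5 R) := I `*` I `*` I `*` I `*` I.

Lemma boxP y : box y -> in_box r y.
Proof.
case: y => [[[[a b] c] d] e] [[[[/= ha hb] hc] hd] he].
by split=> /=; [move: ha|move: hb|move: hc|move: hd|move: he]; rewrite /I /= in_itv.
Qed.

Lemma measurable_box : measurable box.
Proof. have mI : measurable I by exact: measurable_itv.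
exact: (measurableX (measurableX (measurableX (measurableX mI mI) mI) mI) mI). Qed.

Lemma haar_box : haar box = (r ^+ 5)%:E.
Proof.
have L : leb I = r%:E by rewrite /I lebesgue_measure_itv /= lte_fin r0 sube0.
have mI : measurable I by exact: measurable_itv.
pose s2 := sf_prod leb leb; pose s3 := sf_prod s2 leb; pose s4 := sf_prod s3 leb.
have m2 : measurable (I `*` I) by exact: measurableX.
have m3 : measurable (I `*` I `*` I) by exact: measurableX.
have m4 : measurable (I `*` I `*` I `*` I) by exact: measurableX.
have e2 : s2 (I `*` I) = (leb I * leb I)%E by exact: product_measure1E.
have e3 : s3 (I `*` I `*` I) = (s2 (I `*` I) * leb I)%E by exact: product_measure1E.
have e4 : s4 (I `*` I `*` I `*` I) = (s3 (I `*` I `*` I) * leb I)%E by exact: product_measure1E.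
have e5 : haar box = (s4 (I `*` I `*` I `*` I) * leb I)%E.
  exact: (@product_measure1E _ _ _ _ R s4 leb _ I m4 mI).
by rewrite e5 e4 e3 e2 L -!EFinM; congr (_%:E); ring.
Qed.

Definition box_density y : R := r ^- 5 * \1_box y.

Lemma box_density_ge0 y : 0 <= box_density y.
Proof. by rewrite mulr_ge0// invr_ge0 exprn_ge0// ltW. Qed.

Lemma box_density_le y : box_density y <= r ^- 5.
Proof.
apply: ler_piMr; first by rewrite invr_ge0 exprn_ge0// ltW.
by rewrite indicE; case: (y \in box).
Qed.

Lemma box_density_neq0 y : box_density y != 0 -> in_box r y.
Proof.
rewrite /box_density indicE; have [/set_mem/boxP//|_] := boolP (y \in box).
by rewrite mulr0 eqxx.
Qed.

Lemma measurable_box_density : measurable_fun setT box_density.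
Proof. by apply: measurable_funM => //; exact: measurable_indic measurable_box. Qed.

Lemma integral_indic_box : (\int[haar]_x (\1_box x)%:E = (r ^+ 5)%:E)%E.
Proof.
rewrite integral_indic; [|exact: measurableT|exact: measurable_box].
by rewrite setIT; exact: haar_box.
Qed.

Lemma box_density_integrable : haar.-integrable setT (EFin \o box_density).
Proof.
apply: integrable_scale; apply/integrableP; split.
  by apply/measurable_EFinP; exact: measurable_indic measurable_box.
rewrite (_ : (\int[haar]_x _)%E = (\int[haar]_x (\1_box x)%:E)%E); last first.
  by apply: eq_integral => x _; rewrite /= ger0_norm.
by rewrite integral_indic_box ltry.
Qed.

Lemma box_density_mass : \int[haar]_y box_density y = 1.
Proof.
have i1 : haar.-integrable setT (EFin \o (\1_box : B5 R -> R)).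
  have := integrable_scale (r ^+ 5) box_density_integrable; apply: eq_integrable => // x _.
  by rewrite /= /box_density mulrA mulfV ?mul1r// expf_neq0// gt_eqF.
rewrite (RintegralZl _ measurableT i1) /Rintegral integral_indic_box /=.
by rewrite mulVf// expf_neq0// gt_eqF.
Qed.

Lemma box_density_sq : square_integrable haar box_density /\ sqintegral haar box_density = (r ^- 5)%:E.
Proof.
have E : sqintegral haar box_density = (r ^- 5)%:E.
  have -> : sqintegral haar box_density = (\int[haar]_x ((r ^- 5)%:E * (box_density x)%:E))%E.
    apply: eq_integral => x _; rewrite -EFinM; congr (_%:E); rewrite /box_density indicE.
    by case: (x \in box) => /=; ring.
  have m1 : measurable_fun setT (fun x => (box_density x)%:E).
    by apply/measurable_EFinP; exact: measurable_box_density.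
  rewrite haar_integralZl//; last 2 first.
  - by rewrite invr_ge0 exprn_ge0// ltW.
  - by move=> x; rewrite lee_fin box_density_ge0.
  have -> : (\int[haar]_y (box_density y)%:E = 1%:E)%E.
    by rewrite -box_density_mass /Rintegral fineK//; exact: (integrable_fin_num measurableT box_density_integrable).
  by rewrite mule1.
by split=> //; split; [exact: measurable_box_density|rewrite E ltry].
Qed.

End Box.

Lemma zero_square_integrable : square_integrable (@haar R) (fun=> 0).
Proof.
have e : sqintegral (@haar R) (fun=> 0) = 0%E.
  by rewrite /sqintegral; apply: integral0_eq => x _; rewrite expr0n.
by split=> //; rewrite e ltry.
Qed.

Definition re_vec k (Lk : square_integrable haar k) : V := (to_L2 Lk, to_L2 zero_square_integrable).
Definition im_vec k (Lk : square_integrable haar k) : V := (to_L2 zero_square_integrable, to_L2 Lk).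

Lemma vip_re_vec u k (Lk : square_integrable haar k) : vip R u (re_vec Lk) = l2dot haar u.1 k.
Proof.
rewrite -[LHS]/(l2dot haar u.1 k + l2dot haar u.2 (fun=> 0)) [X in _ + X](_ : _ = 0) ?addr0//.
by rewrite /l2dot /Rintegral integral0_eq// => x _; rewrite mulr0.
Qed.

Lemma vip_im_vec u k (Lk : square_integrable haar k) : vip R u (im_vec Lk) = l2dot haar u.2 k.
Proof.
rewrite -[LHS]/(l2dot haar u.1 (fun=> 0) + l2dot haar u.2 k) [X in X + _](_ : _ = 0) ?add0r//.
by rewrite /l2dot /Rintegral integral0_eq// => x _; rewrite mulr0.
Qed.

Lemma l2dot_vcomp u k (T : B5 R -> B5 R) : preserves (@haar R) T ->
  l2dot haar (vcomp T u).1 k = l2dot haar (fun y => u.1 (T y)) k /\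
  l2dot haar (vcomp T u).2 k = l2dot haar (fun y => u.2 (T y)) k.
Proof.
move=> pT; have e := vcomp_coord u pT.
by split; apply: eq_Rintegral => y _; [rewrite (e y).1|rewrite (e y).2].
Qed.

(** * Smoothing from L^1 to L^2 *)

Section SpectralSmoothing.
Variable E : set R -> (B5 R -> R[i]) -> B5 R -> R[i].
Hypothesis HE : spectral_resolution E (@B_op R).

Definition PV := vproj_projection_valued HE.1.
Definition Brel u w := B_op (cfun u) (cfun w).

Lemma Brel_spectral u w : Brel u w <-> spectral_calculus PV id u w.
Proof. by rewrite /Brel HE.2; exact: spectral_integralE. Qed.

Lemma Brel_gap u w : Brel u w -> 2 * nsq (vip R) u <= vip R w u.
Proof. exact: energy_gap. Qed.

Definition heat_rel := semigroup PV.

Lemma heat_rel_left x t u w w' : 0 <= t -> heat_rel t u w ->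
  heat_rel t (vcomp (cartan_mul x) u) w' -> nequiv (vip R) (vcomp (cartan_mul x) w) w'.
Proof.
have pT := haar_left x; have UB v v' : Brel v v' -> Brel (vcomp (cartan_mul x) v) (vcomp (cartan_mul x) v').
  exact: B_op_left.
move=> t0 h h'; exact: (semigroup_comm (@vcomplete R) Brel_spectral Brel_gap (vcompB pT) (vcompZ pT)
  (nsq_vcomp pT) UB t0 h h').
Qed.

(** Commutation and symmetry move the semigroup from the translate of u to g, where it contracts
    L^2. The mass P is thus that of the initial datum, at every time. *)
Lemma heat_density t u w (g : V) (P : R) : 0 <= t -> 0 < P -> heat_rel t u w ->
  (\int[haar]_y (modulus u y)%:E <= P%:E)%E ->
  (\int[haar]_x ((vip R (vcomp (cartan_mul x) w) g) ^+ 2)%:E <= (P ^+ 2 * nsq (vip R) g)%:E)%E.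
Proof.
move=> t0 P0 Hu uP; have [G HG] := semigroup_exists (@vcomplete R) Brel_spectral Brel_gap g t0.
have e x : vip R (vcomp (cartan_mul x) w) g = vip R (vcomp (cartan_mul x) u) G.
  have [W HW] := semigroup_exists (@vcomplete R) Brel_spectral Brel_gap (vcomp (cartan_mul x) u) t0.
  by rewrite (nequiv_ipl _ (heat_rel_left t0 Hu HW)) (semigroup_sym (@vcomplete R) HW HG).
under eq_integral do rewrite e.
have H := nsq_semigroup_le (@vcomplete R) Brel_spectral Brel_gap t0 HG.
apply: (le_trans (convolution_bound G P0 uP)).
by rewrite lee_fin; exact: (ler_wpM2l (sqr_ge0 P) H).
Qed.

Let nash_constant (s v c d : R) : 2 * (5 * s * v) + 4 * (c / d) <= 10 * s * v + 4 * c / d.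
Proof. by rewrite le_eqVlt; apply/orP; left; apply/eqP; ring. Qed.

(** The box estimate involves the Laplacian part of the energy only, which is at most <B w, w>
    because the inverse part is nonnegative. The constants are 2 * 5 from increments over the box
    and 4 from averages against a density of squared norm r^-5. *)
Lemma heat_nash t r u w b (P : R) : 0 <= t -> 0 < P -> 0 < r -> heat_rel t u w -> Brel w b ->
  (\int[haar]_y (modulus u y)%:E <= P%:E)%E ->
  nsq (vip R) w <= 10 * r ^+ 2 * vip R b w + 4 * P ^+ 2 / r ^+ 5.
Proof.
move=> t0 P0 r0 Hu Bw uP.
have [Lk nk] := box_density_sq r0.
have [a [m [Ha Hm Hb]]] := B_opP Bw.
have aw : vip R a w <= vip R b w.
  by rewrite (nequiv_ipl _ Hb) ipDl lerDl; exact: inverse_op_ge0.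
have n1 : nsq (vip R) (re_vec Lk) = r ^- 5.
  by rewrite /nsq vip_re_vec; apply: EFin_inj; rewrite l2dotE.
have n2 : nsq (vip R) (im_vec Lk) = r ^- 5.
  by rewrite /nsq vip_im_vec; apply: EFin_inj; rewrite l2dotE.
have M1 := heat_density (re_vec Lk) t0 P0 Hu uP; have M2 := heat_density (im_vec Lk) t0 P0 Hu uP.
rewrite n1 in M1; rewrite n2 in M2.
have w0 := le_trans (mulr_ge0 (ler0n R 2) (nsq_ge0 (vip R) w)) (Brel_gap Bw).
have C0 := mulr_ge0 (mulr_ge0 (ler0n R 5) (sqr_ge0 r)) w0.
have := density_nash Lk (box_density_ge0 r0) (box_density_le r0) (box_density_integrable r0)
  (box_density_mass r0) C0 _ _ M1 M2 _.
have e1 x : vip R (vcomp (cartan_mul x) w) (re_vec Lk) =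
    l2dot haar (fun y => w.1 (cartan_mul x y)) (box_density r).
  by rewrite vip_re_vec (l2dot_vcomp w _ (haar_left x)).1.
have e2 x : vip R (vcomp (cartan_mul x) w) (im_vec Lk) =
    l2dot haar (fun y => w.2 (cartan_mul x y)) (box_density r).
  by rewrite vip_im_vec (l2dot_vcomp w _ (haar_left x)).2.
move=> /(_ e1 e2) H; apply: le_trans (H _) _.
  move=> y /box_density_neq0 hy; apply: le_trans (nash_laplace hy Ha) _.
  exact: (ler_wpM2l (mulr_ge0 (ler0n R 5) (sqr_ge0 r)) aw).
exact: nash_constant.
Qed.

Lemma heat_smoothing t u w (P : R) : 0 < t -> 0 < P -> heat_rel (2 * t ^+ 2) u w ->
  (\int[haar]_y (modulus u y)%:E <= P%:E)%E ->
  t ^+ 9 * nsq (vip R) w <= 2 * (32 ^+ 5 * 4 * P ^+ 2).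
Proof.
move=> t0 P0 Hu uP.
have c0 : (0 : R) <= 4 by []; have N0 : 0 <= P ^+ 2 by exact: sqr_ge0.
have := semigroup_smoothing (@vcomplete R) Brel_spectral Brel_gap c0 N0 _ t0 Hu.
apply=> s r y b s0 r0 Hy By; exact: (heat_nash (ltW s0) P0 r0 Hy By uP).
Qed.

End SpectralSmoothing.

End Smoothing.

(** * Interpolation and duality *)

Section PowerIdentities.
Variable R : realType.
Implicit Types a s x y N p q r : R.

Lemma powR_sub a b x : 0 < x -> x `^ (a + b) = x `^ a * x `^ b.
Proof. by move=> x0; rewrite powRD// (gt_eqF x0) implybT. Qed.

Lemma powR_le a x y : 0 <= a -> 0 <= x -> x <= y -> x `^ a <= y `^ a.
Proof. by move=> a0 x0 xy; apply: ge0_ler_powR; rewrite ?nnegrE//; exact: le_trans xy. Qed.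

Lemma powR_sqr x : 0 <= x -> x `^ 2 = x ^+ 2.
Proof. by move=> x0; rewrite -powR_mulrn. Qed.

(** Above the height s, the factor (x/s)^(p-1) >= 1 turns an L^1 quantity into an L^p one;
    [cut_below] does the same for L^2 below s. *)
Lemma cut_above p s x : 1 <= p -> 0 < s -> s < x -> x <= s `^ (1 - p) * x `^ p.
Proof.
move=> p1 s0 sx; have x0 : 0 < x by exact: lt_trans sx.
have -> : 1 - p = - (p - 1) by ring.
rewrite powRN -ler_pdivrMl ?invr_gt0 ?powR_gt0// invrK.
have -> : x `^ p = x `^ (p - 1) * x by rewrite -{3}(powRr1 (ltW x0)) -powR_sub// subrK.
by apply: ler_wpM2r; [exact: ltW|apply: powR_le; [rewrite subr_ge0|exact: ltW|exact: ltW]].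
Qed.

Lemma cut_below p s x : 0 < p -> p <= 2 -> 0 <= x -> x <= s -> x ^+ 2 <= s `^ (2 - p) * x `^ p.
Proof.
move=> p0 p2; rewrite le_eqVlt => /predU1P[<- _|x0 xs].
  by rewrite expr0n mulr_ge0 ?powR_ge0.
rewrite -(powR_sqr (ltW x0)) -{1}(subrK p 2) powR_sub//; apply: ler_wpM2r; first exact: powR_ge0.
by apply: powR_le; rewrite ?subr_ge0// ltW.
Qed.

(* The height that balances the L^1 and L^2 pieces. *)
Lemma cut_height A N p : 0 < A -> 0 < N -> 0 < p ->
  let s := A `^ (2 / p) * N in
  A * (s `^ (1 - p) * N `^ p) = A `^ (2 / p - 1) * N /\
  s `^ (2 - p) * N `^ p = (A `^ (2 / p - 1) * N) ^+ 2.
Proof.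
move=> A0 N0 p0 s; have B0 : 0 <= A `^ (2 / p) by exact: powR_ge0.
have N0' := ltW N0; have pn : p != 0 by rewrite gt_eqF.
split.
  rewrite /s powRM// -mulrA -(powR_sub _ _ N0).
  have -> : 1 - p + p = 1 by ring.
  rewrite powRr1// mulrA; congr (_ * _); rewrite -powRrM -{1}(powRr1 (ltW A0)) -powR_sub//.
  by congr (_ `^ _); field.
rewrite /s powRM// -mulrA -(powR_sub _ _ N0).
have -> : 2 - p + p = 2 by ring.
rewrite powR_sqr// exprMn; congr (_ * _); rewrite -powRrM -powR_sqr ?powR_ge0// -powRrM.
by congr (_ `^ _); field.
Qed.

Lemma dual_power q x : 2 <= q -> 0 <= x -> x `^ (q - 2) * x ^+ 2 = x `^ q.
Proof.
move=> q2; rewrite le_eqVlt => /predU1P[<-|x0].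
  by rewrite expr0n mulr0 powR0// gt_eqF// (lt_le_trans _ q2).
by rewrite -powR_sqr ?ltW// -powR_sub// subrK.
Qed.

Lemma dual_modulus q x : 2 <= q -> 0 <= x ->
  (x `^ (q - 2) * x) `^ (q / (q - 1)) = x `^ q.
Proof.
move=> q2; have q1 : 0 < q - 1 by lra.
have qn : q / (q - 1) != 0 by rewrite mulf_neq0// ?invr_eq0 gt_eqF//; lra.
rewrite le_eqVlt => /predU1P[<-|x0].
  by rewrite mulr0 !powR0// gt_eqF// (lt_le_trans _ q2).
rewrite -{2}(powRr1 (ltW x0)) -powR_sub// -powRrM; congr (_ `^ _).
by field; rewrite gt_eqF.
Qed.

(** A power of I stands on both sides and is divided out, leaving I^(1/q) <= G. Here I must be
    finite and positive, which is why the test function in the duality argument is truncated. *)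
Lemma dual_bound q I G : 2 <= q -> 0 < I -> 0 <= G ->
  I ^+ 2 <= (G * I `^ ((q - 1) / q)) ^+ 2 -> I <= G `^ q.
Proof.
move=> q2 I0 G0 H; have q0 : 0 < q by lra.
have I1 : I <= G * I `^ ((q - 1) / q).
  by rewrite -(@ler_pXn2r _ 2)// ?nnegrE ?mulr_ge0 ?powR_ge0// ltW.
have e : I `^ q^-1 * I `^ ((q - 1) / q) = I.
  rewrite -powR_sub// -[RHS](powRr1 (ltW I0)); congr (_ `^ _); field.
  by rewrite gt_eqF.
have I2 : I `^ q^-1 <= G.
  by move: I1; rewrite -{1}e ler_pM2r// powR_gt0.
have -> : I = (I `^ q^-1) `^ q by rewrite -powRrM mulVf ?gt_eqF// powRr1// ltW.
by apply: powR_le => //; [exact: ltW|exact: powR_ge0].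
Qed.

(** Each half of the time contributes a power of the same decay rate; the exponents add up to 2 (1/p
    - 1/q), and 9/4 times this is the stated power of t. *)
Lemma heat_constant (a t p q : R) : 0 < a -> 0 < t -> p != 0 -> q != 0 ->
  (a * (t / 2) `^ (- (9 / 4))) `^ (2 / p - 1) * (a * (t / 2) `^ (- (9 / 4))) `^ (1 - 2 / q) =
  (a * 2 `^ (9 / 4)) `^ (2 * (p^-1 - q^-1)) * t `^ (- (9 / 2 * (p^-1 - q^-1))).
Proof.
move=> a0 t0 pn qn; have h0 : 0 < 2^-1 :> R by rewrite invr_gt0.
have T0 : 0 < a * (t / 2) `^ (- (9 / 4)) by rewrite mulr_gt0// powR_gt0 ?mulr_gt0.
have E1 : 2 / p - 1 + (1 - 2 / q) = 2 * (p^-1 - q^-1) by ring.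
have E2 : a * (t / 2) `^ (- (9 / 4)) = (a * 2 `^ (9 / 4)) * t `^ (- (9 / 4)).
  rewrite (powRM _ (ltW t0) (ltW h0)) -mulrA; congr (a * _); rewrite mulrC; congr (_ * _).
  by rewrite -(powR_inv1 (ler0n R 2)) -powRrM mulN1r opprK.
have E3 : - (9 / 4) * (2 * (p^-1 - q^-1)) = - (9 / 2 * (p^-1 - q^-1)) by field; rewrite pn qn.
have a1 : 0 <= a * 2 `^ (9 / 4) by exact: mulr_ge0 (ltW a0) (powR_ge0 _ _).
apply: (eq_trans (esym (powR_sub _ _ T0))); rewrite E1 E2.
apply: (eq_trans (powRM _ a1 (powR_ge0 _ _))); congr (_ * _).
by apply: (eq_trans (esym (powRrM _ _ _))); rewrite E3.
Qed.

End PowerIdentities.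

(** * From L^p to L^2 and from L^2 to L^q *)

Section LpBounds.
Variable R : realType.
Notation V := (LfunType (@haar R) (one_le_two R) * LfunType (@haar R) (one_le_two R))%type.
Notation normc := ComplexField.Normc.normc.
Implicit Types (f g : B5 R -> R[i]) (u v w : V) (chi : B5 R -> R).

Lemma Lp_normE p f : Lp_norm p f = ((\int[haar]_x ((normc (f x)) `^ p)%:E) `^ p^-1)%E.
Proof.
have e : (fun x => `|(normc (f x))%:E| `^ p)%E = (fun x => ((normc (f x)) `^ p)%:E).
  by apply/funext => x; rewrite abse_EFin ger0_norm ?normc_ge0.
rewrite /Lp_norm unlock; exact: (congr1 (fun F => (\int[haar]_x F x) `^ p^-1)%E e).
Qed.

Lemma power_integral_ge0 p f : (0 <= \int[haar]_x ((normc (f x)) `^ p)%:E)%E.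
Proof. by apply: integral_ge0 => x _; rewrite lee_fin powR_ge0. Qed.

(** The estimates below bound integrals of p-th powers, where cutting and truncation are additive;
    roots are taken only at the end. *)
Lemma Lp_norm_le p f (N : R) : 0 < p -> 0 <= N ->
  (Lp_norm p f <= N%:E)%E <-> (\int[haar]_x ((normc (f x)) `^ p)%:E <= (N `^ p)%:E)%E.
Proof.
move=> p0 N0; have pn : p != 0 by rewrite gt_eqF.
rewrite Lp_normE; move: (power_integral_ge0 p f).
case: (\int[haar]_x _)%E => [r||] //; rewrite ?lee_fin => r0.
  rewrite ?lee_fin; split=> h.
    have -> : r = (r `^ p^-1) `^ p by rewrite -powRrM mulVf// powRr1.
    by apply: powR_le => //; [exact: ltW|exact: powR_ge0].
  have -> : N = (N `^ p) `^ p^-1 by rewrite -powRrM mulfV// powRr1.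
  by apply: powR_le => //; rewrite invr_ge0 ltW.
rewrite poweRyr ?invr_eq0//; by split; rewrite leye_eq.
Qed.

Section Multiplier.
Variables (chi : B5 R -> R) (K : R).
Hypothesis mchi : measurable_fun setT chi.
Hypothesis chiK : forall x, `|chi x| <= K.

Lemma inLp_multiplier f : inLp 2 f -> inLp 2 (fun x => (chi x)%:C%C * f x).
Proof.
move=> /inLp2P[h1 h2].
have H (g : B5 R -> R) : square_integrable haar g -> square_integrable haar (fun x => chi x * g x).
  move=> Lg; have [mg _] := Lg.
  apply: square_integrableP; first exact: measurable_funM.
  have iK := integrable_scale (K ^+ 2) (square_integrable_sq Lg).
  have mm := measurable_funX 2 (measurable_funM mchi mg).
  apply: (@integrable_le _ _ R haar _ (fun x => K ^+ 2 * g x ^+ 2) mm iK) => x /=.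
  rewrite ger0_norm ?sqr_ge0// exprMn; apply: ler_wpM2r; first exact: sqr_ge0.
  rewrite -[leLHS]real_normK ?num_real//; have := chiK x => h.
  by rewrite ler_pXn2r// nnegrE ?normr_ge0//; exact: le_trans h.
apply/inLp2P; split.
  rewrite (_ : (fun x => _) = fun x => chi x * complex.Re (f x)); first exact: H.
  by apply/funext => x; case: (f x) => a b /=; rewrite mul0r subr0.
rewrite (_ : (fun x => _) = fun x => chi x * complex.Im (f x)); first exact: H.
by apply/funext => x; case: (f x) => a b /=; rewrite mul0r addr0.
Qed.

Definition mulv u : V := vec (fun x => (chi x)%:C%C * cfun u x).

Lemma cfun_mulv u : cfun (mulv u) = (fun x => (chi x)%:C%C * cfun u x).
Proof. exact: (vecK (inLp_multiplier (inLp_cfun u))). Qed.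

Lemma modulus_mulv u x : modulus (mulv u) x = `|chi x| * modulus u x.
Proof.
rewrite /modulus cfun_mulv ComplexField.Normc.normcM; congr (_ * _).
by rewrite /= expr0n /= addr0 sqrtr_sqr.
Qed.

Lemma vip_mulv u : ((vip R (mulv u) u)%:E = \int[haar]_x (chi x * modulus u x ^+ 2)%:E)%E.
Proof.
apply: (vip_multiplier (v := u) (w := mulv u) mchi).
by rewrite cfun_mulv; apply: aeW.
Qed.

End Multiplier.

Section SemigroupBounds.
Variable E : set R -> (B5 R -> R[i]) -> B5 R -> R[i].
Hypothesis HE : spectral_resolution E (@B_op R).
Notation heat := (heat_rel HE).

Lemma heat_exists t u : 0 <= t -> exists w, heat t u w.
Proof.
by move=> t0; have H := semigroup_exists (@vcomplete R) (Brel_spectral HE) (@Brel_gap R) u t0; exact: H.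
Qed.

Lemma heat_symmetric t u v w z : heat t u w -> heat t v z -> vip R w v = vip R u z.
Proof. exact: (semigroup_sym (@vcomplete R)). Qed.

Lemma heat_contraction t u w : 0 <= t -> heat t u w -> nsq (vip R) w <= nsq (vip R) u.
Proof.
move=> t0 Hu; have H := nsq_semigroup_le (@vcomplete R) (Brel_spectral HE) (@Brel_gap R) t0 Hu.
exact: H.
Qed.

Lemma heat_add t u v w z : 0 <= t -> heat t u w -> heat t v z ->
  forall y, heat t (u + v) y -> nequiv (vip R) y (w + z).
Proof.
move=> t0 Hu Hv y Hy; apply/nequivP => g; have [G HG] := heat_exists g t0.
by rewrite (heat_symmetric Hy HG) !ipDl (heat_symmetric Hu HG) (heat_symmetric Hv HG).
Qed.

Lemma heat_compose s t u v w z : heat s u v -> heat t v w -> heat (s + t) u z ->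
  nequiv (vip R) z w.
Proof.
move=> H1 H2 H3; have H4 := semigroupD (@vcomplete R) H1 H2.
rewrite addrC in H4; have H := semigroup_unique H3 H4; exact: H.
Qed.

(** From [heat_smoothing] at time t = 2 s^2: the constant 2 * 32^5 * 4 is divided by s^9 =
    (t/2)^(9/2), and the square root passes to norms. *)
Definition amplitude : R := Num.sqrt (2 * (32 ^+ 5 * 4) * 2 `^ (9 / 2)).

Lemma amplitude_gt0 : 0 < amplitude.
Proof.
have h (c : R) : 0 < c -> 0 < 2 * (c * 4) * 2 `^ (9 / 2).
  by move=> c0; rewrite mulr_gt0 ?powR_gt0// mulr_gt0// mulr_gt0.
by rewrite sqrtr_gt0 h// exprn_gt0.
Qed.

Definition decay t := amplitude * t `^ (- (9 / 4)).

Lemma decay_gt0 t : 0 < t -> 0 < decay t.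
Proof. by move=> t0; rewrite mulr_gt0 ?amplitude_gt0 ?powR_gt0. Qed.

Let decay_sqr (c t n P : R) : 0 <= c -> 0 < t ->
  Num.sqrt (t / 2) ^+ 9 * n <= 2 * (c * 4 * P ^+ 2) ->
  n <= (Num.sqrt (2 * (c * 4) * 2 `^ (9 / 2)) * t `^ (- (9 / 4)) * P) ^+ 2.
Proof.
move=> c0 t0 H; have h0 : 0 < t / 2 by rewrite divr_gt0.
have K0 : 0 <= 2 * (c * 4) * 2 `^ (9 / 2) by rewrite !mulr_ge0 ?powR_ge0.
have e9 : Num.sqrt (t / 2) ^+ 9 = t `^ (9 / 2) / 2 `^ (9 / 2).
  rewrite -powR12_sqrt ?ltW// -powR_mulrn ?powR_ge0// -powRrM.
  rewrite (_ : 2^-1 * 9%:R = 9 / 2); last by ring.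
  by rewrite powRM ?ltW ?invr_gt0// -powRN -(powR_inv1 (ler0n R 2)) -powRrM mulN1r.
rewrite !exprMn sqr_sqrtr// -(powR_sqr (powR_ge0 _ _)) -powRrM.
rewrite (_ : - (9 / 4) * 2 = - (9 / 2)); last by field.
rewrite e9 in H; rewrite powRN.
have x0 : 0 < t `^ (9 / 2) by exact: powR_gt0.
have y0 : 0 < 2 `^ (9 / 2) :> R by exact: powR_gt0.
have -> : n = (t `^ (9 / 2) / 2 `^ (9 / 2) * n) * (2 `^ (9 / 2) / t `^ (9 / 2)).
  by field; rewrite !gt_eqF.
apply: le_trans (ler_wpM2r _ H) _; first by rewrite divr_ge0 ?powR_ge0.
by rewrite le_eqVlt; apply/orP; left; apply/eqP; field; rewrite gt_eqF.
Qed.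

Lemma heat_L1_L2 t u w (P : R) : 0 < t -> 0 < P -> heat t u w ->
  (\int[haar]_y (modulus u y)%:E <= P%:E)%E -> nsq (vip R) w <= (decay t * P) ^+ 2.
Proof.
move=> t0 P0 Hu uP; have s0 : 0 < Num.sqrt (t / 2) by rewrite sqrtr_gt0 divr_gt0.
have e : 2 * Num.sqrt (t / 2) ^+ 2 = t by rewrite sqr_sqrtr ?divr_ge0 ?ltW//; field.
rewrite -e in Hu; have := heat_smoothing s0 P0 Hu uP; exact: (decay_sqr (exprn_ge0 5 (ler0n R 32)) t0).
Qed.

Opaque amplitude.

Let four_squares (a b X : R) : a <= X ^+ 2 -> b <= X ^+ 2 -> 2 * a + 2 * b <= (2 * X) ^+ 2.
Proof. by rewrite exprMn; lra. Qed.

Let conjugate (q : R) : 2 <= q ->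
  [/\ 0 < q, 0 < q - 1, 1 < q / (q - 1) & q / (q - 1) <= 2].
Proof.
move=> q2; have q1 : 0 < q - 1 by lra.
by split; [lra|lra|rewrite ltr_pdivlMr//; lra|rewrite ler_pdivrMr//; lra].
Qed.

Let one_lt_neq0 (p : R) : 1 < p -> p != 0.
Proof. by move=> p1; rewrite gt_eqF// (lt_trans _ p1). Qed.

Let square_prod (b G I : R) : (2 * (b * I)) ^+ 2 * G ^+ 2 <= (2 * b * G * I) ^+ 2.
Proof. by rewrite -exprMn le_eqVlt; apply/orP; left; apply/eqP; ring. Qed.

Let four_factor (a b c d N : R) : a * b = c * d -> 4 * c * d * N = 2 * b * (2 * (a * N)).
Proof. by move=> e; rewrite -(mulrA 4) -e; ring. Qed.

(** An explicit cut in place of complex interpolation. The part above the height goes through the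
    L^1 bound, the part below through contraction, and the height makes both contributions equal to
    A^(2/p - 1) N; adding them costs the factor 2. *)
Lemma heat_Lp_L2 t p u w (N : R) : 0 < t -> 1 < p -> p <= 2 -> 0 < N -> heat t u w ->
  (\int[haar]_x ((modulus u x) `^ p)%:E <= (N `^ p)%:E)%E ->
  nsq (vip R) w <= (2 * (decay t `^ (2 / p - 1) * N)) ^+ 2.
Proof.
move=> t0 p1 p2 N0 Hu uN; have t0' := ltW t0; have p0 : 0 < p by exact: lt_trans p1.
have A0 := decay_gt0 t0; set A := decay t in A0 *.
have [c1 c2] := cut_height A0 N0 p0; set s := A `^ (2 / p) * N in c1 c2.
have s0 : 0 < s by rewrite mulr_gt0// powR_gt0.
have mm := measurable_modulus u.
pose D : set (B5 R) := [set x | s < modulus u x].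
have mD : measurable D.
  by have := measurable_fun_ltr (measurable_cst s) mm measurableT (_ : measurable [set true]);
     rewrite setTI; apply.
have m1 : measurable_fun setT (\1_D : B5 R -> R) by exact: measurable_indic.
have m2 : measurable_fun setT (fun x => 1 - \1_D x : R) by exact: measurable_funB.
have b1 x : `|\1_D x : R| <= 1 by rewrite indicE; case: (x \in D); rewrite ?normr1 ?normr0.
have b2 x : `|1 - \1_D x : R| <= 1.
  by rewrite indicE; case: (x \in D); rewrite ?subrr ?subr0 ?normr1 ?normr0.
pose u1 := mulv (\1_D : B5 R -> R) u; pose u2 := mulv (fun x => 1 - \1_D x : R) u.
have uE : u1 + u2 = u.
  apply: cfun_inj; rewrite cfunD (cfun_mulv m1 b1) (cfun_mulv m2 b2); apply/funext => x.
  by rewrite -mulrDl -rmorphD /= addrC subrK mul1r.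
have [W1 H1] := heat_exists u1 t0'; have [W2 H2] := heat_exists u2 t0'.
have Hw : nequiv (vip R) w (W1 + W2) by apply: (heat_add t0' H1 H2); rewrite uE.
have mp : measurable_fun setT (fun x => ((modulus u x) `^ p)%:E).
  by apply/measurable_EFinP; exact: (measurableT_comp (measurable_powR p) mm).
have p0E x : (0 <= ((modulus u x) `^ p)%:E)%E by rewrite lee_fin powR_ge0.
have N1 : 0 < s `^ (1 - p) * N `^ p by rewrite mulr_gt0 ?powR_gt0.
have bound (h : B5 R -> R) (c : R) : 0 <= c -> measurable_fun setT h -> (forall x, 0 <= h x) ->
    (forall x, h x <= c * modulus u x `^ p) -> (\int[haar]_x (h x)%:E <= (c * N `^ p)%:E)%E.
  move=> k0 mh h0 hc; have mhE : measurable_fun setT (fun x => (h x)%:E) by exact/measurable_EFinP.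
  apply: le_trans (_ : (\int[haar]_x (c%:E * ((modulus u x) `^ p)%:E) <= _)%E).
    by apply: (haar_le_integral mhE (measurable_funeM _ mp)) => x; rewrite ?lee_fin -?EFinM ?lee_fin.
  by rewrite (haar_integralZl k0 mp p0E) EFinM lee_wpmul2l// lee_fin.
have i1 : (\int[haar]_x (modulus u1 x)%:E <= (s `^ (1 - p) * N `^ p)%:E)%E.
  apply: bound; [exact: powR_ge0|exact: measurable_modulus|exact: modulus_ge0|] => x.
  rewrite (modulus_mulv m1 b1) indicE; have [/set_mem xD|_] := boolP (x \in D).
    by rewrite normr1 mul1r; apply: cut_above => //; exact: ltW.
  by rewrite normr0 mul0r mulr_ge0 ?powR_ge0.
have i2 : nsq (vip R) u2 <= s `^ (2 - p) * N `^ p.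
  rewrite -lee_fin nsq_normcE.
  have mm2 := measurable_funX 2 (measurable_modulus u2).
  apply: (bound (fun x => modulus u2 x ^+ 2)); [exact: powR_ge0|exact: mm2|by move=> x; exact: sqr_ge0|] => x.
  rewrite (modulus_mulv m2 b2) indicE; have [_|xD] := boolP (x \in D).
    by rewrite subrr normr0 mul0r expr0n mulr_ge0 ?powR_ge0.
  rewrite subr0 normr1 mul1r; apply: cut_below => //; first exact: modulus_ge0.
  by rewrite leNgt; apply: contra xD => h; exact: mem_set.
have n1 := heat_L1_L2 t0 N1 H1 i1; rewrite -/A c1 in n1.
have n2 := le_trans (heat_contraction t0' H2) i2; rewrite c2 in n2.
rewrite (nequiv_nsq Hw); apply: le_trans (nsqD_le _ _ _) _.
exact: four_squares n1 n2.
Qed.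

(** The test function is |w|^(q-2) w cut off where |w| > n: the cut-off keeps it in L^2 and all
    integrals finite. Symmetry moves the semigroup onto it, the previous bound applies with the
    conjugate exponent q/(q-1) in (1, 2], and monotone convergence lets n grow. *)
Lemma heat_L2_Lq t q v w z (G : R) : 0 < t -> 2 <= q -> 0 <= G -> heat t v z ->
  nequiv (vip R) w z -> nsq (vip R) v <= G ^+ 2 ->
  (\int[haar]_x ((modulus w x) `^ q)%:E <= ((2 * decay t `^ (1 - 2 / q) * G) `^ q)%:E)%E.
Proof.
move=> t0 q2 G0 Hv Hw vG; have t0' := ltW t0; have [q0 q1 p1 p2] := conjugate q2.
have mm := measurable_modulus w.
pose D n : set (B5 R) := [set x | modulus w x <= n%:R].
have mD n : measurable (D n).
  by have := measurable_fun_ler mm (measurable_cst (n%:R : R)) measurableT (_ : measurable [set true]);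
     rewrite setTI; apply.
pose chi n x := modulus w x `^ (q - 2) * \1_(D n) x.
have mchi n : measurable_fun setT (chi n).
  by apply: measurable_funM; [exact: (measurableT_comp (measurable_powR (q - 2)) mm)|exact: measurable_indic].
have chi0 n x : 0 <= chi n x by rewrite mulr_ge0 ?powR_ge0.
have chiK n x : `|chi n x| <= n%:R `^ (q - 2).
  rewrite ger0_norm// /chi indicE; have [/set_mem xD|_] := boolP (x \in D n).
    by rewrite mulr1; apply: powR_le; rewrite ?subr_ge0// modulus_ge0.
  by rewrite mulr0 powR_ge0.
set B := 2 * decay t `^ (1 - 2 / q) * G.
have B0 : 0 <= B by rewrite mulr_ge0// mulr_ge0 ?powR_ge0.
have step n : (\int[haar]_x (modulus w x `^ q * \1_(D n) x)%:E <= (B `^ q)%:E)%E.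
  pose h := mulv (chi n) w; pose I := vip R h w.
  have IE : (I%:E = \int[haar]_x (modulus w x `^ q * \1_(D n) x)%:E)%E.
    rewrite /I (vip_mulv (mchi n) (chiK n)); apply: eq_integral => x _; congr (_%:E).
    by rewrite /chi mulrAC dual_power ?modulus_ge0.
  rewrite -IE lee_fin.
  have I0 : 0 <= I.
    by rewrite -lee_fin IE; apply: integral_ge0 => x _; rewrite lee_fin mulr_ge0 ?powR_ge0.
  move: I0; rewrite le_eqVlt => /predU1P[<-|I0]; first exact: powR_ge0.
  apply: dual_bound => //.
  have [y Hy] := heat_exists h t0'.
  have Iy : I = vip R y v by rewrite /I (nequiv_ipr _ Hw) [LHS]ipC (heat_symmetric Hv Hy) ipC.
  have N0 : 0 < I `^ ((q - 1) / q) by exact: powR_gt0.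
  have hN : (\int[haar]_x ((modulus h x) `^ (q / (q - 1)))%:E <= ((I `^ ((q - 1) / q)) `^ (q / (q - 1)))%:E)%E.
    rewrite -powRrM (_ : (q - 1) / q * (q / (q - 1)) = 1); last by field; rewrite !gt_eqF.
    rewrite powRr1 ?(ltW I0)// IE le_eqVlt; apply/orP; left; apply/eqP; apply: eq_integral => x _.
    congr (_%:E); rewrite (modulus_mulv (mchi n) (chiK n)) ger0_norm// /chi indicE.
    have [_|_] := boolP (x \in D n); first by rewrite !mulr1 dual_modulus ?modulus_ge0.
    by rewrite !mulr0 mul0r powR0// mulf_neq0 ?invr_eq0 ?gt_eqF.
  have := heat_Lp_L2 t0 p1 p2 N0 Hy hN.
  rewrite (_ : 2 / (q / (q - 1)) - 1 = 1 - 2 / q); last by field; rewrite !gt_eqF.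
  move=> ny; rewrite Iy in I0 N0 *; apply: le_trans (cauchy_schwarz _ _ _) _.
  apply: le_trans (ler_pM (nsq_ge0 _ _) (nsq_ge0 _ _) ny vG) _.
  rewrite -Iy; exact: square_prod.
have mF n : measurable_fun setT (fun x => (modulus w x `^ q * \1_(D n) x)%:E).
  apply/measurable_EFinP; apply: measurable_funM; last exact: measurable_indic.
  exact: (measurableT_comp (measurable_powR q) mm).
have F0 n x : (0 <= (modulus w x `^ q * \1_(D n) x)%:E)%E by rewrite lee_fin mulr_ge0 ?powR_ge0.
have nd x : nondecreasing_seq (fun n => (modulus w x `^ q * \1_(D n) x)%:E).
  move=> m n mn; rewrite lee_fin ler_wpM2l ?powR_ge0// !indicE ler_nat.
  have [/set_mem xD|//] := boolP (x \in D m).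
  by rewrite mem_set// /D /=; apply: le_trans xD _; rewrite ler_nat.
have L := @cvg_monotone_convergence _ _ _ haar setT measurableT
  (fun n x => (modulus w x `^ q * \1_(D n) x)%:E) mF (fun n x _ => F0 n x) (fun x _ => nd x).
have lim1 x : limn (fun n => (modulus w x `^ q * \1_(D n) x)%:E) = (modulus w x `^ q)%:E.
  apply/cvg_lim => //; apply: cvg_near_cst; exists (Num.truncn (modulus w x)).+1 => // n /= hn.
  rewrite indicE mem_set ?mulr1// /D /=; apply/ltW/(lt_le_trans (truncnS_gt _)).
  by rewrite ler_nat.
have -> : (\int[haar]_x ((modulus w x) `^ q)%:E =
    \int[haar]_x limn (fun n => (modulus w x `^ q * \1_(D n) x)%:E))%E.
  by apply: eq_integral => x _; rewrite lim1.
by rewrite -(cvg_lim (@ereal_hausdorff R) L); apply: lime_le; [exact: cvgP L|exact: nearW].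
Qed.

Lemma heat_Lp_Lq t p q u w (N : R) : 0 < t -> 1 < p -> p <= 2 -> 2 <= q -> 0 < N -> heat t u w ->
  (\int[haar]_x ((modulus u x) `^ p)%:E <= (N `^ p)%:E)%E ->
  (\int[haar]_x ((modulus w x) `^ q)%:E <=
   ((4 * (amplitude * 2 `^ (9 / 4)) `^ (2 * (p^-1 - q^-1)) * t `^ (- (9 / 2 * (p^-1 - q^-1))) * N) `^ q)%:E)%E.
Proof.
move=> t0 p1 p2 q2 N0 Hu uN; have h0 : 0 < t / 2 by rewrite divr_gt0.
have [v Hv] := heat_exists u (ltW h0); have [z Hz] := heat_exists v (ltW h0).
have Hw : nequiv (vip R) w z by apply: (heat_compose Hv Hz); rewrite -splitr.
have G0 : 0 <= 2 * (decay (t / 2) `^ (2 / p - 1) * N).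
  by rewrite mulr_ge0// mulr_ge0 ?powR_ge0// ltW.
have pn := one_lt_neq0 p1; have qn : q != 0 by rewrite gt_eqF// (lt_le_trans _ q2).
have e := heat_constant amplitude_gt0 t0 pn qn.
rewrite (four_factor N e).
exact: (heat_L2_Lq h0 q2 G0 Hz Hw (heat_Lp_L2 h0 p1 p2 N0 Hv uN)).
Qed.

End SemigroupBounds.

End LpBounds.

(** * The heat equation *)

Section HeatEquation.
Variable R : realType.
Notation V := (LfunType (@haar R) (one_le_two R) * LfunType (@haar R) (one_le_two R))%type.
Notation normc := ComplexField.Normc.normc.
Variable E : set R -> (B5 R -> R[i]) -> B5 R -> R[i].
Hypothesis HE : spectral_resolution E (@B_op R).
Implicit Types (f g : B5 R -> R[i]) (u v w : V).

Lemma exp_opP t f g : exp_op E t f g ->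
  [/\ inLp 2 f, inLp 2 g & heat_rel HE t (vec f) (vec g)].
Proof.
move=> H; have [Lf Lg _] := H; split=> //.
by move: H; rewrite /exp_op -{1}(vecK Lf) -{1}(vecK Lg) => /(spectral_integralE HE.1).
Qed.

Lemma Lp_norm_fin p f : inLp p f -> exists2 n : R, 0 <= n & Lp_norm p f = n%:E.
Proof.
move=> [_ _ h]; have h0 : (0 <= Lp_norm p f)%E by exact: Lnorm_ge0.
by exists (fine (Lp_norm p f)); [exact: fine_ge0|rewrite fineK// ge0_fin_numE].
Qed.

(** Minkowski holds for the moduli, and the auxiliary function [h] with values |f| + |g| dominates
    |f + g|. If the norm of [h] is infinite there is nothing to prove. *)
Lemma Lp_norm_triangle r f g : 1 <= r ->
  measurable_fun setT (fun x => complex.Re (f x)) -> measurable_fun setT (fun x => complex.Im (f x)) ->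
  measurable_fun setT (fun x => complex.Re (g x)) -> measurable_fun setT (fun x => complex.Im (g x)) ->
  (Lp_norm r (fun x => f x + g x)%R <= Lp_norm r f + Lp_norm r g)%E.
Proof.
move=> r1 f1 f2 g1 g2; have mf := measurable_normc f1 f2; have mg := measurable_normc g1 g2.
have r0 : 0 < r by exact: lt_le_trans r1.
have M := minkowski_EFin haar mf mg r1.
pose h x : R[i] := (normc (f x) + normc (g x))%:C%C.
have hE : Lp_norm r h = Lnorm haar r%:E (EFin \o ((fun x => normc (f x)) \+ (fun x => normc (g x)))%R).
  apply: eq_Lnorm => x; rewrite /h /= expr0n /= addr0 sqrtr_sqr ger0_norm//.
  by rewrite addr_ge0 ?normc_ge0.
rewrite -hE in M; apply: le_trans M.
have [hfin|] := boolP (Lp_norm r h \is a fin_num); last first.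
  rewrite ge0_fin_numE; last exact: Lnorm_ge0.
  by rewrite -leNgt leye_eq => /eqP ->; exact: leey.
have n0 : 0 <= fine (Lp_norm r h) by apply: fine_ge0; exact: Lnorm_ge0.
have := lexx (Lp_norm r h); rewrite -{2 3}(fineK hfin) => /(Lp_norm_le h r0 n0) H.
apply/(Lp_norm_le _ r0 n0); apply: le_trans H.
have mh : measurable_fun setT (fun x => ((normc (h x)) `^ r)%:E).
  apply/measurable_EFinP; apply: (measurableT_comp (measurable_powR r)).
  rewrite (_ : (fun x => normc (h x)) = fun x => normc (f x) + normc (g x)); first exact: measurable_funD.
  by apply/funext => x; rewrite /h /= expr0n /= addr0 sqrtr_sqr ger0_norm// addr_ge0 ?normc_ge0.
have ma : measurable_fun setT (fun x => ((normc (f x + g x)) `^ r)%:E).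
  apply/measurable_EFinP; apply: (measurableT_comp (measurable_powR r)); apply: measurable_normc.
    rewrite (_ : (fun x => _) = fun x => complex.Re (f x) + complex.Re (g x)); first exact: measurable_funD.
    by apply/funext => x; case: (f x) => a b; case: (g x).
  rewrite (_ : (fun x => _) = fun x => complex.Im (f x) + complex.Im (g x)); first exact: measurable_funD.
  by apply/funext => x; case: (f x) => a b; case: (g x).
apply: (haar_le_integral ma mh) => x; first by rewrite lee_fin powR_ge0.
rewrite lee_fin; apply: powR_le; [exact: ltW|exact: normc_ge0|].
apply: le_trans (le_normcD _ _) _.
by rewrite /h /= expr0n /= addr0 sqrtr_sqr ger0_norm// addr_ge0 ?normc_ge0.
Qed.

Lemma measurable_ReB f g : measurable_fun setT (fun x => complex.Re (f x)) ->
  measurable_fun setT (fun x => complex.Re (g x)) -> measurable_fun setT (fun x => complex.Re (f x - g x)).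
Proof.
move=> mf mg; rewrite (_ : (fun x => _) = fun x => complex.Re (f x) - complex.Re (g x)).
  exact: measurable_funB.
by apply/funext => x; exact: ReB.
Qed.

Lemma measurable_ImB f g : measurable_fun setT (fun x => complex.Im (f x)) ->
  measurable_fun setT (fun x => complex.Im (g x)) -> measurable_fun setT (fun x => complex.Im (f x - g x)).
Proof.
move=> mf mg; rewrite (_ : (fun x => _) = fun x => complex.Im (f x) - complex.Im (g x)).
  exact: measurable_funB.
by apply/funext => x; exact: ImB.
Qed.

Lemma Lp_distC r f g : Lp_dist r f g = Lp_dist r g f.
Proof. by apply: eq_Lnorm => x /=; rewrite -opprB; case: (g x - f x) => a b /=; rewrite !sqrrN. Qed.

Lemma Lp_norm_dist r s f g : 1 <= r -> inLp s f -> inLp s g ->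
  (Lp_norm r f <= Lp_norm r g + Lp_dist r f g)%E.
Proof.
move=> r1 [f1 f2 _] [g1 g2 _].
have := Lp_norm_triangle r1 g1 g2 (measurable_ReB f1 g1) (measurable_ImB f2 g2).
by rewrite (_ : (fun x => g x + (f x - g x)) = f)//; apply/funext => x; rewrite addrC subrK.
Qed.

Definition heat_factor (p q : R) : R := 4 * (amplitude R * 2 `^ (9 / 4)) `^ (2 * (p^-1 - q^-1)).

Lemma heat_factor_gt0 p q : 0 < heat_factor p q.
Proof. by rewrite mulr_gt0// powR_gt0// mulr_gt0 ?powR_gt0// amplitude_gt0. Qed.

Section Exponents.
Variables p q : R.
Hypotheses (p1 : 1 < p) (p2 : p <= 2) (q2 : 2 <= q).

Let p0 : 0 < p. Proof. exact: lt_trans p1. Qed.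
Let q0 : 0 < q. Proof. exact: lt_le_trans q2. Qed.

Let K t := heat_factor p q * t `^ (- (9 / 2 * (p^-1 - q^-1))).

Let K_gt0 t : 0 < t -> 0 < K t.
Proof. by move=> t0; rewrite mulr_gt0 ?heat_factor_gt0 ?powR_gt0. Qed.

Lemma exp_op_bound t f g : 0 < t -> inLp p f -> exp_op E t f g ->
  (Lp_norm q g <= (K t)%:E * Lp_norm p f)%E.
Proof.
move=> t0 Lf /exp_opP[L2f L2g H]; have [n n0 e] := Lp_norm_fin Lf.
have mf x : modulus (vec f) x = normc (f x) by rewrite /modulus vecK.
have mg x : modulus (vec g) x = normc (g x) by rewrite /modulus vecK.
(* The estimate takes a positive bound N on the norm, which may vanish; N = n + d/K overshoots the
   result by d only. *)
rewrite e; apply/lee_addgt0Pr => d d0.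
have e0 : 0 < d / K t by rewrite divr_gt0// K_gt0.
have N0 : 0 < n + d / K t by rewrite ltr_wpDl.
have hN : (\int[haar]_x ((modulus (vec f) x) `^ p)%:E <= ((n + d / K t) `^ p)%:E)%E.
  under eq_integral do rewrite mf.
  by apply/(Lp_norm_le f p0 (ltW N0)); rewrite e lee_fin lerDl ltW.
have := heat_Lp_Lq t0 p1 p2 q2 N0 H hN; rewrite -/(heat_factor p q) -/(K t).
under eq_integral do rewrite mg.
move/(Lp_norm_le g q0 (mulr_ge0 (ltW (K_gt0 t0)) (ltW N0))) => h; apply: le_trans h _.
by rewrite -EFinM -EFinD lee_fin mulrDr [X in _ + X]mulrCA mulfV ?mulr1// gt_eqF// K_gt0.
Qed.

Lemma exp_op_ext_bound t f g : 0 < t -> exp_op_ext E p q t f g ->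
  (Lp_norm q g <= (K t)%:E * Lp_norm p f)%E.
Proof.
move=> t0 [Lf Lg [un [wn [H1 /fine_cvgP[F2 C2] /fine_cvgP[F3 C3]]]]].
have [n n0 e] := Lp_norm_fin Lf; have K0 := K_gt0 t0.
(* An error c in the datum and an error c in the value add up to K c + c = d. *)
rewrite e; apply/lee_addgt0Pr => d d0; pose c := d / (K t + 1).
have K1 : 0 < K t + 1 by rewrite addr_gt0.
have c0 : 0 < c by rewrite divr_gt0.
have h2 : \forall k \near \oo, fine (Lp_dist p (un k) f) < c.
  by have /cvgrPdist_lt /(_ _ c0) := C2; apply: filterS => k; rewrite sub0r normrN /= => /ltr_normlW.
have h3 : \forall k \near \oo, fine (Lp_dist q (wn k) g) < c.
  by have /cvgrPdist_lt /(_ _ c0) := C3; apply: filterS => k; rewrite sub0r normrN /= => /ltr_normlW.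
have [k [f2 f3 k2 k3]] : exists k, [/\ Lp_dist p (un k) f \is a fin_num,
    Lp_dist q (wn k) g \is a fin_num, fine (Lp_dist p (un k) f) < c & fine (Lp_dist q (wn k) g) < c].
  have [k _ hk] : \forall k \near \oo, [/\ Lp_dist p (un k) f \is a fin_num,
    Lp_dist q (wn k) g \is a fin_num, fine (Lp_dist p (un k) f) < c & fine (Lp_dist q (wn k) g) < c].
    by near=> k; split; near: k.
  by exists k; apply: hk => /=.
have [Lu L2u Hk] := H1 k; have [_ L2w _] := exp_opP Hk.
have b1 : (Lp_norm p (un k) <= n%:E + c%:E)%E.
  apply: le_trans (_ : (Lp_norm p f + Lp_dist p (un k) f <= _)%E).
    exact: (Lp_norm_dist (ltW p1) Lu Lf).
  by rewrite e leeD2l// -(fineK f2) lee_fin ltW.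
have b2 : (Lp_norm q g <= Lp_norm q (wn k) + c%:E)%E.
  have [w1 w2 _] := L2w; have [g1 g2 _] := Lg.
  have q1 : 1 <= q by apply: le_trans q2; rewrite ler1n.
  have := Lp_norm_triangle q1 w1 w2 (measurable_ReB g1 w1) (measurable_ImB g2 w2).
  rewrite (_ : (fun x => wn k x + (g x - wn k x)) = g); last by apply/funext => x; rewrite addrC subrK.
  move=> h; apply: le_trans h _; rewrite leeD2l// -/(Lp_dist q g (wn k)) Lp_distC -(fineK f3).
  by rewrite lee_fin ltW.
apply: le_trans b2 _; apply: le_trans (leeD2r _ (exp_op_bound t0 Lu Hk)) _.
apply: le_trans (leeD2r _ (lee_wpmul2l _ b1)) _; first by rewrite lee_fin ltW.
rewrite -EFinD -EFinM -!EFinD lee_fin mulrDr -addrA lerD2l -[X in _ + X]mul1r -mulrDl.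
by rewrite /c mulrC divfK// gt_eqF.
Unshelve. all: by end_near. Qed.

End Exponents.

Lemma addr_ge0_norm (x h : R) : `|h| <= x -> 0 <= x + h.
Proof. by rewrite ler_norml => /andP[]; rewrite -subr_ge0 opprK addrC. Qed.

Let taylor_scale (h t c : R) : h != 0 -> 0 < t ->
  h^-1 ^+ 2 * ((h ^+ 2 * (16 / t ^+ 2)) ^+ 2 * c) = h ^+ 2 * ((16 / t ^+ 2) ^+ 2 * c).
Proof. by move=> h0 t0; field; rewrite h0 gt_eqF. Qed.

(** Dividing the second-order Taylor estimate by h^2 leaves a squared error of order h^2, for h of
    either sign with |h| <= t/2. The initial value is taken by strong continuity, tested on
    sequences. *)
Lemma heat_equation (u0 : B5 R -> R[i]) (u : R -> B5 R -> R[i]) : inLp 2 u0 ->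
  (forall t, 0 <= t -> exp_op E t u0 (u t)) -> heat_solution (@B_op R) u0 u.
Proof.
move=> L0 Hu; pose v := vec u0; pose X t := vec (u t).
have Lu t : 0 <= t -> inLp 2 (u t) by move=> /Hu/exp_opP[].
have HX t : 0 <= t -> heat_rel HE t v (X t) by move=> /Hu/exp_opP[].
split.
- apply/(nequiv_vec (Lu 0 (lexx 0)) L0).
  have H := semigroup0 (@vcomplete R) (HX 0 (lexx 0)); exact: H.
- have N : nsq (vip R) (X t - v) @[t --> 0^'+] --> 0.
    apply/cvg_at_rightP => s [s0 scvg].
    have H := semigroup_cvg0 (@vcomplete R) (Brel_spectral HE) (@Brel_gap R) (fun n => ltW (s0 n)) scvg
      (fun n => HX _ (ltW (s0 n))).
    exact: H.
  have N2 : Lp_norm 2 (cfun (X t - v)) @[t --> 0^'+] --> 0%E by apply/Lp_norm_cvg0.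
  move: N2.
  apply: cvg_trans; apply: near_eq_cvg; near=> t.
  have t0 : 0 <= t by near: t; exact: nbhs_right_ge.
  by rewrite cfunB !vecK//; exact: Lu.
- move=> t t0; have [b Bb Ib] := semigroup_generator (@vcomplete R) (Brel_spectral HE) (@Brel_gap R) t0 (HX t (ltW t0)).
  exists (cfun b); split; first by move: Bb; rewrite /Brel /X vecK//; exact: Lu (ltW t0).
  have N : nsq (vip R) (h^-1 *: (X (t + h) - X t) + b) @[h --> 0^'] --> 0.
    pose M := (16 / t ^+ 2) ^+ 2 * nsq (vip R) v.
    have B h : h != 0 -> `|h| <= t / 2 -> nsq (vip R) (h^-1 *: (X (t + h) - X t) + b) <= h ^+ 2 * M.
      move=> h0 ht; have th : 0 <= t + h by apply: addr_ge0_norm; apply: le_trans ht _; rewrite ler_pdivrMr// ler_pMr// ler1n.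
      have T := semigroup_taylor (@vcomplete R) (Brel_spectral HE) (@Brel_gap R) t0 ht (HX t (ltW t0)) (HX _ th) Ib.
      have -> : h^-1 *: (X (t + h) - X t) + b = h^-1 *: (X (t + h) - X t + h *: b).
        by rewrite [RHS]scalerDr scalerA mulVf// scale1r.
      rewrite nsqZ; apply: le_trans (ler_wpM2l (sqr_ge0 _) T) _.
      by rewrite (taylor_scale _ h0 t0).
    have W : h @[h --> (0 : R)^'] --> (0 : R) by exact: cvg_within.
    have Z : h * h * M @[h --> (0 : R)^'] --> (0 : R) * 0 * M by apply: cvgM; [exact: cvgM|exact: cvg_cst].
    rewrite !mul0r in Z.
    apply: (squeeze_cvgr _ (cvg_cst 0) Z); near=> h; rewrite nsq_ge0/= -expr2; apply: B.
      by near: h; exact: nbhs_dnbhs_neq.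
    by near: h; apply: dnbhs0_le; rewrite divr_gt0.
  have N2 : Lp_norm 2 (cfun (h^-1 *: (X (t + h) - X t) + b)) @[h --> 0^'] --> 0%E by apply/Lp_norm_cvg0.
  move: N2.
  apply: cvg_trans; apply: near_eq_cvg; near=> h.
  have th : 0 <= t + h by apply: addr_ge0_norm; near: h; exact: dnbhs0_le.
  by rewrite cfunD cfunZ cfunB !vecK; [|exact: Lu (ltW t0)|exact: Lu th].
Unshelve. all: by end_near. Qed.

End HeatEquation.

Theorem mainTheorem4 (R : realType) (p q : R)
    (hp1 : 1 < p) (hp2 : p <= 2) (hq2 : 2 <= q) :
  exists C : R, 0 < C /\
  forall E : set R -> (B5 R -> R[i]) -> B5 R -> R[i],
  spectral_resolution E (@B_op R) ->
  (forall (u0 : B5 R -> R[i]) (u : R -> B5 R -> R[i]),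
     inLp p u0 -> inLp 2 u0 ->
     (forall t : R, 0 <= t -> exp_op E t u0 (u t)) ->
     heat_solution (@B_op R) u0 u /\
     forall t : R, 0 < t ->
       (Lp_norm q (u t) <=
         (C * t `^ (- (9 / 2 * (p^-1 - q^-1))))%:E * Lp_norm p u0)%E)
  /\
  (forall (t : R) (u0 w : B5 R -> R[i]),
     0 < t -> exp_op_ext E p q t u0 w ->
     (Lp_norm q w <=
       (C * t `^ (- (9 / 2 * (p^-1 - q^-1))))%:E * Lp_norm p u0)%E).
Proof.
exists (heat_factor p q); split; first exact: heat_factor_gt0.
move=> E HE; split.
- move=> u0 u Lp L2 Hu; split; first exact: (heat_equation HE).
  move=> t t0; exact: (exp_op_bound HE hp1 hp2 hq2 t0 Lp (Hu t (ltW t0))).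
- move=> t u0 w t0 Hext; exact: (exp_op_ext_bound HE hp1 hp2 hq2 t0 Hext).
Qed.
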